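(* Let $g\in G_-^m$, $u\in\mathcal M_{a,b,j}$, and let $E$ be the trivialization of $u$ (so $E(0,0)=I$). Then: (i) $gE(x,t)$ can be factored uniquely as $gE(x,t)=\tilde E(x,t)\tilde g(x,t)\in G_+\times G_-^m$, i.e. with $\tilde E(x,t)\in G_+$ and $\tilde g(x,t)\in G_-^m$; (ii) $\tilde E^{-1}\tilde E_x=\tilde A$, where $\tilde A(x,t,\lambda)=a\lambda+\tilde u(x,t)$ for some $\tilde u\in\mathcal M_{a,b,j}$; (iii) $g*u=\tilde u$ defines an action of $G_-^m$ on $\mathcal M_{a,b,j}$; (iv) $\tilde E$ is the trivialization of $\tilde u$.
   Context: Fix a diagonal $a\in u(n)$, $b\in u(n)$ with $[a,b]=0$, and an integer $j\ge1$. $\mathcal U_a=\{y\in u(n):[a,y]=0\}$ and $\mathcal U_a^\perp$ is its orthogonal complement in $u(n)$ for the trace form $\mathrm{tr}(y_1y_2)$. For $v$ in the Schwartz class $\mathcal S(\mathbb R,\mathcal U_a^\perp)$ let $\mu(x,\lambda)\in GL(n,\mathbb C)$ be its reduced wave function: $\mu$ is meromorphic in $\lambda\in\mathbb C\setminus\mathbb R$, has an asymptotic expansion $\mu\sim I+\mu_1(x)\lambda^{-1}+\mu_2(x)\lambda^{-2}+\cdots$ at $\lambda=\infty$ with $v=[a,\mu_1]$, the map $F(x,\lambda)=\mu(0,\lambda)^{-1}e^{a\lambda x}\mu(x,\lambda)$ is holomorphic in $\lambda\in\mathbb C$ with $F^{-1}F_x=a\lambda+v$, and $\lim_{x\to-\infty}\mu(x,\lambda)=I$.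 $Q_{b,k}(v)$ is the coefficient of $\lambda^{-k}$ in the asymptotic expansion of $\mu^{-1}b\mu$ at $\lambda=\infty$; thus $Q_{b,0}(v)=b$ and $(Q_{b,k}(v))_x+[v,Q_{b,k}(v)]=[Q_{b,k+1}(v),a]$ for $k\ge0$. For functions $u(x,t)$ this is applied for each fixed $t$. $\mathcal M_{a,b,j}$ is the set of smooth $u:\mathbb R^2\to\mathcal U_a^\perp$ with $u(\cdot,t)$ in the Schwartz class for every $t$ which solve the $j$-th flow $u_t=(Q_{b,j}(u))_x+[u,Q_{b,j}(u)]$. The trivialization of $u$ is the solution $E(x,t,\lambda)$ of $E_x=E(a\lambda+u)$, $E_t=E(b\lambda^j+Q_{b,1}(u)\lambda^{j-1}+\dots+Q_{b,j}(u))$, $E(0,0,\lambda)=I$; write $E(x,t)(\lambda)=E(x,t,\lambda)$, so that $E(x,t)\in G_+$. $G_+$ is the group of holomorphic $f:\mathbb C\to GL(n,\mathbb C)$ with $f(\bar\lambda)^*f(\lambda)=I$; $G_-^m$ is the group of rational maps $g$ from $S^2=\mathbb C\cup\{\infty\}$ to $GL(n,\mathbb C)$ (invertible off a finite set) with $g(\infty)=I$ and $g(\bar\lambda)^*g(\lambda)=I$.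
   Formalization: It is assumed in addition that b commutes with every element of U_a, not only with a (automatic if a has distinct eigenvalues); otherwise u = 0 and a suitable g commuting with a but not with b make (i), (ii), (iv) incompatible. *)

(* Defs.v *)
From HB Require Import structures.
From mathcomp Require Import all_boot all_order all_algebra.
From mathcomp Require Import complex.
From mathcomp Require Import all_classical all_reals all_analysis.

Set Implicit Arguments.
Unset Strict Implicit.
Unset Printing Implicit Defensive.

Import Order.TTheory GRing.Theory Num.Theory.
Import numFieldNormedType.Exports.

Local Open Scope classical_set_scope.
Local Open Scope ring_scope.
Local Open Scope complex_scope.

Definition adjmx (R : realType) (n : nat) (M : 'M[R[i]]_n) : 'M[R[i]]_n :=
  map_mx (@conjc R) M^T.

Definition lie (R : realType) (n : nat) (y z : 'M[R[i]]_n) : 'M[R[i]]_n :=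
  y *m z - z *m y.

Definition in_un (R : realType) (n : nat) (y : 'M[R[i]]_n) : Prop :=
  adjmx y = - y.

Definition in_U (R : realType) (n : nat) (a y : 'M[R[i]]_n) : Prop :=
  in_un y /\ lie a y = 0.

Definition in_Uperp (R : realType) (n : nat) (a y : 'M[R[i]]_n) : Prop :=
  in_un y /\ forall z, in_U a z -> \tr (y *m z) = 0.

(* b lies in the centre of U_a, which is automatic when the eigenvalues of a are
   distinct. If it does not, pick g in G_-^m commuting with a and not with b: the
   solution u = 0 has E = e^{a l x + b l^j t}, and g E = E g~ has the
   non-rational solution g~ = e^{-b l^j t} g e^{b l^j t}, so that dressing fails
   to produce the trivialization of a solution. *)
Definition central_in_U (R : realType) (n : nat) (a b : 'M[R[i]]_n) : Prop :=
  forall y, in_U a y -> lie b y = 0.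

Definition cexp (R : realType) (z : R[i]) : R[i] :=
  (expR (complex.Re z))%:C * (cos (complex.Im z) +i* sin (complex.Im z)).

(* e^{s a}; correct only for a diagonal matrix a. *)
Definition expdiag (R : realType) (n : nat) (a : 'M[R[i]]_n) (s : R[i]) :
    'M[R[i]]_n :=
  diag_mx (\row_k cexp (s * a k k)).

Definition has_deriv (R : realType) (n : nat) (f : R -> 'M[R[i]]_n) (x : R)
    (D : 'M[R[i]]_n) : Prop :=
  forall i j,
    is_derive x 1 (fun y : R => complex.Re (f y i j)) (complex.Re (D i j)) /\
    is_derive x 1 (fun y : R => complex.Im (f y i j)) (complex.Im (D i j)).

(* f(x) is invertible and f(x)^-1 f'(x) = A. *)
Definition has_logderiv (R : realType) (n : nat) (f : R -> 'M[R[i]]_n) (x : R)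
    (A : 'M[R[i]]_n) : Prop :=
  f x \in unitmx /\ exists D, has_deriv f x D /\ invmx (f x) *m D = A.

Definition jointly_continuous (R : realType) (n : nat)
    (f : R -> R -> 'M[R[i]]_n) : Prop :=
  forall i j,
    continuous (fun p : R * R => complex.Re (f p.1 p.2 i j)) /\
    continuous (fun p : R * R => complex.Im (f p.1 p.2 i j)).

Fixpoint Ck (R : realType) (n k : nat) (f : R -> R -> 'M[R[i]]_n) : Prop :=
  match k with
  | 0 => jointly_continuous f
  | k'.+1 => exists fx ft : R -> R -> 'M[R[i]]_n,
      [/\ forall x t, has_deriv (fun y => f y t) x (fx x t),
          forall x t, has_deriv (fun s => f x s) t (ft x t),
          Ck k' fx & Ck k' ft]
  end.

Definition smooth (R : realType) (n : nat) (f : R -> R -> 'M[R[i]]_n) : Prop :=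
  forall k, Ck k f.

Definition schwartz_real (R : realType) (f : R -> R) : Prop :=
  (forall k x, derivable (derive1n k f) x 1) /\
  (forall k m, exists B : R, forall x, `|x| ^+ m * `|derive1n k f x| <= B).

Definition schwartz (R : realType) (n : nat) (v : R -> 'M[R[i]]_n) : Prop :=
  forall i j, schwartz_real (fun x => complex.Re (v x i j)) /\
              schwartz_real (fun x => complex.Im (v x i j)).

Definition holo_at (R : realType) (n : nat) (f : R[i] -> 'M[R[i]]_n)
    (z : R[i]) : Prop :=
  forall i j, \forall w \near (z : R[i]^o),
    derivable (fun s : R[i]^o => f s i j : R[i]^o) w 1.

Definition entire (R : realType) (n : nat) (f : R[i] -> 'M[R[i]]_n) : Prop :=
  forall z, holo_at f z.

Definition mero_at (R : realType) (n : nat) (f : R[i] -> 'M[R[i]]_n)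
    (z : R[i]) : Prop :=
  exists (m : nat) (h : R[i] -> 'M[R[i]]_n), holo_at h z /\
    \forall w \near (z : R[i]^o)^', ((w : R[i]) - z) ^+ m *: f w = h w.

(* f(lambda) ~ sum_k c_k lambda^{-k} as lambda -> oo inside Omega. *)
Definition asymptotic (R : realType) (n : nat) (Omega : set R[i])
    (f : R[i] -> 'M[R[i]]_n) (c : nat -> 'M[R[i]]_n) : Prop :=
  forall N : nat, exists K B : R, forall l : R[i],
    Omega l -> K%:C < `|l| -> forall i j,
    `|f l i j - \sum_(k < N) c k i j * l ^- k| <= B%:C * `|l| ^- N.

(* C \ R with the exceptional set Z removed. *)
Definition nonreal_off (R : realType) (Z : set R[i]) : set R[i] :=
  [set l | complex.Im l != 0 /\ ~ Z l].

(* mu is a reduced wave function of v. Z is a set, locally finite in C \ R and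
   common to all x, off which mu(x, .) is holomorphic; the values of mu(x, .)
   on Z and on the real line are irrelevant. All the mu(x, .) have the same
   poles in C \ R, because mu(x, l) = e^{-a l x} mu(0, l) F(x, l). *)
Definition reduced_wave (R : realType) (n : nat) (a : 'M[R[i]]_n)
    (v : R -> 'M[R[i]]_n) (Z : set R[i]) (mu : R -> R[i] -> 'M[R[i]]_n) :
    Prop :=
  [/\ (forall l, complex.Im l != 0 -> \forall w \near (l : R[i]^o)^', ~ Z w),
      (forall x l, complex.Im l != 0 -> mero_at (mu x) l) /\
      (forall x l, nonreal_off Z l -> holo_at (mu x) l /\ mu x l \in unitmx),
      exists m : nat -> R -> 'M[R[i]]_n,
        (forall x, asymptotic (nonreal_off Z) (mu x) (m^~ x)) /\
        (forall x, m 0%N x = 1%:M /\ v x = lie a (m 1%N x)),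
      exists F : R -> R[i] -> 'M[R[i]]_n,
        [/\ forall x, entire (F x),
            forall x l, nonreal_off Z l ->
              F x l = invmx (mu 0 l) *m expdiag a (l * x%:C) *m mu x l
          & forall x l, has_logderiv (F^~ l) x (l *: a + v x)]
    & forall l, nonreal_off Z l ->
        forall i j,
        (mu x l i j : R[i]^o) @[x --> -oo] -->
          ((1%:M : 'M[R[i]]_n) i j : R[i]^o)].

(* Q k x is the value at x of Q_{b,k}(v). *)
Definition is_Q (R : realType) (n : nat) (a b : 'M[R[i]]_n)
    (v : R -> 'M[R[i]]_n) (Q : nat -> R -> 'M[R[i]]_n) : Prop :=
  exists (Z : set R[i]) (mu : R -> R[i] -> 'M[R[i]]_n),
    reduced_wave a v Z mu /\
    forall x, asymptotic (nonreal_off Z)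
                (fun l => invmx (mu x l) *m b *m mu x l) (Q^~ x).

(* The set M_{a,b,j}; functions of (x, t) are written u x t. *)
Definition flow_solutions (R : realType) (n : nat) (a b : 'M[R[i]]_n)
    (j : nat) : set (R -> R -> 'M[R[i]]_n) :=
  [set u |
    [/\ smooth u, forall x t, in_Uperp a (u x t),
        forall t, schwartz (u^~ t)
      & exists Q : R -> nat -> R -> 'M[R[i]]_n,
          (forall t, is_Q a b (u^~ t) (Q t)) /\
          forall x t, exists Qx, has_deriv (Q t j) x Qx /\
            has_deriv (u x) t (Qx + lie (u x t) (Q t j x))]].

Definition is_trivialization (R : realType) (n : nat) (a b : 'M[R[i]]_n)
    (j : nat) (u : R -> R -> 'M[R[i]]_n)
    (E : R -> R -> R[i] -> 'M[R[i]]_n) : Prop :=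
  exists Q : R -> nat -> R -> 'M[R[i]]_n,
    [/\ forall t, is_Q a b (u^~ t) (Q t),
        forall x t l, has_deriv (fun y => E y t l) x
                        (E x t l *m (l *: a + u x t)),
        forall x t l, has_deriv (fun s => E x s l) t
          (E x t l *m (l ^+ j *: b + \sum_(1 <= k < j.+1) l ^+ (j - k) *: Q t k x))
      & forall l, E 0 0 l = 1%:M].

Definition Gplus (R : realType) (n : nat) : set (R[i] -> 'M[R[i]]_n) :=
  [set f | [/\ entire f, forall l, f l \in unitmx
             & forall l, adjmx (f (conjc l)) *m f l = 1%:M]].

(* Rational maps are matrices over the field C(lambda); rat_at g z M says that
   z is not a pole of g and that M is the value of g at z. *)
Definition ratmx (R : realType) (n : nat) := 'M[{fraction {poly R[i]}}]_n.

Definition rat_at (R : realType) (n : nat) (g : ratmx R n) (z : R[i])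
    (M : 'M[R[i]]_n) : Prop :=
  forall i j, exists p q : {poly R[i]},
    [/\ q.[z] != 0, g i j = tofrac p / tofrac q & M i j = p.[z] / q.[z]].

(* The second condition is g(oo) = I. *)
Definition Gminus (R : realType) (n : nat) : set (ratmx R n) :=
  [set g |
    [/\ exists s : seq R[i], forall z, z \notin s ->
          exists M, rat_at g z M /\ M \in unitmx,
        forall e : R, 0 < e -> exists K : R, forall z M,
          K%:C < `|z| -> rat_at g z M ->
          forall i j, `|M i j - (1%:M : 'M[R[i]]_n) i j| < e%:C
      & forall z M N, rat_at g z M -> rat_at g (conjc z) N ->
          adjmx N *m M = 1%:M]].

(* g f = f' h as meromorphic maps, with f' in G_+ and h in G_-^m. *)
Definition factorization (R : realType) (n : nat) (g : ratmx R n)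
    (f f' : R[i] -> 'M[R[i]]_n) (h : ratmx R n) : Prop :=
  [/\ @Gplus R n f', @Gminus R n h
    & forall z M N, rat_at g z M -> rat_at h z N -> M *m f z = f' z *m N].

(* u' = g * u. *)
Definition dressing (R : realType) (n : nat) (a b : 'M[R[i]]_n) (j : nat)
    (g : ratmx R n) (u u' : R -> R -> 'M[R[i]]_n) : Prop :=
  exists (E E' : R -> R -> R[i] -> 'M[R[i]]_n) (g' : R -> R -> ratmx R n),
    [/\ is_trivialization a b j u E,
        forall x t, factorization g (E x t) (E' x t) (g' x t)
      & forall x t l, has_logderiv (fun y => E' y t l) x (l *: a + u' x t)].

(* Main.v *)
Require Import Defs.
From HB Require Import structures.
From mathcomp Require Import all_boot all_order all_algebra.
From mathcomp Require Import complex ring lra.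
From mathcomp Require Import all_classical all_reals all_analysis.

Set Implicit Arguments.
Unset Strict Implicit.
Unset Printing Implicit Defensive.

Import Order.TTheory GRing.Theory Num.Theory.
Import numFieldNormedType.Exports.

Local Open Scope classical_set_scope.
Local Open Scope ring_scope.
Local Open Scope complex_scope.

(** The theorem says that the rational loop group acts on the solutions of a
    flow of the AKNS hierarchy by dressing. Three facts carry it.

    The group [Gminus] is generated by simple elements: by [Gminus_gen], every
    rational matrix that is unitary on the real axis and 1 at infinity is a
    product of factors
      [s (l) = 1 + (conjc al - al) / (l - conjc al) p]
    with [p] an orthogonal projection of rank one. A factorization is unique by
    [factorization_unique], since the quotient of two of them is at once
    entire and rational and equals 1 at infinity. Hence a product acts by
    composition ([factorizationM]), and only one simple element has to be
    treated.

    For a simple element the factorization is explicit. If [E] is the frame of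
    the solution [u], then [E' = s_p E s_P^-1], where [P (x, t)] is the projection
    on the line that [adjmx (E (conjc al))] makes of the image of [p]; this choice
    cancels both poles. [P] satisfies a Riccati equation in [x] and in [t]
    ([hd_frame]), which makes it smooth and gives the new potential
    [u' = u - (conjc al - al) [a, P]]. The densities [q_k] of [u] become the
    coefficients of [s_P (sum q_k l^-k) s_P^-1], and this polynomial identity
    ([hor_dq], [dress_time]) shows that [E'] solves the Lax pair of [u'].
    That [u'] decays rapidly is seen on the diagonal of [P]: it is a probability
    vector following replicator dynamics with rapidly decreasing errors
    ([replicator]), so at each end of the line it concentrates on one
    eigenvalue of [a], and the entries of [[a, P]] are bounded by the others.
    The reduced wave function of [u'] is [s_oo mu s_P^-1] with [s_oo] built from
    the limit of [P] at [-oo] ([dressed_is_Q]).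

    The definition of the hierarchy refers to an unspecified reduced wave
    function, so its densities have to be identified. A formal gauge
    transformation [m] diagonalizes [a l + u] order by order ([gauge_exists]),
    and [m^-1 b m] has smooth coefficients that satisfy the commutator
    recursion ([densities_exist]). Any reduced wave function differs from [m] by
    a series commuting with [a]: conjugation by [e^(a l x)] relates its values at
    [x] and at 0, and the growth rates of the entries differ from one
    horizontal line to another ([strip_entry]). Since [b] is central in the
    centralizer of [a], both yield the same densities ([densities_unique]).
    The recursion is the zero curvature condition, from which the trivialization
    is constructed ([lax_solution_exists]). *)

(** * Moduli and norms of complex matrices *)

Section Modulus.
Variable R : realType.
Notation C := R[i].

(** The modulus as an element of [R]; [`|z|] is an element of [R[i]]. *)
Definition cn (z : C) : R := Normc.normc z.

Lemma cnE z : `|z| = (cn z)%:C. Proof. by []. Qed.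
Lemma cn_ge0 z : 0 <= cn z.
Proof. by rewrite -lecR -cnE normr_ge0. Qed.
Lemma cnM x y : cn (x * y) = cn x * cn y.
Proof. by apply/complexI; rewrite rmorphM -!cnE normrM. Qed.
Lemma cnD x y : cn (x + y) <= cn x + cn y.
Proof. by rewrite -lecR rmorphD -!cnE ler_normD. Qed.
Lemma cnN x : cn (- x) = cn x.
Proof. by apply/complexI; rewrite -!cnE normrN. Qed.
Lemma cnB x y : cn (x - y) <= cn x + cn y.
Proof. by rewrite -(cnN y) cnD. Qed.
Lemma cnJ x : cn (conjc x) = cn x.
Proof. by apply/complexI; rewrite -!cnE normcJ. Qed.
Lemma cn0 : cn 0 = 0.
Proof. by apply/complexI; rewrite -!cnE normr0. Qed.
Lemma cnX x k : cn (x ^+ k) = cn x ^+ k.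
Proof. by apply/complexI; rewrite rmorphXn /= -!cnE normrX. Qed.
Lemma cnV x : cn x^-1 = (cn x)^-1.
Proof. by apply/complexI; rewrite fmorphV /= -!cnE normfV. Qed.
Lemma cn_eq0 x : (cn x == 0) = (x == 0).
Proof. by rewrite -(inj_eq (@complexI R)) -cnE normr_eq0. Qed.
Lemma cn_gt0 x : (0 < cn x) = (x != 0).
Proof. by rewrite lt_def cn_eq0 cn_ge0 andbT. Qed.
Lemma cn_real r : cn r%:C = `|r|.
Proof. by rewrite /cn /= expr0n /= addr0 sqrtr_sqr. Qed.
Lemma cn_re z : `|complex.Re z| <= cn z.
Proof. by rewrite -lecR; apply: normc_ge_Re. Qed.
Lemma cn_im z : `|complex.Im z| <= cn z.
Proof.
have := cn_re (z * 'i%C); rewrite ReiNIm normrN cnM.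
by rewrite (_ : cn 'i%C = 1) ?mulr1 // /cn /= expr0n expr1n add0r sqrtr1.
Qed.
Lemma cn_le z : cn z <= `|complex.Re z| + `|complex.Im z|.
Proof.
rewrite {1}(complexE z) (le_trans (cnD _ _)) // cnM !cn_real.
by rewrite (_ : cn 'i%C = 1) ?mul1r // /cn /= expr0n expr1n add0r sqrtr1.
Qed.
Lemma cn_sum I (r : seq I) (P : pred I) (F : I -> C) :
  cn (\sum_(i <- r | P i) F i) <= \sum_(i <- r | P i) cn (F i).
Proof.
elim/big_rec2: _ => [|i x y _ h]; first by rewrite cn0.
by rewrite (le_trans (cnD _ _)) // lerD2l.
Qed.
Lemma lt_cn r z : (r%:C < `|z|) = (r < cn z).
Proof. by rewrite cnE ltcR. Qed.
Lemma conjM (x y : C) : conjc (x * y) = conjc x * conjc y.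
Proof. by rewrite rmorphM. Qed.

Variable n : nat.
Implicit Types M N : 'M[C]_n.

(** The sum of the moduli of the entries: submultiplicative, and the same for
    a matrix and its adjoint. *)
Definition nm M : R := \sum_i \sum_j cn (M i j).

Lemma nm_ge0 M : 0 <= nm M.
Proof. by apply: sumr_ge0 => i _; apply: sumr_ge0 => j _; apply: cn_ge0. Qed.
Lemma cn_nm M i j : cn (M i j) <= nm M.
Proof.
rewrite /nm (bigD1 i) //= (bigD1 j) //= -addrA lerDl addr_ge0 //.
  by apply: sumr_ge0 => *; apply: cn_ge0.
by apply: sumr_ge0 => *; apply: sumr_ge0 => *; apply: cn_ge0.
Qed.
Lemma nm_le M c : (forall i j, cn (M i j) <= c) -> nm M <= (n * n)%:R * c.
Proof.
move=> h; rewrite /nm; apply: (@le_trans _ _ (\sum_(i < n) \sum_(j < n) c)).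
  by apply: ler_sum => i _; apply: ler_sum.
by rewrite !sumr_const card_ord -mulrnA mulr_natl.
Qed.
Lemma nm0 : nm 0 = 0.
Proof. by rewrite /nm big1 // => i _; rewrite big1 // => j _; rewrite mxE cn0. Qed.
Lemma nmD M N : nm (M + N) <= nm M + nm N.
Proof.
rewrite /nm -big_split ler_sum // => i _; rewrite -big_split ler_sum // => j _.
by rewrite mxE cnD.
Qed.
Lemma nmN M : nm (- M) = nm M.
Proof. by apply: eq_bigr => i _; apply: eq_bigr => j _; rewrite mxE cnN. Qed.
Lemma nmB M N : nm (M - N) <= nm M + nm N.
Proof. by rewrite -(nmN N) nmD. Qed.
Lemma nmZ c M : nm (c *: M) = cn c * nm M.
Proof.
rewrite /nm mulr_sumr; apply: eq_bigr => i _.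
by rewrite mulr_sumr; apply: eq_bigr => j _; rewrite mxE cnM.
Qed.
Lemma nmM M N : nm (M *m N) <= nm M * nm N.
Proof.
rewrite {1}/nm.
apply: (@le_trans _ _ (\sum_i \sum_j \sum_k cn (M i k) * cn (N k j))).
  apply: ler_sum => i _; apply: ler_sum => j _; rewrite mxE.
  by apply: le_trans (cn_sum _ _ _) _; apply: ler_sum => k _; rewrite cnM.
rewrite /nm mulr_suml; apply: ler_sum => i _; rewrite exchange_big mulr_suml.
apply: ler_sum => k _; rewrite -mulr_sumr ler_wpM2l ?cn_ge0 //.
rewrite [leRHS](bigD1 k) //= lerDl sumr_ge0 // => *.
by apply: sumr_ge0 => *; apply: cn_ge0.
Qed.
Lemma nm_adj M : nm (adjmx M) = nm M.
Proof.
rewrite /nm exchange_big; apply: eq_bigr => i _; apply: eq_bigr => j _.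
by rewrite !mxE cnJ.
Qed.
Lemma nm_sum I (r : seq I) (P : pred I) (F : I -> 'M[C]_n) :
  nm (\sum_(i <- r | P i) F i) <= \sum_(i <- r | P i) nm (F i).
Proof.
elim/big_rec2: _ => [|i x y _ h]; first by rewrite nm0.
by rewrite (le_trans (nmD _ _)) // lerD2l.
Qed.
Lemma nm_eq0 M : nm M <= 0 -> M = 0.
Proof.
move=> h; apply/matrixP => i j; rewrite mxE; apply/eqP.
by rewrite -cn_eq0 eq_le cn_ge0 andbT (le_trans (cn_nm M i j)).
Qed.
Lemma nm_tr M : cn (\tr M) <= nm M.
Proof.
apply: le_trans (cn_sum _ _ _) _; apply: ler_sum => i _.
by rewrite (bigD1 i) //= lerDl sumr_ge0 // => *; apply: cn_ge0.
Qed.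

Lemma adjM M N : adjmx (M *m N) = adjmx N *m adjmx M.
Proof. by rewrite /adjmx trmx_mul map_mxM. Qed.
Lemma adjK M : adjmx (adjmx M) = M.
Proof. by apply/matrixP => i j; rewrite !mxE conjcK. Qed.
Lemma adjD M N : adjmx (M + N) = adjmx M + adjmx N.
Proof. by apply/matrixP => i j; rewrite !mxE rmorphD. Qed.
Lemma adjN M : adjmx (- M) = - adjmx M.
Proof. by apply/matrixP => i j; rewrite !mxE rmorphN. Qed.
Lemma adjB M N : adjmx (M - N) = adjmx M - adjmx N.
Proof. by rewrite adjD adjN. Qed.
Lemma adjZ c M : adjmx (c *: M) = conjc c *: adjmx M.
Proof. by apply/matrixP => i j; rewrite !mxE rmorphM. Qed.
Lemma adj0 : adjmx (0 : 'M[C]_n) = 0.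
Proof. by apply/matrixP => i j; rewrite !mxE conjc0. Qed.
Lemma adj1 : adjmx (1%:M : 'M[C]_n) = 1%:M.
Proof. by apply/matrixP => i j; rewrite !mxE eq_sym rmorph_nat. Qed.
Lemma adj_sum I (r : seq I) (P : pred I) (F : I -> 'M[C]_n) :
  adjmx (\sum_(i <- r | P i) F i) = \sum_(i <- r | P i) adjmx (F i).
Proof. by elim/big_rec2: _ => [|i x y _ <-]; rewrite ?adj0 ?adjD. Qed.
Lemma tr_MadjM M :
  \tr (M *m adjmx M) = (\sum_i \sum_j cn (M i j) ^+ 2)%:C.
Proof.
rewrite rmorph_sum; apply: eq_bigr => i _; rewrite mxE rmorph_sum.
by apply: eq_bigr => j _; rewrite !mxE -sqr_normc cnE -rmorphXn.
Qed.
End Modulus.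
(** * Differential calculus of matrix functions *)

Section Deriv.
Variable R : realType.
Notation C := R[i].

Lemma is_derive_ext (f g : R -> R) (x d : R) :
  f =1 g -> is_derive x 1 f d -> is_derive x 1 g d.
Proof. by move=> /funext ->. Qed.

(** The scalar form of [has_deriv]. *)
Definition hdc (f : R -> C) (x : R) (d : C) : Prop :=
  is_derive x 1 (fun y => complex.Re (f y)) (complex.Re d) /\
  is_derive x 1 (fun y => complex.Im (f y)) (complex.Im d).

Lemma hdc_ext f g x d : f =1 g -> hdc f x d -> hdc g x d.
Proof. by move=> /funext ->. Qed.
Lemma hdc_cst c x : hdc (fun=> c) x 0.
Proof. by split; apply: is_derive_cst. Qed.
Lemma hdc_add f g x d e : hdc f x d -> hdc g x e ->
  hdc (fun y => f y + g y) x (d + e).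
Proof.
move=> [f1 f2] [g1 g2]; split; rewrite raddfD /=.
  by apply: is_derive_ext (is_deriveD f1 g1) => y; rewrite raddfD.
by apply: is_derive_ext (is_deriveD f2 g2) => y; rewrite raddfD.
Qed.
Lemma ReM (x y : C) : complex.Re (x * y) =
  complex.Re x * complex.Re y - complex.Im x * complex.Im y.
Proof. by case: x; case: y. Qed.
Lemma ImM (x y : C) : complex.Im (x * y) =
  complex.Re x * complex.Im y + complex.Im x * complex.Re y.
Proof. by case: x => a b; case: y => c d /=; rewrite [b * c]mulrC. Qed.
Lemma hdc_mul f g x d e : hdc f x d -> hdc g x e ->
  hdc (fun y => f y * g y) x (d * g x + f x * e).
Proof.
move=> [f1 f2] [g1 g2]; split; rewrite raddfD /= ?(ReM, ImM).
  apply: (@is_derive_eq _ _ _ _ _ _ _ _ (is_derive_ext _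
    (is_deriveB (is_deriveM f1 g1) (is_deriveM f2 g2)))).
    by move=> y; rewrite ReM.
  by rewrite /GRing.scale /=; ring.
apply: (@is_derive_eq _ _ _ _ _ _ _ _ (is_derive_ext _
    (is_deriveD (is_deriveM f1 g2) (is_deriveM f2 g1)))).
  by move=> y; rewrite ImM.
by rewrite /GRing.scale /=; ring.
Qed.
Lemma hdc_conj f x d : hdc f x d -> hdc (fun y => conjc (f y)) x (conjc d).
Proof.
move=> [f1 f2]; split; rewrite ?(Re_conjc, Im_conjc).
  by rewrite (_ : complex.Re (conjc d) = complex.Re d); [apply: is_derive_ext f1 => y; case: (f y)|case: d {f1 f2}].
rewrite (_ : complex.Im (conjc d) = - complex.Im d); last by case: d {f1 f2}.
by apply: is_derive_ext (is_deriveN f2) => y /=; rewrite fctE; case: (f y).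
Qed.
Lemma hdc_real (f : R -> R) (x d : R) : is_derive x 1 f d -> hdc (fun y => (f y)%:C) x d%:C.
Proof. by move=> h; split => //=; apply: is_derive_cst. Qed.
Lemma hdc_sum I (r : seq I) (P : pred I) (F : I -> R -> C) D x :
  (forall i, P i -> hdc (F i) x (D i)) ->
  hdc (fun y => \sum_(i <- r | P i) F i y) x (\sum_(i <- r | P i) D i).
Proof.
move=> h; elim: r => [|i r IH].
  by rewrite big_nil; apply: hdc_ext (hdc_cst 0 x) => y; rewrite big_nil.
rewrite big_cons; case: ifP => Pi.
  by apply: hdc_ext (hdc_add (h i Pi) IH) => y; rewrite big_cons Pi.
by apply: hdc_ext IH => y; rewrite big_cons Pi.
Qed.
Lemma hdc_unique f x d e : hdc f x d -> hdc f x e -> d = e.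
Proof.
move=> [f1 f2] [g1 g2]; apply/eqP; rewrite eq_complex.
have := @derive_val _ _ _ _ _ _ _ f1; rewrite (@derive_val _ _ _ _ _ _ _ g1) => <-.
have := @derive_val _ _ _ _ _ _ _ f2; rewrite (@derive_val _ _ _ _ _ _ _ g2) => <-.
by rewrite !eqxx.
Qed.

Variable n : nat.
Implicit Types f g : R -> 'M[C]_n.

Lemma hd_ext f g x D : f =1 g -> has_deriv f x D -> has_deriv g x D.
Proof. by move=> /funext ->. Qed.
Lemma hd_eq f x D D' : has_deriv f x D -> D = D' -> has_deriv f x D'.
Proof. by move=> h <-. Qed.
Lemma hd_cst c x : has_deriv (fun=> c) x (0 : 'M[C]_n).
Proof. by move=> i j; rewrite mxE; apply: hdc_cst. Qed.
Lemma hd_add f g x D E : has_deriv f x D -> has_deriv g x E ->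
  has_deriv (fun y => f y + g y) x (D + E).
Proof.
move=> hf hg i j; rewrite mxE.
by apply: hdc_ext (hdc_add (hf i j) (hg i j)) => y; rewrite mxE.
Qed.
Lemma hd_scale (c : R -> C) f x d D : hdc c x d -> has_deriv f x D ->
  has_deriv (fun y => c y *: f y) x (d *: f x + c x *: D).
Proof.
move=> hc hf i j; rewrite !mxE.
by apply: hdc_ext (hdc_mul hc (hf i j)) => y; rewrite mxE.
Qed.
Lemma hd_Z c f x D : has_deriv f x D -> has_deriv (fun y => c *: f y) x (c *: D).
Proof.
by move=> h; have := hd_scale (hdc_cst c x) h; rewrite scale0r add0r.
Qed.
Lemma hd_opp f x D : has_deriv f x D -> has_deriv (fun y => - f y) x (- D).
Proof.
by move=> h; rewrite -scaleN1r; apply: hd_ext (hd_Z (-1) h) => y; rewrite scaleN1r.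
Qed.
Lemma hd_sub f g x D E : has_deriv f x D -> has_deriv g x E ->
  has_deriv (fun y => f y - g y) x (D - E).
Proof. by move=> hf hg; apply: hd_add => //; apply: hd_opp. Qed.
Lemma hd_mul f g x D E : has_deriv f x D -> has_deriv g x E ->
  has_deriv (fun y => f y *m g y) x (D *m g x + f x *m E).
Proof.
move=> hf hg i j; rewrite !mxE -big_split /=.
have := @hdc_sum _ (index_enum 'I_n) xpredT (fun k y => f y i k * g y k j)
  (fun k => D i k * g x k j + f x i k * E k j) x.
move=> /(_ (fun k _ => hdc_mul (hf i k) (hg k j))).
by apply: hdc_ext => y; rewrite mxE.
Qed.
Lemma hd_mulr f x D M : has_deriv f x D ->
  has_deriv (fun y => f y *m M) x (D *m M).
Proof. by move=> h; have := hd_mul h (hd_cst M x); rewrite mulmx0 addr0. Qed.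
Lemma hd_mull f x D M : has_deriv f x D ->
  has_deriv (fun y => M *m f y) x (M *m D).
Proof. by move=> h; have := hd_mul (hd_cst M x) h; rewrite mul0mx add0r. Qed.
Lemma hd_adj f x D : has_deriv f x D ->
  has_deriv (fun y => adjmx (f y)) x (adjmx D).
Proof.
move=> h i j; rewrite !mxE.
by apply: hdc_ext (hdc_conj (h j i)) => y; rewrite !mxE.
Qed.
Lemma hd_tr f x D : has_deriv f x D -> hdc (fun y => \tr (f y)) x (\tr D).
Proof.
move=> h; apply: (@hdc_sum _ _ xpredT (fun i y => f y i i) (fun i => D i i) x).
by move=> i _; apply: h.
Qed.
Lemma hd_sum I (r : seq I) (P : pred I) (F : I -> R -> 'M[C]_n) D x :
  (forall i, P i -> has_deriv (F i) x (D i)) ->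
  has_deriv (fun y => \sum_(i <- r | P i) F i y) x (\sum_(i <- r | P i) D i).
Proof.
move=> h k l; rewrite summxE.
apply: hdc_ext (@hdc_sum _ r P (fun i y => F i y k l) (fun i => D i k l) x _).
  by move=> y; rewrite summxE.
by move=> i Pi; apply: h.
Qed.
Lemma hd_unique f x D E : has_deriv f x D -> has_deriv f x E -> D = E.
Proof. by move=> hf hg; apply/matrixP => i j; apply: hdc_unique (hf i j) (hg i j). Qed.

Lemma hd_cst0 f x y : (forall z, has_deriv f z 0) -> f x = f y.
Proof.
move=> h; apply/matrixP => i j; apply/eqP; rewrite eq_complex.
apply/andP; split; apply/eqP.
  apply: (@is_derive_0_is_cst _ (fun z => complex.Re (f z i j))) => z.
  by have [] := h z i j; rewrite mxE.
apply: (@is_derive_0_is_cst _ (fun z => complex.Im (f z i j))) => z.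
by have [] := h z i j; rewrite mxE.
Qed.

Lemma is_derive_cont (f : R -> R) (x d : R) : is_derive x 1 f d -> {for x, continuous f}.
Proof. by move=> [h _]; apply/differentiable_continuous/derivable1_diffP. Qed.

(** Mean value inequality against a majorant [g]. *)
Lemma mvi (f df g dg : R -> R) (a b : R) : a <= b ->
  (forall x, a <= x <= b -> is_derive x 1 f (df x)) ->
  (forall x, a <= x <= b -> is_derive x 1 g (dg x)) ->
  (forall x, a <= x <= b -> df x <= dg x) -> f b - f a <= g b - g a.
Proof.
move=> ab hf hg h.
have hd x : a <= x <= b -> is_derive x 1 (g - f) (dg x - df x).
  by move=> xab; apply: is_deriveB; [apply: hg|apply: hf].
have [| |c cab] := @MVT_segment _ (g - f) (fun x => dg x - df x) a b ab.
- by move=> x /[!in_itv]/= /andP[/ltW ax /ltW xb]; apply: hd; rewrite ax xb.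
- apply: continuous_in_subspaceT => x; rewrite inE /= in_itv /= => xab.
  exact: is_derive_cont (hd _ xab).
move: cab; rewrite in_itv /= => cab.
rewrite !fctE => e; rewrite -subr_ge0.
have -> : g b - g a - (f b - f a) = (dg c - df c) * (b - a) by rewrite -e; ring.
by rewrite mulr_ge0 // subr_ge0 ?h.
Qed.
End Deriv.
Section MeanValue.
Variable R : realType.
Notation C := R[i].

Lemma is_derive_reflect (f : R -> R) (x d : R) :
  is_derive (- x) 1 f d -> is_derive x 1 (fun y => f (- y)) (- d).
Proof.
move=> h; have hN : is_derive x 1 (fun y : R => - y) (-1) by exact: is_deriveN.
have := @is_derive1_comp _ f (fun y : R => - y) x d (-1) h hN.
by rewrite mulrN1.
Qed.

(** Symmetric version: a bound for the derivative on a ball around 0. *)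
Lemma mvik (f df : R -> R) (X c : R) (k : nat) :
  (forall x : R, `|x| <= X -> is_derive x 1 f (df x)) ->
  (forall x : R, `|x| <= X -> `|df x| <= c * `|x| ^+ k) ->
  forall x : R, `|x| <= X -> `|f x - f 0| <= c * `|x| ^+ k.+1 / k.+1%:R.
Proof.
have key (g dg : R -> R) : (forall x : R, `|x| <= X -> is_derive x 1 g (dg x)) ->
  (forall x : R, `|x| <= X -> `|dg x| <= c * `|x| ^+ k) ->
  forall x : R, 0 <= x -> x <= X -> `|g x - g 0| <= c * x ^+ k.+1 / k.+1%:R.
  move=> hg hc x x0 xX.
  have inX (z : R) : 0 <= z <= x -> `|z| <= X.
    by case/andP=> z0 zx; rewrite ger0_norm // (le_trans zx).
  have hd (e z : R) : is_derive z 1 (fun y : R => e / k.+1%:R * y ^+ k.+1) (e * z ^+ k).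
    have h := is_deriveZ (e / k.+1%:R) (is_deriveX k.+1 (is_derive_id z 1)).
    apply: is_derive_ext (is_derive_eq h _) => [y|]; first by rewrite !fctE.
    by rewrite /GRing.scale /= mulr1 mulrA divfK // pnatr_eq0.
  have hz z : 0 <= z <= x -> - (c * z ^+ k) <= dg z <= c * z ^+ k.
    move=> hz; have := hc z (inX z hz); rewrite ler_norml (ger0_norm (_ : 0 <= z)) //.
    by case/andP: hz.
  have h1 := mvi x0 (fun z hz => hg z (inX z hz)) (fun z _ => hd c z) (fun z h => (andP (hz z h)).2).
  have h2 := mvi x0 (fun z _ => hd (- c) z) (fun z hz => hg z (inX z hz)).
  rewrite ler_norml; apply/andP; split.
    have -> : - (c * x ^+ k.+1 / k.+1%:R) =
        - c / k.+1%:R * x ^+ k.+1 - - c / k.+1%:R * 0 ^+ k.+1.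
      by rewrite expr0n mulr0 subr0; ring.
    apply: h2.
    by move=> z h; rewrite mulNr; case/andP: (hz z h).
  by move: h1; rewrite expr0n mulr0 subr0 mulrAC.
move=> hf hc x xX; have [x0|x0] := leP 0 x.
  by rewrite (ger0_norm x0); apply: (key f df) => //; rewrite (le_trans (ler_norm _)).
have hf' (y : R) : `|y| <= X -> is_derive y 1 (fun z => f (- z)) (- df (- y)).
  by move=> yX; apply: is_derive_reflect; apply: hf; rewrite normrN.
have hc' (y : R) : `|y| <= X -> `|- df (- y)| <= c * `|y| ^+ k.
  by move=> yX; rewrite normrN -[in leRHS](normrN y) hc // normrN.
have := key _ _ hf' hc' (- x); rewrite opprK oppr0 (ltr0_norm x0); apply.
  by rewrite oppr_ge0 ltW.
by move: xX; rewrite ltr0_norm.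
Qed.

Lemma hdc_mvk (f df : R -> C) (X c : R) (k : nat) :
  (forall x : R, `|x| <= X -> hdc f x (df x)) ->
  (forall x : R, `|x| <= X -> cn (df x) <= c * `|x| ^+ k) ->
  forall x : R, `|x| <= X -> cn (f x - f 0) <= 2 * (c * `|x| ^+ k.+1 / k.+1%:R).
Proof.
move=> hf hc x xX; apply: le_trans (cn_le _) _; rewrite !raddfB /=.
have h1 := @mvik _ _ X c k (fun y hy => (hf y hy).1)
  (fun y hy => le_trans (cn_re _) (hc y hy)) x xX.
have h2 := @mvik _ _ X c k (fun y hy => (hf y hy).2)
  (fun y hy => le_trans (cn_im _) (hc y hy)) x xX.
by move: (lerD h1 h2); rewrite mulr_natl mulr2n.
Qed.

Variable n : nat.

(** What is lost when a mean value inequality is applied to the real and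
    imaginary parts of all entries. *)
Definition Kn : R := (n * n)%:R * 2.
Lemma Kn_ge0 : 0 <= Kn. Proof. by rewrite mulr_ge0. Qed.

Lemma hd_mvk (f df : R -> 'M[C]_n) (X c : R) (k : nat) :
  (forall x : R, `|x| <= X -> has_deriv f x (df x)) ->
  (forall x : R, `|x| <= X -> nm (df x) <= c * `|x| ^+ k) ->
  forall x : R, `|x| <= X -> nm (f x - f 0) <= Kn * (c * `|x| ^+ k.+1 / k.+1%:R).
Proof.
move=> hf hc x xX; rewrite /Kn -[leRHS]mulrA; apply: nm_le => i j; rewrite !mxE.
apply: (@hdc_mvk (fun y => f y i j) (fun y => df y i j) X) => // y yX.
  exact: hf.
by apply: le_trans (cn_nm _ _ _) (hc y yX).
Qed.

Lemma hd_mv (f df : R -> 'M[C]_n) (X c : R) :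
  (forall x : R, `|x| <= X -> has_deriv f x (df x)) ->
  (forall x : R, `|x| <= X -> nm (df x) <= c) ->
  forall x : R, `|x| <= X -> nm (f x - f 0) <= Kn * (c * `|x|).
Proof.
move=> hf hc x xX; have := @hd_mvk f df X c 0%N hf _ x xX; rewrite expr1 divr1; apply.
by move=> y yX; rewrite expr0 mulr1 hc.
Qed.

(** Multiplication by [expR (- c * x)] reduces the claim to monotonicity on
    the right half line, and reflection gives the left one. *)
Lemma gronwall (y dy : R -> R) (X c : R) :
  (forall x : R, `|x| <= X -> is_derive x 1 y (dy x)) ->
  (forall x : R, `|x| <= X -> `|dy x| <= c * y x) ->
  forall x : R, `|x| <= X -> y x <= y 0 * expR (c * `|x|).
Proof.
have key (g dg : R -> R) : (forall x : R, `|x| <= X -> is_derive x 1 g (dg x)) ->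
  (forall x : R, `|x| <= X -> `|dg x| <= c * g x) ->
  forall x : R, 0 <= x -> x <= X -> g x <= g 0 * expR (c * x).
  move=> hg hc x x0 xX.
  have inX (z : R) : 0 <= z <= x -> `|z| <= X.
    by case/andP=> z0 zx; rewrite ger0_norm // (le_trans zx).
  have he (z : R) : is_derive z 1 (fun y : R => expR (- c * y)) (- c * expR (- c * z)).
    have h1 : is_derive z 1 (fun y : R => - c * y) (- c).
      by apply: is_derive_eq; rewrite ?scaler0 /GRing.scale /=; ring.
    have := @is_derive1_comp _ expR (fun y : R => - c * y) z _ _ (is_derive_expR _) h1.
    by rewrite mulrC.
  have h1 (z : R) (hz : 0 <= z <= x) := is_deriveM (hg z (inX z hz)) (he z).
  have h2 := mvi x0 h1 (fun z _ => is_derive_cst 0 z 1).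
  have : forall z : R, 0 <= z <= x -> g z *: (- c * expR (- c * z)) + expR (- c * z) *: dg z <= 0.
    move=> z hz; have := hc z (inX z hz); rewrite ler_norml => /andP[_ h].
    rewrite /GRing.scale /= (_ : _ + _ = expR (- c * z) * (dg z - c * g z)); last by ring.
    by rewrite mulr_ge0_le0 ?expR_ge0 // subr_le0.
  move=> /h2; rewrite !fctE mulr0 expR0 mulr1 subrr subr_le0 => h.
  rewrite -(ler_pM2r (expR_gt0 (- c * x))) -mulrA -expRD mulNr subrr expR0 mulr1.
  by rewrite -mulNr.
move=> hf hc x xX; have [x0|x0] := leP 0 x.
  by rewrite (ger0_norm x0); apply: (key y dy) => //; rewrite (le_trans (ler_norm _)).
have hf' (z : R) : `|z| <= X -> is_derive z 1 (fun w => y (- w)) (- dy (- z)).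
  by move=> yX; apply: is_derive_reflect; apply: hf; rewrite normrN.
have hc' (z : R) : `|z| <= X -> `|- dy (- z)| <= c * y (- z).
  by move=> yX; rewrite normrN hc // normrN.
have := key _ _ hf' hc' (- x); rewrite opprK oppr0 (ltr0_norm x0); apply.
  by rewrite oppr_ge0 ltW.
by move: xX; rewrite ltr0_norm.
Qed.
End MeanValue.
(** * Linear differential equations depending on a parameter *)

Section Primitive.
Variable R : realType.
Notation C := R[i].

(** The integral from [- X] is differentiable on both sides of 0. *)
Lemma prim_local (f : R -> R) (X : R) : continuous f -> 0 < X ->
  exists F : R -> R, F 0 = 0 /\ forall x : R, `|x| < X -> is_derive x 1 F (f x).
Proof.
move=> cf X0; pose mu := (@lebesgue_measure R).
pose G (x : R) : R := (\int[mu]_(t in `[- X, x]) f t)%R.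
have hG (x : R) : `|x| < X -> is_derive x 1 G (f x).
  rewrite ltr_norml => /andP[xX Xx].
  have int : mu.-integrable [set` Interval (BLeft (- X)) (BRight X)] (EFin \o f).
    apply: continuous_compact_integrable; first exact: segment_compact.
    by apply: continuous_subspaceT.
  have [|d e] := @continuous_FTC1 R f (BLeft (- X)) x X Xx int _ (cf x).
    suff : (BLeft (- X) < BRight x)%O by []. by rewrite bnd_simp ltW.
  by split; [exact: d|rewrite -derive1E; exact: e].
exists (fun x => G x - G 0); split; first by rewrite subrr.
move=> x xX; have := is_deriveB (hG x xX) (is_derive_cst (G 0) x 1).
by rewrite subr0.
Qed.

(** Primitives vanishing at 0 on nested balls agree, so they can be glued. *)
Lemma prim (f : R -> R) : continuous f ->
  exists F : R -> R, F 0 = 0 /\ forall x : R, is_derive x 1 F (f x).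
Proof.
move=> cf.
have /choice[F hF] : forall N : nat, exists F : R -> R, F 0 = 0 /\
    forall x : R, `|x| < N%:R -> is_derive x 1 F (f x).
  move=> N; have [F [F0 hF]] := prim_local cf (ltr0Sn R N).
  exists F; split=> // x xN; apply: hF; apply: lt_trans xN _.
  by rewrite ltr_nat.
have agree N M (x : R) : `|x| < N%:R -> `|x| < M%:R -> F N x = F M x.
  move=> xN xM; have d (y : R) : `|y| <= `|x| ->
      is_derive y 1 (fun z => F N z - F M z) 0.
    move=> yx; rewrite -(subrr (f y)).
    by apply: is_deriveB; apply: (hF _).2; apply: le_lt_trans yx _.
  have := @mvik _ _ (fun=> 0) `|x| 0 0%N d _ x (lexx _).
  rewrite (hF N).1 (hF M).1 subrr subr0 !mul0r normr_le0 subr_eq0 => h.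
  by apply/eqP/h => y _; rewrite normr0 mul0r.
exists (fun x => F (Num.Def.archi_bound x) x); split; first exact: (hF _).1.
move=> x; have xN := archi_boundP (normr_ge0 x).
pose N := (Num.Def.archi_bound `|x|).+1.
have xN' : `|x| < N%:R by apply: lt_trans xN _; rewrite ltr_nat.
have hb (y : R) : `|y| < (Num.Def.archi_bound y)%:R by exact: unstable.ltr_norm_bound.
apply: near_eq_is_derive ((hF N).2 x xN').
have e0 : 0 < N%:R - `|x| by rewrite subr_gt0.
exists (N%:R - `|x|) => //= y /=; rewrite distrC => yx; apply: agree => //.
have := ler_normD (y - x) x; rewrite subrK => h.
by apply: le_lt_trans h _; rewrite -ltrBrDr.
Qed.
End Primitive.
(** Continuity of matrix functions, relative to a family of balls. *)
Section BallContinuity.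
Variables (R : realType) (n : nat) (T : Type) (B : R -> T -> T -> Prop).
Notation C := R[i].
Hypothesis B_mono : forall d d' x y, d <= d' -> B d x y -> B d' x y.
Implicit Types f g : T -> 'M[C]_n.

Definition gcont f := forall x (e : R), 0 < e ->
  exists2 d : R, 0 < d & forall y, B d x y -> nm (f y - f x) <= e.

Lemma ball_min d d' x y : B (Num.min d d') x y -> B d x y /\ B d' x y.
Proof. by move=> h; split; apply: B_mono h; rewrite ge_min lexx ?orbT. Qed.

Lemma gcont_cst c : gcont (fun=> c).
Proof. by move=> x e e0; exists 1 => // y _; rewrite subrr nm0 ltW. Qed.
Lemma gcontD f g : gcont f -> gcont g -> gcont (fun x => f x + g x).
Proof.
move=> hf hg x e e0; have e2 : 0 < e / 2 by rewrite divr_gt0.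
have [d d0 h1] := hf x _ e2; have [d' d'0 h2] := hg x _ e2.
exists (Num.min d d'); first by rewrite lt_min d0.
move=> y /ball_min[y1 y2].
rewrite opprD addrACA (le_trans (nmD _ _)) // (splitr e).
by rewrite lerD ?h1 ?h2.
Qed.
Lemma gcontM f g : gcont f -> gcont g -> gcont (fun x => f x *m g x).
Proof.
move=> hf hg x e e0.
pose c := 1 + nm (f x) + nm (g x).
have c1 : 1 <= c by rewrite /c -addrA lerDl addr_ge0 ?nm_ge0.
have c0 : 0 < c by apply: lt_le_trans c1.
have e2 : 0 < Num.min 1 (e / (2 * c)) by rewrite lt_min ltr01 divr_gt0 ?mulr_gt0.
have [d d0 h1] := hf x _ e2; have [d' d'0 h2] := hg x _ e2.
exists (Num.min d d'); first by rewrite lt_min d0.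
move=> y /ball_min[/h1 y1 /h2 y2].
have -> : f y *m g y - f x *m g x = (f y - f x) *m g y + f x *m (g y - g x).
  by rewrite mulmxBl mulmxBr addrA subrK.
move: y1 y2; rewrite !le_min => /andP[_ y1] /andP[y2 y3].
rewrite (le_trans (nmD _ _)) // (splitr e).
have hgy : nm (g y) <= c.
  have := nmD (g y - g x) (g x); rewrite subrK => h.
  by apply: le_trans h _; rewrite /c lerD2r (le_trans y2) // lerDl nm_ge0.
have e2c : e / 2 = e / (2 * c) * c by rewrite invfM mulrA divfK ?gt_eqF.
apply: lerD; apply: le_trans (nmM _ _) _; rewrite e2c.
  by apply: ler_pM => //; rewrite nm_ge0.
rewrite mulrC; apply: ler_pM => //; rewrite ?nm_ge0 //.
by rewrite /c addrAC lerDr addr_ge0 ?nm_ge0.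
Qed.
Lemma gcontZ c f : gcont f -> gcont (fun x => c *: f x).
Proof.
move=> h; have := gcontM (gcont_cst c%:M) h.
by congr gcont; apply/funext => x; rewrite mul_scalar_mx.
Qed.
Lemma gcont_sum I (r : seq I) (P : pred I) (F : I -> T -> 'M[C]_n) :
  (forall i, P i -> gcont (F i)) -> gcont (fun x => \sum_(i <- r | P i) F i x).
Proof.
move=> h; elim: r => [|i r IH].
  by have := gcont_cst 0; congr gcont; apply/funext => x; rewrite big_nil.
case: (boolP (P i)) => Pi.
  have := gcontD (h i Pi) IH.
  by congr gcont; apply/funext => x; rewrite big_cons Pi.
by move: IH; congr gcont; apply/funext => x; rewrite big_cons (negbTE Pi).
Qed.
End BallContinuity.

Section Continuity.
Variables (R : realType) (n : nat).
Notation C := R[i].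
Implicit Types f g : R -> 'M[C]_n.

Definition mcont f := @gcont R n R (fun d x y => `|y - x| < d) f.

Let ball_mono (d d' x y : R) : d <= d' -> `|y - x| < d -> `|y - x| < d'.
Proof. by move=> dd' /lt_le_trans; apply. Qed.

Lemma mcont_cst c : mcont (fun=> c).
Proof. exact: gcont_cst. Qed.
Lemma mcontD f g : mcont f -> mcont g -> mcont (fun x => f x + g x).
Proof. exact: gcontD. Qed.
Lemma mcontM f g : mcont f -> mcont g -> mcont (fun x => f x *m g x).
Proof. exact: gcontM. Qed.
Lemma mcontZ c f : mcont f -> mcont (fun x => c *: f x).
Proof. exact: gcontZ. Qed.
Lemma mcont_sum I (r : seq I) (P : pred I) (F : I -> R -> 'M[C]_n) :
  (forall i, P i -> mcont (F i)) -> mcont (fun x => \sum_(i <- r | P i) F i x).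
Proof. exact: gcont_sum. Qed.
Lemma mcont_re f i j : mcont f -> continuous (fun x => complex.Re (f x i j)).
Proof.
move=> h x; apply/cvgrPdist_le => e e0; have [d d0 hd] := h x e e0.
exists d => //= y /=; rewrite distrC => /hd; apply: le_trans.
rewrite distrC -raddfB; apply: le_trans (cn_re _) _.
by have := cn_nm (f y - f x) i j; rewrite !mxE.
Qed.
Lemma mcont_im f i j : mcont f -> continuous (fun x => complex.Im (f x i j)).
Proof.
move=> h x; apply/cvgrPdist_le => e e0; have [d d0 hd] := h x e e0.
exists d => //= y /=; rewrite distrC => /hd; apply: le_trans.
rewrite distrC -raddfB; apply: le_trans (cn_im _) _.
by have := cn_nm (f y - f x) i j; rewrite !mxE.
Qed.
Lemma mcont_nm f : mcont f -> continuous (fun x => nm (f x)).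
Proof.
move=> h x; apply/cvgrPdist_le => e e0; have [d d0 hd] := h x e e0.
exists d => //= y /=; rewrite distrC => /hd; apply: le_trans.
rewrite ler_norml; apply/andP; split; first rewrite lerNl opprB; rewrite lerBlDr.
  by have := nmD (f y - f x) (f x); rewrite subrK.
by have := nmD (f x - f y) (f y); rewrite subrK -(nmN (f x - f y)) opprB.
Qed.
Lemma mcont_bound f (X : R) : mcont f ->
  exists2 c, 0 <= c & forall x, `|x| <= X -> nm (f x) <= c.
Proof.
move=> h; have [X0|X0] := ltP X 0.
  exists 0 => // x xX; have := le_lt_trans xX X0.
  by rewrite normr_lt0.
have XX : - X <= X by rewrite (le_trans _ X0) ?oppr_le0.
have hc : {within `[- X, X], continuous (fun x => nm (f x))}.
  by apply: continuous_subspaceT => x; apply: mcont_nm.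
have [c _ hcm] := EVT_max XX hc.
exists (nm (f c)); first exact: nm_ge0.
by move=> x xX; apply: hcm; rewrite in_itv /= -ler_norml.
Qed.
Lemma hd_mcont f D : (forall x, has_deriv f x (D x)) -> mcont f.
Proof.
move=> h x e e0.
have hc i j : continuous (fun y => complex.Re (f y i j)) /\
              continuous (fun y => complex.Im (f y i j)).
  by split=> y; have [h1 h2] := h y i j; [apply: is_derive_cont h1|apply: is_derive_cont h2].
pose e' := e / (Kn R n + 1).
have K0 : 0 < Kn R n + 1 by rewrite ltr_wpDl ?Kn_ge0.
have e'0 : 0 < e' by rewrite divr_gt0.
have : \forall y \near x, forall i j,
    `|complex.Re (f x i j) - complex.Re (f y i j)| <= e' /\
    `|complex.Im (f x i j) - complex.Im (f y i j)| <= e'.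
  pose P (i j : 'I_n) (y : R) :=
    `|complex.Re (f x i j) - complex.Re (f y i j)| <= e' /\
    `|complex.Im (f x i j) - complex.Im (f y i j)| <= e'.
  apply: (@filter_forall R 'I_n (fun i y => forall j, P i j y) (nbhs x) _) => i.
  apply: (@filter_forall R 'I_n (fun j y => P i j y) (nbhs x) _) => j.
  have [h1 h2] := hc i j.
  near=> y; split; near: y.
    by have /cvgrPdist_le := h1 x; apply.
  by have /cvgrPdist_le := h2 x; apply.
case=> d /= d0 hd; exists d => // y yx.
have hij i j : cn ((f y - f x) i j) <= 2 * e'.
  have [] := hd y _ i j; first by rewrite /= distrC.
  rewrite !mxE => h1 h2; apply: le_trans (cn_le _) _; rewrite !raddfB /=.
  by rewrite mulr_natl mulr2n lerD // distrC.
apply: le_trans (nm_le hij) _.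
have -> : (n * n)%:R * (2 * e') = Kn R n * e' by rewrite /Kn mulrA.
by rewrite /e' mulrCA ger_pMr // ler_pdivrMr // mul1r lerDl.
Unshelve. all: by end_near. Qed.

Lemma mprim f : mcont f ->
  exists F, F 0 = 0 /\ forall x, has_deriv F x (f x).
Proof.
move=> h.
have /choice[Fr hFr] : forall ij : 'I_n * 'I_n, exists F : R -> R, F 0 = 0 /\
    forall x : R, is_derive x 1 F (complex.Re (f x ij.1 ij.2)).
  by move=> [i j]; apply: prim; apply: mcont_re.
have /choice[Fi hFi] : forall ij : 'I_n * 'I_n, exists F : R -> R, F 0 = 0 /\
    forall x : R, is_derive x 1 F (complex.Im (f x ij.1 ij.2)).
  by move=> [i j]; apply: prim; apply: mcont_im.
exists (fun x => \matrix_(i, j) (Fr (i, j) x +i* Fi (i, j) x)); split.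
  by apply/matrixP => i j; rewrite !mxE (hFr _).1 (hFi _).1.
move=> x i j; split.
  by apply: is_derive_ext ((hFr (i, j)).2 x) => y; rewrite mxE.
by apply: is_derive_ext ((hFi (i, j)).2 x) => y; rewrite mxE.
Qed.
End Continuity.
Section LinearODE.
Variables (R : realType) (n : nat).
Notation C := R[i].

Lemma cvg0_le0 (r : R^nat) (c a : R) : 0 <= c -> r @ \oo --> 0 ->
  (forall K, a <= c * r K) -> a <= 0.
Proof.
move=> c0 r0 h; have h1 : (c * r K) @[K --> \oo] --> (0 : R).
  by rewrite -(mulr0 c); apply: cvgM => //; apply: cvg_cst.
rewrite -(cvg_lim (@Rhausdorff R) h1); apply: limr_ge; first by apply/cvg_ex; exists 0.
by apply: nearW.
Qed.

Lemma seq_lim (s : R^nat) (r0 : R^nat) : r0 @ \oo --> 0 ->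
  (forall K L, (K <= L)%N -> `|s L - s K| <= r0 K) ->
  exists l, forall K d, (forall L, (K <= L)%N -> `|s L - s K| <= d) -> `|l - s K| <= d.
Proof.
move=> hr hs.
have cs : cvgn s.
  apply/cauchy_cvgP; apply/cauchy_exP => e e0.
  have /cvgrPdist_lt /(_ _ e0) [N _ hN] := hr.
  exists (s N); exists N => // L /= NL.
  have := hN N (leqnn N); rewrite /= sub0r normrN => h.
  rewrite /ball /= distrC; apply: le_lt_trans (hs _ _ NL) _.
  by apply: le_lt_trans (ler_norm _) h.
exists (limn s) => K d hd.
have h1 : `|s L - s K| @[L --> \oo] --> `|limn s - s K|.
  by apply: cvg_norm; apply: cvgB => //; apply: cvg_cst.
rewrite -(cvg_lim (@Rhausdorff R) h1); apply: limr_le; first by apply/cvg_ex; eexists; exact: h1.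
by exists K.
Qed.

Lemma mseq_lim (s : nat -> 'M[C]_n) (r0 : R^nat) : r0 @ \oo --> 0 ->
  (forall K L, (K <= L)%N -> nm (s L - s K) <= r0 K) ->
  exists l, forall K d, (forall L, (K <= L)%N -> nm (s L - s K) <= d) -> nm (l - s K) <= Kn R n * d.
Proof.
move=> hr hs.
have hre (d : R) K L i j : nm (s L - s K) <= d ->
    `|complex.Re (s L i j) - complex.Re (s K i j)| <= d.
  apply: le_trans; rewrite -raddfB; apply: le_trans (cn_re _) _.
  by have := cn_nm (s L - s K) i j; rewrite !mxE.
have him (d : R) K L i j : nm (s L - s K) <= d ->
    `|complex.Im (s L i j) - complex.Im (s K i j)| <= d.
  apply: le_trans; rewrite -raddfB; apply: le_trans (cn_im _) _.
  by have := cn_nm (s L - s K) i j; rewrite !mxE.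
have /choice[lr hlr] : forall ij : 'I_n * 'I_n, exists l, forall K d,
    (forall L, (K <= L)%N -> `|complex.Re (s L ij.1 ij.2) - complex.Re (s K ij.1 ij.2)| <= d) ->
    `|l - complex.Re (s K ij.1 ij.2)| <= d.
  by move=> [i j]; apply: (seq_lim hr) => K L KL; apply: hre; apply: hs.
have /choice[li hli] : forall ij : 'I_n * 'I_n, exists l, forall K d,
    (forall L, (K <= L)%N -> `|complex.Im (s L ij.1 ij.2) - complex.Im (s K ij.1 ij.2)| <= d) ->
    `|l - complex.Im (s K ij.1 ij.2)| <= d.
  by move=> [i j]; apply: (seq_lim hr) => K L KL; apply: him; apply: hs.
exists (\matrix_(i, j) (lr (i, j) +i* li (i, j))) => K d hd.
rewrite /Kn -mulrA; apply: nm_le => i j; rewrite !mxE.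
apply: le_trans (cn_le _) _; rewrite !raddfB /= mulr_natl mulr2n lerD //.
  by apply: (hlr (i, j)) => L KL; apply: hre; apply: hd.
by apply: (hli (i, j)) => L KL; apply: him; apply: hd.
Qed.

Lemma mprim_op : exists P : (R -> 'M[C]_n) -> R -> 'M[C]_n,
  forall f, mcont f -> P f 0 = 0 /\ forall x, has_deriv (P f) x (f x).
Proof.
have /choice[P hP] : forall f : R -> 'M[C]_n, exists F : R -> 'M[C]_n,
    mcont f -> F 0 = 0 /\ forall x, has_deriv F x (f x).
  move=> f; have [hf|hf] := pselect (mcont f); last by exists f.
  by have [F hF] := mprim hf; exists F.
by exists P.
Qed.

(** Picard's series: with [Z_0 = 1] and [Z_(k+1)] the primitive of [Z_k A]
    vanishing at 0, the sum [Y] converges locally uniformly and coincides with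
    1 plus the primitive of [Y A]. *)
Theorem ode_exists (A : R -> 'M[C]_n) : mcont A ->
  exists Y, Y 0 = 1%:M /\ forall x, has_deriv Y x (Y x *m A x).
Proof.
move=> hA; have [P hP] := mprim_op.
pose Z := fix Z k := if k is k'.+1 then P (fun x => Z k' x *m A x) else (fun=> 1%:M).
have cZ k : mcont (Z k).
  elim: k => [|k IH]; first exact: mcont_cst.
  exact: hd_mcont (hP _ (mcontM IH hA)).2.
have dZ k x : has_deriv (Z k.+1) x (Z k x *m A x) by exact: (hP _ (mcontM (cZ k) hA)).2.
have Z0 k : Z k.+1 0 = 0 by exact: (hP _ (mcontM (cZ k) hA)).1.
pose c0 : R := nm (1%:M : 'M[C]_n).
have c00 : 0 <= c0 := nm_ge0 _.
pose S K x := \sum_(k < K) Z k x.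
have cS K : mcont (S K) by apply: mcont_sum => k _; apply: cZ.
pose rho (w : R) K : R := c0 * (expR w - series (exp_coeff w) K).
have rho0 w : rho w @ \oo --> 0.
  rewrite -[X in _ --> X](mulr0 c0); apply: cvgM; first exact: cvg_cst.
  by rewrite -(subrr (expR w)); apply: cvgB; [apply: cvg_cst|apply: is_cvg_series_exp_coeff].
have key (X : R) : exists2 w : R, 0 <= w & forall x, `|x| <= X ->
    forall K L, (K <= L)%N -> nm (S L x - S K x) <= rho w K.
  have [c cge0 hc] := mcont_bound X hA.
  have [X0|X0] := ltP X 0.
    by exists 0 => // x xX; have := le_lt_trans xX X0; rewrite normr_lt0.
  pose v := Kn R n * c; have v0 : 0 <= v by rewrite mulr_ge0 ?Kn_ge0.
  have hZ k x : `|x| <= X -> nm (Z k x) <= c0 * (v ^+ k / k`!%:R) * `|x| ^+ k.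
    elim: k x => [|k IH] x xX; first by rewrite !expr0 fact0 divr1 !mulr1.
    have := @hd_mvk _ _ (Z k.+1) (fun x => Z k x *m A x) X (c0 * (v ^+ k / k`!%:R) * c) k.
    rewrite Z0 => /(_ (fun x _ => dZ k x)) /(_ _ x xX); rewrite subr0 => h.
    apply: le_trans (h _) _; last first.
      rewrite factS natrM invfM (exprS v k) le_eqVlt; apply/orP; left; apply/eqP.
      by rewrite /v; ring.
    move=> y yX; apply: le_trans (nmM _ _) _; rewrite mulrAC.
    by apply: ler_pM; rewrite ?nm_ge0 ?IH ?hc.
  exists (v * X); first by rewrite mulr_ge0.
  move=> x xX K L KL.
  have hk k : nm (Z k x) <= c0 * exp_coeff (v * X) k.
    apply: le_trans (hZ k x xX) _.
    have -> : exp_coeff (v * X) k = v ^+ k / k`!%:R * X ^+ k.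
      by rewrite /exp_coeff /= exprMn mulrAC.
    rewrite -[leLHS]mulrA ler_wpM2l // ler_wpM2l //.
      by rewrite mulr_ge0 ?exprn_ge0 ?invr_ge0.
    by rewrite lerXn2r ?nnegrE.
  have -> : S L x - S K x = \sum_(K <= k < L) Z k x.
    by rewrite /S -!(big_mkord xpredT (fun k => Z k x)) (@big_cat_nat _ _ _ K 0 L) //= addrAC subrr add0r.
  apply: le_trans (nm_sum _ _ _) _.
  apply: (@le_trans _ _ (\sum_(K <= k < L) c0 * exp_coeff (v * X) k)).
    by apply: ler_sum.
  rewrite -mulr_sumr /rho ler_wpM2l //.
  rewrite lerBrDr addrC /series /= -big_cat_nat //=.
  apply: nondecreasing_cvgn_le; last exact: is_cvg_series_exp_coeff.
  by apply: nondecreasing_series => k _ _; apply: exp_coeff_ge0; rewrite mulr_ge0.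
have /choice[Y hY] : forall x, exists l, forall K d,
    (forall L, (K <= L)%N -> nm (S L x - S K x) <= d) -> nm (l - S K x) <= Kn R n * d.
  move=> x; have [w _ hw] := key `|x|.
  by apply: (mseq_lim (rho0 w)); apply: hw.
have hYr X w x : (forall x, `|x| <= X ->
    forall K L, (K <= L)%N -> nm (S L x - S K x) <= rho w K) ->
    `|x| <= X -> forall K, nm (Y x - S K x) <= Kn R n * rho w K.
  by move=> hw xX K; apply: hY; apply: hw.
have cY : mcont Y.
  move=> x e e0; have [w w0 hw] := key (`|x| + 1).
  have e3 : 0 < e / 3 by rewrite divr_gt0.
  have : (Kn R n * rho w K) @[K --> \oo] --> (0 : R).
    by rewrite -(mulr0 (Kn R n)); apply: cvgM => //; apply: cvg_cst.
  move=> /cvgrPdist_lt /(_ _ e3) [K _ /(_ K (leqnn K))] /=.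
  rewrite sub0r normrN => /(le_lt_trans (ler_norm _)) /ltW hK.
  have [d d0 hd] := cS K x _ e3.
  exists (Num.min d 1); first by rewrite lt_min d0 ltr01.
  move=> y; rewrite lt_min => /andP[/hd yd y1].
  have hy : `|y| <= `|x| + 1.
    by have := ler_normD (y - x) x; rewrite subrK => h; apply: le_trans h _; rewrite addrC lerD2l ltW.
  have hx : `|x| <= `|x| + 1 by rewrite lerDl.
  have -> : Y y - Y x = (Y y - S K y) + (S K y - S K x) - (Y x - S K x).
    by rewrite opprB !addrA !subrK.
  have -> : e = e / 3 + e / 3 + e / 3 by field.
  apply: le_trans (nmB _ _) _; apply: lerD; last exact: le_trans (hYr _ _ _ hw hx K) hK.
  apply: le_trans (nmD _ _) _; apply: lerD => //.
  exact: le_trans (hYr _ _ _ hw hy K) hK.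
have [W0 dW] := hP _ (mcontM cY hA); set W := P _ in W0 dW.
have YW x : Y x = 1%:M + W x.
  apply/eqP; rewrite -subr_eq0; apply/eqP; apply: nm_eq0.
  have [w w0 hw] := key `|x|; have [c cge0 hc] := mcont_bound `|x| hA.
  apply: (@cvg0_le0 (rho w) (Kn R n + Kn R n * (Kn R n * c * `|x|))) => //.
    by rewrite addr_ge0 ?mulr_ge0 ?Kn_ge0.
  move=> K.
  have d1 y : has_deriv (fun x => S K.+1 x - W x) y (S K y *m A y - Y y *m A y).
    apply: hd_sub; last exact: dW.
    have h1 : has_deriv (fun x => 1%:M + \sum_(k < K) Z k.+1 x) y (0 + \sum_(k < K) (Z k y *m A y)).
      by apply: hd_add; [apply: hd_cst|apply: hd_sum => k _; apply: dZ].
    rewrite /S mulmx_suml -[X in has_deriv _ _ X]add0r.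
    by apply: hd_ext h1 => z; rewrite big_ord_recl.
  have := @hd_mv _ _ _ _ `|x| (Kn R n * rho w K * c) (fun y _ => d1 y) _ x (lexx _).
  have S0 : S K.+1 0 = 1%:M.
    by rewrite /S big_ord_recl big1 ?addr0 // => k _; exact: Z0.
  rewrite W0 subr0 S0 => h.
  have -> : Y x - (1%:M + W x) = (Y x - S K.+1 x) + (S K.+1 x - W x - 1%:M).
    by rewrite addrA addrA subrK opprD addrA addrAC.
  apply: le_trans (nmD _ _) _; rewrite mulrDl; apply: lerD.
    apply: le_trans (hYr _ _ _ hw (lexx _) K.+1) _.
    rewrite ler_wpM2l ?Kn_ge0 // /rho ler_wpM2l // lerD2l lerN2.
    rewrite /series /= big_nat_recr //= lerDl exp_coeff_ge0 //.
  apply: le_trans (h _) _.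
    move=> y yX; rewrite -mulmxBl (le_trans (nmM _ _)) //.
    apply: ler_pM; rewrite ?nm_ge0 ?hc // -nmN opprB.
    exact: hYr hw yX K.
  by rewrite le_eqVlt; apply/orP; left; apply/eqP; ring.
exists Y; split; first by rewrite YW W0 addr0.
move=> x; have h1 : has_deriv (fun x => 1%:M + W x) x (0 + Y x *m A x).
  by apply: hd_add; [apply: hd_cst|apply: dW].
by rewrite -[X in has_deriv _ _ X]add0r; apply: hd_ext h1 => y; rewrite YW.
Qed.
End LinearODE.
Section Perturbation.
Variables (R : realType) (n : nat).
Notation C := R[i].

(** The squared Frobenius norm, whose derivative along a solution is a trace.
    *)
Definition sqn (M : 'M[C]_n) : R := \sum_i \sum_j cn (M i j) ^+ 2.

Lemma sqn_ge0 M : 0 <= sqn M.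
Proof. by apply: sumr_ge0 => i _; apply: sumr_ge0 => j _; rewrite exprn_ge0 ?cn_ge0. Qed.
Lemma nm_sqn M : nm M <= (n * n)%:R * Num.sqrt (sqn M).
Proof.
apply: nm_le => i j; rewrite -[leLHS]ger0_norm ?cn_ge0 // -sqrtr_sqr ler_wsqrtr //.
rewrite /sqn (bigD1 i) //= (bigD1 j) //= -addrA lerDl addr_ge0 //.
  by apply: sumr_ge0 => *; rewrite exprn_ge0 ?cn_ge0.
by apply: sumr_ge0 => *; apply: sumr_ge0 => *; rewrite exprn_ge0 ?cn_ge0.
Qed.
Lemma nm2_sqn M : nm M ^+ 2 <= (n * n)%:R ^+ 2 * sqn M.
Proof.
by rewrite -(sqr_sqrtr (sqn_ge0 M)) -exprMn lerXn2r ?nnegrE ?nm_ge0 ?nm_sqn ?mulr_ge0 ?sqrtr_ge0.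
Qed.

(** The growth of a solution is governed by the Hermitian part of the
    coefficient. *)
Lemma sol_bound (X c : R) : 0 <= c -> exists2 M, 0 <= M & forall A Y : R -> 'M[C]_n,
  Y 0 = 1%:M -> (forall x, `|x| <= X -> has_deriv Y x (Y x *m A x)) ->
  (forall x, `|x| <= X -> nm (A x + adjmx (A x)) <= c) ->
  forall x, `|x| <= X -> nm (Y x) <= M.
Proof.
move=> c0; pose k : R := (n * n)%:R ^+ 2 * c.
pose m : R := sqn (1%:M : 'M[C]_n) * expR (k * X).
exists ((n * n)%:R * Num.sqrt m); first by rewrite mulr_ge0 ?sqrtr_ge0.
move=> A Y Y0 hY hA x xX; apply: le_trans (nm_sqn _) _.
rewrite ler_wpM2l // ler_wsqrtr // /m.
have d (z : R) : `|z| <= X -> is_derive z 1 (fun y => sqn (Y y))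
    (complex.Re (\tr (Y z *m (A z + adjmx (A z)) *m adjmx (Y z)))).
  move=> zX; have [h _] := hd_tr (hd_mul (hY z zX) (hd_adj (hY z zX))).
  apply: is_derive_eq; first by apply: is_derive_ext h => y; rewrite tr_MadjM.
  by rewrite adjM mulmxA -mulmxDl -mulmxDr.
have := @gronwall _ _ _ X k d _ x xX; rewrite Y0 => h.
apply: le_trans (h _) _; last first.
  by rewrite ler_wpM2l ?sqn_ge0 // ler_expR ler_wpM2l // mulr_ge0 // exprn_ge0.
move=> z zX; apply: le_trans (cn_re _) _; apply: le_trans (nm_tr _) _.
apply: le_trans (nmM _ _) _; rewrite nm_adj.
apply: (@le_trans _ _ (nm (Y z) * c * nm (Y z))).
  apply: ler_wpM2r; first exact: nm_ge0.
  by apply: le_trans (nmM _ _) _; rewrite ler_wpM2l ?nm_ge0 ?hA.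
by rewrite mulrAC -expr2 /k [leRHS]mulrAC ler_wpM2r // nm2_sqn.
Qed.

(** First order variation of the solution of [Y' = Y A] when [A] moves by
    [d A'] up to second order: [Y] moves by [d T Y] where [T' = Y A' Y^-1]. *)
Lemma perturb (X M : R) : 0 <= X -> 0 <= M -> exists2 K, 0 <= K &
  forall (A0 A1 A' Y0 Y0i Y1 T : R -> 'M[C]_n) (d : C),
  Y0 0 = 1%:M -> Y1 0 = 1%:M -> T 0 = 0 ->
  (forall x, `|x| <= X ->
    [/\ has_deriv Y1 x (Y1 x *m A1 x),
        has_deriv Y0i x (- (A0 x *m Y0i x)) & has_deriv T x (Y0 x *m A' x *m Y0i x)]) ->
  (forall x, Y0 x *m Y0i x = 1%:M) ->
  (forall x, `|x| <= X -> [/\ nm (Y0 x) <= M, nm (Y0i x) <= M & nm (Y1 x) <= M]) ->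
  (forall x, `|x| <= X -> nm (A1 x - A0 x) <= M * cn d /\
                          nm (A1 x - A0 x - d *: A' x) <= M * cn d ^+ 2) ->
  forall x, `|x| <= X -> nm (Y1 x - Y0 x - d *: (T x *m Y0 x)) <= K * cn d ^+ 2.
Proof.
move=> X0 M0; pose k1 := Kn R n * (M * M * M * X).
pose k2 := Kn R n * ((k1 * M * M * M + M * M * M) * X) * M.
have Kn0 := Kn_ge0 R n; have k10 : 0 <= k1 by rewrite /k1 !mulr_ge0.
have k20 : 0 <= k2.
  by rewrite /k2; apply: mulr_ge0 => //; apply: mulr_ge0 => //; apply: mulr_ge0 => //; rewrite addr_ge0 ?mulr_ge0.
exists k2 => // A0 A1 A' Y0 Y0i Y1 T d Y00 Y10 T0 hd hinv hM hA x xX.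
have Y0i0 : Y0i 0 = 1%:M by have := hinv 0; rewrite Y00 mul1mx.
have e0 := cn_ge0 d; set e := cn d in e0 hA *.
have hinv' z : Y0i z *m Y0 z = 1%:M by apply: mulmx1C.
have d1 z : `|z| <= X -> has_deriv (fun z => Y1 z *m Y0i z) z
    (Y1 z *m (A1 z - A0 z) *m Y0i z).
  move=> zX; have [h1 h2 _] := hd z zX; apply: hd_eq (hd_mul h1 h2) _.
  by rewrite mulmxN mulmxBr mulmxBl !mulmxA.
have b1 z : `|z| <= X -> nm (Y1 z *m Y0i z - 1%:M) <= k1 * e.
  move=> zX; have := @hd_mv _ _ _ _ X (M * (M * e) * M) d1 _ z zX.
  rewrite Y10 Y0i0 mulmx1 => h; apply: le_trans (h _) _.
    move=> y yX; have [hy1 hy2 hy3] := hM y yX; have [ha1 ha2] := hA y yX.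
    apply: le_trans (nmM _ _) _; apply: ler_pM; rewrite ?nm_ge0 //.
    by apply: le_trans (nmM _ _) _; apply: ler_pM; rewrite ?nm_ge0.
  have -> : k1 * e = Kn R n * (M * (M * e) * M * X) by rewrite /k1; ring.
  by rewrite ler_wpM2l // ler_wpM2l // !mulr_ge0.
have d2 z : `|z| <= X -> has_deriv (fun z => Y1 z *m Y0i z - d *: T z) z
    ((Y1 z *m Y0i z - 1%:M) *m Y0 z *m (A1 z - A0 z) *m Y0i z
     + Y0 z *m (A1 z - A0 z - d *: A' z) *m Y0i z).
  move=> zX; have [_ _ h3] := hd z zX; apply: hd_eq (hd_sub (d1 z zX) (hd_Z d h3)) _.
  have -> : (Y1 z *m Y0i z - 1%:M) *m Y0 z = Y1 z - Y0 z.
    by rewrite mulmxBl mul1mx -mulmxA hinv' mulmx1.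
  move: (A1 z - A0 z) => B.
  by rewrite (mulmxBr (Y0 z)) !mulmxBl addrA subrK -scalemxAr -scalemxAl.
have := @hd_mv _ _ _ _ X ((k1 * M * M * M + M * M * M) * e ^+ 2) d2 _ x xX.
rewrite Y10 Y0i0 T0 scaler0 subr0 mulmx1 => h.
have -> : Y1 x - Y0 x - d *: (T x *m Y0 x) =
    (Y1 x *m Y0i x - d *: T x - 1%:M) *m Y0 x.
  by rewrite !mulmxBl mul1mx -mulmxA hinv' mulmx1 -scalemxAl addrAC.
apply: le_trans (nmM _ _) _.
apply: (@le_trans _ _ (Kn R n * ((k1 * M * M * M + M * M * M) * e ^+ 2 * X) * M)); last first.
  by rewrite /k2 le_eqVlt; apply/orP; left; apply/eqP; ring.
have [hy1 hy2 hy3] := hM x xX.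
have p0 : 0 <= (k1 * M * M * M + M * M * M) * e ^+ 2.
  by apply: mulr_ge0; rewrite ?exprn_ge0 // addr_ge0 ?mulr_ge0.
apply: ler_pM; rewrite ?nm_ge0 //; apply: le_trans (h _) _; last first.
  by rewrite ler_wpM2l // ler_wpM2l.
move=> y yX; have [hz1 hz2 hz3] := hM y yX; have [ha1 ha2] := hA y yX.
apply: le_trans (nmD _ _) _; rewrite mulrDl; apply: lerD.
  have -> : k1 * M * M * M * e ^+ 2 = k1 * e * M * (M * e) * M by ring.
  apply: le_trans (nmM _ _) _; apply: ler_pM; rewrite ?nm_ge0 //.
  apply: le_trans (nmM _ _) _; apply: ler_pM; rewrite ?nm_ge0 //.
  apply: le_trans (nmM _ _) _; apply: ler_pM; rewrite ?nm_ge0 //.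
  exact: b1.
have -> : M * M * M * e ^+ 2 = M * (M * e ^+ 2) * M by ring.
apply: le_trans (nmM _ _) _; apply: ler_pM; rewrite ?nm_ge0 //.
by apply: le_trans (nmM _ _) _; apply: ler_pM; rewrite ?nm_ge0.
Qed.

Lemma pow_taylor (l : C) k : exists d c, 0 <= c /\ forall h, cn h <= 1 ->
  cn ((l + h) ^+ k - l ^+ k - h * d) <= c * cn h ^+ 2.
Proof.
elim: k => [|k [d [c [c0 hc]]]].
  by exists 0, 0; split => // h _; rewrite !expr0 subrr mulr0 subr0 cn0 mul0r.
exists (l ^+ k + d * l), (cn d + c * (cn l + 1)).
split; first by rewrite addr_ge0 ?mulr_ge0 ?addr_ge0 ?cn_ge0.
move=> h h1.
have -> : (l + h) ^+ k.+1 - l ^+ k.+1 - h * (l ^+ k + d * l) =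
    h ^+ 2 * d + ((l + h) ^+ k - l ^+ k - h * d) * (l + h) by rewrite !exprS; ring.
apply: le_trans (cnD _ _) _; rewrite cnM cnX [leRHS]mulrDl [_ ^+ 2 * _]mulrC lerD2l cnM [leRHS]mulrAC.
apply: ler_pM; rewrite ?cn_ge0 ?hc //.
by apply: le_trans (cnD _ _) _; rewrite lerD2l.
Qed.

(** A first order expansion with quadratic remainder, uniform in direction, is
    complex differentiability. *)
Lemma entire_taylor (f D : C -> 'M[C]_n) (K : C -> R) :
  (forall l, 0 <= K l) ->
  (forall l h, cn h <= 1 -> nm (f (l + h) - f l - h *: D l) <= K l * cn h ^+ 2) ->
  entire f.
Proof.
move=> K0 hf z i j; exists 1 => [|w _]; first exact: ltr01.
apply/cvg_ex; exists (D w i j : C^o); apply/cvgrPdist_le => /= e e0.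
have [r er] : exists r, e = r%:C by apply/complex_realP; apply: ger0_real; apply: ltW.
move: e0; rewrite er ltcR => r0.
pose dl := Num.min 1 (r / (K w + 1)).
have K1 : 0 < K w + 1 by rewrite ltr_wpDl.
have dl0 : 0 < dl by rewrite lt_min ltr01 divr_gt0.
exists dl%:C; first by rewrite /= ltcR.
move=> h /=; rewrite sub0r normrN cnE ltcR lt_min => /andP[h1 h2] hn0.
rewrite cnE lecR.
have -> : D w i j - h^-1 *: (f (h *: 1 + w) i j - f w i j) =
   - (h^-1 * ((f (w + h) - f w - h *: D w) i j)).
  rewrite !mxE [h *: 1](_ : _ = h); last by rewrite /GRing.scale /= mulr1.
  by rewrite [h + w]addrC /GRing.scale /=; field.
rewrite cnN cnM cnV.
have ch : 0 < cn h by rewrite cn_gt0.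
rewrite mulrC ler_pdivrMr //.
apply: le_trans (cn_nm _ _ _) _; apply: le_trans (hf _ _ (ltW h1)) _.
rewrite expr2 mulrA ler_wpM2r ?cn_ge0 //.
move: h2; rewrite ltr_pdivlMr // => /ltW; apply: le_trans.
by rewrite mulrDr mulr1 mulrC lerDl cn_ge0.
Qed.
End Perturbation.
Section Fundamental.
Variables (R : realType) (n : nat).
Notation C := R[i].

Definition pol (d : nat) (c : nat -> R -> 'M[C]_n) (x : R) (l : C) : 'M[C]_n :=
  \sum_(k < d.+1) l ^+ k *: c k x.

Variables (d : nat) (c : nat -> R -> 'M[C]_n).
Hypothesis c_un : forall k x, in_un (c k x).
Hypothesis c_cont : forall k, mcont (c k).

Lemma pol_adj x l : adjmx (pol d c x (conjc l)) = - pol d c x l.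
Proof.
rewrite /pol adj_sum -sumrN; apply: eq_bigr => k _.
by rewrite adjZ rmorphXn /= conjcK (c_un k x) scalerN.
Qed.

Lemma pol_cont l : mcont (fun x => pol d c x l).
Proof. by apply: mcont_sum => k _; apply: mcontZ. Qed.

Lemma coef_bound (X : R) : exists2 b, 0 <= b & forall k x, (k < d.+1)%N ->
  `|x| <= X -> nm (c k x) <= b.
Proof.
elim: (d.+1) => [|m [b b0 hb]]; first by exists 0.
have [b' b'0 hb'] := mcont_bound X (c_cont m).
exists (b + b'); first exact: addr_ge0.
move=> k x; rewrite ltnS leq_eqVlt => /orP[/eqP-> xX|km xX].
  by apply: le_trans (hb' x xX) _; rewrite lerDr.
by apply: le_trans (hb k x km xX) _; rewrite lerDl.
Qed.

Lemma pol_taylor (X : R) (l : C) : exists (A' : R -> 'M[C]_n) (M : R),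
  [/\ mcont A', 0 <= M & forall x h, `|x| <= X -> cn h <= 1 ->
   nm (pol d c x (l + h) - pol d c x l) <= M * cn h /\
   nm (pol d c x (l + h) - pol d c x l - h *: A' x) <= M * cn h ^+ 2].
Proof.
have /choice[D hD] := @pow_taylor R l.
have /choice[e he] := hD.
have [b b0 hb] := coef_bound X.
pose A' x := \sum_(k < d.+1) D k *: c k x.
have cA : mcont A' by apply: mcont_sum => k _; apply: mcontZ.
pose M1 := \sum_(k < d.+1) e k * b.
have [M2 M20 hM2] := mcont_bound X cA.
have M10 : 0 <= M1 by apply: sumr_ge0 => k _; rewrite mulr_ge0 ?(he k).1.
exists A', (M1 + M2); split => //; first exact: addr_ge0.
move=> x h xX h1.
have h2 : nm (pol d c x (l + h) - pol d c x l - h *: A' x) <= M1 * cn h ^+ 2.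
  rewrite /pol /A' scaler_sumr -!sumrB mulr_suml.
  apply: le_trans (nm_sum _ _ _) _; apply: ler_sum => k _.
  rewrite scalerA -!scalerBl nmZ mulrAC; apply: ler_pM; rewrite ?cn_ge0 ?nm_ge0 ?hb //.
  exact: (he k).2.
split; last by apply: le_trans h2 _; rewrite ler_wpM2r ?exprn_ge0 ?cn_ge0 // lerDl.
have -> : pol d c x (l + h) - pol d c x l =
  (pol d c x (l + h) - pol d c x l - h *: A' x) + h *: A' x by rewrite subrK.
apply: le_trans (nmD _ _) _; rewrite mulrDl; apply: lerD.
  apply: le_trans h2 _; rewrite ler_wpM2l // expr2 ler_piMr ?cn_ge0 //.
by rewrite nmZ mulrC ler_wpM2r ?cn_ge0 ?hM2.
Qed.

Lemma pol_bound (X L : R) : exists2 M, 0 <= M & forall x l, `|x| <= X -> cn l <= L ->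
  nm (pol d c x l) <= M.
Proof.
have [b b0 hb] := coef_bound X.
exists (\sum_(k < d.+1) `|L| ^+ k * b).
  by apply: sumr_ge0 => k _; rewrite mulr_ge0 ?exprn_ge0.
move=> x l xX lL; apply: le_trans (nm_sum _ _ _) _; apply: ler_sum => k _.
rewrite nmZ cnX; apply: ler_pM; rewrite ?exprn_ge0 ?cn_ge0 ?nm_ge0 ?hb //.
by rewrite lerXn2r ?nnegrE ?cn_ge0 // (le_trans lL) // ler_norm.
Qed.

(** Holomorphy of the solution in the spectral parameter is read off the first
    order variation formula. *)
Theorem fundamental : exists Y : R -> C -> 'M[C]_n,
  [/\ forall l, Y 0 l = 1%:M,
      forall x l, has_deriv (fun y => Y y l) x (Y x l *m pol d c x l),
      forall x l, Y x l *m adjmx (Y x (conjc l)) = 1%:M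
    & forall x, entire (Y x)].
Proof.
have /choice[Z hZ] : forall l, exists Y, Y 0 = 1%:M /\
    forall x, has_deriv Y x (Y x *m pol d c x l).
  by move=> l; apply: ode_exists; apply: pol_cont.
pose Y x l := Z l x.
have Y0 l : Y 0 l = 1%:M by exact: (hZ l).1.
have dY x l : has_deriv (fun y => Y y l) x (Y x l *m pol d c x l) by exact: (hZ l).2.
have dYi x l : has_deriv (fun y => adjmx (Y y (conjc l))) x
    (- (pol d c x l *m adjmx (Y x (conjc l)))).
  by apply: hd_eq (hd_adj (dY x (conjc l))) _; rewrite adjM pol_adj mulNmx.
have YYi x l : Y x l *m adjmx (Y x (conjc l)) = 1%:M.
  rewrite (@hd_cst0 _ _ (fun x => Y x l *m adjmx (Y x (conjc l))) x 0).
    by rewrite !Y0 adj1 mulmx1.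
  move=> z; apply: hd_eq (hd_mul (dY z l) (dYi z l)) _.
  by rewrite mulmxN !mulmxA subrr.
exists Y; split => // x.
suff key l : exists D : 'M[C]_n, exists2 K : R, 0 <= K & forall h, cn h <= 1 ->
    nm (Y x (l + h) - Y x l - h *: D) <= K * cn h ^+ 2.
  have /choice[D hD] := key.
  have /choice[K hK] : forall l, exists K, 0 <= K /\ forall h, cn h <= 1 ->
      nm (Y x (l + h) - Y x l - h *: D l) <= K * cn h ^+ 2.
    by move=> l; have [K K0 hK] := hD l; exists K.
  by apply: (@entire_taylor _ _ _ D K) => l; [exact: (hK l).1|exact: (hK l).2].
have [A' [M [cA M0 hM]]] := pol_taylor `|x| l.
have [M1 M10 hM1] := pol_bound `|x| (cn l + 1).
have [M2 M20 hM2] := @sol_bound _ n `|x| (M1 + M1) (addr_ge0 M10 M10).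
have bY z h : `|z| <= `|x| -> cn h <= 1 -> nm (Y z (l + h)) <= M2.
  move=> zx h1; apply: (hM2 (fun x => pol d c x (l + h)) (fun x => Y x (l + h))) => //.
  move=> w wx; apply: le_trans (nmD _ _) _; rewrite nm_adj.
  have : cn (l + h) <= cn l + 1 by apply: le_trans (cnD _ _) _; rewrite lerD2l.
  by move=> hl; rewrite lerD ?hM1.
have bY0 z : `|z| <= `|x| -> nm (Y z l) <= M2.
  by move=> zx; rewrite -[l]addr0; apply: bY; rewrite ?cn0.
have bYi z : `|z| <= `|x| -> nm (adjmx (Y z (conjc l))) <= M2.
  move=> zx; rewrite nm_adj.
  apply: (hM2 (fun x => pol d c x (conjc l)) (fun x => Y x (conjc l))) => //.
  move=> w wx; apply: le_trans (nmD _ _) _; rewrite nm_adj.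
  by rewrite lerD ?hM1 // cnJ lerDl.
have cT : mcont (fun z => Y z l *m A' z *m adjmx (Y z (conjc l))).
  by apply: mcontM; [apply: mcontM => //|]; apply: hd_mcont => z; [exact: dY|exact: dYi].
have [T [T0 dT]] := mprim cT.
have [K K0 hK] := @perturb _ n `|x| (M + M2) (normr_ge0 x) (addr_ge0 M0 M20).
exists (T x *m Y x l), K => // h h1.
have le1 : M2 <= M + M2 by rewrite lerDr.
apply: (hK (fun x => pol d c x l) (fun x => pol d c x (l + h)) A' (fun x => Y x l)
  (fun x => adjmx (Y x (conjc l))) (fun x => Y x (l + h)) T h) => //.
  move=> z zx; have bz := bY z h zx h1; have b0 := bY0 z zx; have bi := bYi z zx.
  by split; apply: le_trans le1.
move=> z zx; have [p1 p2] := hM z h zx h1.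
by split; [apply: le_trans p1 _|apply: le_trans p2 _];
  rewrite ler_wpM2r ?exprn_ge0 ?cn_ge0 // lerDl.
Qed.
End Fundamental.

Section Uniqueness.
Variables (R : realType) (n : nat).
Notation C := R[i].

(** [Z *m Yi] has derivative 0. *)
Lemma sol_unique (A Y Yi Z : R -> 'M[C]_n) :
  Y 0 = 1%:M -> (forall x, Y x *m Yi x = 1%:M) ->
  (forall x, has_deriv Yi x (- (A x *m Yi x))) ->
  (forall x, has_deriv Z x (Z x *m A x)) -> forall x, Z x = Z 0 *m Y x.
Proof.
move=> Y0 hinv dYi dZ x.
have Yi0 : Yi 0 = 1%:M by have := hinv 0; rewrite Y0 mul1mx.
have h : Z x *m Yi x = Z 0.
  rewrite (@hd_cst0 _ _ (fun x => Z x *m Yi x) x 0) ?Yi0 ?mulmx1 //.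
  move=> z; apply: hd_eq (hd_mul (dZ z) (dYi z)) _.
  by rewrite mulmxN !mulmxA subrr.
by rewrite -h -mulmxA (mulmx1C (hinv x)) mulmx1.
Qed.
End Uniqueness.
(** * Rational matrices *)

Lemma fracMD (F : fieldType) (p1 q1 p2 q2 p q : F) :
  q1 != 0 -> q2 != 0 -> q != 0 ->
  p1 / q1 * (p2 / q2) + p / q = (p1 * p2 * q + p * (q1 * q2)) / (q1 * q2 * q).
Proof. by move=> h1 h2 h; rewrite mulf_div addf_div ?mulf_neq0. Qed.

Section Fractions.
Variables (T : idomainType) (n : nat).
Implicit Types (p q d : T) (N : 'M[T]_n).

Lemma fraction_quotient (x : {fraction T}) :
  exists p q : T, q != 0 /\ x = tofrac p / tofrac q.
Proof.
elim/quotW: x => r; exists r.1, r.2; split; first exact: denom_ratioP.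
have d0 := denom_ratioP r.
have e (p : T) : tofrac p = (\pi_(FracField.type T) (Ratio p 1))%qT.
  by rewrite /FracField.tofrac; unlock.
have -> : (tofrac r.2)^-1 = (\pi_(FracField.type T) (FracField.invf (Ratio r.2 1)))%qT.
  by rewrite e; apply: esym; exact: FracField.pi_inv.
rewrite e.
have -> : forall x y, ((\pi_(FracField.type T) x) * (\pi_(FracField.type T) y))%qT
    = (\pi_(FracField.type T) (FracField.mulf x y))%qT.
  by move=> x y; apply: esym; exact: (FracField.pi_mul x y).
apply/eqmodP; rewrite /FracField.mulf /FracField.invf /=.
have o1 := oner_neq0 T.
rewrite !numer_Ratio ?denom_Ratio ?numer_Ratio ?denom_Ratio ?mul1r ?mulr1 //.
by rewrite Ratio_numden; exact: FracField.equivf_refl.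
Qed.

Lemma frac_cross p q p' q' : q != 0 -> q' != 0 ->
  tofrac p / tofrac q = tofrac p' / tofrac q' :> {fraction T} -> p * q' = p' * q.
Proof.
move=> q0 q'0 /eqP; rewrite eqr_div ?tofrac_eq0 // -!tofracM tofrac_eq => /eqP//.
Qed.

Definition ratof N d : 'M[{fraction T}]_n := \matrix_(i, j) (tofrac (N i j) / tofrac d).

Lemma ratof_ex (g : 'M[{fraction T}]_n) : exists N d, d != 0 /\ g = ratof N d.
Proof.
have /choice[f hf] : forall ij : 'I_n * 'I_n, exists pq : T * T,
    pq.2 != 0 /\ g ij.1 ij.2 = tofrac pq.1 / tofrac pq.2.
  by move=> ij; have [p [q h]] := fraction_quotient (g ij.1 ij.2); exists (p, q).
pose d : T := \prod_ij (f ij).2.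
have d0 : d != 0 by apply/prodf_neq0 => ij _; exact: (hf ij).1.
exists (\matrix_(i, j) ((f (i, j)).1 * \prod_(kl | kl != (i, j)) (f kl).2)), d.
split => //; apply/matrixP => i j; rewrite !mxE (hf (i, j)).2 /=.
have q0 := (hf (i, j)).1.
have -> : d = (f (i, j)).2 * \prod_(kl | kl != (i, j)) (f kl).2.
  by rewrite /d (bigD1 (i, j)).
rewrite !tofracM.
have r0 : tofrac (\prod_(kl | kl != (i, j)) (f kl).2) != 0 :> {fraction T}.
  by rewrite tofrac_eq0; apply/prodf_neq0 => kl _; exact: (hf kl).1.
by rewrite -mulf_div divff // mulr1.
Qed.

Lemma ratof_eqP N d N' d' : d != 0 -> d' != 0 ->
  ratof N d = ratof N' d' <-> d' *: N = d *: N'.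
Proof.
move=> d0 d'0; split=> [/matrixP h|/matrixP h]; apply/matrixP => i j; have := h i j; rewrite !mxE.
  move/eqP; rewrite eqr_div ?tofrac_eq0 // -!tofracM tofrac_eq => /eqP.
  by rewrite mulrC => ->; rewrite mulrC.
move=> e; apply/eqP; rewrite eqr_div ?tofrac_eq0 // -!tofracM tofrac_eq.
by rewrite mulrC e mulrC.
Qed.

Lemma ratofM N1 d1 N2 d2 : ratof N1 d1 *m ratof N2 d2 = ratof (N1 *m N2) (d1 * d2).
Proof.
apply/matrixP => i j; rewrite !mxE rmorph_sum mulr_suml; apply: eq_bigr => k _.
by rewrite !mxE mulf_div -!tofracM.
Qed.

Lemma ratof1 d : d != 0 -> ratof d%:M d = 1%:M.
Proof.
move=> d0; apply/matrixP => i j; rewrite !mxE tofracMn mulrnAl divff //.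
by rewrite tofrac_eq0.
Qed.

End Fractions.

Section RationalMatrices.
Variables (R : realType) (n : nat).
Notation C := R[i].
Notation P := {poly C}.
Implicit Types (p q d : P) (N : 'M[P]_n) (z : C) (g : ratmx R n).

Lemma poly_off (s : seq C) p : (forall z, z \notin s -> p.[z] = 0) -> p = 0.
Proof.
move=> h; pose q := p * \prod_(a <- s) ('X - a%:P).
have q0 z : q.[z] = 0.
  rewrite /q hornerM; have [zs|/h->] := boolP (z \in s); last by rewrite mul0r.
  have : root (\prod_(a <- s) ('X - a%:P)) z by rewrite root_prod_XsubC.
  by move/rootP=> ->; rewrite mulr0.
have : q = 0.
  apply/eqP; apply: contraT => qn0.
  have := @max_poly_roots _ q [seq (k%:R : C) | k <- iota 0 (size q)] qn0.
  rewrite size_map size_iota ltnn => h'; apply: h'.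
    by apply/allP => z _; apply/rootP.
  rewrite map_inj_uniq ?iota_uniq // => k l /eqP; rewrite eqr_nat => /eqP//.
move/eqP; rewrite mulf_eq0 => /orP[/eqP//|/eqP h0].
have : \prod_(a <- s) ('X - a%:P) != 0 by rewrite monic_neq0 // monic_prod_XsubC.
by rewrite h0 eqxx.
Qed.

Lemma poly_roots_seq p : exists s : seq C, p != 0 -> forall z, (z \in s) = root p z.
Proof.
have [r hr] := closed_field_poly_normal p.
exists r => p0 z; rewrite hr rootZ ?lead_coef_eq0 //.
by rewrite root_prod_XsubC.
Qed.

Definition evm N z : 'M[C]_n := map_mx (horner_eval z) N.

Lemma evmM N1 N2 z : evm (N1 *m N2) z = evm N1 z *m evm N2 z.
Proof. exact: map_mxM. Qed.
Lemma evmE N z i j : evm N z i j = (N i j).[z]. Proof. by rewrite mxE. Qed.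
Lemma evm_scalar p z : evm p%:M z = p.[z]%:M.
Proof. by rewrite /evm map_scalar_mx. Qed.

Lemma evm_off (s : seq C) N N' : (forall z, z \notin s -> evm N z = evm N' z) -> N = N'.
Proof.
move=> h; apply/matrixP => i j; apply/eqP; rewrite -subr_eq0; apply/eqP.
apply: (@poly_off s) => z zs; rewrite hornerD hornerN.
by have /matrixP/(_ i j) := h z zs; rewrite !evmE => ->; rewrite subrr.
Qed.

Lemma horner_neq0 p z : p.[z] != 0 -> p != 0.
Proof. by apply: contraNneq => ->; rewrite horner0. Qed.

Lemma rat_at_ev N d z M : d.[z] != 0 -> rat_at (ratof N d) z M ->
  M = d.[z]^-1 *: evm N z.
Proof.
move=> dz h; apply/matrixP => i j; rewrite mxE evmE.
have [p [q [qz e ->]]] := h i j; move: e; rewrite mxE => /frac_cross e.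
have {}e := e (horner_neq0 dz) (horner_neq0 qz).
have := congr1 (fun p : P => p.[z]) e; rewrite !hornerM => e'.
by rewrite [_^-1 * _]mulrC; apply/eqP; rewrite eqr_div // e'.
Qed.
Lemma ev_rat_at N d z : d.[z] != 0 -> rat_at (ratof N d) z (d.[z]^-1 *: evm N z).
Proof.
by move=> dz i j; exists (N i j), d; split; [|rewrite mxE|rewrite mxE evmE mulrC].
Qed.

Definition pc : P -> P := map_poly (@conjc R).
Definition padj N : 'M[P]_n := map_mx pc N^T.

Lemma pcM p q : pc (p * q) = pc p * pc q. Proof. exact: rmorphM. Qed.
Lemma pcD p q : pc (p + q) = pc p + pc q. Proof. exact: rmorphD. Qed.
Lemma pcB p q : pc (p - q) = pc p - pc q. Proof. exact: rmorphB. Qed.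
Lemma pcK p : pc (pc p) = p.
Proof. by rewrite /pc -map_poly_comp; apply: map_poly_id => x _ /=; rewrite conjcK. Qed.
Lemma pc_eq0 p : (pc p == 0) = (p == 0).
Proof. by rewrite /pc map_poly_eq0. Qed.
Lemma size_pc p : size (pc p) = size p.
Proof. by rewrite /pc size_map_poly. Qed.
Lemma pc_horner p z : (pc p).[z] = conjc p.[conjc z].
Proof. by rewrite -{1}(conjcK z) horner_map. Qed.
Lemma pc_XsubC a : pc ('X - a%:P) = 'X - (conjc a)%:P.
Proof. by rewrite pcB /pc map_polyX map_polyC. Qed.
Lemma padjE N i j : padj N i j = pc (N j i). Proof. by rewrite !mxE. Qed.
Lemma padjM N1 N2 : padj (N1 *m N2) = padj N2 *m padj N1.
Proof. by rewrite /padj /pc trmx_mul map_mxM. Qed.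
Lemma padjK N : padj (padj N) = N.
Proof. by apply/matrixP => i j; rewrite !padjE pcK. Qed.
Lemma padjZ p N : padj (p *: N) = pc p *: padj N.
Proof. by apply/matrixP => i j; rewrite !mxE pcM. Qed.
Lemma padjD N1 N2 : padj (N1 + N2) = padj N1 + padj N2.
Proof. by apply/matrixP => i j; rewrite !mxE pcD. Qed.
Lemma padj_scalar p : padj p%:M = (pc p)%:M.
Proof.
apply/matrixP => i j; rewrite padjE !mxE eq_sym.
by case: eqP => _; rewrite ?mulr1n ?mulr0n // /pc rmorph0.
Qed.
Lemma evm_padj N z : evm (padj N) z = adjmx (evm N (conjc z)).
Proof. by apply/matrixP => i j; rewrite evmE padjE pc_horner !mxE. Qed.

Lemma rat_at_conj g gc N d : d != 0 -> g = ratof N d -> gc = ratof (padj N) (pc d) ->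
  forall z M, rat_at g (conjc z) M -> rat_at gc z (adjmx M).
Proof.
move=> d0 -> -> z M h i j; have [p [q [qz e eM]]] := h j i.
exists (pc p), (pc q); rewrite !pc_horner; split; first by rewrite conjc_eq0.
  rewrite mxE padjE; apply/eqP; rewrite eqr_div ?tofrac_eq0 ?pc_eq0 ?(horner_neq0 qz) //.
  rewrite -!tofracM tofrac_eq -!pcM; apply/eqP; congr pc; move: e; rewrite mxE.
  by move/frac_cross; apply => //; apply: horner_neq0 qz.
by rewrite !mxE eM rmorphM fmorphV.
Qed.

Lemma rat_atM g (h : ratmx R n) z A B : rat_at g z A -> rat_at h z B -> rat_at (g *m h) z (A *m B).
Proof.
move=> hg hh i j; rewrite !mxE.
elim/big_rec2: _ => [|k x y _ [p [q [qz -> ->]]]].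
  by exists 0, 1; rewrite !hornerE; split; rewrite ?oner_neq0 ?mul0r ?tofrac0 ?mul0r.
have [p1 [q1 [q1z -> ->]]] := hg i k; have [p2 [q2 [q2z -> ->]]] := hh k j.
have q0 := horner_neq0 qz; have q10 := horner_neq0 q1z; have q20 := horner_neq0 q2z.
exists (p1 * p2 * q + p * (q1 * q2)), (q1 * q2 * q).
rewrite !(hornerM, hornerD); split; first by rewrite !mulf_neq0.
  by rewrite fracMD ?tofrac_eq0 // !(tofracM, tofracD).
by rewrite fracMD.
Qed.
Lemma rat_at_uniq g z A B : rat_at g z A -> rat_at g z B -> A = B.
Proof.
move=> h1 h2; apply/matrixP => i j.
have [p [q [qz e ->]]] := h1 i j; have [p' [q' [qz' e' ->]]] := h2 i j.
have := frac_cross (horner_neq0 qz) (horner_neq0 qz') (etrans (esym e) e').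
move/(congr1 (fun p : P => p.[z])); rewrite !hornerM => h.
by apply/eqP; rewrite eqr_div // h.
Qed.
Lemma rat_at1 z : rat_at (1%:M : ratmx R n) z 1%:M.
Proof.
have h : (1 : P).[z] != 0 by rewrite hornerC oner_neq0.
have := @ev_rat_at (1%:M) 1 z h.
by rewrite ratof1 ?oner_neq0 // evm_scalar hornerC invr1 scale1r.
Qed.
End RationalMatrices.
Section Growth.
Variable R : realType.
Notation C := R[i].
Notation P := {poly C}.
Implicit Types p q d r : P.

Lemma coef_sum_ub (m : nat) (a : nat -> C) (z : C) : 1 <= cn z ->
  cn (\sum_(i < m) a i * z ^+ i) <= (\sum_(i < m) cn (a i)) * cn z ^+ m.-1.
Proof.
move=> z1; apply: le_trans (cn_sum _ _ _) _; rewrite mulr_suml; apply: ler_sum => i _.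
rewrite cnM cnX ler_wpM2l ?cn_ge0 // ler_weXn2l //.
by case: m i => [[]|m i] //=; rewrite -ltnS.
Qed.

Lemma poly_ub p : exists2 S, 0 <= S & forall z, 1 <= cn z ->
  cn p.[z] <= S * cn z ^+ (size p).-1.
Proof.
exists (\sum_(i < size p) cn p`_i); first by apply: sumr_ge0 => i _; exact: cn_ge0.
by move=> z z1; rewrite horner_coef; apply: coef_sum_ub.
Qed.

Lemma poly_lb p : p != 0 -> exists K c, [/\ 1 <= K, 0 < c & forall z, K < cn z ->
  c * cn z ^+ (size p).-1 <= cn p.[z]].
Proof.
move=> p0; pose m := (size p).-1; have sp : size p = m.+1 by rewrite prednK // size_poly_gt0.
pose S := \sum_(i < m) cn p`_i; pose c := cn p`_m.
have S0 : 0 <= S by apply: sumr_ge0 => i _; exact: cn_ge0.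
have c0 : 0 < c by rewrite cn_gt0 -[m]/(size p).-1 -lead_coefE lead_coef_eq0.
exists (1 + 2 * S / c), (c / 2); split.
- by rewrite lerDl divr_ge0 ?mulr_ge0 // ltW.
- by rewrite divr_gt0.
move=> z hz; have z1 : 1 <= cn z.
  by apply: ltW; apply: le_lt_trans hz; rewrite lerDl divr_ge0 ?mulr_ge0 // ltW.
rewrite -/m horner_coef sp big_ord_recr /=.
have h1 := coef_sum_ub m (fun i => p`_i) z1; rewrite -/S in h1.
set s := \sum_(i < m) _ in h1 *.
have h2 : c * cn z ^+ m <= cn (s + p`_m * z ^+ m) + cn s.
  have := cnB (s + p`_m * z ^+ m) s; rewrite addrC addKr cnM cnX -/c; apply.
have h3 : cn s <= c / 2 * cn z ^+ m.
  apply: le_trans h1 _; case: (posnP m) => [m0|m_gt0].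
    have -> : S = 0 by rewrite /S m0 big_ord0.
    by rewrite mul0r mulr_ge0 ?exprn_ge0 ?cn_ge0 // divr_ge0 // ltW.
  rewrite -[X in _ <= _ * _ ^+ X](prednK m_gt0) exprS mulrA ler_wpM2r ?exprn_ge0 ?cn_ge0 //.
  have : 2 * S / c <= cn z by apply: ltW; apply: le_lt_trans hz; rewrite lerDr.
  by rewrite ler_pdivrMr // => h; move: h; lra.
by move: h2 h3; lra.
Qed.

Lemma poly_small r d (e : R) : (size r < size d)%N -> 0 < e ->
  exists K, forall z, K < cn z -> d.[z] != 0 /\ cn r.[z] < e * cn d.[z].
Proof.
move=> rd e0; have d0 : d != 0 by rewrite -size_poly_gt0 (leq_ltn_trans _ rd).
have [K [c [K1 c0 hK]]] := poly_lb d0; have [S S0 hS] := poly_ub r.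
exists (K + S / (e * c)) => z hz.
have hS' : 0 <= S / (e * c) by rewrite divr_ge0 // mulr_ge0 ?ltW.
have zK : K < cn z by apply: le_lt_trans hz; rewrite lerDl.
have z1 : 1 < cn z by apply: le_lt_trans zK.
have hd := hK z zK; have z0 : 0 < cn z by apply: lt_trans z1.
have dz : 0 < cn d.[z] by apply: lt_le_trans hd; rewrite mulr_gt0 ?exprn_gt0.
split; first by rewrite -cn_gt0.
have [->|r0] := eqVneq r 0; first by rewrite horner0 cn0 mulr_gt0.
apply: le_lt_trans (hS z (ltW z1)) _.
apply: lt_le_trans (_ : e * (c * cn z ^+ (size d).-1) <= _); last by rewrite ler_wpM2l // ltW.
have sr : (0 < size r)%N by rewrite size_poly_gt0.
have h1 : cn z ^+ (size r).-1 * cn z <= cn z ^+ (size d).-1.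
  rewrite -exprSr ler_weXn2l ?ltW // prednK // -ltnS prednK // (leq_ltn_trans _ rd) //.
apply: lt_le_trans (_ : e * (c * (cn z ^+ (size r).-1 * cn z)) <= _); last first.
  by rewrite !ler_wpM2l // ltW.
rewrite mulrA [_ * cn z]mulrC mulrA ltr_pM2r ?exprn_gt0 //.
rewrite mulrC -ltr_pdivrMr ?mulr_gt0 //.
by apply: le_lt_trans hz; rewrite lerDr (le_trans _ K1).
Qed.

(** Otherwise [r / d] would stay away from 0 along the positive real axis. *)
Lemma small_poly r d : d != 0 ->
  (forall e : R, 0 < e -> exists K, forall z, K < cn z -> d.[z] != 0 -> cn r.[z] <= e * cn d.[z]) ->
  (size r < size d)%N.
Proof.
move=> d0 h; rewrite ltnNge; apply/negP => dr.
have r0 : r != 0 by rewrite -size_poly_gt0 (leq_trans _ dr) // size_poly_gt0.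
have [K [c [K1 c0 hK]]] := poly_lb r0; have [S S0 hS] := poly_ub d.
have [K' [c' [K'1 c'0 hK']]] := poly_lb d0.
have e0 : 0 < c / (2 * (S + 1)) by rewrite divr_gt0 // mulr_gt0 // ltr_wpDl.
have [K2 hK2] := h _ e0.
pose t := K + K' + `|K2| + 1; pose z : C := t%:C.
have K0 : 0 <= K by rewrite (le_trans _ K1).
have K'0 : 0 <= K' by rewrite (le_trans _ K'1).
have a0 := normr_ge0 K2.
have t0 : 0 < t by rewrite /t; lra.
have ez : cn z = t by rewrite cn_real gtr0_norm.
have zK : K < cn z by rewrite ez /t; lra.
have zK' : K' < cn z by rewrite ez /t; lra.
have zK2 : K2 < cn z by rewrite ez; have := ler_norm K2; rewrite /t; lra.
have z1 : 1 <= cn z by rewrite (le_trans K1) // ltW.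
have p0 : 0 < cn z ^+ (size d).-1 by rewrite exprn_gt0 // ez.
have dz : d.[z] != 0 by rewrite -cn_gt0 (lt_le_trans _ (hK' z zK')) // mulr_gt0.
have h1 := hK2 z zK2 dz.
have h2 := hK z zK; have h3 := hS z z1.
have h4 : cn z ^+ (size d).-1 <= cn z ^+ (size r).-1.
  by rewrite ler_weXn2l // -ltnS !prednK // size_poly_gt0.
have h5 : c * cn z ^+ (size d).-1 <= c / (2 * (S + 1)) * (S * cn z ^+ (size d).-1).
  apply: le_trans (_ : c * cn z ^+ (size r).-1 <= _); first by rewrite ler_wpM2l // ltW.
  by apply: le_trans h2 _; apply: le_trans h1 _; rewrite ler_wpM2l // ltW.
move: h5; rewrite mulrA ler_pM2r // mulrAC ler_pdivlMr ?mulr_gt0 ?ltr_wpDl //.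
rewrite -subr_ge0 => h6.
have : 0 < c * (S + 2) by rewrite mulr_gt0 // ltr_wpDl.
by move: h6; rewrite !mulrDr; lra.
Qed.

Lemma size_mul_lt p q r : q != 0 -> (size p < size q)%N -> r != 0 ->
  (size (p * r)%R < size (q * r)%R)%N.
Proof.
move=> q0 pq r0; rewrite (size_mul q0 r0).
have r1 : (0 < size r)%N by rewrite size_poly_gt0.
apply: leq_ltn_trans (size_polyMleq _ _) _.
by case: (size p) (size q) (size r) pq r1 => [|a] [|b] [|c] //= *; rewrite ?addSn ?addn0 ?ltn_add2r; rewrite ?addnS ?ltnS ?leq_addl // leq_add2r.
Qed.
End Growth.
Section UnitaryRational.
Variables (R : realType) (n : nat).
Notation C := R[i].
Notation P := {poly C}.
Implicit Types (p q d : P) (N : 'M[P]_n) (z : C) (g h : ratmx R n).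

(** [N / d] is unitary on the real line and equal to 1 at infinity. *)
Definition unitary_frac N d :=
  [/\ d != 0, padj N *m N = (pc d * d)%:M &
   forall i j, (size (N i j - (d%:M : 'M[P]_n) i j)%R < size d)%N].

Lemma unitary_fracC N d : unitary_frac N d -> N *m padj N = (pc d * d)%:M.
Proof.
move=> [d0 hU _]; have dd0 : pc d * d != 0 by rewrite mulf_neq0 // pc_eq0.
have h1 : ratof (padj N) (pc d * d) *m ratof N 1 = 1%:M.
  by rewrite ratofM hU mulr1 ratof1.
have := mulmx1C h1; rewrite ratofM mul1r -(ratof1 n dd0).
by move/(ratof_eqP _ _ dd0 dd0) => h; apply/matrixP => i j; have /matrixP/(_ i j) := h;
  rewrite [LHS]mxE [RHS]mxE => /(mulfI dd0).
Qed.

(** Clearing denominators turns unitarity into a polynomial identity, and the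
    value at infinity into a comparison of degrees. *)
Lemma Gminus_unitary g : @Gminus R n g -> exists N d, unitary_frac N d /\ g = ratof N d.
Proof.
move=> [_ hinf hU]; have [N [d [d0 eg]]] := ratof_ex g.
exists N, d; split => //; rewrite {}eg in hinf hU *.
have [s hs] := poly_roots_seq d; have [s' hs'] := poly_roots_seq (pc d).
have dz z : z \notin s -> d.[z] != 0 by rewrite hs.
have dz' z : z \notin s' -> d.[conjc z] != 0.
  by rewrite hs' ?pc_eq0 // /root pc_horner conjc_eq0.
split => //.
  apply: (@evm_off _ _ (s ++ s')) => z; rewrite mem_cat negb_or => /andP[/dz h1 /dz' h2].
  have := hU z _ _ (ev_rat_at N h1) (ev_rat_at N h2).
  rewrite adjZ -scalemxAl -scalemxAr scalerA => h.
  rewrite evmM evm_padj evm_scalar hornerM pc_horner -scalemx1 -h scalerA.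
  by rewrite fmorphV -invfM divff ?scale1r // mulf_neq0 // conjc_eq0.
move=> i j; apply: small_poly => // e e0.
have [K hK] := hinf e e0; exists K => z zK dz0.
have := hK z _ _ (ev_rat_at N dz0) i j.
rewrite lt_cn => /(_ zK); rewrite cnE ltcR => /ltW hh.
have cd : 0 < cn d.[z] by rewrite cn_gt0.
rewrite -ler_pdivrMr // -cnV -cnM mulrC; apply: le_trans hh.
rewrite le_eqVlt; apply/orP; left; apply/eqP; congr cn.
rewrite hornerD hornerN mulrBr [in RHS]mxE evmE; congr (_ - _).
by rewrite !mxE; case: (i == j); rewrite ?mulr1n ?mulr0n ?mulVf ?horner0 ?mulr0.
Qed.

Lemma unitary_Gminus N d : unitary_frac N d -> @Gminus R n (ratof N d).
Proof.
move=> [d0 hU hinf]; split.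
- have [s hs] := poly_roots_seq d; have [s' hs'] := poly_roots_seq (pc d).
  exists (s ++ s') => z; rewrite mem_cat negb_or hs // hs' ?pc_eq0 // => /andP[h1 h2].
  exists (d.[z]^-1 *: evm N z); split; first exact: ev_rat_at.
  have h : ((pc d).[z]^-1 *: evm (padj N) z) *m (d.[z]^-1 *: evm N z) = 1%:M.
    rewrite -scalemxAl -scalemxAr scalerA -evmM hU evm_scalar hornerM -scalemx1 scalerA.
    by rewrite -invfM mulVf ?scale1r // mulf_neq0.
  by case: (mulmx1_unit h).
- move=> e e0.
  have /choice[K hK] : forall ij : 'I_n * 'I_n, exists K, forall z, K < cn z ->
      d.[z] != 0 /\ cn (N ij.1 ij.2 - (d%:M : 'M[P]_n) ij.1 ij.2).[z] < e * cn d.[z].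
    by move=> [i j]; apply: poly_small.
  exists (\sum_ij `|K ij|) => z M; rewrite lt_cn => zK hM i j.
  have zKij : K (i, j) < cn z.
    apply: le_lt_trans zK; apply: le_trans (ler_norm _) _.
    by rewrite (bigD1 (i, j)) //= lerDl sumr_ge0.
  have [dz hr] := hK (i, j) z zKij.
  rewrite (rat_at_ev dz hM) cnE ltcR.
  have cd : 0 < cn d.[z] by rewrite cn_gt0.
  move: hr; rewrite -ltr_pdivrMr // -cnV -cnM mulrC; apply: le_lt_trans.
  rewrite le_eqVlt; apply/orP; left; apply/eqP; congr cn.
  rewrite hornerD hornerN mulrBr [in LHS]mxE evmE; congr (_ - _).
  by rewrite !mxE; case: (i == j); rewrite ?mulr1n ?mulr0n ?mulVf ?horner0 ?mulr0.
- move=> z M M' hM hM'.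
  have h1 := rat_at_conj d0 (erefl _) (erefl _) hM'.
  have := rat_atM h1 hM; rewrite ratofM hU ratof1 ?mulf_neq0 ?pc_eq0 // => h.
  exact: rat_at_uniq h (@rat_at1 R n z).
Qed.

Lemma size_sum_lt I (r : seq I) (F : I -> P) (m : nat) : (0 < m)%N ->
  (forall i, (size (F i) < m)%N) -> (size (\sum_(i <- r) F i)%R < m)%N.
Proof.
move=> m0 h; elim/big_ind: _ => [|x y hx hy|//]; first by rewrite size_poly0.
by apply: leq_ltn_trans (size_polyD _ _) _; rewrite gtn_max hx.
Qed.

Lemma close_mul N1 d1 N2 d2 : d1 != 0 -> d2 != 0 ->
  (forall i j, (size (N1 i j - (d1%:M : 'M[P]_n) i j)%R < size d1)%N) ->
  (forall i j, (size (N2 i j - (d2%:M : 'M[P]_n) i j)%R < size d2)%N) ->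
  forall i j, (size ((N1 *m N2) i j - ((d1 * d2)%:M : 'M[P]_n) i j)%R < size (d1 * d2)%R)%N.
Proof.
move=> d10 d20 h1 h2 i j.
have e : (N1 *m N2) i j - ((d1 * d2)%:M : 'M[P]_n) i j =
   \sum_k (N1 i k - (d1%:M : 'M[P]_n) i k) * N2 k j + d1 * (N2 i j - (d2%:M : 'M[P]_n) i j).
  have -> : N1 *m N2 = (N1 - d1%:M) *m N2 + d1 *: N2.
    by rewrite mulmxBl mul_scalar_mx subrK.
  rewrite mulrBr addrA; congr (_ - _); last by rewrite !mxE mulrnAr.
  rewrite !mxE; congr (_ + _); apply: eq_bigr => k _.
  by rewrite !mxE.
rewrite e; have s0 : (0 < size (d1 * d2)%R)%N by rewrite size_poly_gt0 mulf_neq0.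
have sN2 k l : (size (N2 k l) <= size d2)%N.
  rewrite -[N2 k l](subrK ((d2%:M : 'M[P]_n) k l)).
  apply: leq_trans (size_polyD _ _) _; rewrite geq_max (ltnW (h2 k l)) /= mxE.
  by case: (k == l); rewrite ?mulr1n // mulr0n size_poly0.
apply: leq_ltn_trans (size_polyD _ _) _; rewrite gtn_max; apply/andP; split.
  apply: size_sum_lt => // k.
  apply: (@leq_ltn_trans (size ((N1 i k - (d1%:M : 'M[P]_n) i k) * d2)%R)); last exact: size_mul_lt.
  have [->|x0] := eqVneq (N1 i k - (d1%:M : 'M[P]_n) i k) 0; first by rewrite !mul0r size_poly0.
  rewrite (size_mul x0 d20); apply: leq_trans (size_polyMleq _ _) _.
  by rewrite -!subn1 leq_sub2r // leq_add2l.
by rewrite mulrC [d1 * d2]mulrC; apply: size_mul_lt.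
Qed.

Lemma unitary_fracM N1 d1 N2 d2 : unitary_frac N1 d1 -> unitary_frac N2 d2 ->
  unitary_frac (N1 *m N2) (d1 * d2).
Proof.
move=> [d10 U1 h1] [d20 U2 h2]; split; first exact: mulf_neq0; last exact: close_mul.
rewrite padjM mulmxA -(mulmxA (padj N2)) U1 scalar_mxC -mulmxA U2.
rewrite -scalar_mxM pcM; congr (_%:M); ring.
Qed.

Lemma GminusM g h : @Gminus R n g -> @Gminus R n h -> @Gminus R n (g *m h).
Proof.
move=> /Gminus_unitary[N1 [d1 [h1 ->]]] /Gminus_unitary[N2 [d2 [h2 ->]]].
by rewrite ratofM; apply: unitary_Gminus; apply: unitary_fracM.
Qed.

Lemma unitary_frac1 : unitary_frac 1%:M 1.
Proof.
split; first exact: oner_neq0.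
  by rewrite padj_scalar mulmx1 mulr1.
by move=> i j; rewrite subrr size_poly0 size_poly1.
Qed.
Lemma Gminus1 : @Gminus R n 1%:M.
Proof. by rewrite -(ratof1 n (oner_neq0 P)); apply: unitary_Gminus unitary_frac1. Qed.

Lemma unitary_padj N d : unitary_frac N d -> unitary_frac (padj N) (pc d).
Proof.
move=> h; have [d0 _ hi] := h; split; first by rewrite pc_eq0.
  by rewrite padjK (unitary_fracC h) pcK mulrC.
move=> i j; rewrite size_pc padjE.
have -> : (pc d)%:M i j = pc ((d%:M : 'M[P]_n) j i).
  by rewrite -padjE padj_scalar.
by rewrite -pcB size_pc.
Qed.
End UnitaryRational.
(** * Uniqueness of factorizations *)

Section FactorizationUniqueness.
Variables (R : realType) (n : nat).
Notation C := R[i].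
Notation P := {poly C}.
Implicit Types (f : C -> C) (z : C).

Definition ccont f := forall z (e : R), 0 < e ->
  exists2 d : R, 0 < d & forall w, cn (w - z) < d -> cn (f w - f z) <= e.

Lemma ccont_cst c : ccont (fun=> c).
Proof. by move=> z e e0; exists 1 => // w _; rewrite subrr cn0 ltW. Qed.
Lemma ccont_id : ccont id.
Proof. by move=> z e e0; exists e => // w /ltW. Qed.
Lemma ccontD f1 f2 : ccont f1 -> ccont f2 -> ccont (fun z => f1 z + f2 z).
Proof.
move=> h1 h2 z e e0; have e2 : 0 < e / 2 by rewrite divr_gt0.
have [d d0 hd] := h1 z _ e2; have [d' d'0 hd'] := h2 z _ e2.
exists (Num.min d d'); first by rewrite lt_min d0.
move=> w; rewrite lt_min => /andP[w1 w2].
rewrite opprD addrACA (le_trans (cnD _ _)) // (splitr e).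
by rewrite lerD ?hd ?hd'.
Qed.
Lemma ccontM f1 f2 : ccont f1 -> ccont f2 -> ccont (fun z => f1 z * f2 z).
Proof.
move=> h1 h2 z e e0.
pose c := 1 + cn (f1 z) + cn (f2 z).
have c1 : 1 <= c by rewrite /c -addrA lerDl addr_ge0 ?cn_ge0.
have c0 : 0 < c by apply: lt_le_trans c1.
have e2 : 0 < Num.min 1 (e / (2 * c)) by rewrite lt_min ltr01 divr_gt0 ?mulr_gt0.
have [d d0 hd] := h1 z _ e2; have [d' d'0 hd'] := h2 z _ e2.
exists (Num.min d d'); first by rewrite lt_min d0.
move=> w; rewrite lt_min => /andP[/hd w1 /hd' w2].
have -> : f1 w * f2 w - f1 z * f2 z = (f1 w - f1 z) * f2 w + f1 z * (f2 w - f2 z).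
  by rewrite mulrBl mulrBr addrA subrK.
move: w1 w2; rewrite !le_min => /andP[_ y1] /andP[y2 y3].
rewrite (le_trans (cnD _ _)) // (splitr e) !cnM.
have hgy : cn (f2 w) <= c.
  have := cnD (f2 w - f2 z) (f2 z); rewrite subrK => h.
  by apply: le_trans h _; rewrite /c lerD2r (le_trans y2) // lerDl cn_ge0.
have e2c : e / 2 = e / (2 * c) * c by rewrite invfM mulrA divfK ?gt_eqF.
apply: lerD; rewrite e2c.
  by apply: ler_pM => //; rewrite cn_ge0.
rewrite mulrC; apply: ler_pM => //; rewrite ?cn_ge0 //.
by rewrite /c addrAC lerDr addr_ge0 ?cn_ge0.
Qed.
Lemma ccont_sum I (r : seq I) (F : I -> C -> C) :
  (forall i, ccont (F i)) -> ccont (fun z => \sum_(i <- r) F i z).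
Proof.
move=> h; elim: r => [|i r IH].
  by have := ccont_cst 0; congr ccont; apply/funext => x; rewrite big_nil.
have := ccontD (h i) IH.
by congr ccont; apply/funext => x; rewrite big_cons.
Qed.
Lemma ccont_conj f : ccont f -> ccont (fun z => conjc (f (conjc z))).
Proof.
move=> h z e e0; have [d d0 hd] := h (conjc z) e e0; exists d => // w hw.
by rewrite -rmorphB cnJ hd // -rmorphB cnJ.
Qed.
Lemma ccont_poly (p : P) : ccont (fun z => p.[z]).
Proof.
elim/poly_ind: p => [|p c IH].
  by have := ccont_cst 0; congr ccont; apply/funext => x; rewrite horner0.
have := ccontD (ccontM IH ccont_id) (ccont_cst c).
by congr ccont; apply/funext => z; rewrite hornerMXaddC.
Qed.

Lemma entire_ccont (F : C -> 'M[C]_n) i j : entire F -> ccont (fun z => F z i j).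
Proof.
move=> h z e e0; have hz := nbhs_singleton (h z i j).
have /= hc : {for (z : C^o), continuous (fun s : C^o => F s i j : C^o)}.
  by apply/differentiable_continuous/derivable1_diffP.
have e0' : 0 < e%:C by rewrite ltcR.
move/cvgrPdist_le : hc => /(_ _ e0')[r /= r0 hr].
have [s es] : exists s, r = s%:C by apply/complex_realP; apply: ger0_real; apply: ltW.
exists s; first by rewrite -ltcR -es.
move=> w hw; have := hr w; rewrite /= -normrN opprB cnE es ltcR => /(_ hw).
by rewrite -normrN opprB cnE lecR.
Qed.

Lemma off_near (s : seq C) z (d : R) : 0 < d -> exists w, w \notin s /\ cn (w - z) < d.
Proof.
move=> d0; pose L := [seq z + (d / k.+2%:R)%:C | k <- iota 0 (size s).+1].
have uL : uniq L.
  rewrite map_inj_uniq ?iota_uniq // => k l /addrI /complexI /(mulfI (lt0r_neq0 d0)) /invr_inj /eqP.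
  by rewrite eqr_nat => /eqP[].
have : has [pred w | w \notin s] L.
  apply: contraT; rewrite -all_predC => /allP h.
  have : {subset L <= s} by move=> w /h /=; rewrite negbK.
  by move=> /(uniq_leq_size uL); rewrite size_map size_iota ltnn.
case/hasP => w /mapP[k _ ->] /= hs; exists (z + (d / k.+2%:R)%:C); split => //.
rewrite addrC addKr cn_real ger0_norm ?divr_ge0 ?ltW //.
by rewrite ltr_pdivrMr // ltr_pMr // ltr1n.
Qed.

Lemma ccont_eq (s : seq C) f1 f2 : ccont f1 -> ccont f2 ->
  (forall z, z \notin s -> f1 z = f2 z) -> forall z, f1 z = f2 z.
Proof.
move=> h1 h2 h z; apply/eqP; rewrite -subr_eq0 -cn_eq0 eq_le cn_ge0 andbT.
apply/ler_addgt0Pl => e e0; rewrite addr0.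
have e2 : 0 < e / 2 by rewrite divr_gt0.
have [d d0 hd] := h1 z _ e2; have [d' d'0 hd'] := h2 z _ e2.
have [|w [ws]] := @off_near s z (Num.min d d'); first by rewrite lt_min d0.
rewrite lt_min => /andP[w1 w2].
have -> : f1 z - f2 z = (f2 w - f2 z) - (f1 w - f1 z) by rewrite (h w ws); ring.
rewrite (le_trans (cnB _ _)) // [e](splitr e).
by rewrite lerD ?hd ?hd'.
Qed.

Lemma contdvd (D p : P) f : D != 0 -> ccont f ->
  (forall z, p.[z] = D.[z] * f z) -> exists W, p = D * W.
Proof.
move: {2}(size D) (leqnn (size D)) => m.
elim: m D p => [|m IH] D p; first by rewrite leqn0 size_poly_eq0 => /eqP-> /eqP.
move=> sD D0 cf h.
have [D1|D1] := eqVneq (size D) 1.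
  have /size_poly1P[c c0 eD] : size D == 1 by rewrite D1.
  exists (c^-1 *: p); rewrite eD mul_polyC scalerA divff // scale1r //.
have [a /factor_theorem[q eq]] := closed_rootP D D1.
have /factor_theorem[p' ep] : root p a.
  by rewrite /root h eq hornerM !hornerE subrr mulr0 mul0r.
have q0 : q != 0 by apply: contraNneq D0 => q0; rewrite eq q0 mul0r.
have [||W eW] := IH q p' _ q0 cf.
- by rewrite -ltnS (leq_trans _ sD) // eq size_Mmonic ?monicXsubC // size_XsubC addn2.
- apply: (@ccont_eq [:: a] (fun z => p'.[z]) (fun z => q.[z] * f z)).
  + exact: ccont_poly.
  + exact: ccontM (ccont_poly _) cf.
  move=> w; rewrite inE => wa; have := h w; rewrite ep eq !hornerE.
  rewrite mulrAC => /mulIf; apply.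
  by rewrite subr_eq0.
by exists W; rewrite ep eq eW mulrAC.
Qed.

(** [adjmx F2 *m F1] is continuous and coincides with the rational matrix [h2
    h1^-1], so it is a polynomial; being 1 at infinity, it is 1. *)
Lemma factorization_unique (g : ratmx R n) (F F1 F2 : C -> 'M[C]_n) (h1 h2 : ratmx R n) :
  factorization g F F1 h1 -> factorization g F F2 h2 -> F1 = F2 /\ h1 = h2.
Proof.
move=> [[E1 _ U1] /Gminus_unitary[N1 [d1 [u1 ->]]] H1] [[E2 I2 U2] /Gminus_unitary[N2 [d2 [u2 ->]]] H2].
have [d10 n1 i1] := u1; have [d20 n2 i2] := u2.
have [N [d [d0 eg]]] := ratof_ex g; rewrite {}eg in H1 H2.
have [s hs] := poly_roots_seq (d * d1 * d2 * pc d1).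
have {}hs z : z \notin s -> [/\ d.[z] != 0, d1.[z] != 0, d2.[z] != 0 & (pc d1).[z] != 0].
  rewrite hs ?mulf_neq0 ?pc_eq0 // /root !hornerM !mulf_eq0 !negb_or.
  by case/andP => /andP[/andP[]].
have key z : z \notin s -> F1 z *m (d1.[z]^-1 *: evm N1 z) = F2 z *m (d2.[z]^-1 *: evm N2 z).
  move=> /hs[dz d1z d2z _].
  rewrite -(H1 z _ _ (ev_rat_at N dz) (ev_rat_at N1 d1z)).
  by rewrite -(H2 z _ _ (ev_rat_at N dz) (ev_rat_at N2 d2z)).
have inv1 z : z \notin s -> (d1.[z]^-1 *: evm N1 z) *m ((pc d1).[z]^-1 *: evm (padj N1) z) = 1%:M.
  move=> /hs[_ d1z _ p1z]; rewrite -scalemxAl -scalemxAr scalerA -evmM (unitary_fracC u1).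
  by rewrite evm_scalar hornerM -scalemx1 scalerA -invfM [d1.[z] * _]mulrC mulVf ?scale1r // mulf_neq0.
pose Phi z := adjmx (F2 (conjc z)) *m F1 z.
have ePhi z : z \notin s -> evm (N2 *m padj N1) z = (d2 * pc d1).[z] *: Phi z.
  move=> zs; have [_ d1z d2z p1z] := hs z zs.
  have -> : Phi z = (d2.[z]^-1 *: evm N2 z) *m ((pc d1).[z]^-1 *: evm (padj N1) z).
    rewrite /Phi -[F1 z]mulmx1 -(inv1 z zs) (mulmxA (F1 z)) key // !mulmxA.
    by rewrite U2 mul1mx.
  rewrite -scalemxAl -scalemxAr !scalerA -evmM hornerM.
  rewrite [X in _ = X *: _](_ : _ = 1) ?scale1r //.
  by rewrite -mulrA -invfM divff ?mulf_neq0.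
have cPhi i j : ccont (fun z => Phi z i j).
  have := @ccont_sum _ (index_enum 'I_n) (fun k z => conjc (F2 (conjc z) k i) * F1 z k j).
  move=> /(_ (fun k => ccontM (ccont_conj (entire_ccont k i E2)) (entire_ccont k j E1))).
  congr ccont; apply/funext => z; rewrite /Phi mxE; apply: eq_bigr => k _.
  by rewrite !mxE.
have D0 : d2 * pc d1 != 0 by rewrite mulf_neq0 ?pc_eq0.
have up := unitary_padj u1; have [_ _ ip] := up.
have hcl := close_mul d20 (_ : pc d1 != 0) i2 ip; rewrite pc_eq0 in hcl.
have eN : N2 *m padj N1 = (d2 * pc d1)%:M.
  apply/matrixP => i j.
  have [W eW] : exists W, (N2 *m padj N1) i j = (d2 * pc d1) * W.
    apply: (contdvd D0 (cPhi i j)); apply: (@ccont_eq s).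
    - exact: ccont_poly.
    - exact: ccontM (ccont_poly _) (cPhi i j).
    by move=> z zs; have /matrixP/(_ i j) := ePhi z zs; rewrite evmE [RHS]mxE.
  have e : (N2 *m padj N1) i j - ((d2 * pc d1)%:M : 'M[P]_n) i j =
     (W - (i == j)%:R) * (d2 * pc d1).
    by rewrite eW mxE mulrBl mulrC; case: (i == j); rewrite ?mul1r ?mul0r.
  have := hcl d10 i j; rewrite e.
  have [w0|W0] := eqVneq (W - (i == j)%:R) 0.
    by move=> _; apply/eqP; rewrite -subr_eq0 e w0 mul0r.
  rewrite (size_mul W0 D0) => hh; exfalso; move: hh.
  have : (0 < size (W - (i == j)%:R)%R)%N by rewrite size_poly_gt0.
  by case: (size (W - (i == j)%:R)%R) => // k _; rewrite addSn /= ltnNge leq_addl.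
have eN' : d2 *: N1 = d1 *: N2.
  have : (N2 *m padj N1) *m N1 = (d2 * pc d1) *: N1 by rewrite eN mul_scalar_mx.
  rewrite -mulmxA n1 scalar_mxC mul_scalar_mx [d2 * _]mulrC -!scalerA => e.
  apply/matrixP => i j; have /matrixP/(_ i j) := e; rewrite !mxE => /mulfI e'.
  by apply/esym/e'; rewrite pc_eq0.
have eh : ratof N1 d1 = ratof N2 d2 by apply/ratof_eqP.
split => //; apply/funext => z; apply/matrixP => i j.
apply: (@ccont_eq s (fun z => F1 z i j) (fun z => F2 z i j)).
- exact: entire_ccont.
- exact: entire_ccont.
move=> w ws; have [dw d1w d2w _] := hs w ws.
have k1 := key w ws.
have k2 := rat_at_ev d1w (eq_ind_r (fun h => rat_at h w _) (ev_rat_at N2 d2w) eh).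
have : F1 w = F2 w; last by move=> ->.
by rewrite -[F1 w]mulmx1 -(inv1 w ws) mulmxA k1 k2 -mulmxA (inv1 w ws) mulmx1.
Qed.
End FactorizationUniqueness.
(** * Generation of the rational loop group by simple elements *)

Section RankOne.
Variables (R : realType) (n : nat).
Notation C := R[i].
Notation P := {poly C}.

(** Orthogonal projections of rank one, characterized without choosing a
    spanning vector. *)
Definition rk1 (p : 'M[C]_n) :=
  [/\ adjmx p = p, \tr p = 1 & forall x, p *m x *m p = \tr (x *m p) *: p].

Lemma rk1_idem p : rk1 p -> p *m p = p.
Proof. by move=> [_ t /(_ 1%:M)]; rewrite mulmx1 mul1mx t scale1r. Qed.

Lemma rk1_vec (v : 'cV[C]_n) : v != 0 -> exists w : 'rV[C]_n,
  rk1 (v *m w) /\ (w *m v) 0 0 = 1.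
Proof.
move=> v0; pose w0 : 'rV[C]_n := map_mx (@conjc R) v^T.
pose s : R := \sum_k cn (v k 0) ^+ 2.
have es : (w0 *m v) 0 0 = s%:C.
  rewrite mxE rmorph_sum; apply: eq_bigr => k _.
  by rewrite !mxE mulrC -sqr_normc cnE -rmorphXn.
have s0 : s != 0.
  apply: contraNneq v0 => s0; apply/eqP/matrixP => k l; rewrite (ord1 l) mxE.
  apply/eqP; rewrite -cn_eq0 -sqrf_eq0.
  move/eqP: s0; rewrite psumr_eq0 => [/allP/(_ k)|k' _]; last by rewrite exprn_ge0 ?cn_ge0.
  by rewrite mem_index_enum => /(_ isT).
have sC0 : s%:C != 0 :> C by rewrite -(rmorph0 (@real_complex_def _ (Phant R))) (inj_eq (@complexI R)).
pose w := (s%:C)^-1 *: w0; exists w.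
have ewv : (w *m v) 0 0 = 1 by rewrite -scalemxAl mxE es mulVf.
split => //; split.
- apply/matrixP => i j; rewrite !mxE !big_ord_recl !big_ord0 !mxE !addr0.
  by rewrite !conjM conjcK conjc_inv conjc_real; ring.
- by rewrite mxtrace_mulC [w *m v]mx11_scalar ewv mxtrace1.
- move=> x; rewrite !mulmxA mxtrace_mulC mulmxA [in RHS](mx11_scalar (w *m x *m v)) mxtrace_scalar mulr1n.
  rewrite -(mulmxA v w) -(mulmxA v (w *m x)) (mx11_scalar (w *m x *m v)).
  by rewrite mul_mx_scalar -scalemxAl [_%:M 0 0]mxE mulr1n.
Qed.
End RankOne.
Lemma affine_mul (A : comNzRingType) (n : nat) (t t' c c' : A) (p x : 'M[A]_n) :
  (t%:M + c *: p) *m (t'%:M + c' *: x) =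
  (t * t')%:M + ((c * t') *: p + (t * c') *: x + (c * c') *: (p *m x)).
Proof.
rewrite mulmxDl !mulmxDr !mul_scalar_mx scale_scalar_mx scalerA mul_mx_scalar scalerA.
rewrite -scalemxAl -scalemxAr scalerA [t' * c]mulrC -!addrA; congr (_ + _).
by rewrite addrCA.
Qed.

Section SimpleElements.
Variables (R : realType) (n : nat).
Notation C := R[i].
Notation P := {poly C}.
Implicit Types (a : C) (p x : 'M[C]_n) (N : 'M[P]_n) (d : P).

Definition cpx p : 'M[P]_n := map_mx (@polyC C) p.

(** Numerator of [1 + (conjc a - a) / (l - conjc a) p], which has a pole at
    [conjc a] and is singular at [a]. *)
Definition simN a p : 'M[P]_n :=
  ('X - (conjc a)%:P)%:M + cpx ((conjc a - a) *: p).
Definition simple a p : ratmx R n := ratof (simN a p) ('X - (conjc a)%:P).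

Inductive gen : ratmx R n -> Prop :=
| gen1 : gen 1%:M
| genS a p : complex.Im a != 0 -> rk1 p -> gen (simple a p)
| genM g h : gen g -> gen h -> gen (g *m h).

Lemma XsubC_neq0 a : 'X - a%:P != 0 :> P.
Proof. by rewrite polyXsubC_eq0. Qed.
Hint Resolve XsubC_neq0 : core.

Lemma cpxM p x : cpx (p *m x) = cpx p *m cpx x.
Proof. exact: map_mxM. Qed.
Lemma cpxD p x : cpx (p + x) = cpx p + cpx x.
Proof. exact: map_mxD. Qed.
Lemma cpxZ c p : cpx (c *: p) = c%:P *: cpx p.
Proof. exact: map_mxZ. Qed.
Lemma cpx0 : cpx 0 = 0.
Proof. exact: map_mx0. Qed.
Lemma cpx1 : cpx 1%:M = 1%:M.
Proof. by rewrite /cpx map_scalar_mx. Qed.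

(** Orthogonal projections add up, so that a full set of coordinate
    projections produces a scalar factor. *)
Lemma simple_mul a p x : p *m x = 0 ->
  simple a p *m simple a x = simple a (p + x).
Proof.
move=> px; rewrite /simple ratofM; apply/ratof_eqP => //; first by rewrite mulf_neq0.
rewrite -scalerA; congr (_ *: _); set t := 'X - _.
rewrite /simN !cpxZ cpxD scalerDr; set c := (_ - _)%:P.
rewrite -/t affine_mul -cpxM px cpx0 scaler0 addr0 scale_scalar_mx.
by rewrite scalerA scalerDr [c * t]mulrC.
Qed.

Lemma simple_inv a p : rk1 p -> simple a p *m simple (conjc a) p = 1%:M.
Proof.
move=> hp; rewrite /simple ratofM conjcK -(ratof1 n (_ : ('X - (conjc a)%:P) * ('X - a%:P) != 0)) ?mulf_neq0 //.
congr ratof; rewrite /simN conjcK !cpxZ; set t := 'X - _; set t' := 'X - a%:P.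
have -> : a - conjc a = - (conjc a - a) by rewrite opprB.
rewrite polyCN; set c := (_ - _)%:P.
have ec : c = t' - t by rewrite /c polyCB /t /t'; ring.
rewrite affine_mul -cpxM rk1_idem // -!scalerDl.
by rewrite (_ : c * t' + t * - c + c * - c = 0) ?scale0r ?addr0 // ec; ring.
Qed.

Lemma simple0 a : simple a 0 = 1%:M.
Proof. by rewrite /simple /simN scaler0 cpx0 addr0 ratof1. Qed.

Lemma rk1_delta (k : 'I_n) : rk1 (delta_mx k k : 'M[C]_n).
Proof.
split.
- by apply/matrixP => i j; rewrite !mxE rmorph_nat andbC.
- by rewrite /mxtrace (bigD1 k) //= big1 ?addr0 ?mxE ?eqxx // => i ik; rewrite mxE (negbTE ik).
- move=> x; apply/matrixP => i j.
  have e1 : forall l, (delta_mx k k *m x) i l = (i == k)%:R * x k l.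
    move=> l; rewrite mxE (bigD1 k) //= big1 ?addr0 ?mxE ?eqxx ?andbT // => m mk.
    by rewrite mxE (negbTE mk) andbF mul0r.
  rewrite mxE (bigD1 k) //= big1 ?addr0; last by move=> m mk; rewrite [delta_mx _ _ m _]mxE (negbTE mk) mulr0.
  rewrite e1 !mxE eqxx /=.
  have -> : \tr (x *m delta_mx k k) = x k k.
    rewrite /mxtrace (bigD1 k) //= big1 ?addr0.
      rewrite mxE (bigD1 k) //= big1 ?addr0 ?mxE ?eqxx ?mulr1 // => m mk.
      by rewrite mxE (negbTE mk) mulr0.
    move=> m mk; rewrite mxE big1 // => l _; rewrite mxE (negbTE mk) andbF mulr0 //.
  by case: (i == k); case: (j == k); rewrite /= ?mul1r ?mul0r ?mulr1 ?mulr0.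
Qed.

Lemma gen_scalar a : complex.Im a != 0 -> gen (ratof ('X - a%:P)%:M ('X - (conjc a)%:P)).
Proof.
move=> a0; pose S m : 'M[C]_n := \sum_(k < n | (k < m)%N) delta_mx k k.
have gS m : (m <= n)%N -> gen (simple a (S m)).
  elim: m => [|m IH] mn.
    by rewrite /S big_pred0 // simple0; apply: gen1.
  pose k := Ordinal mn.
  have eS : S m.+1 = S m + delta_mx k k.
    rewrite /S (bigD1 k) //= addrC; congr (_ + _); apply: eq_bigl => l.
    by rewrite ltnS ltn_neqAle andbC -(inj_eq val_inj).
  rewrite eS -simple_mul; first by apply: genM; [apply: IH; apply: ltnW|apply: genS => //; apply: rk1_delta].
  rewrite /S mulmx_suml big1 // => l lm; rewrite mul_delta_mx_cond.
  by rewrite (_ : l == k = false) ?mulr0n //; apply: contraTF lm => /eqP->; rewrite -leqNgt.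
have -> : ratof ('X - a%:P)%:M ('X - (conjc a)%:P) = simple a (S n).
  have -> : S n = 1%:M.
    apply/matrixP => i j; rewrite /S summxE [RHS]mxE (bigD1 i) //= big1 ?addr0 ?mxE ?eqxx 1?eq_sym //.
    by move=> l /andP[_ li]; rewrite mxE [i == l]eq_sym (negbTE li).
  rewrite /simple /simN cpxZ cpx1 scale_scalar_mx mulr1 -raddfD /= polyCB.
  by rewrite addrA subrK.
exact: gS.
Qed.
End SimpleElements.
Section Generation.
Variables (R : realType) (n : nat).
Notation C := R[i].
Notation P := {poly C}.
Implicit Types (a : C) (N : 'M[P]_n) (d : P).

Lemma unitary_frac_scale (x : P) N d : x != 0 ->
  unitary_frac (x *: N) (x * d) -> unitary_frac N d.
Proof.
move=> x0 [h1 h2 h3]; have d0 : d != 0 by apply: contraNneq h1 => ->; rewrite mulr0.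
split => //.
  move: h2; rewrite padjZ -scalemxAl -scalemxAr scalerA pcM.
  have -> : pc x * pc d * (x * d) = (pc x * x) * (pc d * d) by ring.
  rewrite -scale_scalar_mx => /matrixP h; apply/matrixP => i j.
  have := h i j; rewrite [LHS]mxE [RHS]mxE => /mulfI; apply.
  by rewrite mulf_neq0 // pc_eq0.
move=> i j; have := h3 i j.
have -> : (x *: N) i j - ((x * d)%:M : 'M[P]_n) i j = x * (N i j - (d%:M : 'M[P]_n) i j).
  by rewrite !mxE mulrBr mulrnAr.
have [->|y0] := eqVneq (N i j - (d%:M : 'M[P]_n) i j) 0.
  by rewrite size_poly0 size_poly_gt0.
rewrite (size_mul x0 y0) (size_mul x0 d0).
have : (0 < size x)%N by rewrite size_poly_gt0.
by case: (size x) => // k _; rewrite !addSn /= ltn_add2l.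
Qed.

Lemma ratof_scale (x : P) N d : x != 0 -> d != 0 -> ratof (x *: N) (x * d) = ratof N d.
Proof.
by move=> x0 d0; apply/ratof_eqP; rewrite ?mulf_neq0 // scalerA mulrC.
Qed.

(** [(X - a) / (X - conjc a)] is unimodular on the real axis, so it can be
    used to reflect a pole. *)
Lemma unitary_flip a N d : unitary_frac N (('X - a%:P) * d) ->
  unitary_frac N (('X - (conjc a)%:P) * d).
Proof.
move=> [h1 h2 h3]; have d0 : d != 0 by apply: contraNneq h1 => ->; rewrite mulr0.
have xa0 b : 'X - b%:P != 0 :> P by rewrite polyXsubC_eq0.
have sz b : size (('X - b%:P) * d) = (size d).+1.
  by rewrite (size_mul (xa0 b) d0) size_XsubC.
split; first by rewrite mulf_neq0.
  by rewrite h2 !pcM !pc_XsubC conjcK; congr (_%:M); ring.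
move=> i j; rewrite sz.
have -> : N i j - ((('X - (conjc a)%:P) * d)%:M : 'M[P]_n) i j =
  (N i j - ((('X - a%:P) * d)%:M : 'M[P]_n) i j) + (((conjc a - a) *: d)%:M : 'M[P]_n) i j.
  rewrite !mxE; case: (i == j); rewrite ?mulr1n ?mulr0n ?addr0 // -mul_polyC polyCB; ring.
apply: leq_ltn_trans (size_polyD _ _) _; rewrite gtn_max; apply/andP; split.
  by have := h3 i j; rewrite sz.
rewrite mxE ltnS; case: (i == j); rewrite ?mulr1n ?mulr0n ?size_poly0 //.
exact: size_scale_leq.
Qed.

Lemma simple_unitary a (p : 'M[C]_n) : rk1 p -> unitary_frac (simN a p) ('X - (conjc a)%:P).
Proof.
move=> hp; have [pa _ _] := hp; split; first by rewrite polyXsubC_eq0.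
  have -> : padj (simN a p) = simN (conjc a) p.
    have ep : padj (cpx p) = cpx p.
      by apply/matrixP => i j; rewrite padjE /cpx !mxE /pc map_polyC /= -[in RHS]pa !mxE.
    have pcC (c : C) : pc c%:P = (conjc c)%:P by rewrite /pc map_polyC.
    have ec : conjc (conjc a - a) = a - conjc a by rewrite rmorphB /= conjcK.
    by rewrite /simN !cpxZ padjD padj_scalar padjZ pc_XsubC ep pcC ec !conjcK.
  have := simple_inv (conjc a) hp; rewrite /simple conjcK ratofM.
  have z0 : ('X - a%:P) * ('X - (conjc a)%:P) != 0 :> P by rewrite mulf_neq0 ?polyXsubC_eq0.
  rewrite -(ratof1 n z0) => /(ratof_eqP _ _ z0 z0) h.
  rewrite pc_XsubC conjcK; apply/matrixP => i j; have /matrixP/(_ i j) := h.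
  by rewrite [LHS]mxE [RHS]mxE => /(mulfI z0).
move=> i j; rewrite size_XsubC [simN _ _ _ _]mxE addrAC subrr add0r mxE size_polyC.
by case: (_ != 0).
Qed.

Lemma Gminus_simple a (p : 'M[C]_n) : rk1 p -> @Gminus R n (simple a p).
Proof. by move=> hp; apply: unitary_Gminus; apply: simple_unitary. Qed.

(** The matrix determinant lemma; the extra factor [x] clears the denominator.
    *)
Lemma det_rank_one (A : idomainType) (m : nat) (x : A) (u : 'cV[A]_m) (w : 'rV[A]_m) :
  x != 0 -> x * \det (x%:M + u *m w) = (x + (w *m u) 0 0) * x ^+ m.
Proof.
move=> x0.
pose M : 'M[A]_(1 + m) := block_mx 1%:M w (- u) x%:M.
have e1 : \det M = \det (x%:M + u *m w).
  have -> : M = block_mx 1%:M 0 (- u) 1%:M *m block_mx 1%:M w 0 (x%:M + u *m w).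
    by rewrite mulmx_block !mulmx1 !mul1mx !mul0mx !addr0 mulNmx addrCA addNr addr0.
  by rewrite det_mulmx det_lblock det_ublock !det1 !mul1r.
have e2 : \det M * x = (x + (w *m u) 0 0) * x ^+ m.
  have : M *m block_mx x%:M 0 u 1%:M = block_mx (x%:M + w *m u) w 0 x%:M.
    rewrite /M mulmx_block !mulmx1 !mul1mx !mulmx0 !add0r mulNmx mul_scalar_mx.
    by rewrite mul_mx_scalar addNr.
  move/(congr1 (fun M => \det M)); rewrite det_mulmx det_lblock det_ublock det1 mulr1.
  rewrite det_scalar1 => ->.
  by rewrite det_scalar [x%:M + _]mx11_scalar det_scalar1 !mxE mulr1n.
by rewrite -e1 mulrC e2.
Qed.

(** Each zero of [\det N] in the lower half plane is removed by splitting off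
    the simple element of a vector in the kernel there. Once no such zero is
    left, [pc d] is coprime to [\det N] and therefore divides [padj N], which
    forces [N = d]. *)
Lemma gen_upper (m : nat) N (s r : seq C) (k : C) :
  (forall t, t \in s -> 0 < complex.Im t) ->
  k != 0 -> \det N = k *: \prod_(z <- r) ('X - z%:P) ->
  (count (fun z : C => (complex.Im z < 0)%R) r <= m)%N ->
  unitary_frac N (\prod_(z <- s) ('X - z%:P)) ->
  gen (ratof N (\prod_(z <- s) ('X - z%:P))).
Proof.
move=> hs; elim: m N r => [|m IH] N r k0 hdet hc hN; set d := \prod_(z <- s) _ in hN *.
  have hr z : z \in r -> 0 <= complex.Im z.
    move=> zr; rewrite leNgt; apply/negP => z0.
    have : (0 < count (fun z : C => (complex.Im z < 0)%R) r)%N by rewrite -has_count; apply/hasP; exists z.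
    by move: hc; rewrite leqn0 => /eqP->.
  have cop : coprimep (\det N) (pc d).
    have -> : pc d = \prod_(z <- s) ('X - (conjc z)%:P).
      by rewrite /d /pc rmorph_prod; apply: eq_bigr => z _; apply: pc_XsubC.
    rewrite hdet coprimepZl //.
    elim: (s) hs => [_|t s' IHs hs']; first by rewrite big_nil coprimep1.
    rewrite big_cons coprimepMr IHs; last by move=> z zs; apply: hs'; rewrite inE zs orbT.
    rewrite andbT coprimep_XsubC root_prod_XsubC; apply/negP => /hr.
    have := hs' t (mem_head _ _); case: t {hs'} => tr ti /= h; rewrite oppr_ge0.
    by rewrite leNgt h.
  have [d0 hU hi] := hN; have pd0 : pc d != 0 by rewrite pc_eq0.
  have [_ _ hip] := unitary_padj hN.
  have e1 : padj N = (pc d)%:M.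
    apply/matrixP => i j.
    have : \det N *: padj N = pc d *: (d *: \adj N).
      rewrite (_ : pc d *: _ = (pc d * d)%:M *m \adj N); last by rewrite mul_scalar_mx scalerA.
      by rewrite -hU -mulmxA mul_mx_adj scalar_mxC mul_scalar_mx.
    move=> /matrixP/(_ i j) h0.
    have e : \det N * padj N i j = pc d * (d *: \adj N) i j.
      by move: h0; rewrite [LHS]mxE [RHS]mxE.
    have : pc d %| \det N * padj N i j by rewrite e dvdp_mulr.
    rewrite Gauss_dvdpr; last by rewrite coprimep_sym.
    move=> /dvdpP[W eW].
    have eij : padj N i j - ((pc d)%:M : 'M[P]_n) i j = (W - (i == j)%:R) * pc d.
      by rewrite eW mxE mulrBl; case: (i == j); rewrite ?mul1r ?mul0r.
    have [w0|W0] := eqVneq (W - (i == j)%:R) 0.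
      by apply/eqP; rewrite -subr_eq0 eij w0 mul0r.
    have := hip i j; rewrite eij (size_mul W0 pd0) => hh; exfalso; move: hh.
    have : (0 < size (W - (i == j)%:R)%R)%N by rewrite size_poly_gt0.
    by case: (size (W - (i == j)%:R)%R) => // l _; rewrite addSn /= ltnNge leq_addl.
  have -> : N = d%:M by rewrite -(padjK N) e1 padj_scalar pcK.
  by rewrite ratof1 //; apply: gen1.
have [hc'|hc'] := leqP (count (fun z : C => (complex.Im z < 0)%R) r) m; first exact: IH hdet hc' hN.
have : has (fun z : C => (complex.Im z < 0)%R) r by rewrite has_count (leq_trans _ hc').
case/hasP => b br b0.
have [d0 hU hi] := hN.
have : \det (evm N b)^T = 0.
  have -> : \det (evm N b)^T = (\det N).[b] by rewrite det_tr /evm det_map_mx.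
  rewrite hdet hornerZ.
  have /rootP -> : root (\prod_(z <- r) ('X - z%:P)) b by rewrite root_prod_XsubC.
  by rewrite mulr0.
move/eqP/det0P => [v' v'0 hv'].
pose v := v'^T.
have hv : evm N b *m v = 0 by rewrite -[LHS]trmxK trmx_mul /v trmxK hv' trmx0.
have v0 : v != 0 by apply: contraNneq v'0 => h; rewrite -[v']trmxK -/v h trmx0.
have [w [hp wv]] := rk1_vec v0; pose p := v *m w.
have hNp : forall i j, exists q, (N *m cpx p) i j = q * ('X - b%:P).
  move=> i j; apply/factor_theorem; rewrite /root -evmE evmM.
  have -> : evm (cpx p) b = p.
    by apply/matrixP => k1 k2; rewrite evmE mxE hornerC.
  by rewrite mulmxA hv mul0mx mxE.
have /choice[Q hQ] : forall ij : 'I_n * 'I_n, exists q, (N *m cpx p) ij.1 ij.2 = q * ('X - b%:P).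
  by move=> [i j]; apply: hNp.
pose N' : 'M[P]_n := \matrix_(i, j) Q (i, j).
have eN' : N *m cpx p = ('X - b%:P) *: N'.
  by apply/matrixP => i j; rewrite (hQ (i, j)) [RHS]mxE mulrC mxE.
pose N1 := N + (b - conjc b)%:P *: N'.
have xb0 c : 'X - c%:P != 0 :> P by rewrite polyXsubC_eq0.
have eN1 : ('X - b%:P) *: N1 = N *m simN (conjc b) p.
  rewrite /simN conjcK mulmxDr mul_mx_scalar cpxZ -scalemxAr eN' scalerDr.
  by rewrite !scalerA [('X - b%:P) * _]mulrC.
have uN1 : unitary_frac N1 d.
  apply: (unitary_frac_scale (xb0 b)); rewrite eN1 mulrC.
  have := unitary_fracM hN (simple_unitary (conjc b) hp).
  by rewrite conjcK.
have eg : ratof N d = ratof N1 d *m simple b p.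
  rewrite -(ratof_scale N1 (xb0 b) d0) eN1 mulrC.
  have -> : ratof (N *m simN (conjc b) p) (d * ('X - b%:P)) = ratof N d *m simple (conjc b) p.
    by rewrite /simple conjcK ratofM.
  rewrite -mulmxA; have := simple_inv (conjc b) hp; rewrite conjcK => ->.
  by rewrite mulmx1.
rewrite eg; apply: genM; last by apply: genS => //; rewrite lt_eqF.
apply: (IH N1 (conjc b :: rem b r)) => //.
  apply: (mulIf (xb0 b)); apply: (mulIf (expf_neq0 n (xb0 b))).
  have e1 : \det N1 * ('X - b%:P) ^+ n = \det N * \det (simN (conjc b) p).
    by rewrite -det_mulmx -eN1 detZ mulrC.
  have e2 : ('X - b%:P) * \det (simN (conjc b) p) = ('X - (conjc b)%:P) * ('X - b%:P) ^+ n.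
    have -> : simN (conjc b) p = ('X - b%:P)%:M +
        map_mx (@polyC C) v *m map_mx (@polyC C) ((b - conjc b) *: w).
      by rewrite /simN conjcK -map_mxM -scalemxAr.
    have hw : (map_mx (@polyC C) ((b - conjc b) *: w) *m map_mx (@polyC C) v) 0 0 =
        b%:P - (conjc b)%:P.
      by rewrite -map_mxM mxE -scalemxAl mxE wv mulr1 -polyCB.
    rewrite det_rank_one // hw.
    by congr (_ * _); rewrite addrA subrK.
  have -> : \det N1 * ('X - b%:P) * ('X - b%:P) ^+ n =
      \det N * (('X - b%:P) * \det (simN (conjc b) p)).
    by rewrite mulrAC e1 mulrCA mulrA mulrC mulrA.
  rewrite e2 hdet (perm_big _ (perm_to_rem br)).
  by rewrite !big_cons -!mul_polyC /=; ring.
move: hc; rewrite (permP (perm_to_rem br)) /= b0 add1n ltnS.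
rewrite (_ : complex.Im (conjc b) < 0 = false) //.
by case: (b) b0 => br' bi /= h; rewrite oppr_lt0 ltNge (ltW h).
Qed.
End Generation.
Section GenerationEnd.
Variables (R : realType) (n : nat).
Notation C := R[i].
Notation P := {poly C}.
Implicit Types (a : C) (N : 'M[P]_n) (d : P).

Lemma unitary_det N d : unitary_frac N d -> \det N != 0.
Proof.
move=> [d0 hU _]; apply/eqP => h.
have := congr1 (fun M => \det M) hU; rewrite det_mulmx h mulr0 det_scalar => /esym/eqP.
by rewrite expf_eq0 mulf_eq0 pc_eq0 (negbTE d0) andbF.
Qed.

(** Poles in the lower half plane are reflected one at a time by scalar
    factors, which are themselves products of simple elements. *)
Lemma gen_nonreal N (s1 s2 : seq C) :
  (forall t, t \in s1 -> 0 < complex.Im t) -> (forall t, t \in s2 -> complex.Im t != 0) ->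
  unitary_frac N (\prod_(z <- s1 ++ s2) ('X - z%:P)) ->
  gen (ratof N (\prod_(z <- s1 ++ s2) ('X - z%:P))).
Proof.
elim: s2 s1 => [|t s2 IH] s1 h1 h2.
  rewrite cats0 => hN.
  have [r hr] := closed_field_poly_normal (\det N).
  apply: (@gen_upper _ _ (count (fun z : C => (complex.Im z < 0)%R) r) N s1 r (lead_coef (\det N))) => //.
  by rewrite lead_coef_eq0 (unitary_det hN).
have h2' u : u \in s2 -> complex.Im u != 0 by move=> us; apply: h2; rewrite inE us orbT.
have t0 := h2 t (mem_head _ _).
have eP (u : C) : \prod_(z <- s1 ++ u :: s2) ('X - z%:P) = ('X - u%:P) * \prod_(z <- s1 ++ s2) ('X - z%:P) :> P.
  by rewrite !big_cat big_cons /= mulrCA.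
have eP' (u : C) : \prod_(z <- (u :: s1) ++ s2) ('X - z%:P) = ('X - u%:P) * \prod_(z <- s1 ++ s2) ('X - z%:P) :> P.
  by rewrite cat_cons big_cons.
rewrite eP => hN.
have [tp|tn] := ltP 0 (complex.Im t).
  rewrite -eP' in hN *; apply: IH => // u; rewrite inE => /orP[/eqP->//|]; exact: h1.
have tn' : 0 < complex.Im (conjc t).
  by move: t0 tn; case: (t) => tr ti /=; rewrite oppr_gt0 lt_neqAle => -> ->.
have hN' := unitary_flip hN; rewrite -eP' in hN'.
have g1 : gen (ratof N (\prod_(z <- (conjc t :: s1) ++ s2) ('X - z%:P))).
  by apply: IH => // u; rewrite inE => /orP[/eqP->//|]; exact: h1.
have g2 : gen (ratof ('X - (conjc t)%:P)%:M ('X - t%:P) : ratmx R n).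
  have := @gen_scalar R n (conjc t); rewrite conjcK; apply.
  by rewrite gt_eqF.
set D := \prod_(z <- s1 ++ s2) _ in eP eP' hN *.
have D0 : D != 0 by case: hN; rewrite mulf_eq0 negb_or => /andP[].
have -> : ratof N (('X - t%:P) * D) = ratof ('X - (conjc t)%:P)%:M ('X - t%:P) *m
   ratof N (\prod_(z <- (conjc t :: s1) ++ s2) ('X - z%:P)).
  rewrite ratofM eP' mul_scalar_mx mulrCA ratof_scale ?polyXsubC_eq0 //.
  by rewrite mulf_neq0 ?polyXsubC_eq0.
exact: genM.
Qed.

(** A unitary matrix is bounded, so it has no real pole. *)
Lemma unitary_real_root N d a : complex.Im a = 0 -> root d a ->
  unitary_frac N d -> exists N', N = ('X - a%:P) *: N'.
Proof.
move=> a0 /rootP da [d0 hU _].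
have ea : conjc a = a by case: (a) a0 => ar ai /= ->; rewrite oppr0.
have e0 : adjmx (evm N a) *m evm N a = 0.
  rewrite -{1}ea -evm_padj -evmM hU evm_scalar hornerM da mulr0.
  by rewrite -scalemx1 scale0r.
have eN : evm N a = 0.
  have : sqn (adjmx (evm N a)) = 0.
    by apply/complexI; rewrite -tr_MadjM adjK e0 mxtrace0.
  move=> h; have := nm_sqn (adjmx (evm N a)); rewrite h sqrtr0 mulr0 nm_adj.
  exact: nm_eq0.
have /choice[Q hQ] : forall ij : 'I_n * 'I_n, exists q, N ij.1 ij.2 = q * ('X - a%:P).
  by move=> [i j]; apply/factor_theorem; rewrite /root -evmE eN mxE.
exists (\matrix_(i, j) Q (i, j)); apply/matrixP => i j.
by rewrite (hQ (i, j)) [RHS]mxE mxE mulrC.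
Qed.

Lemma unitary_gen (m : nat) N d : (size d <= m)%N -> unitary_frac N d -> gen (ratof N d).
Proof.
elim: m N d => [|m IH] N d hm hN; have [d0 hU hi] := hN.
  by move: hm; rewrite leqn0 size_poly_eq0 (negbTE d0).
have [s hs] := closed_field_poly_normal d.
have l0 : lead_coef d != 0 by rewrite lead_coef_eq0.
have [/hasP[a as_ /eqP a0]|hreal] := boolP (has (fun z : C => complex.Im z == 0) s).
  have ra : root d a by rewrite hs rootZ // root_prod_XsubC.
  have [N' eN'] := unitary_real_root a0 ra hN.
  have /factor_theorem[d' ed'] := ra.
  have x0 : 'X - a%:P != 0 :> P by rewrite polyXsubC_eq0.
  have d'0 : d' != 0 by apply: contraNneq d0 => h; rewrite ed' h mul0r.
  rewrite ed' mulrC eN' ratof_scale //; apply: IH.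
    by rewrite -ltnS (leq_trans _ hm) // ed' size_Mmonic ?monicXsubC // size_XsubC addn2.
  by apply: (unitary_frac_scale x0); rewrite -eN' mulrC -ed'.
pose d' : P := \prod_(z <- s) ('X - z%:P).
have k0 : (lead_coef d)%:P != 0 by rewrite polyC_eq0.
pose N' := ((lead_coef d)^-1)%:P *: N.
have eN' : (lead_coef d)%:P *: N' = N by rewrite scalerA -polyCM divff // scale1r.
have ed' : (lead_coef d)%:P * d' = d by rewrite mul_polyC -hs.
have d'0 : d' != 0 by apply: contraNneq d0 => h; rewrite -ed' h mulr0.
rewrite -ed' -eN' ratof_scale //; apply: (@gen_nonreal N' [::] s) => //.
  by move=> t ts; apply: contraNneq hreal => t0; apply/hasP; exists t => //; apply/eqP.
by rewrite cat0s -/d'; apply: (unitary_frac_scale k0); rewrite eN' ed'.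
Qed.

Theorem Gminus_gen (g : ratmx R n) : @Gminus R n g -> gen g.
Proof. by move=> /Gminus_unitary[N [d [h ->]]]; apply: unitary_gen h. Qed.

Lemma gen_Gminus (g : ratmx R n) : gen g -> @Gminus R n g.
Proof.
elim=> [|a p _ hp|g1 g2 _ h1 _ h2]; first exact: Gminus1.
  exact: Gminus_simple.
exact: GminusM.
Qed.
End GenerationEnd.
(** * Smooth functions of two variables *)

Section Smooth.
Variables (R : realType) (n : nat).
Notation C := R[i].
Implicit Types f g : R -> R -> 'M[C]_n.

Definition rect_ball (d : R) (p q : R * R) := `|q.1 - p.1| < d /\ `|q.2 - p.2| < d.
Lemma rect_ball_mono d d' p q : d <= d' -> rect_ball d p q -> rect_ball d' p q.
Proof. by move=> dd' [h1 h2]; split; apply: lt_le_trans dd'. Qed.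

Lemma rect_near (p : R * R) (d : R) (P : set (R * R)) : 0 < d ->
  (forall q, rect_ball d p q -> P q) -> nbhs p P.
Proof.
move=> d0 h; exists (ball p.1 d, ball p.2 d) => /=.
  by split; apply: nbhsx_ballx.
by move=> q [/= q1 q2]; apply: h; split; rewrite distrC.
Qed.
Lemma near_rect (p : R * R) (P : set (R * R)) : nbhs p P ->
  exists2 d : R, 0 < d & forall q, rect_ball d p q -> P q.
Proof.
case=> [[A B] /= [[d1 d10 h1] [d2 d20 h2]] h].
exists (Num.min d1 d2); first by rewrite lt_min [0 < d1]d10 [0 < d2]d20.
move=> q [q1 q2]; move: q1 q2; rewrite !lt_min => /andP[q1 _] /andP[_ q2].
by apply: h; split; [apply: h1|apply: h2]; rewrite /ball_ /= distrC.
Qed.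

Definition jc f := @gcont R n (R * R)%type rect_ball (fun p => f p.1 p.2).

Lemma jcP f : jc f <-> jointly_continuous f.
Proof.
split=> [h i j|h].
  split=> p; apply/cvgrPdist_le => e e0; have [d d0 hd] := h p e e0.
    apply: (rect_near d0) => q /hd.
    rewrite /=; apply: le_trans; rewrite distrC -raddfB; apply: le_trans (cn_re _) _.
    by have := cn_nm (f q.1 q.2 - f p.1 p.2) i j; rewrite !mxE.
  apply: (rect_near d0) => q /hd.
  apply: le_trans; rewrite distrC -raddfB; apply: le_trans (cn_im _) _.
  by have := cn_nm (f q.1 q.2 - f p.1 p.2) i j; rewrite !mxE.
move=> p e e0.
pose e' := e / (Kn R n + 1).
have K0 : 0 < Kn R n + 1 by rewrite ltr_wpDl ?Kn_ge0.
have e'0 : 0 < e' by rewrite divr_gt0.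
pose P (i j : 'I_n) (q : R * R) :=
    `|complex.Re (f p.1 p.2 i j) - complex.Re (f q.1 q.2 i j)| <= e' /\
    `|complex.Im (f p.1 p.2 i j) - complex.Im (f q.1 q.2 i j)| <= e'.
have : \forall q \near p, forall i j, P i j q.
  apply: (@filter_forall (R * R)%type 'I_n (fun i q => forall j, P i j q) (nbhs p) _) => i.
  apply: (@filter_forall (R * R)%type 'I_n (fun j q => P i j q) (nbhs p) _) => j.
  have [h1 h2] := h i j.
  near=> q; split; near: q.
    by have /cvgrPdist_le := h1 p; apply.
  by have /cvgrPdist_le := h2 p; apply.
move=> /near_rect[d d0 hd]; exists d => // q hq.
have hij i j : cn ((f q.1 q.2 - f p.1 p.2) i j) <= 2 * e'.
  have [] := hd q hq i j.
  rewrite !mxE => h1 h2; apply: le_trans (cn_le _) _; rewrite !raddfB /=.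
  by rewrite mulr_natl mulr2n lerD // distrC.
apply: le_trans (nm_le hij) _.
have -> : (n * n)%:R * (2 * e') = Kn R n * e' by rewrite /Kn mulrA.
by rewrite /e' mulrCA ger_pMr // ler_pdivrMr // mul1r lerDl.
Unshelve. all: by end_near. Qed.

Lemma jc_bound f (X T : R) : jc f -> exists2 c, 0 <= c &
  forall x t, `|x| <= X -> `|t| <= T -> nm (f x t) <= c.
Proof.
move=> h.
pose g (p : R * R) : R := nm (f p.1 p.2).
have cg : continuous g.
  move=> p; apply/cvgrPdist_le => e e0; have [d d0 hd] := h p e e0.
  apply: (rect_near d0) => q /hd.
  apply: le_trans; rewrite ler_norml; apply/andP; split; first rewrite lerNl opprB; rewrite lerBlDr.
    by have := nmD (f q.1 q.2 - f p.1 p.2) (f p.1 p.2); rewrite subrK.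
  by have := nmD (f p.1 p.2 - f q.1 q.2) (f q.1 q.2); rewrite subrK -(nmN (f p.1 p.2 - f q.1 q.2)) opprB.
have ck : compact (`[- X, X]%classic `*` `[- T, T]%classic).
  by apply: compact_setX; apply: segment_compact.
have /compact_bounded [M [_ hM]] : compact (g @` (`[- X, X]%classic `*` `[- T, T]%classic)).
  by apply: continuous_compact ck; apply: continuous_subspaceT.
exists (`|M| + 1); first by rewrite addr_ge0.
move=> x t xX tT.
have M1 : M < `|M| + 1 by apply: le_lt_trans (ler_norm _) _; rewrite ltrDl.
have hg : (g @` (`[- X, X]%classic `*` `[- T, T]%classic)) (g (x, t)).
  by exists (x, t) => //; split; rewrite /= in_itv /= -ler_norml.
by have := hM _ M1 _ hg; rewrite /= ger0_norm // nm_ge0.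
Qed.

Lemma is_derive_shift (F : R -> R) (x0 x d : R) :
  is_derive (x0 + x) 1 F d -> is_derive x 1 (fun y => F (x0 + y)) d.
Proof.
move=> h; have h1 : is_derive x 1 (fun y : R => x0 + y) 1.
  apply: is_derive_ext (is_derive_eq (is_deriveD (is_derive_cst x0 x 1) (is_derive_id x 1)) (add0r 1)) => y.
  by rewrite fctE.
have := @is_derive1_comp _ F (fun y : R => x0 + y) x d 1 h h1.
by rewrite mulr1.
Qed.
Lemma hd_shift (F : R -> 'M[C]_n) (x0 x : R) D :
  has_deriv F (x0 + x) D -> has_deriv (fun y => F (x0 + y)) x D.
Proof. by move=> h i j; have [h1 h2] := h i j; split; apply: is_derive_shift. Qed.

Lemma hd_mv_at (F dF : R -> 'M[C]_n) (x0 X c : R) :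
  (forall x, `|x - x0| <= X -> has_deriv F x (dF x)) ->
  (forall x, `|x - x0| <= X -> nm (dF x) <= c) ->
  forall x, `|x - x0| <= X -> nm (F x - F x0) <= Kn R n * (c * `|x - x0|).
Proof.
move=> h1 h2 x hx.
have := @hd_mv R n (fun y => F (x0 + y)) (fun y => dF (x0 + y)) X c _ _ (x - x0) hx.
rewrite [x0 + (x - x0)]addrC subrK addr0; apply.
  by move=> y yX; apply: hd_shift; apply: h1; rewrite addrC addKr.
by move=> y yX; apply: h2; rewrite addrC addKr.
Qed.

(** Along a path first in [t] and then in [x], the second step is controlled
    by the mean value inequality. *)
Lemma jc_of_partials f fx ft : (forall x t, has_deriv (fun y => f y t) x (fx x t)) ->
  (forall x t, has_deriv (f x) t (ft x t)) ->
  (forall x0 t0, exists2 d : R, 0 < d & exists c, forall x t,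
     `|x - x0| < d -> `|t - t0| < d -> nm (fx x t) <= c) -> jc f.
Proof.
move=> hx ht hb [x0 t0] e e0 /=.
have [d d0 [c hc]] := hb x0 t0.
have e2 : 0 < e / 2 by rewrite divr_gt0.
have [d1 d10 hd1] := @hd_mcont R n (f x0) _ (fun t => ht x0 t) t0 _ e2.
pose K := Kn R n * (`|c| + 1) + 1.
have K0 : 0 < K by rewrite ltr_wpDl // mulr_ge0 ?Kn_ge0 // addr_ge0.
exists (Num.min (Num.min (d / 2) d1) (e / 2 / K)).
  by rewrite !lt_min d10 !divr_gt0.
move=> [x t] [/=]; rewrite !lt_min => /andP[/andP[xd _] xe] /andP[/andP[td td1] _].
have dd : d / 2 < d by rewrite ltr_pdivrMr // mulr_natr mulr2n ltrDl.
have -> : f x t - f x0 t0 = (f x t - f x0 t) + (f x0 t - f x0 t0) by rewrite addrA subrK.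
apply: le_trans (nmD _ _) _; rewrite [e](splitr e); apply: lerD; last exact: hd1.
have := @hd_mv_at (fun y => f y t) (fun y => fx y t) x0 (d / 2) (`|c| + 1) (fun y _ => hx y t) _ x (ltW xd).
move=> h; apply: le_trans (h _) _.
  move=> y yd; apply: le_trans (hc y t _ _) _; rewrite ?(le_lt_trans yd) ?(lt_trans td) //.
  by apply: le_trans (ler_norm _) _; rewrite lerDl.
move: xe; rewrite ltr_pdivlMr // => /ltW; apply: le_trans.
by rewrite mulrA mulrC ler_wpM2l // lerDl.
Qed.

Lemma Ck_jc k f : Ck k f -> jc f.
Proof.
elim: k f => [|k IH] f; first by move=> /jcP.
move=> [fx [ft [hx ht /IH cx _]]]; apply: (jc_of_partials hx ht) => x0 t0.
have [d d0 hd] := cx (x0, t0) _ ltr01; exists d => //.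
exists (1 + nm (fx x0 t0)) => x t h1 h2.
have := hd (x, t) (conj h1 h2) => /= h3.
by have := nmD (fx x t - fx x0 t0) (fx x0 t0); rewrite subrK => h4; apply: le_trans h4 _; rewrite lerD2r.
Qed.

Lemma CkS k f : Ck k.+1 f -> Ck k f.
Proof.
elim: k f => [|k IH] f; first by move=> /Ck_jc /jcP.
by move=> [fx [ft [hx ht cx ct]]]; exists fx, ft; split => //; apply: IH.
Qed.

Lemma Ck_cst k c : Ck k (fun _ _ => c : 'M[C]_n).
Proof.
elim: k c => [|k IH] c; first by apply/jcP; apply: (gcont_cst (T := (R * R)%type)).
exists (fun _ _ => 0), (fun _ _ => 0).
by split => // *; apply: hd_cst.
Qed.
Lemma CkD k f g : Ck k f -> Ck k g -> Ck k (fun x t => f x t + g x t).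
Proof.
elim: k f g => [|k IH] f g; first by move=> /jcP h1 /jcP h2; apply/jcP; apply: gcontD rect_ball_mono _ _ h1 h2.
move=> [fx [ft [hx ht cx ct]]] [gx [gt [kx kt dx dt]]].
exists (fun x t => fx x t + gx x t), (fun x t => ft x t + gt x t).
by split; do ?[move=> x t; apply: hd_add => //]; apply: IH.
Qed.
Lemma CkM k f g : Ck k f -> Ck k g -> Ck k (fun x t => f x t *m g x t).
Proof.
elim: k f g => [|k IH] f g; first by move=> /jcP h1 /jcP h2; apply/jcP; apply: gcontM rect_ball_mono _ _ h1 h2.
move=> hf hg; have hf' := CkS hf; have hg' := CkS hg.
move: hf hg => [fx [ft [hx ht cx ct]]] [gx [gt [kx kt dx dt]]].
exists (fun x t => fx x t *m g x t + f x t *m gx x t),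
       (fun x t => ft x t *m g x t + f x t *m gt x t).
by split; do ?[move=> x t; apply: hd_mul => //]; apply: CkD; apply: IH.
Qed.

Definition had (w M : 'M[C]_n) : 'M[C]_n := \matrix_(i, j) (w i j * M i j).
Lemma hd_had w (F : R -> 'M[C]_n) x D : has_deriv F x D ->
  has_deriv (fun y => had w (F y)) x (had w D).
Proof.
move=> h i j; rewrite mxE.
have := hdc_mul (hdc_cst (w i j) x) (h i j); rewrite mul0r add0r.
by apply: hdc_ext => y; rewrite mxE.
Qed.
Lemma nm_had w M : nm (had w M) <= nm w * nm M.
Proof.
rewrite /nm mulr_suml; apply: ler_sum => i _; rewrite mulr_suml; apply: ler_sum => j _.
by rewrite mxE cnM ler_wpM2l ?cn_ge0 // cn_nm.
Qed.
Lemma hadB w M N : had w (M - N) = had w M - had w N.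
Proof. by apply/matrixP => i j; rewrite !mxE mulrBr. Qed.
Lemma Ck_had k w f : Ck k f -> Ck k (fun x t => had w (f x t)).
Proof.
elim: k f => [|k IH] f.
  move=> /jcP h; apply/jcP => p e e0.
  have w0 : 0 < nm w + 1 by rewrite ltr_wpDl ?nm_ge0.
  have [d d0 hd] := h p (e / (nm w + 1)) (divr_gt0 e0 w0).
  exists d => // q /hd; rewrite ler_pdivlMr // => hq.
  rewrite -hadB; apply: le_trans (nm_had _ _) _; apply: le_trans hq.
  by rewrite mulrC ler_wpM2l ?nm_ge0 // lerDl.
move=> [fx [ft [hx ht cx ct]]].
exists (fun x t => had w (fx x t)), (fun x t => had w (ft x t)).
by split; do ?[move=> x t; apply: hd_had => //]; apply: IH.
Qed.

Lemma smooth_cst c : smooth (fun _ _ => c : 'M[C]_n).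
Proof. by move=> k; apply: Ck_cst. Qed.
Lemma smoothD f g : smooth f -> smooth g -> smooth (fun x t => f x t + g x t).
Proof. by move=> h1 h2 k; apply: CkD. Qed.
Lemma smoothM f g : smooth f -> smooth g -> smooth (fun x t => f x t *m g x t).
Proof. by move=> h1 h2 k; apply: CkM. Qed.
Lemma smoothZ c f : smooth f -> smooth (fun x t => c *: f x t).
Proof.
move=> h; have := smoothM (smooth_cst c%:M) h.
by congr smooth; apply/funext => x; apply/funext => t; rewrite mul_scalar_mx.
Qed.
Lemma smoothN f : smooth f -> smooth (fun x t => - f x t).
Proof.
move=> /(smoothZ (-1)).
by congr smooth; apply/funext => x; apply/funext => t; rewrite scaleN1r.
Qed.
Lemma smoothB f g : smooth f -> smooth g -> smooth (fun x t => f x t - g x t).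
Proof. by move=> h1 h2; apply: smoothD => //; apply: smoothN. Qed.
Lemma smooth_had w f : smooth f -> smooth (fun x t => had w (f x t)).
Proof. by move=> h k; apply: Ck_had. Qed.
Lemma smooth_sum I (r : seq I) (P : pred I) (F : I -> R -> R -> 'M[C]_n) :
  (forall i, P i -> smooth (F i)) -> smooth (fun x t => \sum_(i <- r | P i) F i x t).
Proof.
move=> h; elim: r => [|i r IH].
  have := smooth_cst 0; congr smooth; apply/funext => x; apply/funext => t.
  by rewrite big_nil.
have [Pi|Pi] := boolP (P i).
  have := smoothD (h i Pi) IH; congr smooth; apply/funext => x; apply/funext => t.
  by rewrite big_cons Pi.
move: IH; congr smooth; apply/funext => x; apply/funext => t.
by rewrite big_cons (negbTE Pi).
Qed.

(** Derivatives are unique, so the partial derivatives at all orders are the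
    same functions. *)
Lemma smooth_partials f : smooth f -> exists fx ft,
  [/\ forall x t, has_deriv (fun y => f y t) x (fx x t),
      forall x t, has_deriv (f x) t (ft x t), smooth fx & smooth ft].
Proof.
move=> h; have [fx [ft [hx ht _ _]]] := h 1%N.
exists fx, ft; split => // k; have [gx [gt [kx kt cx ct]]] := h k.+1.
  suff -> : fx = gx by [].
  by apply/funext => x; apply/funext => t; apply: hd_unique (hx x t) (kx x t).
suff -> : ft = gt by [].
by apply/funext => x; apply/funext => t; apply: hd_unique (ht x t) (kt x t).
Qed.
Lemma smooth_jc f : smooth f -> jc f.
Proof. by move=> h; apply: (@Ck_jc 0); apply: h. Qed.

Definition dx f : R -> R -> 'M[C]_n := fun x t => \matrix_(i, j)
  ((fun y => complex.Re (f y t i j))^`()%classic x +i* (fun y => complex.Im (f y t i j))^`()%classic x).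
Lemma dxE f x t D : has_deriv (fun y => f y t) x D -> dx f x t = D.
Proof.
move=> h; apply/matrixP => i j; have [h1 h2] := h i j; rewrite mxE !derive1E.
apply/eqP; rewrite eq_complex /=; apply/andP; split; apply/eqP.
  exact: (@derive_val _ _ _ _ _ _ _ h1).
exact: (@derive_val _ _ _ _ _ _ _ h2).
Qed.
Lemma smooth_dx f : smooth f -> smooth (dx f) /\ forall x t, has_deriv (fun y => f y t) x (dx f x t).
Proof.
move=> h; have [fx [ft [hx _ sx _]]] := smooth_partials h.
have -> : dx f = fx by apply/funext => x; apply/funext => t; apply: dxE.
by [].
Qed.
End Smooth.
(** * Formal series and gauge transformations *)

Section Series.
Variables (R : realType) (n : nat).
Notation C := R[i].
Notation M := 'M[C]_n.
Implicit Types c d e : nat -> M.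

Definition conv c d : nat -> M := fun k => \sum_(i < k.+1) c i *m d (k - i)%N.
Definition const_ser (b : M) : nat -> M := fun k => if k is 0%N then b else 0.

Lemma convA c d e : conv c (conv d e) = conv (conv c d) e.
Proof.
apply/funext => k; rewrite /conv.
transitivity (\sum_(i < k.+1) \sum_(j < k.+1 | (i <= j)%N) c i *m d (j - i)%N *m e (k - j)%N).
  apply: eq_bigr => i _; rewrite mulmx_sumr.
  rewrite -(big_mkord xpredT (fun j => c i *m (d j *m e (k - i - j)%N))).
  rewrite -(big_mkord (fun j => (i <= j)%N) (fun j => c i *m d (j - i)%N *m e (k - j)%N)).
  have ik : (i <= k)%N by rewrite -ltnS.
  rewrite (@big_cat_nat _ _ _ i 0 k.+1) //=; last by rewrite leqW.
  rewrite [X in _ = X + _]big_nat_cond [X in _ = X + _]big_pred0 ?add0r; last first.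
    by move=> j; rewrite ltnNge; case: (i <= j)%N; rewrite ?andbF.
  have := big_addn 0 k.+1 i (fun j => (i <= j)%N) (fun j => c i *m d (j - i)%N *m e (k - j)%N).
  rewrite add0n => ->; rewrite subSn // big_nat_cond [RHS]big_nat_cond.
  apply: eq_big => j; first by rewrite leq_addl !andbT.
  by move=> _; rewrite addnK mulmxA subnDA subnAC.
rewrite (exchange_big_dep xpredT) //=; apply: eq_bigr => j _; rewrite mulmx_suml.
rewrite -(big_mkord (fun i => (i <= j)%N) (fun i => c i *m d (j - i)%N *m e (k - j)%N)).
rewrite -(big_mkord xpredT (fun i => c i *m d (j - i)%N *m e (k - j)%N)).
rewrite (big_nat_widen 0 j.+1 k.+1) //.
Qed.

Lemma conv_constl b c k : conv (const_ser b) c k = b *m c k.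
Proof.
rewrite /conv big_ord_recl /= subn0 big1 ?addr0 // => i _.
by rewrite mul0mx.
Qed.
Lemma conv_constr b c k : conv c (const_ser b) k = c k *m b.
Proof.
rewrite /conv big_ord_recr /= subnn big1 ?add0r // => i _.
by rewrite /const_ser; case E : (k - i)%N => [|m]; rewrite ?mulmx0 //; move: (ltn_ord i); rewrite -subn_gt0 E.
Qed.
Lemma conv1l c : conv (const_ser 1%:M) c = c.
Proof. by apply/funext => k; rewrite conv_constl mul1mx. Qed.
Lemma conv1r c : conv c (const_ser 1%:M) = c.
Proof. by apply/funext => k; rewrite conv_constr mulmx1. Qed.
Lemma convDl c d e : conv (c + d) e = conv c e + conv d e.
Proof. by apply/funext => k; rewrite /conv !fctE -big_split; apply: eq_bigr => i _; rewrite mulmxDl. Qed.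
Lemma convDr c d e : conv e (c + d) = conv e c + conv e d.
Proof. by apply/funext => k; rewrite /conv !fctE -big_split; apply: eq_bigr => i _; rewrite mulmxDr. Qed.
Lemma convNl c e : conv (- c) e = - conv c e.
Proof. by apply/funext => k; rewrite /conv !fctE -sumrN; apply: eq_bigr => i _; rewrite mulNmx. Qed.
Lemma convNr c e : conv e (- c) = - conv e c.
Proof. by apply/funext => k; rewrite /conv !fctE -sumrN; apply: eq_bigr => i _; rewrite mulmxN. Qed.
Lemma convBl c d e : conv (c - d) e = conv c e - conv d e.
Proof. by rewrite convDl convNl. Qed.
Lemma convBr c d e : conv e (c - d) = conv e c - conv e d.
Proof. by rewrite convDr convNr. Qed.

Definition adjs c : nat -> M := fun k => adjmx (c k).
Lemma adjs_conv c d : adjs (conv c d) = conv (adjs d) (adjs c).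
Proof.
apply/funext => k; rewrite /adjs /conv adj_sum (reindex_inj rev_ord_inj) /=.
by apply: eq_bigr => i _; rewrite adjM subSS subKn // -ltnS.
Qed.
Lemma adjs_const b : adjs (const_ser b) = const_ser (adjmx b).
Proof. by apply/funext => -[|k] //=; rewrite /adjs adj0. Qed.

(** Multiplication of a series in [1 / l] by [l], up to its leading
    coefficient. *)
Definition sh c : nat -> M := fun k => c k.+1.
Lemma sh_conv c d : c 0%N = 0 -> sh (conv c d) = conv (sh c) d.
Proof.
by move=> c0; apply/funext => k; rewrite /sh /conv big_ord_recl c0 mul0mx add0r.
Qed.
Lemma sh_convr c d : d 0%N = 0 -> sh (conv c d) = conv c (sh d).
Proof.
move=> d0; apply/funext => k; rewrite /sh /conv big_ord_recr /= subnn d0 mulmx0 addr0.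
by apply: eq_bigr => i _; rewrite subSn // -ltnS.
Qed.

Definition ad (a : M) c : nat -> M := conv c (const_ser a) - conv (const_ser a) c.
Lemma adE a c k : ad a c k = - lie a (c k).
Proof. by rewrite /ad !fctE conv_constr conv_constl opprB. Qed.
Lemma ad_conv a c d : ad a (conv c d) = conv (ad a c) d + conv c (ad a d).
Proof. by rewrite /ad convBl convBr !convA [RHS]addrC addrA subrK. Qed.
Lemma ad_const a b : lie a b = 0 -> ad a (const_ser b) = 0.
Proof. by move=> h; apply/funext => -[|k]; rewrite adE /= ?h /lie ?mulmx0 ?mul0mx ?subrr oppr0. Qed.

Lemma strong_rec (T : Type) (x0 : T) (F : nat -> (nat -> T) -> T) :
  (forall k f g, (forall i, (i < k)%N -> f i = g i) -> F k f = F k g) ->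
  exists f, forall k, f k = F k f.
Proof.
move=> hF.
pose G := fix G k : nat -> T := if k is k'.+1 then
  (fun i => if i == k' then F k' (G k') else G k' i) else (fun=> x0).
pose f k := G k.+1 k.
have fG k i : (i < k)%N -> G k i = f i.
  elim: k => // k IH; rewrite ltnS leq_eqVlt => /orP[/eqP->//|ik] /=.
  by rewrite (ltn_eqF ik) IH.
exists f => k; rewrite {1}/f /= eqxx; apply: hF => i; exact: fG.
Qed.

Lemma conv_linv c : c 0%N = 1%:M -> exists d, d 0%N = 1%:M /\ conv d c = const_ser 1%:M.
Proof.
move=> c0.
have [|d hd] := @strong_rec M 0
  (fun k f => const_ser 1%:M k - \sum_(i < k) f i *m c (k - i)%N).
  move=> k f g h; congr (_ - _); apply: eq_bigr => i _; rewrite h //.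
have hdc : conv d c = const_ser 1%:M.
  by apply/funext => k; rewrite /conv big_ord_recr /= subnn c0 mulmx1 hd addrCA subrr addr0.
by exists d; split => //; rewrite hd big_ord0 subr0.
Qed.
Lemma conv_inv c : c 0%N = 1%:M -> exists d,
  [/\ d 0%N = 1%:M, conv d c = const_ser 1%:M & conv c d = const_ser 1%:M].
Proof.
move=> c0; have [d [d0 hd]] := conv_linv c0; have [e [_ he]] := conv_linv d0.
exists d; split => //.
have : c = e by rewrite -[e]conv1r -hd convA he conv1l.
by move=> ->.
Qed.
Lemma conv0 c d : conv c d 0%N = c 0%N *m d 0%N.
Proof. by rewrite /conv big_ord1 subnn. Qed.
End Series.
Section GaugeAlgebra.
Variables (R : realType) (n : nat).
Notation C := R[i].
Notation M := 'M[C]_n.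
Implicit Types c d e m q h : nat -> M.

(** [m' = m (a l + u) - (a l + h) m] as formal series in [1 / l]: the gauge
    transformation [m] takes [a l + u] to [a l + h]. *)
Definition gauge_eq (a u : M) m h m' :=
  m' = sh (ad a m) + conv m (const_ser u) - conv h m.

(** The derivative of [d m = 1]. *)
Lemma gauge_inv_eq (a u : M) m h m' d d' : m 0%N = 1%:M -> d 0%N = 1%:M ->
  conv d m = const_ser 1%:M -> conv m d = const_ser 1%:M ->
  gauge_eq a u m h m' -> conv d' m + conv d m' = 0 ->
  d' = sh (ad a d) + conv d h - conv (const_ser u) d.
Proof.
move=> m0 d0 dm md hm hd.
have ad0 c : c 0%N = 1%:M -> ad a c 0%N = 0.
  by move=> c0; rewrite adE c0 /lie mulmx1 mul1mx subrr oppr0.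
have e1 : conv (sh (ad a d)) m + conv d (sh (ad a m)) = 0.
  rewrite -(sh_conv _ (ad0 _ d0)) -(sh_convr _ (ad0 _ m0)).
  have : ad a (conv d m) = 0 by rewrite dm ad_const // /lie mulmx1 mul1mx subrr.
  rewrite ad_conv => h0; apply/funext => k; have := congr1 (fun c => c k.+1) h0.
  by rewrite !fctE.
have e2 : conv d' m = - conv d m' by apply/eqP; rewrite -addr_eq0 hd.
have e3 : conv d m' = - conv (sh (ad a d)) m + const_ser u - conv d (conv h m).
  rewrite hm convBr convDr convA dm conv1l; congr (_ + _ - _).
  by apply/eqP; rewrite -addr_eq0 addrC e1.
have : conv d' m = conv (sh (ad a d) + conv d h - conv (const_ser u) d) m.
  rewrite convBl convDl -[conv (conv (const_ser u) d) m]convA dm conv1r e2 e3.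
  by rewrite !opprD !opprK -convA addrAC.
move=> /(congr1 (fun c => conv c d)); rewrite -!convA md !conv1r.
by [].
Qed.

(** Differentiating [m q = b m] and cancelling [m] leaves the commutator of
    [q] with [a l + u], as [b] commutes with the diagonal part [h]. *)
Lemma recursion_of_gauge (a b u : M) m h m' d q q' : m 0%N = 1%:M -> lie a b = 0 ->
  conv d m = const_ser 1%:M ->
  conv (const_ser b) h = conv h (const_ser b) ->
  gauge_eq a u m h m' -> q 0%N = b -> conv m q = conv (const_ser b) m ->
  conv m' q + conv m q' = conv (const_ser b) m' ->
  q' = sh (ad a q) + conv q (const_ser u) - conv (const_ser u) q.
Proof.
move=> m0 ab dm bh hm q0 mq hd.
have adm0 : ad a m 0%N = 0 by rewrite adE m0 /lie mulmx1 mul1mx subrr oppr0.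
have adq0 : ad a q 0%N = 0 by rewrite adE q0 ab oppr0.
have e1 : conv (sh (ad a m)) q + conv m (sh (ad a q)) = conv (const_ser b) (sh (ad a m)).
  rewrite -(sh_conv _ adm0) -(sh_convr _ adq0).
  have := congr1 (ad a) mq; rewrite !ad_conv ad_const // => e.
  rewrite -(sh_convr _ adm0); apply/funext => k; have := congr1 (fun c => c k.+1) e.
  rewrite !fctE => ->; rewrite /conv [X in X + _]big1 ?add0r // => i _.
  by rewrite mul0mx.
suff : conv m q' = conv m (sh (ad a q) + conv q (const_ser u) - conv (const_ser u) q).
  by move=> /(congr1 (conv d)); rewrite !convA dm !conv1l.
have e2 : conv m q' = conv (const_ser b) m' - conv m' q by rewrite -hd addrAC subrr add0r.
rewrite e2 hm; move: (sh (ad a m)) (sh (ad a q)) e1 => X1 X2 e1.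
rewrite !convBl !convDl !convBr !convDr -e1 !convA mq bh.
rewrite -[conv (conv h (const_ser b)) m]convA -mq convA.
set x1 := conv X1 q; set x2 := conv m X2; set x3 := conv (conv _ _) (const_ser u).
set x4 := conv (conv h m) q; set x5 := conv _ q.
rewrite [x1 + x2]addrC !opprD !opprK !addrA.
rewrite [_ - x1 - x5 + x4]addrAC -[x2 + x1 + x3]addrA [x1 + x3]addrC !addrA.
by rewrite [_ - x4 - x1]addrAC addrK subrK.
Qed.
End GaugeAlgebra.
Section Gauge.
Variables (R : realType) (n : nat).
Notation C := R[i].
Notation M := 'M[C]_n.
Variable a : M.
Hypothesis a_diag : is_diag_mx a.

(** The part of a matrix that commutes with [a]. *)
Definition dg (x : M) : M := had (\matrix_(i, j) (a i i == a j j)%:R) x.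
(** Inverse of [lie a] on the entries where it is not zero; elsewhere [0^-1 =
    0] makes it vanish. *)
Definition ainv (x : M) : M := had (\matrix_(i, j) (a i i - a j j)^-1) x.

Lemma lie_diagE x i j : lie a x i j = (a i i - a j j) * x i j.
Proof.
have h k l : k != l -> a k l = 0 by move/is_diag_mxP : a_diag; apply.
rewrite !mxE (bigD1 i) //= big1 ?addr0; last by move=> k ki; rewrite h ?mul0r // eq_sym.
rewrite (bigD1 j) //= big1 ?addr0; last by move=> k kj; rewrite h ?mulr0.
by rewrite mulrBl [x i j * _]mulrC.
Qed.
Lemma lie_dg x : lie a (dg x) = 0.
Proof.
apply/matrixP => i j; rewrite lie_diagE !mxE.
by case: eqVneq => [->|_]; rewrite ?subrr ?mul0r ?mulr0.
Qed.
Lemma lie_ainv x : lie a (ainv x) = x - dg x.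
Proof.
apply/matrixP => i j; rewrite lie_diagE !mxE.
case: eqVneq => [->|h]; first by rewrite subrr mul0r mul1r subrr.
by rewrite mulrA divff ?mul1r ?mul0r ?subr0 // subr_eq0.
Qed.
(** [lie a] is diagonal in the basis of matrix units, so it is injective on
    its image. *)
Lemma lie_lie0 x : lie a (lie a x) = 0 -> lie a x = 0.
Proof.
move=> /matrixP h; apply/matrixP => i j; have := h i j; rewrite !lie_diagE mxE.
by move/eqP; rewrite mulf_eq0 => /orP[/eqP->|/eqP]; rewrite ?mul0r ?mxE // => ->.
Qed.
Lemma lieM x y : lie a x = 0 -> lie a y = 0 -> lie a (x *m y) = 0.
Proof.
rewrite /lie => /eqP; rewrite subr_eq0 => /eqP h1 /eqP; rewrite subr_eq0 => /eqP h2.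
by rewrite mulmxA h1 -mulmxA h2 mulmxA subrr.
Qed.
Lemma lieD x y : lie a (x + y) = lie a x + lie a y.
Proof. by rewrite /lie mulmxDl mulmxDr opprD addrACA. Qed.
Lemma lieN x : lie a (- x) = - lie a x.
Proof. by rewrite /lie mulNmx mulmxN opprB opprK addrC. Qed.
Lemma lie_sum I (r : seq I) (F : I -> M) :
  (forall i, lie a (F i) = 0) -> lie a (\sum_(i <- r) F i) = 0.
Proof.
move=> h; elim/big_ind: _ => [|x y hx hy|//]; first by rewrite /lie mulmx0 mul0mx subrr.
by rewrite lieD hx hy addr0.
Qed.

Lemma smooth_conv (c d : nat -> R -> R -> M) k : (forall i, (i <= k)%N -> smooth (c i)) ->
  (forall i, (i <= k)%N -> smooth (d i)) ->
  smooth (fun x t => conv (fun i => c i x t) (fun i => d i x t) k).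
Proof.
move=> hc hd; apply: (@smooth_sum _ _ _ _ _ (fun (i : 'I_k.+1) x t => c i x t *m d (k - i)%N x t)).
by move=> i _; apply: smoothM; [apply: hc; rewrite -ltnS|apply: hd; rewrite leq_subr].
Qed.

Lemma hd_conv (c d c' d' : nat -> R -> M) x k : (forall i, has_deriv (c i) x (c' i x)) ->
  (forall i, has_deriv (d i) x (d' i x)) ->
  has_deriv (fun y => conv (fun i => c i y) (fun i => d i y) k) x
    (conv (fun i => c' i x) (fun i => d i x) k + conv (fun i => c i x) (fun i => d' i x) k).
Proof.
move=> hc hd; rewrite /conv -big_split; apply: hd_sum => i _; exact: hd_mul.
Qed.

Lemma smooth_inverse (m : nat -> R -> R -> M) : (forall k, smooth (m k)) ->
  (forall x t, m 0%N x t = 1%:M) -> exists d : nat -> R -> R -> M,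
  [/\ forall k, smooth (d k), forall x t, d 0%N x t = 1%:M,
   forall x t, conv (fun k => d k x t) (fun k => m k x t) = const_ser 1%:M &
   forall x t, conv (fun k => m k x t) (fun k => d k x t) = const_ser 1%:M].
Proof.
move=> sm m0.
have [|d hd] := @strong_rec (R -> R -> M) (fun _ _ => 0) (fun k f x t =>
   const_ser 1%:M k - \sum_(i < k) f i x t *m m (k - i)%N x t).
  move=> k f g h; apply/funext => x; apply/funext => t; congr (_ - _).
  by apply: eq_bigr => i _; rewrite h.
have dm x t : conv (fun k => d k x t) (fun k => m k x t) = const_ser 1%:M.
  by apply/funext => k; rewrite /conv big_ord_recr /= subnn m0 mulmx1 hd addrCA subrr addr0.
have d0 x t : d 0%N x t = 1%:M by rewrite hd big_ord0 subr0.
exists d; split => //.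
  elim/ltn_ind => k IH; rewrite hd; apply: smoothB; first exact: smooth_cst.
  apply: (@smooth_sum _ _ _ _ _ (fun (i : 'I_k) x t => d i x t *m m (k - i)%N x t)) => i _.
  by apply: smoothM => //; apply: IH.
move=> x t; have [e [_ he1 he2]] := @conv_inv _ _ (fun k => d k x t) (d0 x t).
have : (fun k => m k x t) = e.
  by rewrite -[RHS]conv1r -(dm x t) convA he1 conv1l.
by move=> ->.
Qed.

(** Formal diagonalization: the gauge is solved order by order, the
    [a]-commuting part of the equation giving [h] and the rest giving [m]. *)
Lemma gauge_exists (u : R -> R -> M) : smooth u -> exists m h : nat -> R -> R -> M,
  [/\ forall k, smooth (m k), forall x t, m 0%N x t = 1%:M,
      forall k x t, lie a (h k x t) = 0
    & forall x t, gauge_eq a (u x t) (fun k => m k x t) (fun k => h k x t)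
                   (fun k => dx (m k) x t)].
Proof.
move=> su.
pose mm (r : nat -> R -> R -> M) k : R -> R -> M := fun x t => if k is k'.+1 then ainv (r k' x t) else 1%:M.
have [|r hr] := @strong_rec (R -> R -> M) (fun _ _ => 0) (fun k r x t =>
   mm r k x t *m u x t - dx (mm r k) x t - \sum_(i < k) dg (r i x t) *m mm r (k - i)%N x t).
  move=> k f g h.
  have e i : (i <= k)%N -> mm f i = mm g i.
    by case: i => // i ik; apply/funext => x; apply/funext => t; rewrite /mm h.
  apply/funext => x; apply/funext => t; rewrite !e //; congr (_ - _).
  by apply: eq_bigr => i _; rewrite h // e // leq_subr.
have smm k : (forall i, (i < k)%N -> smooth (r i)) -> forall i, (i <= k)%N -> smooth (mm r i).
  move=> h [|i] ik; first exact: smooth_cst.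
  by apply: smooth_had; apply: h.
have sr k : smooth (r k).
  elim/ltn_ind: k => k IH; rewrite hr; apply: smoothB.
    apply: smoothB; first by apply: smoothM => //; apply: smm IH _ _.
    by have [] := smooth_dx (smm k IH k (leqnn k)).
  apply: (@smooth_sum _ _ _ _ _ (fun (i : 'I_k) x t => dg (r i x t) *m mm r (k - i)%N x t)) => i _.
  apply: smoothM; first by apply: smooth_had; apply: IH.
  by apply: smm IH _ _; rewrite leq_subr.
exists (mm r), (fun k x t => dg (r k x t)); split => //.
- by move=> k; apply: (smm k) => // i _; apply: sr.
- by move=> k x t; apply: lie_dg.
move=> x t; apply/funext => k; rewrite /sh !fctE adE conv_constr.
have -> : lie a (mm r k.+1 x t) = r k x t - dg (r k x t) by exact: lie_ainv.
rewrite /conv big_ord_recr /= subnn mulmx1.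
have := congr1 (fun f => f x t) (hr k); rewrite /=.
move: (dg (r k x t)) (r k x t) (dx (mm r k) x t) (mm r k x t *m u x t) => y r' d' w; move: (\sum_(i < k) _) => z ->.
by apply/matrixP => i j; rewrite !mxE; ring.
Qed.
End Gauge.
Lemma addr_shuffle (V : zmodType) (x1 x2 x3 x4 x5 : V) :
  x1 + x4 + x3 + (x2 + x5 - x3) = x1 + x2 + x4 + x5.
Proof. by rewrite addrC -addrA [- x3 + _]addrC addrK addrC addrACA addrA. Qed.

Section Densities.
Variables (R : realType) (n : nat).
Notation C := R[i].
Notation M := 'M[C]_n.
Variable a : M.
Hypothesis a_diag : is_diag_mx a.
Hypothesis a_un : in_un a.

(** The coefficients of [m^-1 b m], for [d] the inverse of [m]. *)
Definition qs (d m : nat -> R -> R -> M) (b : M) : nat -> R -> R -> M :=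
  fun k x t => conv (fun k => d k x t) (conv (const_ser b) (fun k => m k x t)) k.

Lemma lie_swap (x y : M) : lie x y = 0 -> x *m y = y *m x.
Proof. by move/eqP; rewrite subr_eq0 => /eqP. Qed.

(** The centralizer of [a] is spanned over [R[i]] by its skew-Hermitian
    elements. *)
Lemma central_complex (b : M) : central_in_U a b ->
  forall x, lie a x = 0 -> lie b x = 0.
Proof.
move=> hb x ax; have ax' := lie_swap ax.
have aa : adjmx a = - a := a_un.
have axs : lie a (adjmx x) = 0.
  have := congr1 (@adjmx R n) ax'; rewrite !adjM aa mulmxN mulNmx => h.
  by rewrite /lie -(opprK (a *m _)) -h opprK subrr.
have h1 : lie b (x - adjmx x) = 0.
  apply: hb; split; first by rewrite /in_un adjB adjK opprB.
  by rewrite lieD lieN ax axs subr0.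
have h2 : lie b ('i%C *: (x + adjmx x)) = 0.
  apply: hb; split.
    rewrite /in_un adjZ adjD adjK -scaleNr addrC; congr (_ *: _).
    by apply/eqP; rewrite eq_complex /= oppr0 !eqxx.
  by rewrite /lie -scalemxAr -scalemxAl -scalerBr -/(lie a _) lieD ax axs addr0 scaler0.
have h3 : lie b (x + adjmx x) = 0.
  move: h2; rewrite /lie -scalemxAr -scalemxAl -scalerBr => /eqP.
  have i0 : 'i%C != 0 :> C by rewrite eq_complex /= oner_eq0 andbF.
  by rewrite scaler_eq0 (negbTE i0) => /eqP.
have := lieD b (x - adjmx x) (x + adjmx x); rewrite h1 h3 addr0.
rewrite addrACA [- _ + _]addrC subrr addr0 lieD => /eqP.
by rewrite -mulr2n -scaler_nat scaler_eq0 pnatr_eq0 => /orP[//|/eqP].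
Qed.

(** Skew-Hermitian symmetry is not built into the gauge [m]. But the adjoint
    of the inverse of [m] is another gauge, so the two differ by a series
    commuting with [a], hence with [b], and the series cancels from [m^-1 b
    m]. *)
Theorem densities_exist (b : M) (u : R -> R -> M) : in_un b -> lie a b = 0 ->
  (forall x, lie a x = 0 -> lie b x = 0) ->
  smooth u -> (forall x t, in_un (u x t)) ->
  exists m d : nat -> R -> R -> M,
  [/\ forall x t, m 0%N x t = 1%:M /\ d 0%N x t = 1%:M,
      forall x t, conv (fun k => d k x t) (fun k => m k x t) = const_ser 1%:M /\
                  conv (fun k => m k x t) (fun k => d k x t) = const_ser 1%:M,
      (forall k, smooth (qs d m b k)) /\ (forall k x t, in_un (qs d m b k x t)),
      forall x t, qs d m a 0%N x t = a /\ qs d m b 0%N x t = b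
    & forall c k x t, c = a \/ c = b -> has_deriv (fun y => qs d m c k y t) x
         (lie (qs d m c k.+1 x t) a + lie (qs d m c k x t) (u x t))].
Proof.
move=> b_un ab hb su uu.
have [m [h [sm m0 ah gm]]] := gauge_exists a_diag su.
have [d [sd d0 dm md]] := smooth_inverse sm m0.
have hq c x t : c = a \/ c = b ->
    conv (const_ser c) (fun k => h k x t) = conv (fun k => h k x t) (const_ser c).
  move=> hc; apply/funext => j; rewrite conv_constl conv_constr; apply: lie_swap.
  by case: hc => ->; [exact: ah|apply: hb; exact: ah].
have sq c k : smooth (qs d m c k).
  apply: smooth_conv => // i _.
  have := smoothM (smooth_cst c) (sm i); congr smooth; apply/funext => x; apply/funext => t.
  exact: esym (conv_constl c (fun k => m k x t) i).
have q0 c x t : qs d m c 0%N x t = c.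
  by rewrite /qs conv0 conv_constl d0 m0 mulmx1 mul1mx.
have dd k x t : has_deriv (fun y => d k y t) x (dx (d k) x t) by exact: (smooth_dx (sd k)).2.
have ddm k x t : has_deriv (fun y => m k y t) x (dx (m k) x t) by exact: (smooth_dx (sm k)).2.
have ddm0 x t : conv (fun k => dx (d k) x t) (fun k => m k x t) +
    conv (fun k => d k x t) (fun k => dx (m k) x t) = 0.
  apply/funext => k; rewrite !fctE.
  have h1 := @hd_conv R n (fun k y => d k y t) (fun k y => m k y t)
    (fun k y => dx (d k) y t) (fun k y => dx (m k) y t) x k (fun i => dd i x t) (fun i => ddm i x t).
  apply: hd_unique h1 _; apply: hd_ext (hd_cst (const_ser 1%:M k) x) => y.
  by rewrite dm.
have rec c k x t : c = a \/ c = b -> has_deriv (fun y => qs d m c k y t) x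
         (lie (qs d m c k.+1 x t) a + lie (qs d m c k x t) (u x t)).
  move=> hc; have ac : lie a c = 0 by case: hc => ->; rewrite ?ab // /lie subrr.
  have dq j z : has_deriv (fun y => qs d m c j y t) z (dx (qs d m c j) z t) by exact: (smooth_dx (sq c j)).2.
  have mq z : conv (fun k => m k z t) (fun k => qs d m c k z t) = conv (const_ser c) (fun k => m k z t).
    by rewrite [X in conv _ X](_ : _ = conv (fun k => d k z t) (conv (const_ser c) (fun k => m k z t))) // convA md conv1l.
  have hder : conv (fun k => dx (m k) x t) (fun k => qs d m c k x t) +
     conv (fun k => m k x t) (fun k => dx (qs d m c k) x t) =
     conv (const_ser c) (fun k => dx (m k) x t).
    apply/funext => j; rewrite !fctE conv_constl.
    have h1 := @hd_conv R n (fun k y => m k y t) (fun k y => qs d m c k y t)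
      (fun k y => dx (m k) y t) (fun k y => dx (qs d m c k) y t) x j (fun i => ddm i x t) (fun i => dq i x).
    apply: hd_unique h1 _; apply: hd_ext (hd_mull c (ddm j x t)) => y.
    by rewrite mq conv_constl.
  have e := congr1 (fun f => f k) (recursion_of_gauge (m0 x t) ac (dm x t) (hq c x t hc)
    (gm x t) (q0 c x t) (mq x) hder).
  have {}e : dx (qs d m c k) x t = sh (ad a (fun k => qs d m c k x t)) k +
      conv (fun k => qs d m c k x t) (const_ser (u x t)) k -
      conv (const_ser (u x t)) (fun k => qs d m c k x t) k by [].
  rewrite /sh adE conv_constr conv_constl in e.
  by apply: hd_eq (dq k x) _; rewrite e -addrA /lie opprB.
exists m, d; split => //; split => //.
move=> k x t.
(* [ms] is the adjoint of the inverse gauge, and [Y] compares the two gauges. *)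
pose ms x t : nat -> M := adjs (fun k => d k x t).
pose Y k x t := conv (ms x t) (fun k => d k x t) k.
have aa : adjmx a = - a := a_un.
have lie_adj z : lie a z = 0 -> lie a (adjmx z) = 0.
  move=> /lie_swap/(congr1 (@adjmx R n)); rewrite !adjM aa mulmxN mulNmx => h'.
  by rewrite /lie -(opprK (a *m _)) -h' opprK subrr.
have de z s := gauge_inv_eq (m0 z s) (d0 z s) (dm z s) (md z s) (gm z s) (ddm0 z s).
have mse z s : adjs (fun k => dx (d k) z s) = sh (ad a (ms z s)) +
     conv (adjs (fun k => h k z s)) (ms z s) + conv (ms z s) (const_ser (u z s)).
  rewrite de; apply/funext => j; rewrite /adjs !fctE /sh adjB adjD.
  have hu : adjmx (u z s) = - u z s := uu z s.
  rewrite -[adjmx (conv _ _ j)]/(adjs _ j) adjs_conv -[adjmx (conv (const_ser _) _ j)]/(adjs _ j) adjs_conv adjs_const hu.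
  rewrite !conv_constr mulmxN opprK; congr (_ + _ + _).
  rewrite !adE adjN /lie adjB !adjM aa mulmxN mulNmx /ms /adjs.
  by rewrite !opprB opprK addrC.
have Ye j z s : has_deriv (fun y => Y j y s) z ((sh (ad a (fun k => Y k z s)) +
    conv (adjs (fun k => h k z s)) (fun k => Y k z s) + conv (fun k => Y k z s) (fun k => h k z s)) j).
  have h1 := @hd_conv R n (fun k y => ms y s k) (fun k y => d k y s)
      (fun k y => adjmx (dx (d k) y s)) (fun k y => dx (d k) y s) z j
      (fun i => hd_adj (dd i z s)) (fun i => dd i z s).
  apply: hd_eq h1 _; rewrite -[LHS]/((conv (adjs (fun k => dx (d k) z s)) _ + conv (ms z s) (fun k => dx (d k) z s)) j).
  rewrite mse de; congr (_ j).
  have am0 : ad a (ms z s) 0%N = 0 by rewrite adE /ms /adjs d0 adj1 /lie mulmx1 mul1mx subrr oppr0.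
  have ad0 : ad a (fun k => d k z s) 0%N = 0 by rewrite adE d0 /lie mulmx1 mul1mx subrr oppr0.
  have -> : sh (ad a (fun k => Y k z s)) = conv (sh (ad a (ms z s))) (fun k => d k z s) + conv (ms z s) (sh (ad a (fun k => d k z s))).
    rewrite -(sh_conv _ am0) -(sh_convr _ ad0).
    have -> : (fun k => Y k z s) = conv (ms z s) (fun k => d k z s) by [].
    by rewrite ad_conv.
  have -> : (fun k => Y k z s) = conv (ms z s) (fun k => d k z s) by [].
  move: (sh (ad a (ms z s))) (sh (ad a (fun k => d k z s))) => X1 X2.
  rewrite !convDl convBr convDr !convA.
  exact: addr_shuffle.
have Ya j z s : lie a (Y j z s) = 0.
  elim/ltn_ind: j z s => -[|j] IH z s.
    by rewrite /Y conv0 /ms /adjs d0 adj1 mulmx1 /lie mulmx1 mul1mx subrr.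
  pose D := sh (ad a (fun k => Y k z s)) j +
    conv (adjs (fun k => h k z s)) (fun k => Y k z s) j +
    conv (fun k => Y k z s) (fun k => h k z s) j.
  have hD : has_deriv (fun y => Y j y s) z D := Ye j z s.
  have lD : lie a D = 0.
    have h1 := hd_sub (hd_mull a hD) (hd_mulr a hD).
    apply: hd_unique h1 _; apply: hd_ext (hd_cst 0 z) => y.
    by have := IH j (leqnn _) y s; rewrite /lie => ->.
  apply: (lie_lie0 a_diag).
  have l1 : lie a (conv (adjs (fun k => h k z s)) (fun k => Y k z s) j) = 0.
    apply: lie_sum => i; apply: lieM; first by apply: lie_adj.
    by apply: IH; rewrite ltnS leq_subr.
  have l2 : lie a (conv (fun k => Y k z s) (fun k => h k z s) j) = 0.
    apply: lie_sum => i; apply: lieM; [apply: IH; exact: ltn_ord|exact: ah].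
  move: lD; rewrite /D [lie a (_ + _ + _)]lieD l2 addr0 lieD l1 addr0 /sh adE lieN => /eqP.
  by rewrite oppr_eq0 => /eqP.
have Yb : conv (fun k => Y k x t) (const_ser b) = conv (const_ser b) (fun k => Y k x t).
  by apply/funext => j; rewrite conv_constl conv_constr; apply/esym/lie_swap/hb.
have eY : ms x t = conv (fun k => Y k x t) (fun k => m k x t).
  have -> : (fun k => Y k x t) = conv (ms x t) (fun k => d k x t) by [].
  by rewrite -convA dm conv1r.
have emY : conv (adjs (fun k => m k x t)) (fun k => Y k x t) = (fun k => d k x t).
  have e1 : conv (adjs (fun k => m k x t)) (ms x t) = const_ser 1%:M.
    by rewrite /ms -adjs_conv dm adjs_const adj1.
  rewrite -[LHS]conv1r -(md x t) convA -(convA (adjs _)) -eY e1 conv1l //.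
rewrite /in_un.
have -> : adjmx (qs d m b k x t) =
    adjs (conv (fun k => d k x t) (conv (const_ser b) (fun k => m k x t))) k by [].
rewrite !adjs_conv adjs_const.
have -> : adjmx b = - b := b_un.
rewrite -/(ms x t) eY.
have -> : const_ser (- b) = - const_ser b by apply/funext => -[|j]; rewrite !fctE /= ?oppr0.
rewrite convNr convNl.
have -> : conv (conv (adjs (fun k => m k x t)) (const_ser b)) (conv (fun k => Y k x t) (fun k => m k x t)) =
    conv (fun k => d k x t) (conv (const_ser b) (fun k => m k x t)).
  by rewrite -convA [conv (const_ser b) (conv (fun k => Y k x t) _)]convA -Yb -convA convA emY.
by [].
Qed.
End Densities.
(** * Asymptotic expansions and uniqueness of the densities *)

Section Asymptotics.
Variables (R : realType) (n : nat).
Notation C := R[i].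
Notation M := 'M[C]_n.
Variable W : set C.
Implicit Types (f g : C -> M) (c d : nat -> M).

Definition bd f := exists K B : R, forall l, W l -> K < cn l -> nm (f l) <= B.

Lemma bd_near K f g : (forall l, W l -> K < cn l -> nm (f l) <= nm (g l)) -> bd g -> bd f.
Proof.
move=> h [K' [B hB]]; exists (Num.max K K'), B => l Wl.
by rewrite gt_max => /andP[k1 k2]; apply: le_trans (hB l Wl k2); apply: h.
Qed.
Lemma bd_eq K f g : (forall l, W l -> K < cn l -> f l = g l) -> bd g -> bd f.
Proof. by move=> h; apply: (@bd_near K) => l Wl /(h l Wl) ->. Qed.
Lemma bd_cst (b : M) : bd (fun=> b).
Proof. by exists 0, (nm b). Qed.
Lemma bdD f g : bd f -> bd g -> bd (fun l => f l + g l).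
Proof.
move=> [K [B h]] [K' [B' h']]; exists (Num.max K K'), (B + B') => l Wl.
rewrite gt_max => /andP[k1 k2]; apply: le_trans (nmD _ _) _.
by apply: lerD; [apply: h|apply: h'].
Qed.
Lemma bdM f g : bd f -> bd g -> bd (fun l => f l *m g l).
Proof.
move=> [K [B h]] [K' [B' h']]; exists (Num.max K K'), (B * B') => l Wl.
rewrite gt_max => /andP[k1 k2]; apply: le_trans (nmM _ _) _.
by apply: ler_pM; rewrite ?nm_ge0 //; [apply: h|apply: h'].
Qed.
Lemma bdZ (z : C) f : bd f -> bd (fun l => z *: f l).
Proof.
move=> [K [B h]]; exists K, (cn z * B) => l Wl k; rewrite nmZ.
by apply: ler_wpM2l; rewrite ?cn_ge0 //; apply: h.
Qed.
Lemma bd_inv f : bd f -> bd (fun l => l^-1 *: f l).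
Proof.
apply: (@bd_near 1) => l _ l1; rewrite nmZ cnV.
by apply: ler_piMl; rewrite ?nm_ge0 // invf_le1 ?ltW // (lt_trans ltr01).
Qed.

(** Splitting off one coefficient at a time makes products and inverses
    inductive. *)
Fixpoint asyN N f c : Prop := if N is N'.+1 then
  asyN N' (fun l => l *: (f l - c 0%N)) (sh c) else bd f.

Lemma sh_sum N c (l : C) : l != 0 -> l *: (\sum_(k < N.+1) l ^- k *: c k - c 0%N) = \sum_(k < N) l ^- k *: sh c k.
Proof.
move=> l0; rewrite big_ord_recl expr0 invr1 scale1r addrC addKr scaler_sumr.
by apply: eq_bigr => i _; rewrite scalerA exprS invfM mulrA divff // mul1r.
Qed.

Lemma asyN_bd N f c : asyN N f c <-> bd (fun l => l ^+ N *: (f l - \sum_(k < N) l ^- k *: c k)).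
Proof.
elim: N f c => [|N IH] f c.
  by split; apply: (@bd_eq 0) => l _ _; rewrite big_ord0 subr0 expr0 scale1r.
have e l : 0 < cn l -> l ^+ N.+1 *: (f l - \sum_(k < N.+1) l ^- k *: c k) =
    l ^+ N *: (l *: (f l - c 0%N) - \sum_(k < N) l ^- k *: sh c k).
  rewrite cn_gt0 => l0; rewrite -sh_sum // -scalerBr scalerA -exprSr; congr (_ *: _).
  by rewrite opprB addrA subrK.
split=> /= [/IH|h]; first by apply: (@bd_eq 0) => l _; apply: e.
by apply/IH; move: h; apply: (@bd_eq 0) => l _ /e.
Qed.

Lemma asyN_near N K f g c : (forall l, W l -> K < cn l -> f l = g l) -> asyN N g c -> asyN N f c.
Proof. by move=> h /asyN_bd b; apply/asyN_bd; move: b; apply: (@bd_eq K) => l Wl Kl; rewrite h. Qed.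

Lemma asyN_bound N f c : asyN N f c -> bd f.
Proof.
elim: N f c => [//|N IH] f c /IH /= h.
have := bdD (bd_cst (c 0%N)) (bd_inv h); apply: (@bd_eq 0) => l _; rewrite cn_gt0 => l0.
by rewrite scalerA mulVf // scale1r addrC subrK.
Qed.
Lemma asyN_pred N f c : asyN N.+1 f c -> asyN N f c.
Proof.
elim: N f c => [|N IH] f c; first exact: (@asyN_bound 1).
by move=> /IH.
Qed.
Lemma asyND N f g c d : asyN N f c -> asyN N g d -> asyN N (fun l => f l + g l) (c + d).
Proof.
elim: N f g c d => [|N IH] f g c d; first exact: bdD.
move=> h1 h2; have := IH _ _ _ _ h1 h2; rewrite /=.
by apply: (@asyN_near _ 0) => l _ _; rewrite fctE opprD addrACA scalerDr.
Qed.
Lemma asyN_mull N b f c : asyN N f c -> asyN N (fun l => b *m f l) (fun k => b *m c k).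
Proof.
elim: N f c => [|N IH] f c; first exact/bdM/bd_cst.
move=> /IH /=; apply: (@asyN_near _ 0) => l _ _.
by rewrite -scalemxAr mulmxBr.
Qed.
Lemma asyN_cst N b : asyN N (fun=> b) (const_ser b).
Proof.
elim: N b => [|N IH] b; first exact: bd_cst.
rewrite /=; have -> : sh (const_ser b) = const_ser 0 by apply/funext => -[|k].
by apply: (@asyN_near _ 0) (IH 0) => l _ _; rewrite subrr scaler0.
Qed.

Lemma asyNM N f g c d : asyN N f c -> asyN N g d -> asyN N (fun l => f l *m g l) (conv c d).
Proof.
elim: N f g c d => [|N IH] f g c d; first exact: bdM.
move=> h1 h2; have h2' := asyN_pred h2.
have := asyND (asyN_mull (N := N) (c 0%N) h2)
  (IH (fun l => l *: (f l - c 0%N)) g (sh c) d h1 h2'); rewrite /=.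
have -> : (fun k => c 0%N *m sh d k) + conv (sh c) d = sh (conv c d).
  by apply/funext => k; rewrite !fctE /sh /conv [RHS]big_ord_recl.
apply: (@asyN_near _ 0) => l _ _; rewrite conv0 -scalemxAr -scalemxAl -scalerDr; congr (_ *: _).
by rewrite mulmxBr mulmxBl [RHS]addrC addrA subrK.
Qed.

(** Writing [f = 1 + l^-1 r] gives [g = 1 - l^-1 (r g)], which first bounds
    [g] and then expands it. *)
Lemma asyN_inv f g c d : (forall N, asyN N f c) -> c 0%N = 1%:M -> conv c d = const_ser 1%:M ->
  (forall l, W l -> f l *m g l = 1%:M) -> forall N, asyN N g d.
Proof.
move=> hf c0 cd fg; pose r l := l *: (f l - 1%:M).
have d0 : d 0%N = 1%:M by have := congr1 (fun s => s 0%N) cd; rewrite conv0 c0 mul1mx.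
have hr N : asyN N r (sh c) by have := hf N.+1; rewrite /= c0.
have gr l : W l -> 0 < cn l -> l *: (g l - 1%:M) = - (r l *m g l).
  by move=> Wl _; rewrite -scalemxAl mulmxBl fg // mul1mx -scalerN opprB.
elim=> [|N IH].
  have [K [B hB]] := hr 0%N.
  exists (Num.max K (Num.max 1 (2 * B))), (2 * nm (1%:M : M)) => l Wl.
  rewrite !gt_max => /and3P[Kl l1 lB].
  have l0 : 0 < cn l := lt_trans ltr01 l1.
  have h1 : cn l * nm (g l - 1%:M) <= B * nm (g l).
    rewrite -nmZ gr // nmN; apply: le_trans (nmM _ _) _.
    by apply: ler_wpM2r; [exact: nm_ge0|exact: hB].
  have h2 : nm (g l) <= nm (g l - 1%:M) + nm (1%:M : M) by have := nmD (g l - 1%:M) 1%:M; rewrite subrK.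
  have h3 : 2 * B * nm (g l) <= cn l * nm (g l) by apply: ler_wpM2r; rewrite ?nm_ge0 // ltW.
  have h4 : cn l * (2 * nm (g l - 1%:M)) <= cn l * nm (g l) by nra.
  by move: h4; rewrite ler_pM2l // => h4; lra.
rewrite /=; have -> : sh d = - conv (sh c) d.
  apply/funext => k; rewrite fctE; have := congr1 (fun s => s k.+1) cd.
  rewrite /conv big_ord_recl c0 mul1mx /= => /eqP; rewrite addr_eq0 => /eqP.
  by rewrite /sh.
have := asyN_mull (- 1%:M) (asyNM (hr N) IH).
have -> : (fun k => (- 1%:M) *m conv (sh c) d k) = - conv (sh c) d.
  by apply/funext => k; rewrite !fctE mulNmx mul1mx.
by apply: (@asyN_near _ 0) => l Wl l0; rewrite d0 gr // mulNmx mul1mx.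
Qed.

Definition unbd := forall K : R, exists2 l, W l & K < cn l.

Lemma bd_zero b : unbd -> bd (fun l => l *: b) -> b = 0.
Proof.
move=> hW [K [B h]]; apply: nm_eq0; rewrite leNgt; apply/negP => b0.
have [l Wl] := hW (Num.max K (B / nm b)).
rewrite gt_max => /andP[/(h l Wl)]; rewrite nmZ ltr_pdivrMr // => h1 h2.
by have := lt_le_trans h2 h1; rewrite ltxx.
Qed.
Lemma asyN_unique N f c d : unbd -> asyN N.+1 f c -> asyN N.+1 f d -> forall k, (k <= N)%N -> c k = d k.
Proof.
move=> hW; have e0 K g c' d' : asyN K.+1 g c' -> asyN K.+1 g d' -> c' 0%N = d' 0%N.
  move=> h1 h2; apply/eqP; rewrite -subr_eq0; apply/eqP/bd_zero => //.
  have h1' := @asyN_bound K (fun l => l *: (g l - c' 0%N)) (sh c') h1.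
  have h2' := @asyN_bound K (fun l => l *: (g l - d' 0%N)) (sh d') h2.
  have := bdD h2' (bdZ (-1) h1'); apply: (@bd_eq 0) => l _ _.
  by rewrite scaleN1r -scalerBr opprB [g l - _ + _]addrC addrA subrK.
elim: N f c d => [|N IH] f c d h1 h2 [|k] kN //; [exact: e0 h1 h2|exact: e0 h1 h2|].
apply: (IH (fun l => l *: (f l - c 0%N)) (sh c) (sh d) h1 _ k kN).
by rewrite (e0 _ _ _ _ h1 h2).
Qed.

Lemma asymptoticP f c : asymptotic W f c <-> forall N, asyN N f c.
Proof.
have hk (N : nat) (l : C) : 0 < cn l -> nm (l ^+ N *: (f l - \sum_(k < N) l ^- k *: c k)) = cn l ^+ N * nm (f l - \sum_(k < N) l ^- k *: c k).
  by rewrite nmZ cnX.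
have he N l i j : (f l - \sum_(k < N) l ^- k *: c k) i j = f l i j - \sum_(k < N) c k i j * l ^- k.
  by rewrite !mxE summxE; congr (_ - _); apply: eq_bigr => k _; rewrite mxE mulrC.
split=> [h N|h N].
  apply/asyN_bd; have [K [B hB]] := h N.
  exists (Num.max K 0), ((n * n)%:R * B) => l Wl; rewrite gt_max => /andP[Kl l0].
  have hX : 0 < cn l ^+ N by rewrite exprn_gt0.
  rewrite hk // mulrC -ler_pdivlMr // -mulrA; apply: nm_le => i j; rewrite he.
  have := hB l Wl; rewrite lt_cn => /(_ Kl i j).
  by rewrite cnE [`|l|]cnE -rmorphXn -fmorphV -rmorphM lecR.
have /asyN_bd[K [B hB]] := h N.
exists (Num.max K 0), B => l Wl; rewrite lt_cn gt_max => /andP[Kl l0] i j.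
have hX : 0 < cn l ^+ N by rewrite exprn_gt0.
have := hB l Wl Kl; rewrite hk // mulrC -ler_pdivlMr // => h1.
rewrite cnE [`|l|]cnE -rmorphXn -fmorphV -rmorphM lecR -he.
exact: le_trans (cn_nm _ i j) h1.
Qed.
End Asymptotics.
Section ComplexNeighbourhoods.
Variable R : realType.
Notation C := R[i].

Lemma nbhsCP (z : C) (P : set C) : nbhs (z : C^o) P <->
  exists2 d : R, 0 < d & forall w, cn (w - z) < d -> P w.
Proof.
split=> [/nbhs_ballP[e /= e0 h]|[d d0 h]].
  have [eR e1] : complex.Im e = 0 /\ 0 < complex.Re e.
    by move: e0; rewrite ltcE /= => /andP[/eqP-> ->].
  exists (complex.Re e) => // w hw; apply: h.
  rewrite -ball_normE /ball_ /= distrC.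
  have -> : e = (complex.Re e)%:C by apply/eqP; rewrite eq_complex /= eR !eqxx.
  by rewrite ltcR.
apply/nbhs_ballP; exists d%:C => /=; first by rewrite ltcR.
move=> w; rewrite -ball_normE /ball_ /= distrC => hw; apply: h.
by rewrite -ltcR.
Qed.

Lemma dnbhsCP (z : C) (P : set C) : (\forall w \near (z : C^o)^', P w) <->
  exists2 d : R, 0 < d & forall w, w != z -> cn (w - z) < d -> P w.
Proof.
split=> [h|[d d0 h]].
  have /nbhsCP[d d0 hd] : nbhs (z : C^o) [set w | w != z -> P w] by exact: h.
  by exists d => // w wz /hd; apply.
suff : nbhs (z : C^o) [set w | w != z -> P w] by [].
by apply/nbhsCP; exists d => // w hw wz; apply: h.
Qed.

Lemma cexp_cn (z : C) : cn (cexp z) = expR (complex.Re z).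
Proof.
rewrite /cexp cnM cn_real ger0_norm ?expR_ge0 //.
have -> : cn (cos (complex.Im z) +i* sin (complex.Im z)) = 1; last by rewrite mulr1.
by rewrite /cn /Normc.normc cos2Dsin2 sqrtr1.
Qed.

(** The left-hand value depends on the height [s] unless [p = 0]. *)
Lemma strip_zero (p q th : R) : 0 <= p -> th != 0 ->
  (forall e s1 s2 : R, 0 < e -> 0 < s1 -> s1 < s2 -> s2 < 1 ->
     exists2 s, s1 < s < s2 & `|expR (- (th * s)) * p - q| <= e) -> p = 0 /\ q = 0.
Proof.
move=> p0 th0 h.
suff p0' : p = 0.
  split=> //; apply/eqP; rewrite -normr_eq0 eq_le normr_ge0 andbT.
  apply/ler_addgt0Pr => e e0; rewrite add0r.
  have [||||s _] := h e (4%:R^-1) (2%:R^-1) => //; try by lra.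
  by rewrite p0' mulr0 sub0r normrN.
apply/eqP; rewrite eq_le p0 andbT leNgt; apply/negP => pp.
pose D := `|expR (- (th * 4%:R^-1)) - expR (- (th * 2%:R^-1))|.
have D0 : 0 < D.
  rewrite normr_gt0 subr_eq0; apply/eqP => /expR_inj/eqP.
  by rewrite eqr_opp -subr_eq0 -mulrBr mulf_eq0 (negbTE th0) /= => /eqP; lra.
have e0 : 0 < p * D / 4 by rewrite divr_gt0 // mulr_gt0.
have [|||s /andP[s1 s2] hs] := h _ (8%:R^-1) (4%:R^-1) e0 => //; try by lra.
have [|||s' /andP[s1' s2'] hs'] := h _ (2%:R^-1) (3%:R/4) e0 => //; try by lra.
have h1 : p * `|expR (- (th * s)) - expR (- (th * s'))| <= p * D / 4 + p * D / 4.
  rewrite -[X in X * _](ger0_norm p0) -normrM mulrBr ![p * _]mulrC.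
  have -> : expR (- (th * s)) * p - expR (- (th * s')) * p = (expR (- (th * s)) * p - q) - (expR (- (th * s')) * p - q).
    by rewrite opprB addrA subrK.
  by apply: le_trans (ler_normB _ _) _; rewrite mulrC in hs hs' *; apply: lerD; rewrite // mulrC.
have h2 : D <= `|expR (- (th * s)) - expR (- (th * s'))|.
  have [t0|t0] := ltP 0 th.
    have k1 : expR (- (th * 4%:R^-1)) <= expR (- (th * s)) by rewrite ler_expR lerN2 ler_wpM2l // ltW.
    have k2 : expR (- (th * s')) <= expR (- (th * 2%:R^-1)) by rewrite ler_expR lerN2 ler_wpM2l // ltW.
    have k3 : expR (- (th * 2%:R^-1)) <= expR (- (th * 4%:R^-1)).
      by rewrite ler_expR lerN2 ler_wpM2l ?ltW //; lra.
    rewrite /D !ger0_norm; lra.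
  have k1 : expR (- (th * s)) <= expR (- (th * 4%:R^-1)) by rewrite ler_expR lerN2 ler_wnM2l // ltW.
  have k2 : expR (- (th * 2%:R^-1)) <= expR (- (th * s')) by rewrite ler_expR lerN2 ler_wnM2l // ltW.
  have k3 : expR (- (th * 4%:R^-1)) <= expR (- (th * 2%:R^-1)).
    by rewrite ler_expR lerN2 ler_wnM2l //; lra.
  rewrite /D !ler0_norm; lra.
have h3 : p * D <= p * D / 2.
  by apply: le_trans (ler_wpM2l p0 h2) _; apply: le_trans h1 _; lra.
have : 0 < p * D by rewrite mulr_gt0.
lra.
Qed.

(** The exceptional set is locally finite, so it does not fill a segment of a
    horizontal line. *)
Lemma strip_unbd (Z : set C) : (forall l, complex.Im l != 0 -> \forall w \near (l : C^o)^', ~ Z w) ->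
  forall K s1 s2 : R, 0 < s1 -> s1 < s2 -> exists l, [/\ nonreal_off Z l, K < cn l & s1 < complex.Im l < s2].
Proof.
move=> hZ K s1 s2 s10 s12.
pose s := (s1 + s2) / 2; pose z : C := (`|K| + 1) +i* s.
have zs : complex.Im z != 0 by rewrite /= /s; lra.
have /dnbhsCP[d d0 hd] := hZ _ zs.
pose w := z + (d / 2)%:C.
have wi : complex.Im w = s by rewrite /= addr0.
have dz : w - z = (d / 2)%:C by rewrite addrC addKr.
have d2 : 0 < d / 2 by rewrite divr_gt0.
exists w; split.
- split; first by rewrite wi.
  apply: hd; last by rewrite dz cn_real gtr0_norm // ltr_pdivrMr // mulr_natr mulr2n ltrDl.
  by rewrite -subr_eq0 dz -cn_eq0 cn_real normr_eq0 lt0r_neq0.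
- apply: lt_le_trans (cn_re w); rewrite /= ger0_norm; last by rewrite !addr_ge0 // ltW.
  by have := ler_norm K; lra.
by rewrite wi /s; apply/andP; split; lra.
Qed.
End ComplexNeighbourhoods.
Section WaveUniqueness.
Variables (R : realType) (n : nat).
Notation C := R[i].
Notation M := 'M[C]_n.

(** The adjoint at the conjugate parameter plays the role of the inverse. *)
Lemma hd_cofund (A Y : R -> C -> M) (x : R) : (forall l, adjmx (A x (conjc l)) = - A x l) ->
  (forall l, has_deriv (fun y => Y y l) x (Y x l *m A x l)) ->
  forall l, has_deriv (fun y => adjmx (Y y (conjc l))) x (- (A x l *m adjmx (Y x (conjc l)))).
Proof.
move=> hA hY l; apply: hd_eq (hd_adj (hY (conjc l))) _.
by rewrite adjM hA mulNmx.
Qed.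

Variable a : M.
Hypothesis a_diag : is_diag_mx a.
Hypothesis a_un : in_un a.

Lemma lax_adj (w : M) (l : C) : in_un w -> adjmx (conjc l *: a + w) = - (l *: a + w).
Proof.
move=> hw; rewrite adjD adjZ.
have -> : adjmx a = - a := a_un.
have -> : adjmx w = - w := hw.
have -> : conjc (conjc l) = l by case: l => ? ?; rewrite /= opprK.
by rewrite scalerN opprD.
Qed.

Lemma fund_lax (v : R -> M) : mcont v -> (forall x, in_un (v x)) -> exists Y : R -> C -> M,
  [/\ forall l, Y 0 l = 1%:M,
      forall x l, has_deriv (fun y => Y y l) x (Y x l *m (l *: a + v x)),
      forall x l, Y x l *m adjmx (Y x (conjc l)) = 1%:M
    & forall x, entire (Y x)].
Proof.
move=> cv uv.
pose c k x := if k is k'.+1 then if k' is 0 then a else 0 else v x.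
have [|k|Y [Y0 Yd Yu Ye]] := @fundamental R n 1 c.
- case=> [|[|k]] x //=; first by rewrite /in_un adj0 oppr0.
- by case: k => [|[|k]] //; apply: mcont_cst.
exists Y; split=> // x l; apply: hd_eq (Yd x l) _; congr (_ *m _).
by rewrite /pol big_ord_recl big_ord1 expr0 scale1r expr1 addrC.
Qed.

Definition trunc (q : nat -> M) (N : nat) (l : C) : M := \sum_(k < N.+1) l ^- k *: q k.

Lemma trunc_asy W q N : asyN W N (trunc q N) q.
Proof.
apply/asyN_bd; apply: (@bd_eq _ _ W 0 _ _ _ (bd_cst W (q N))) => l _; rewrite cn_gt0 => l0.
by rewrite /trunc big_ord_recr /= addrAC subrr add0r scalerA divff ?scale1r // expf_neq0.
Qed.

(** All terms but the last one cancel by the recursion. *)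
Lemma trunc_lax (q : nat -> M) (v : M) N (l : C) : l != 0 -> q 0%N = a ->
  (l *: a + v) *m trunc q N l - trunc q N l *m (l *: a + v) +
    trunc (fun k => lie (q k.+1) a + lie (q k) v) N l = l ^- N *: lie (q N.+1) a.
Proof.
move=> l0 q0; elim: N => [|N IH].
  rewrite /trunc !big_ord1 expr0 invr1 !scale1r q0 /lie mulmxDl mulmxDr -scalemxAl -scalemxAr.
  move: (l *: (a *m a)) (a *m v) (v *m a) (q 1%N *m a) (a *m q 1%N) => X1 X2 X3 X4 X5.
  by apply/matrixP => i j; rewrite !mxE; ring.
have e (p : nat -> M) : trunc p N.+1 l = trunc p N l + l ^- N.+1 *: p N.+1.
  by rewrite /trunc big_ord_recr.
rewrite !e mulmxDr [(_ + _ *: q N.+1) *m _]mulmxDl.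
have h (A t s p r x y : M) : A *m t - t *m A + p = x -> x + (A *m s - s *m A) + r = y ->
    A *m t + A *m s - (t *m A + s *m A) + (p + r) = y.
  by move=> <- <-; apply/matrixP => i j; rewrite !mxE; ring.
apply: (h _ _ _ _ _ _ _ IH); rewrite exprS invfM.
have : l ^- N = (l^-1 / l ^+ N) * l by rewrite mulrAC mulVf // mul1r.
move: (l^-1 / l ^+ N : C) => z ->.
rewrite -scalerA -scalemxAr -(scalemxAl z) -scalerBr -!scalerDr; congr (_ *: _).
rewrite /lie mulmxDl mulmxDr -scalemxAl -scalemxAr.
move: (a *m q N.+1) (q N.+1 *m a) (q N.+1 *m v) (v *m q N.+1) (q N.+2 *m a) (a *m q N.+2) => X1 X2 X3 X4 X5 X6.
by apply/matrixP => i j; rewrite !mxE; ring.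
Qed.

Lemma hd_trunc (q : nat -> R -> M) (dq : nat -> M) (x : R) N l : (forall k, has_deriv (q k) x (dq k)) ->
  has_deriv (fun y => trunc (fun k => q k y) N l) x (trunc dq N l).
Proof. by move=> h; apply: hd_sum => k _; apply: hd_Z. Qed.

Lemma nm_lax_herm (v : M) (l : C) : in_un v ->
  nm ((l *: a + v) + adjmx (l *: a + v)) <= 2 * `|complex.Im l| * nm a.
Proof.
move=> hv; have h : adjmx (l *: a + v) = - (conjc l *: a + v).
  by rewrite -lax_adj //; congr (adjmx (_ *: _ + _)); case: l => ? ?; rewrite /= opprK.
rewrite h; have -> : l *: a + v - (conjc l *: a + v) = (l - conjc l) *: a.
  by rewrite scalerBl; apply/matrixP => i j; rewrite !mxE; ring.
rewrite nmZ; apply: ler_wpM2r (nm_ge0 _) _ _ _.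
have -> : l - conjc l = (2 * complex.Im l)%:C * 'i%C.
  by case: l {h} => x y; apply/eqP; rewrite eq_complex /=; apply/andP; split; apply/eqP; ring.
by rewrite cnM cn_real normrM ger0_norm // /cn /= expr0n expr1n /= add0r sqrtr1 mulr1.
Qed.

(** Conjugating the truncated density by a solution near the real axis
    changes it little: the derivative telescopes to its last term. *)
Lemma conj_trunc (v : R -> M) (q : nat -> R -> M) (Y : R -> C -> M) :
  (forall x, in_un (v x)) -> (forall x, q 0%N x = a) ->
  (forall k x, has_deriv (q k) x (lie (q k.+1 x) a + lie (q k x) (v x))) ->
  (forall l, Y 0 l = 1%:M) ->
  (forall x l, has_deriv (fun y => Y y l) x (Y x l *m (l *: a + v x))) ->
  (forall x l, Y x l *m adjmx (Y x (conjc l)) = 1%:M) ->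
  forall (x : R) N, exists2 B, 0 <= B & forall l, l != 0 -> `|complex.Im l| <= 1 ->
    nm (Y x l *m trunc (fun k => q k x) N l *m adjmx (Y x (conjc l)) - trunc (fun k => q k 0) N l)
      <= B * cn l ^- N.
Proof.
move=> uv q0 dq Y0 Yd Yu x N.
have cq k : mcont (q k) := hd_mcont (dq k).
have [B1 B10 hB1] := mcont_bound `|x| (cq N.+1).
have c0 : 0 <= 2 * nm a by rewrite mulr_ge0 ?nm_ge0.
have [K K0 hK] := @sol_bound R n `|x| _ c0.
have Yb y l : `|y| <= `|x| -> `|complex.Im l| <= 1 -> nm (Y y l) <= K.
  move=> yx l1; apply: (hK (fun y => l *: a + v y) (fun y => Y y l)) => // z zx.
  apply: le_trans (nm_lax_herm _ (uv z)) _; rewrite mulrAC ler_piMr // mulr_ge0 ?nm_ge0 //.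
exists (Kn R n * (K * (2 * B1 * nm a) * K * `|x|)).
  by rewrite !mulr_ge0 ?nm_ge0 ?Kn_ge0.
move=> l l0 l1; pose G y := Y y l *m trunc (fun k => q k y) N l *m adjmx (Y y (conjc l)).
have l1' : `|complex.Im (conjc l)| <= 1 by case: l l1 {l0 G} => ? ? /=; rewrite normrN.
have dG y : has_deriv G y (Y y l *m (l ^- N *: lie (q N.+1 y) a) *m adjmx (Y y (conjc l))).
  have h1 := hd_mul (hd_mul (Yd y l) (hd_trunc N l (fun k => dq k y)))
     (@hd_cofund (fun y l => l *: a + v y) Y y (fun l => lax_adj l (uv y)) (Yd y) l).
  apply: hd_eq h1 _; rewrite -(@trunc_lax (fun k => q k y) (v y) N l l0 (q0 y)).
  move: (Y y l) (adjmx _) (l *: a + v y) (trunc _ N l) (trunc _ N l) => y1 y2 A t t'.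
  by rewrite mulmxDr mulmxBr !mulmxDl mulNmx mulmxN -!mulmxA; apply/matrixP => i j; rewrite !mxE; ring.
have := @hd_mv R n G _ `|x| (K * (2 * B1 * nm a * cn l ^- N) * K) (fun y _ => dG y) _ x (lexx _).
have -> : G 0 = trunc (fun k => q k 0) N l by rewrite /G !Y0 adj1 mulmx1 mul1mx.
move=> h; apply: le_trans (h _) _.
  move=> y yx; apply: le_trans (nmM _ _) _; apply: ler_pM; rewrite ?nm_ge0 // ?nm_adj ?Yb //.
  apply: le_trans (nmM _ _) _; apply: ler_pM; rewrite ?nm_ge0 // ?Yb //.
  rewrite nmZ cnV cnX mulrC; apply: ler_wpM2r; first by rewrite invr_ge0 exprn_ge0 ?cn_ge0.
  apply: le_trans (nmB _ _) _; have := nmM (q N.+1 y) a; have := nmM a (q N.+1 y).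
  have := hB1 y yx; have := nm_ge0 a; nra.
rewrite le_eqVlt; apply/orP; left; apply/eqP; ring.
Qed.
End WaveUniqueness.
Section DensityUniqueness.
Variables (R : realType) (n : nat).
Notation C := R[i].
Notation M := 'M[C]_n.
Variable a : M.
Hypothesis a_diag : is_diag_mx a.
Hypothesis a_un : in_un a.

(** Order by order, [lie a (Y k)] commutes with [a] itself and therefore
    vanishes. *)
Lemma commuting_series (Y T : nat -> M) : Y 0%N = 1%:M -> conv Y (const_ser a) = conv T Y ->
  (forall k, lie a (T k) = 0) -> forall k, lie a (Y k) = 0.
Proof.
move=> Y0 YT aT; elim/ltn_ind => k IH; apply: (lie_lie0 a_diag).
have T0 : T 0%N = a.
  by have := congr1 (fun s => s 0%N) YT; rewrite !conv0 Y0 mulmx1 mul1mx.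
have -> : lie a (Y k) = - \sum_(i < k) T i.+1 *m Y (k - i.+1)%N.
  have := congr1 (fun s => s k) YT; rewrite conv_constr /conv big_ord_recl T0 subn0 /lie.
  rewrite (eq_bigr (fun i : 'I_k => T i.+1 *m Y (k - i.+1)%N)) // => ->.
  by rewrite opprD addrA subrr add0r.
rewrite lieN lie_sum ?oppr0 // => i; apply: lieM; first exact: aT.
by apply: IH; rewrite ltn_subrL /= (leq_ltn_trans _ (ltn_ord i)).
Qed.

Lemma diag_entry k : a k k = 0 +i* complex.Im (a k k).
Proof.
have := congr1 (fun A : M => A k k) a_un; rewrite !mxE; case: (a k k) => x y /eqP.
rewrite eq_complex /= => /andP[/eqP h _].
by congr (_ +i* _); lra.
Qed.

Lemma expdiagM (s : C) (T : M) i j : (expdiag a s *m T) i j = cexp (s * a i i) * T i j.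
Proof. by rewrite mul_diag_mx !mxE. Qed.
Lemma Mexpdiag (s : C) (T : M) i j : (T *m expdiag a s) i j = T i j * cexp (s * a j j).
Proof. by rewrite mul_mx_diag !mxE. Qed.

(** [e^(a l x)] has modulus 1 on the real axis, but its entries grow at
    different rates off it; comparing two lines in the strip leaves only the
    entries on which [a] is scalar. *)
Lemma strip_entry (W : set C) (x : R) (tx t0 : nat -> M) :
  (forall K s1 s2 : R, 0 < s1 -> s1 < s2 -> exists l, [/\ W l, K < cn l & s1 < complex.Im l < s2]) ->
  x != 0 ->
  (forall N, exists Tx T0 : C -> M, [/\ asyN W N Tx tx, asyN W N T0 t0 &
     exists K B : R, forall l, W l -> K < cn l -> `|complex.Im l| <= 1 -> exists2 er : M,
       nm er <= B * cn l ^- N &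
       expdiag a (l * x%:C) *m Tx l = (T0 l + er) *m expdiag a (l * x%:C)]) ->
  forall k, lie a (tx k) = 0 /\ lie a (t0 k) = 0.
Proof.
move=> hW x0 h.
suff hs i j : a i i != a j j -> forall k, tx k i j = 0 /\ t0 k i j = 0.
  move=> k; split; apply/matrixP => i j; rewrite lie_diagE // mxE; have [->|/hs/(_ k)[h1 h2]] := eqVneq (a i i) (a j j);
  by rewrite ?subrr ?mul0r // ?h1 ?h2 mulr0.
move=> aij; elim/ltn_ind => k IH.
(* [expR (- (th * complex.Im l))] is the ratio of the moduli of the two
   exponentials. *)
pose th := x * (complex.Im (a i i) - complex.Im (a j j)).
have th0 : th != 0.
  rewrite mulf_neq0 // subr_eq0; apply: contra_neq aij => e.
  by rewrite (diag_entry i) (diag_entry j) e.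
have [Tx' [T0' [hTx hT0 [K0 [B hB]]]]] := h k.+1.
have tail (T : C -> M) (t : nat -> M) : asyN W k.+1 T t -> (forall m, (m < k)%N -> t m i j = 0) ->
    exists K B : R, forall l, W l -> K < cn l -> cn (l ^+ k.+1 * T l i j - l * t k i j) <= B.
  move=> /asyN_bd[K [B' hB']] ht; exists (Num.max K 0), B' => l Wl; rewrite gt_max => /andP[Kl l0].
  apply: le_trans (hB' l Wl Kl); apply: le_trans (cn_nm _ i j).
  have l0' : l != 0 by rewrite -cn_gt0.
  rewrite !mxE summxE big_ord_recr /= big1 ?add0r => [|m _]; last by rewrite mxE ht ?mulr0 //.
  by rewrite mxE mulrBr mulrA exprS mulfK ?expf_neq0.
have [K1 [B1 hB1]] := tail _ _ hTx (fun m mk => (IH m mk).1).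
have [K2 [B2 hB2]] := tail _ _ hT0 (fun m mk => (IH m mk).2).
suff [h1 h2] : cn (tx k i j) = 0 /\ cn (t0 k i j) = 0.
  by split; apply/eqP; rewrite -cn_eq0 ?h1 ?h2.
apply: (@strip_zero _ _ _ th) => //; first exact: cn_ge0.
move=> e s1 s2 e0 s10 s12 s21.
pose K := (expR `|th| * B1 + B2 + B) / e.
have [l [Wl Kl /andP[l1 l2]]] := hW (Num.max (Num.max K1 K2) (Num.max (Num.max K K0) 1)) s1 s2 s10 s12.
exists (complex.Im l); first by rewrite l1 l2.
move: Kl; rewrite !gt_max => /andP[/andP[k1 k2] /andP[/andP[k3 k0] k4]].
have cl : 0 < cn l := lt_trans ltr01 k4.
have Il : `|complex.Im l| <= 1 by rewrite ger0_norm; lra.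
have [er her eqe] := hB l Wl k0 Il.
have b1 := hB1 l Wl k1; have b2 := hB2 l Wl k2.
have cE m : cn (cexp (l * x%:C * a m m)) = expR (- (x * complex.Im (a m m) * complex.Im l)).
  by rewrite cexp_cn {1}(diag_entry m) !ReM ImM /=; congr expR; ring.
have := congr1 (fun A : M => A i j) eqe; rewrite expdiagM Mexpdiag mxE.
move: (cexp _) (cE i) (cexp _) (cE j) => ei ciE ej cjE eqij.
have ej0 : 0 < cn ej by rewrite cjE expR_gt0.
have eij : expR (- (th * complex.Im l)) = cn ei / cn ej.
  by rewrite ciE cjE -expRN -expRD; congr expR; rewrite /th; ring.
have key : cn (ei * (l * tx k i j) - ej * (l * t0 k i j)) <= cn ei * B1 + cn ej * B2 + cn ej * B.
  have -> : ei * (l * tx k i j) - ej * (l * t0 k i j) =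
     ej * (l ^+ k.+1 * T0' l i j - l * t0 k i j) + ej * (l ^+ k.+1 * er i j) - ei * (l ^+ k.+1 * Tx' l i j - l * tx k i j).
    transitivity (l ^+ k.+1 * ((T0' l i j + er i j) * ej) - ej * (l * t0 k i j) - ei * (l ^+ k.+1 * Tx' l i j - l * tx k i j)); last by ring.
    by rewrite -eqij; ring.
  apply: le_trans (cnB _ _) _; rewrite addrC -addrA; apply: lerD.
    by rewrite cnM; apply: ler_wpM2l; rewrite ?cn_ge0.
  apply: le_trans (cnD _ _) _; rewrite !cnM; apply: lerD; apply: ler_wpM2l; rewrite ?cn_ge0 //.
  rewrite cnX mulrC -ler_pdivlMr ?exprn_gt0 //.
  exact: le_trans (cn_nm _ _ _) her.
have key2 : cn l * `|cn ei * cn (tx k i j) - cn ej * cn (t0 k i j)| <= cn ei * B1 + cn ej * B2 + cn ej * B.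
  apply: le_trans key; rewrite -[X in X * _]ger0_norm ?cn_ge0 // -normrM mulrBr.
  have -> : cn l * (cn ei * cn (tx k i j)) = cn (ei * (l * tx k i j)) by rewrite !cnM mulrCA.
  have -> : cn l * (cn ej * cn (t0 k i j)) = cn (ej * (l * t0 k i j)) by rewrite !cnM mulrCA.
  move: (ei * _) (ej * _) => y z; rewrite ler_norml; apply/andP; split.
    by have := cnD (z - y) y; rewrite subrK -(cnN (z - y)) opprB; lra.
  by have := cnD (y - z) z; rewrite subrK; lra.
have key3 : cn l * `|expR (- (th * complex.Im l)) * cn (tx k i j) - cn (t0 k i j)| <= expR `|th| * B1 + B2 + B.
  have B10 : 0 <= B1 := le_trans (cn_ge0 _) b1.
  have -> : `|expR (- (th * complex.Im l)) * cn (tx k i j) - cn (t0 k i j)| =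
      `|cn ei * cn (tx k i j) - cn ej * cn (t0 k i j)| / cn ej.
    rewrite -[X in _ = _ / X]gtr0_norm // -normrV ?unitfE ?lt0r_neq0 // -normrM; congr `|_|.
    by rewrite eij; field; rewrite lt0r_neq0.
  rewrite mulrA ler_pdivrMr //; apply: le_trans key2 _.
  have : cn ei <= expR `|th| * cn ej.
    rewrite -ler_pdivrMr // -eij ler_expR.
    apply: le_trans (ler_norm _) _; rewrite normrN normrM ler_piMr //.
  by move=> /(ler_wpM2r B10); lra.
move: k3; rewrite ltr_pdivrMr // => k3.
rewrite -(ler_pM2l cl); apply: le_trans key3 _.
by rewrite ltW // (lt_le_trans k3) // mulrC.
Qed.
End DensityUniqueness.
Section DensitiesUnique.
Variables (R : realType) (n : nat).
Notation C := R[i].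
Notation M := 'M[C]_n.
Variable a : M.
Hypothesis a_diag : is_diag_mx a.
Hypothesis a_un : in_un a.

(** The densities are determined by [v]: every reduced wave function differs
    from the formal gauge by a series commuting with [a], hence with [b]. *)
Theorem densities_unique (b : M) (v : R -> M) (m d : nat -> R -> M) Q :
  (forall x, lie a x = 0 -> lie b x = 0) -> mcont v -> (forall x, in_un (v x)) ->
  (forall x, m 0%N x = 1%:M) -> (forall x, d 0%N x = 1%:M) ->
  (forall x, conv (fun k => d k x) (fun k => m k x) = const_ser 1%:M) ->
  (forall x, conv (fun k => m k x) (fun k => d k x) = const_ser 1%:M) ->
  (forall k x, has_deriv (fun y => conv (fun k => d k y) (conv (const_ser a) (fun k => m k y)) k) x
     (lie (conv (fun k => d k x) (conv (const_ser a) (fun k => m k x)) k.+1) a +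
      lie (conv (fun k => d k x) (conv (const_ser a) (fun k => m k x)) k) (v x))) ->
  is_Q a b v Q ->
  forall k x, Q k x = conv (fun k => d k x) (conv (const_ser b) (fun k => m k x)) k.
Proof.
move=> hb cv uv m0 d0 dm md dq [Z [mu [[hZ [_ hmu] [Mw [hM hM0]] [F [_ hF hFd]] _] hQ]]] k x.
pose W := nonreal_off Z.
pose q k x := conv (fun k => d k x) (conv (const_ser a) (fun k => m k x)) k.
have [Y [Y0 Yd Yu _]] := fund_lax a_un cv uv.
have unit y l : W l -> mu y l \in unitmx by move=> /hmu -/(_ y)[].
have FY y l : W l -> F y l = Y y l.
  move=> Wl; have F0 : F 0 l = 1%:M.
    rewrite hF // mulr0 /expdiag.
    have -> : \row_k0 cexp ((0 : C) * a k0 k0) = const_mx 1.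
      apply/matrixP => i j; rewrite !mxE mul0r /cexp /= expR0 cos0 sin0.
      by apply/eqP; rewrite eq_complex /= !mul1r mulr0 subr0 mul0r addr0 !eqxx.
    by rewrite diag_const_mx mulmx1 mulVmx // unit.
  have := @sol_unique R n (fun y => l *: a + v y) (fun y => Y y l) (fun y => adjmx (Y y (conjc l))) (fun y => F y l).
  rewrite F0 => -> //; rewrite ?mul1mx //.
  - move=> z; exact: (@hd_cofund R n (fun y l => l *: a + v y) Y z (fun l => lax_adj a_un l (uv z)) (Yd z)).
  move=> z; have [u [D [hD <-]]] := hFd z l.
  by rewrite mulKVmx.
have asM y N : asyN W N (mu y) (Mw^~ y) by exact: (asymptoticP _ _ _).1 (hM y) N.
have hinv y : exists Mi, [/\ conv Mi (Mw^~ y) = const_ser 1%:M, conv (Mw^~ y) Mi = const_ser 1%:M &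
    forall N, asyN W N (fun l => invmx (mu y l)) Mi].
  have [Mi [_ h1 h2]] := @conv_inv R n (Mw^~ y) (hM0 y).1; exists Mi; split=> //.
  by apply: (asyN_inv (asM y)) => // [|l Wl]; [exact: (hM0 y).1|rewrite mulmxV // unit].
pose T y N l := mu y l *m trunc (fun k => q k y) N l *m invmx (mu y l).
have q0 y : q 0%N y = a by rewrite /q conv0 conv_constl d0 m0 mulmx1 mul1mx.
have aT y Mi Mi0 j : y != 0 -> (forall N, asyN W N (fun l => invmx (mu y l)) Mi) ->
    (forall N, asyN W N (fun l => invmx (mu 0 l)) Mi0) ->
    lie a (conv (conv (Mw^~ y) (fun k => q k y)) Mi j) = 0 /\
    lie a (conv (conv (Mw^~ 0) (fun k => q k 0)) Mi0 j) = 0.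
  move=> y0 aMi aMi0; apply: (@strip_entry R n a a_diag a_un W y _ _ _ y0 _ j); first exact: strip_unbd.
  move=> N; exists (T y N), (T 0 N); split.
  + by apply: asyNM => //; apply: asyNM => //; apply: trunc_asy.
  + by apply: asyNM => //; apply: asyNM => //; apply: trunc_asy.
  have [B B0 hB] := conj_trunc a_un uv q0 dq Y0 Yd Yu y N.
  have [K1 [c1 h1]] := asyN_bound (asM 0 0%N).
  have [K2 [c2 h2]] := asyN_bound (aMi0 0%N).
  exists (Num.max 0 (Num.max K1 K2)), (c1 * B * c2) => l Wl.
  rewrite !gt_max => /and3P[l0 /(h1 l Wl) b1 /(h2 l Wl) b2] Il.
  rewrite cn_gt0 in l0; have := hB l l0 Il; move: (Yu y l) (FY y l Wl); rewrite hF //.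
  have := mulVmx (unit 0 l Wl); have := mulmxV (unit y l Wl); have := mulmxV (unit 0 l Wl).
  rewrite /T; move: (trunc (fun k => q k y) N l) (trunc (fun k => q k 0) N l) b1 b2 => ty t0.
  move: (mu 0 l) (mu y l) (invmx (mu 0 l)) (invmx (mu y l)) (adjmx _) (Y y l) (expdiag _ _).
  move=> m0' my m0i myi Yi Y1 e b1 b2 e1 e2 e3 YY eY bE.
  have YY' := mulmx1C YY.
  exists (m0' *m (Y1 *m ty *m Yi - t0) *m m0i).
    rewrite -[_ / _]mulrA [c2 / _]mulrC !mulrA -[c1 * B / _]mulrA.
    apply: le_trans (nmM _ _) _; apply: ler_pM; rewrite ?nm_ge0 //.
    by apply: le_trans (nmM _ _) _; apply: ler_pM; rewrite ?nm_ge0.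
  rewrite mulmxBr mulmxBl addrC subrK.
  have h3 : Yi *m (m0i *m e) = myi.
    have -> : m0i *m e = Y1 *m myi by rewrite -eY -(mulmxA (m0i *m e)) e2 mulmx1.
    by rewrite mulmxA YY' mul1mx.
  have h4 : m0' *m Y1 = e *m my by rewrite -eY !mulmxA e1 mul1mx.
  by rewrite -[RHS]mulmxA -[RHS]mulmxA -[_ *m Yi *m _]mulmxA h3 !mulmxA h4.
pose Mx := Mw^~ x.
have [Mi [hMi1 hMi2 asMi aTx]] : exists Mi, [/\ conv Mi Mx = const_ser 1%:M, conv Mx Mi = const_ser 1%:M,
    forall N, asyN W N (fun l => invmx (mu x l)) Mi &
    forall j, lie a (conv (conv Mx (fun k => q k x)) Mi j) = 0].
  have [Mi [e1 e2 e3]] := hinv x; exists Mi; split => // j.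
  have [x0|x0] := eqVneq x 0; last first.
    by have [Mi0 [_ _ f3]] := hinv 0; have [] := aT x Mi Mi0 j x0 e3 f3.
  have [M1 [_ _ f3]] := hinv 1; rewrite /Mx x0 in e3 *.
  by have [] := aT 1 M1 Mi j (oner_neq0 R) f3 e3.
(* [S] compares the wave function with the formal gauge. *)
pose S := conv Mx (fun k => d k x).
have Sm : conv S (fun k => m k x) = Mx by rewrite /S -convA dm conv1r.
have aS : forall j, lie a (S j) = 0.
  apply: (@commuting_series R n a a_diag S (conv (conv Mx (fun k => q k x)) Mi)) => //.
    by rewrite /S conv0 d0 mulmx1; exact: (hM0 x).1.
  rewrite /S -!convA [conv Mi _]convA hMi1 conv1l.
  by rewrite md conv1r.
have Sb : conv S (const_ser b) = conv (const_ser b) S.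
  by apply/funext => j; rewrite conv_constl conv_constr; apply/esym/lie_swap/hb.
have eQ : conv Mi (conv (const_ser b) Mx) = conv (fun k => d k x) (conv (const_ser b) (fun k => m k x)).
  rewrite -Sm [conv (const_ser b) (conv S _)]convA -Sb -convA /S.
  by rewrite -convA [conv Mi _]convA hMi1 conv1l.
have hW : unbd W.
  by move=> K; have [l [Wl Kl _]] := strip_unbd hZ K (ltr01) (ltr1n R 2); exists l.
have h1 : asyN W k.+1 (fun l => invmx (mu x l) *m b *m mu x l) (Q^~ x) := (asymptoticP _ _ _).1 (hQ x) k.+1.
have h2 : asyN W k.+1 (fun l => invmx (mu x l) *m b *m mu x l) (conv Mi (conv (const_ser b) Mx)).
  have := asyNM (asMi k.+1) (asyNM (asyN_cst W k.+1 b) (asM x k.+1)).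
  by apply: (@asyN_near _ _ _ _ 0) => l _ _; rewrite mulmxA.
by rewrite -eQ; exact: (asyN_unique hW h1 h2 (leqnn k)).
Qed.
End DensitiesUnique.
(** * The frame of a solution *)

Section MatrixEntries.
Variables (A : pzRingType) (n : nat).
Implicit Types x y : 'M[A]_n.
Lemma entD x y i j : (x + y) i j = x i j + y i j. Proof. by rewrite mxE. Qed.
Lemma entN x i j : (- x) i j = - x i j. Proof. by rewrite mxE. Qed.
Lemma entZ c x i j : (c *: x) i j = c * x i j. Proof. by rewrite mxE. Qed.
End MatrixEntries.

(* Identities between noncommutative polynomials in matrices. *)
Ltac mxnorm := rewrite ?(mulmxDl, mulmxDr, mulmxBl, mulmxBr, mulNmx, mulmxN, mul0mx, mulmx0, mul1mx, mulmx1, mulmxA, scaler0, oppr0, subr0, addr0).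
Ltac mxZ := rewrite -?(scalemxAl, scalemxAr).
Ltac mxlin := apply/matrixP => ? ?; rewrite ?(entD, entN, entZ); ring.
Ltac ncring := repeat progress (mxnorm; mxZ); mxlin.
Section QuadraticEstimate.
Variables (R : realType) (n : nat).
Notation C := R[i].

Lemma is_derive_quad (f : R -> R) (x d K : R) : 0 <= K ->
  (forall h : R, `|h| <= 1 -> `|f (x + h) - f x - h * d| <= K * `|h| ^+ 2) -> is_derive x 1 f d.
Proof.
move=> K0 hf.
have hc : (fun h => h^-1 *: (f (h *: (1 : R^o) + x) - f x)) @ (0 : R^o)^' --> d.
  apply/cvgrPdist_le => e e0.
  have K1 : 0 < K + 1 by rewrite ltr_wpDl.
  exists (Num.min 1 (e / (K + 1))); first by rewrite /= lt_min ltr01 divr_gt0.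
  move=> h /=; rewrite sub0r normrN lt_min => /andP[h1 h2] hn0.
  have -> : d - h^-1 *: (f (h *: 1 + x) - f x) = - (h^-1 * (f (x + h) - f x - h * d)).
    rewrite [h *: 1](_ : _ = h); last by rewrite /GRing.scale /= mulr1.
    by rewrite [h + x]addrC /GRing.scale /=; field.
  rewrite normrN normrM normfV mulrC ler_pdivrMr ?normr_gt0 //.
  apply: le_trans (hf h (ltW h1)) _; rewrite expr2 mulrA ler_wpM2r //.
  move: h2; rewrite ltr_pdivlMr // => /ltW; apply: le_trans.
  by rewrite mulrDr mulr1 mulrC lerDl.
by apply: DeriveDef; [apply/cvg_ex; exists d|apply: cvg_lim].
Qed.

Lemma hd_quad (f : R -> 'M[C]_n) (x : R) D (K : R) : 0 <= K ->
  (forall h : R, `|h| <= 1 -> nm (f (x + h) - f x - h%:C *: D) <= K * `|h| ^+ 2) -> has_deriv f x D.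
Proof.
move=> K0 hf i j.
have e h : (f (x + h) - f x - h%:C *: D) i j = f (x + h) i j - f x i j - h%:C * D i j by rewrite !mxE.
split; apply: (@is_derive_quad _ _ _ K) => // h h1; apply: le_trans (hf h h1);
  apply: le_trans (cn_nm _ i j); rewrite e.
  by apply: le_trans (cn_re _); rewrite !raddfB /= ReM /= mul0r subr0.
by apply: le_trans (cn_im _); rewrite !raddfB /= ImM /= mul0r addr0.
Qed.

Lemma taylor2 (u ut utt : R -> R -> 'M[C]_n) :
  (forall x t, has_deriv (u x) t (ut x t)) -> (forall x t, has_deriv (ut x) t (utt x t)) ->
  jc ut -> jc utt -> forall (X t : R), exists2 K, 0 <= K & forall x h, `|x| <= X -> `|h| <= 1 ->
    nm (u x (t + h) - u x t) <= K * `|h| /\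
    nm (u x (t + h) - u x t - h%:C *: ut x t) <= K * `|h| ^+ 2.
Proof.
move=> hu hut c1 c2 X t.
have [b1 b10 hb1] := @jc_bound _ _ ut X (`|t| + 1) c1.
have [b2 b20 hb2] := @jc_bound _ _ utt X (`|t| + 1) c2.
have tb h : `|h| <= 1 -> `|t + h| <= `|t| + 1.
  by move=> h1; apply: le_trans (ler_normD _ _) _; rewrite lerD2l.
pose k := Kn R n; have k0 : 0 <= k := Kn_ge0 R n.
exists (k * b1 + k * (k * b2)); first by rewrite addr_ge0 ?mulr_ge0.
have s h : `|h| <= 1 -> forall g dg : R -> 'M[C]_n, (forall z, has_deriv g z (dg z)) ->
  forall c, (forall z, `|z| <= `|h| -> nm (dg (t + z)) <= c) -> nm (g (t + h) - g t) <= k * (c * `|h|).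
  move=> h1 g dg hg c hc; have := @hd_mv R n (fun z => g (t + z)) (fun z => dg (t + z)) `|h| c _ hc h (lexx _).
  by rewrite addr0; apply=> z _; apply: hd_shift.
move=> x h xX h1; split.
  apply: le_trans (s h h1 _ _ (hu x) b1 _) _.
    by move=> z zh; apply: hb1 => //; apply: tb; apply: le_trans h1.
  by rewrite [X in X <= _]mulrA; apply: ler_wpM2r; rewrite // lerDl !mulr_ge0.
pose G z := u x (t + z) - z%:C *: ut x t.
have dG z : has_deriv G z (ut x (t + z) - ut x t).
  apply: hd_sub; first exact: hd_shift.
  have := hd_scale (hdc_real (is_derive_id z (1 : R))) (hd_cst (ut x t) z).
  by move=> h'; apply: hd_eq h' _; rewrite scaler0 addr0 scale1r.
have := @hd_mvk R n G _ `|h| (k * b2) 1 (fun z _ => dG z) _ h (lexx _).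
rewrite /G addr0 scale0r subr0 => hh.
have -> : u x (t + h) - u x t - h%:C *: ut x t = u x (t + h) - h%:C *: ut x t - u x t by rewrite addrAC.
apply: le_trans (hh _) _.
  move=> z zh; rewrite expr1 -mulrA; apply: s (hut x) _ _; first exact: le_trans h1.
  by move=> y yz; apply: hb2 => //; apply: tb; apply: le_trans h1; apply: le_trans zh.
rewrite -/k mulrA -mulrA mulrA; have h2 : 0 <= `|h| ^+ 2 by rewrite exprn_ge0.
have : 0 <= k * b1 by rewrite mulr_ge0.
have : 0 <= k * (k * b2) * `|h| ^+ 2 by rewrite !mulr_ge0.
have : 0 <= k * b1 * `|h| ^+ 2 by rewrite !mulr_ge0.
by rewrite mulrDl; nra.
Qed.
End QuadraticEstimate.

Section Holomorphy.
Variables (R : realType) (n : nat).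
Notation C := R[i].
Implicit Types f g : C -> 'M[C]_n.

Lemma holoP f z : holo_at f z <-> exists2 d : R, 0 < d &
  forall w, cn (w - z) < d -> forall i j, derivable (fun s : C^o => f s i j : C^o) w 1.
Proof.
split=> [h|[d d0 h] i j]; last by apply/nbhsCP; exists d => // w /h.
have fz : Filter (nbhs (z : C^o)) by exact: nbhs_filter.
have : nbhs (z : C^o) [set w | forall i j, derivable (fun s : C^o => f s i j : C^o) w 1].
  apply: (@filter_forall C 'I_n (fun i w => forall j, derivable (fun s : C^o => f s i j : C^o) w 1) _ fz) => i.
  exact: (@filter_forall C 'I_n (fun j w => derivable (fun s : C^o => f s i j : C^o) w 1) _ fz (h i)).
by move=> /nbhsCP[d d0 hd]; exists d.
Qed.

Lemma holo_at_cst (b : 'M[C]_n) z : holo_at (fun=> b) z.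
Proof. by apply/holoP; exists 1 => // w _ i j; apply: derivable_cst. Qed.
Lemma holo_atM f g z : holo_at f z -> holo_at g z -> holo_at (fun l => f l *m g l) z.
Proof.
move=> /holoP[d d0 h] /holoP[d' d'0 h']; apply/holoP; exists (Num.min d d'); first by rewrite lt_min d0.
move=> w; rewrite lt_min => /andP[/h wd /h' wd'] i j.
have -> : (fun s : C^o => (f s *m g s) i j : C^o) = \sum_k (fun s : C^o => (f s i k : C^o)) * (fun s : C^o => (g s k j : C^o)).
  by apply/funext => s; rewrite mxE fct_sumE.
by apply: derivable_sum => k; apply: derivableM.
Qed.
Lemma holo_atD f g z : holo_at f z -> holo_at g z -> holo_at (fun l => f l + g l) z.
Proof.
move=> /holoP[d d0 h] /holoP[d' d'0 h']; apply/holoP; exists (Num.min d d'); first by rewrite lt_min d0.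
move=> w; rewrite lt_min => /andP[/h wd /h' wd'] i j.
have -> : (fun s : C^o => (f s + g s) i j : C^o) = (fun s : C^o => f s i j : C^o) + (fun s : C^o => g s i j : C^o).
  by apply/funext => s; rewrite mxE.
exact: derivableD.
Qed.
Lemma holo_scal (h : C -> C) z (d : R) : 0 < d -> (forall w, cn (w - z) < d -> derivable (fun s : C^o => h s : C^o) w 1) ->
  holo_at (fun l => (h l)%:M : 'M[C]_n) z.
Proof.
move=> d0 hh; apply/holoP; exists d => // w /hh hw i j; have [->|ij] := eqVneq i j.
  by have -> : (fun s : C^o => ((h s)%:M : 'M[C]_n) j j : C^o) = (fun s : C^o => h s : C^o) by apply/funext => s; rewrite mxE eqxx mulr1n.
have -> : (fun s : C^o => ((h s)%:M : 'M[C]_n) i j : C^o) = cst 0 by apply/funext => s; rewrite mxE (negbTE ij).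
exact: derivable_cst.
Qed.
Lemma holo_pole (a z : C) : z != a -> holo_at (fun l => ((l - a)^-1)%:M : 'M[C]_n) z.
Proof.
move=> za; apply: (@holo_scal _ _ (cn (z - a))); first by rewrite cn_gt0 subr_eq0.
move=> w wz; have wa : w != a by move: wz; apply: contraTneq => ->; rewrite -cnN opprB ltxx.
apply: derivableV; first by rewrite subr_eq0.
by apply: derivableB; [exact: derivable_id|exact: derivable_cst].
Qed.
Lemma entireM f g : entire f -> entire g -> entire (fun l => f l *m g l).
Proof. by move=> hf hg z; apply: holo_atM. Qed.
Lemma mero_at_holo f z : holo_at f z -> mero_at f z.
Proof. by move=> h; exists 0%N, f; split=> //; apply/dnbhsCP; exists 1 => // w _ _; rewrite expr0 scale1r. Qed.
End Holomorphy.

Section Trivialization.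
Variables (R : realType) (n : nat).
Notation C := R[i].
Notation M := 'M[C]_n.
Variable a : M.
Hypothesis a_un : in_un a.

(** The coefficient of the [t] equation, a polynomial in the spectral
    parameter. *)
Definition lpol (j : nat) (c : nat -> R -> R -> M) (x t : R) (l : C) : M :=
  \sum_(k < j.+1) l ^+ k *: c k x t.

(** Zero curvature condition for the pair [a l + u], [lpol j c]. *)
Definition zero_curv j (u : R -> R -> M) (c : nat -> R -> R -> M) := exists ut,
  (forall x t, has_deriv (u x) t (ut x t)) /\
  forall x t l, has_deriv (fun y => lpol j c y t l) x
    (ut x t - lie (l *: a + u x t) (lpol j c x t l)).

Lemma lpol_adj j c x t l : (forall k x t, in_un (c k x t)) -> adjmx (lpol j c x t (conjc l)) = - lpol j c x t l.
Proof. by move=> h; exact: (@pol_adj R n j (fun k x => c k x t) (fun k x => h k x t) x l). Qed.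

Lemma smooth_mcontx (f : R -> R -> M) t : smooth f -> mcont (fun x => f x t).
Proof. by move=> /smooth_partials[fx [ft [h _ _ _]]]; apply: hd_mcont (fun x => h x t). Qed.
Lemma smooth_mcontt (f : R -> R -> M) x : smooth f -> mcont (f x).
Proof. by move=> /smooth_partials[fx [ft [_ h _ _]]]; apply: hd_mcont (h x). Qed.

(** [E' E^-1] has both partial derivatives 0. *)
Lemma lax_solution_unique (u : R -> R -> M) (B : R -> R -> C -> M) (E E' : R -> R -> C -> M) (l : C) :
  (forall x t, in_un (u x t)) -> (forall x t l, adjmx (B x t (conjc l)) = - B x t l) ->
  (forall x t l, has_deriv (fun y => E y t l) x (E x t l *m (l *: a + u x t))) ->
  (forall x t l, has_deriv (fun s => E x s l) t (E x t l *m B x t l)) ->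
  (forall x t l, E x t l *m adjmx (E x t (conjc l)) = 1%:M) ->
  E 0 0 l = 1%:M ->
  (forall x t, has_deriv (fun y => E' y t l) x (E' x t l *m (l *: a + u x t))) ->
  (forall x t, has_deriv (fun s => E' x s l) t (E' x t l *m B x t l)) ->
  forall x t, E' x t l = E' 0 0 l *m E x t l.
Proof.
move=> uu uB Ex Et EE E0 Ex' Et' x t.
pose Ei x t := adjmx (E x t (conjc l)).
have EiE x' t' : Ei x' t' *m E x' t' l = 1%:M by apply: mulmx1C; apply: EE.
have dx' y s : has_deriv (fun y => Ei y s) y (- ((l *: a + u y s) *m Ei y s)).
  exact: (@hd_cofund R n (fun y l => l *: a + u y s) (fun y l => E y s l) y (fun l => lax_adj a_un l (uu y s)) (fun l => Ex y s l)).
have dt' y s : has_deriv (fun s => Ei y s) s (- (B y s l *m Ei y s)).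
  exact: (@hd_cofund R n (fun s l => B y s l) (fun s l => E y s l) s (uB y s) (fun l => Et y s l)).
have cst (G : R -> R -> M) : (forall x t, has_deriv (fun y => G y t) x 0) -> (forall x t, has_deriv (G x) t 0) -> G x t = G 0 0.
  move=> h1 h2; rewrite (hd_cst0 (f := fun y => G y t) x 0) //.
  exact: (hd_cst0 (f := G 0) t 0).
have : E' x t l *m Ei x t = E' 0 0 l *m Ei 0 0.
  apply: (cst (fun x t => E' x t l *m Ei x t)) => y s.
    by apply: hd_eq (hd_mul (Ex' y s) (dx' y s)) _; rewrite mulmxN mulmxA subrr.
  by apply: hd_eq (hd_mul (Et' y s) (dt' y s)) _; rewrite mulmxN mulmxA subrr.
have -> : Ei 0 0 = 1%:M by have := EE 0 0 l; rewrite E0 mul1mx.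
rewrite mulmx1 => <-; by rewrite -mulmxA EiE mulmx1.
Qed.

(** The flow in [t] of a solution of the [x] equation is found by varying the
    coefficient, and zero curvature identifies it. *)
Theorem lax_solution_exists j (u : R -> R -> M) (c : nat -> R -> R -> M) :
  smooth u -> (forall x t, in_un (u x t)) -> (forall k, smooth (c k)) ->
  (forall k x t, in_un (c k x t)) -> zero_curv j u c ->
  exists E : R -> R -> C -> M,
  [/\ forall l, E 0 0 l = 1%:M,
      forall x t l, has_deriv (fun y => E y t l) x (E x t l *m (l *: a + u x t)),
      forall x t l, has_deriv (fun s => E x s l) t (E x t l *m lpol j c x t l),
      forall x t l, E x t l *m adjmx (E x t (conjc l)) = 1%:M
    & forall x t, entire (E x t)].
Proof.
move=> su uu sc uc [ut [hut zc]].
have hF t : exists Y : R -> C -> M,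
  [/\ forall l, Y 0 l = 1%:M,
      forall x l, has_deriv (fun y => Y y l) x (Y x l *m (l *: a + u x t)),
      forall x l, Y x l *m adjmx (Y x (conjc l)) = 1%:M
    & forall x, entire (Y x)].
  by apply: fund_lax => //; apply: smooth_mcontx.
have [F hF'] := choice hF.
have F0 t l : F t 0 l = 1%:M by have [] := hF' t.
have Fx t x l : has_deriv (fun y => F t y l) x (F t x l *m (l *: a + u x t)) by have [] := hF' t.
have FF t x l : F t x l *m adjmx (F t x (conjc l)) = 1%:M by have [] := hF' t.
have Fe t x : entire (F t x) by have [] := hF' t.
have [k t|k|e [e0 et ee eE]] := @fundamental R n j (fun k t => c k 0 t).
- exact: uc.
- exact: smooth_mcontt.
pose Fi t x l := adjmx (F t x (conjc l)).
have Fix t x l : has_deriv (fun y => Fi t y l) x (- ((l *: a + u x t) *m Fi t x l)).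
  exact: (@hd_cofund R n (fun x l => l *: a + u x t) (F t) x (fun l => lax_adj a_un l (uu x t)) (Fx t x)).
have FiF t x l : Fi t x l *m F t x l = 1%:M by apply: mulmx1C; apply: FF.
have Ft x t l : has_deriv (fun s => F s x l) t (F t x l *m lpol j c x t l - lpol j c 0 t l *m F t x l).
  have [ux [ut' [_ hut' _ sut']]] := smooth_partials su.
  have eut : ut = ut' by apply/funext=> y; apply/funext => s; apply: hd_unique (hut y s) (hut' y s).
  have [_ [utt [_ hutt _ sutt]]] := smooth_partials sut'.
  rewrite -eut in hutt sut'.
  have [K1 K10 hK1] := taylor2 hut hutt (smooth_jc sut') (smooth_jc sutt) `|x| t.
  have c0 : 0 <= 2 * `|complex.Im l| * nm a by rewrite !mulr_ge0 ?nm_ge0.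
  have [K2 K20 hK2] := @sol_bound R n `|x| _ c0.
  have [K K0 hK] := @perturb R n `|x| (K1 + K2) (normr_ge0 x) (addr_ge0 K10 K20).
  (* By zero curvature, [T] is the primitive of [F ut F^-1]. *)
  pose T y := F t y l *m lpol j c y t l *m Fi t y l - lpol j c 0 t l.
  have Fb s y (l' : C) : `|complex.Im l'| = `|complex.Im l| -> `|y| <= `|x| -> nm (F s y l') <= K1 + K2.
    move=> el yx; apply: (@le_trans _ _ K2); last by rewrite lerDr.
    apply: (hK2 (fun y => l' *: a + u y s) (fun y => F s y l')) => // z zx.
    by have := nm_lax_herm a_un l' (uu z s); rewrite el; apply.
  apply: (@hd_quad R n _ _ _ K) => // h h1.
  have := hK (fun y => l *: a + u y t) (fun y => l *: a + u y (t + h)) (fun y => ut y t)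
     (fun y => F t y l) (fun y => Fi t y l) (fun y => F (t + h) y l) T h%:C
     (F0 t l) (F0 (t + h) l) _ _ (fun y => FF t y l) _ _ x (lexx _).
  have -> : T x *m F t x l = F t x l *m lpol j c x t l - lpol j c 0 t l *m F t x l.
    by rewrite /T mulmxBl -[_ *m Fi t x l *m _]mulmxA FiF mulmx1.
  rewrite cn_real; apply.
  - by rewrite /T /Fi !F0 adj1 mulmx1 mul1mx subrr.
  - move=> y _; split=> //.
    have h2 := hd_sub (hd_mul (hd_mul (Fx t y l) (zc y t l)) (Fix t y l)) (hd_cst (lpol j c 0 t l) y).
    apply: hd_eq h2 _; move: (F t y l) (Fi t y l) (l *: a + u y t) (lpol _ _ _ _ _) (ut y t) => Y Yi A B U.
    by rewrite /lie; ncring.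
  - move=> y yx; split; last exact: Fb.
      exact: Fb.
    by rewrite nm_adj; apply: Fb => //; case: (l) => ? ? /=; rewrite normrN.
  move=> y yx; have [k1 k2] := hK1 y h yx h1; rewrite opprD addrACA subrr add0r.
  have K12 : K1 <= K1 + K2 by rewrite lerDl.
  split; first exact: le_trans k1 (ler_wpM2r (normr_ge0 h) K12).
  exact: le_trans k2 (ler_wpM2r (exprn_ge0 2 (normr_ge0 h)) K12).
exists (fun x t l => e t l *m F t x l); split.
- by move=> l; rewrite e0 F0 mul1mx.
- by move=> x t l; apply: hd_eq (hd_mull _ (Fx t x l)) _; rewrite mulmxA.
- move=> x t l; apply: hd_eq (hd_mul (et t l) (Ft x t l)) _.
  by rewrite -[pol _ _ _ _]/(lpol j c 0 t l) mulmxBr !mulmxA addrC subrK.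
- move=> x t l; rewrite adjM mulmxA -[_ *m F t x l *m _]mulmxA FF mulmx1; exact: ee.
move=> x t; exact: entireM.
Qed.
End Trivialization.
Section Flow.
Variables (R : realType) (n : nat).
Notation C := R[i].
Notation M := 'M[C]_n.
Variables a b : M.
Hypothesis a_diag : is_diag_mx a.
Hypothesis a_un : in_un a.
Hypothesis b_un : in_un b.
Hypothesis ab_comm : lie a b = 0.
Hypothesis b_central : central_in_U a b.

(** Horner sum [q 0 l^(m-1) + ... + q (m-1)]: the polynomial part of [l^(m-1)]
    times the series with coefficients [q]. *)
Fixpoint hor (q : nat -> M) (m : nat) (l : C) : M :=
  if m is m'.+1 then l *: hor q m' l + q m' else 0.

Lemma horE q m l : hor q m.+1 l = \sum_(i < m.+1) l ^+ (m - i) *: q i.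
Proof.
elim: m => [|m IH]; first by rewrite big_ord1 /= scaler0 add0r expr0 scale1r.
rewrite big_ord_recr /= subnn expr0 scale1r -[X in l *: X + _]/(hor q m.+1 l) IH scaler_sumr; congr (_ + _).
by apply: eq_bigr => i _; rewrite scalerA -exprS subSn // -ltnS.
Qed.

Lemma hor_lpol j (q : nat -> R -> R -> M) x t l :
  lpol j (fun k => q (j - k)%N) x t l = hor (fun k => q k x t) j.+1 l.
Proof.
rewrite horE /lpol [RHS](reindex_inj rev_ord_inj) /=; apply: eq_bigr => i _.
by rewrite subSS subKn // -ltnS.
Qed.

Lemma hor_sum j (q : nat -> M) l : q 0%N = b ->
  l ^+ j *: b + \sum_(1 <= k < j.+1) l ^+ (j - k) *: q k = hor q j.+1 l.
Proof.
by move=> q0; rewrite horE -(big_mkord xpredT (fun k => l ^+ (j - k) *: q k)) big_ltn // subn0 q0.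
Qed.

(** The recursion makes the commutators telescope. *)
Lemma hd_hor (q : nat -> R -> M) (u : M) (x : R) m l : q 0%N x = b ->
  (forall k, has_deriv (q k) x (lie (q k.+1 x) a + lie (q k x) u)) ->
  has_deriv (fun y => hor (fun k => q k y) m l) x
    (lie (q m x) a - lie (l *: a + u) (hor (fun k => q k x) m l)).
Proof.
move=> q0 dq; elim: m => [|m IH] /=.
  apply: hd_eq (hd_cst 0 x) _; rewrite q0.
  have -> : lie b a = 0 by rewrite -(oppr0 M) -ab_comm /lie opprB.
  by rewrite /lie; ncring.
apply: hd_eq (hd_add (hd_Z l IH) (dq m)) _; rewrite /lie; ncring.
Qed.

(** The last clause makes [q] the only possible densities of [u]. *)
Definition densities (u : R -> R -> M) (q : nat -> R -> R -> M) :=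
  [/\ forall k, smooth (q k), forall k x t, in_un (q k x t), forall x t, q 0%N x t = b,
      forall k x t, has_deriv (fun y => q k y t) x (lie (q k.+1 x t) a + lie (q k x t) (u x t))
    & forall t Q, is_Q a b (u^~ t) Q -> Q = (fun k x => q k x t)].

Lemma densities_of (u : R -> R -> M) : smooth u -> (forall x t, in_un (u x t)) ->
  exists q, densities u q.
Proof.
move=> su uu; have hb := central_complex a_un b_central.
have [m [d [md0 mdi [sq uq] q0 rec]]] := densities_exist a_diag a_un b_un ab_comm hb su uu.
exists (qs d m b); split=> //.
- by move=> x t; have [] := q0 x t.
- by move=> k x t; apply: rec; right.
move=> t Q hQ; apply/funext => k; apply/funext => x.
apply: (@densities_unique R n a a_diag a_un b (u^~ t) (fun k x => m k x t) (fun k x => d k x t) Q hb _ _ _ _ _ _ _ hQ).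
- exact: smooth_mcontx.
- by move=> y.
- by move=> y; have [] := md0 y t.
- by move=> y; have [] := md0 y t.
- by move=> y; have [] := mdi y t.
- by move=> y; have [] := mdi y t.
by move=> i y; apply: rec; left.
Qed.

Variable j : nat.

(** In terms of the densities, the flow is [u_t = [q_(j+1), a]]. *)
Definition flow_pair (u : R -> R -> M) (q : nat -> R -> R -> M) :=
  [/\ densities u q, smooth u, forall x t, in_un (u x t)
    & forall x t, has_deriv (u x) t (lie (q j.+1 x t) a)].

Lemma flow_pair_of u : flow_solutions a b j u -> exists q, flow_pair u q /\ forall t, is_Q a b (u^~ t) (fun k x => q k x t).
Proof.
move=> [su uu _ [Q [hQ hu]]]; have uu' x t : in_un (u x t) by have [] := uu x t.
have [q dq] := densities_of su uu'; have [sq uq q0 rec uq'] := dq.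
have eQ t : Q t = (fun k x => q k x t) by apply: uq'.
exists q; split; last by move=> t; rewrite -eQ.
split=> // x t; have [Qx [h1 h2]] := hu x t.
rewrite eQ in h1 h2; apply: hd_eq h2 _.
by rewrite (hd_unique h1 (rec j x t)) -addrA /lie; ncring.
Qed.

Lemma flow_zero_curv u q : flow_pair u q -> zero_curv a j u (fun k => q (j - k)%N).
Proof.
move=> [[_ _ q0 rec _] _ _ ut]; exists (fun x t => lie (q j.+1 x t) a); split=> // x t l.
rewrite hor_lpol; apply: hd_ext (@hd_hor (fun k y => q k y t) (u x t) x j.+1 l (q0 x t) (fun k => rec k x t)) => y.
by rewrite hor_lpol.
Qed.

Definition lax_sol (u : R -> R -> M) (q : nat -> R -> R -> M) (E : R -> R -> C -> M) :=
  [/\ forall l, E 0 0 l = 1%:M,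
      forall x t l, has_deriv (fun y => E y t l) x (E x t l *m (l *: a + u x t)),
      forall x t l, has_deriv (fun s => E x s l) t (E x t l *m hor (fun k => q k x t) j.+1 l),
      forall x t l, E x t l *m adjmx (E x t (conjc l)) = 1%:M
    & forall x t, entire (E x t)].

Lemma hor_adj u q x t l : flow_pair u q ->
  adjmx (hor (fun k => q k x t) j.+1 (conjc l)) = - hor (fun k => q k x t) j.+1 l.
Proof. by move=> [[_ uq _ _ _] _ _ _]; rewrite -!hor_lpol lpol_adj. Qed.

Lemma lax_sol_exists u q : flow_pair u q -> exists E, lax_sol u q E.
Proof.
move=> h; have [[sq uq _ _ _] su uu _] := h.
have [E [E0 Ex Et EE eE]] := @lax_solution_exists R n a a_un j u (fun k => q (j - k)%N) su uu (fun k => sq _) (fun k => uq _) (flow_zero_curv h).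
by exists E; split=> // x t l; rewrite -hor_lpol.
Qed.

Lemma lax_sol_unique u q E E' l : flow_pair u q -> lax_sol u q E ->
  (forall x t, has_deriv (fun y => E' y t l) x (E' x t l *m (l *: a + u x t))) ->
  (forall x t, has_deriv (fun s => E' x s l) t (E' x t l *m hor (fun k => q k x t) j.+1 l)) ->
  forall x t, E' x t l = E' 0 0 l *m E x t l.
Proof.
move=> h [E0 Ex Et EE _] Ex' Et'; have [_ _ uu _] := h.
apply: (@lax_solution_unique R n a a_un u (fun x t l => hor (fun k => q k x t) j.+1 l)) => //.
by move=> x t l'; apply: hor_adj h.
Qed.

Lemma lax_sol_triv u q E : flow_pair u q -> (forall t, is_Q a b (u^~ t) (fun k x => q k x t)) ->
  lax_sol u q E -> is_trivialization a b j u E.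
Proof.
move=> [[_ _ q0 _ _] _ _ _] hQ [E0 Ex Et EE _]; exists (fun t k x => q k x t); split=> // x t l.
by rewrite hor_sum.
Qed.

(** A trivialization is a solution of the Lax pair with the right initial
    value, and there is only one. *)
Lemma triv_lax_sol u q E : flow_pair u q -> is_trivialization a b j u E -> lax_sol u q E.
Proof.
move=> h [Q [hQ Ex Et E0]]; have [[_ _ q0 _ uq] _ _ _] := h.
have eQ t : Q t = (fun k x => q k x t) by apply: uq.
have Et' x t l : has_deriv (fun s => E x s l) t (E x t l *m hor (fun k => q k x t) j.+1 l).
  by have := Et x t l; rewrite eQ hor_sum.
have [E1 hE1] := lax_sol_exists h.
suff -> : E = E1 by [].
apply/funext => x; apply/funext => t; apply/funext => l.
by rewrite (lax_sol_unique h hE1 (fun x t => Ex x t l) (fun x t => Et' x t l)) E0 mul1mx.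
Qed.

Lemma lax_sol_Gplus u q E x t : lax_sol u q E -> @Gplus R n (E x t).
Proof.
move=> [_ _ _ EE eE]; split=> [//|l|l]; first by have [] := mulmx1_unit (EE x t l).
exact: mulmx1C (EE x t l).
Qed.
End Flow.
(** * Decay of the dressing projection *)

Section Decay.
Variable R : realType.

Lemma exp_compare (h dh : R -> R) (c X Y : R) : X <= Y ->
  (forall x : R, X <= x <= Y -> is_derive x 1 h (dh x)) ->
  (forall x : R, X <= x <= Y -> dh x <= c * h x) -> h Y <= h X * expR (c * (Y - X)).
Proof.
move=> XY hd hc.
have he (z : R) : is_derive z 1 (fun y : R => expR (- c * y)) (- c * expR (- c * z)).
  have h1 : is_derive z 1 (fun y : R => - c * y) (- c).
    by apply: is_derive_eq; rewrite ?scaler0 /GRing.scale /=; ring.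
  have := @is_derive1_comp _ expR (fun y : R => - c * y) z _ _ (is_derive_expR _) h1.
  by rewrite mulrC.
have h1 (z : R) (hz : X <= z <= Y) := is_deriveM (hd z hz) (he z).
have h2 := mvi XY h1 (fun z _ => is_derive_cst 0 z 1).
have : forall z : R, X <= z <= Y -> h z *: (- c * expR (- c * z)) + expR (- c * z) *: dh z <= 0.
  move=> z hz; have := hc z hz => h3.
  rewrite /GRing.scale /= (_ : _ + _ = expR (- c * z) * (dh z - c * h z)); last by ring.
  by rewrite mulr_ge0_le0 ?expR_ge0 // subr_le0.
move=> /h2; rewrite !fctE subrr subr_le0 => h4.
rewrite -(ler_pM2r (expR_gt0 (- c * Y))) -mulrA -expRD.
by have -> : c * (Y - X) + - c * Y = - c * X by ring.
Qed.

(** The weight that measures decay at [+oo]; multiples of it serve as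
    supersolutions. *)
Definition wgt (N : nat) (x : R) : R := ((1 + x) ^+ N)^-1.

Lemma wgt_gt0 N x : 0 <= x -> 0 < wgt N x.
Proof. by move=> x0; rewrite invr_gt0 exprn_gt0 // ltr_pwDl. Qed.
Lemma wgt_ge0 N x : 0 <= x -> 0 <= wgt N x.
Proof. by move=> /(wgt_gt0 N)/ltW. Qed.
Lemma wgtV_ge0 N M (x y : R) : 0 <= x -> 0 <= y -> 0 <= (wgt N x)^-1 * wgt M y.
Proof. by move=> x0 y0; apply: mulr_ge0; [rewrite invr_ge0|]; apply: wgt_ge0. Qed.
Lemma mwgt_ge0 N (B x : R) : 0 <= B -> 0 <= x -> 0 <= B * wgt N x.
Proof. by move=> B0 x0; apply: mulr_ge0 => //; apply: wgt_ge0. Qed.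
Lemma wgt_mono N x y : 0 <= x -> x <= y -> wgt N y <= wgt N x.
Proof.
move=> x0 xy; rewrite lef_pV2 ?posrE ?exprn_gt0 ?ltr_pwDl ?(le_trans x0) //.
by rewrite lerXn2r ?nnegrE ?lerD2l // addr_ge0 // (le_trans x0).
Qed.
Lemma wgtS N x : wgt N.+1 x = wgt N x / (1 + x).
Proof. by rewrite /wgt exprSr invfM. Qed.
Lemma wgt_der (N : nat) (x : R) : 0 <= x -> is_derive x 1 (wgt N) (- N%:R * wgt N.+1 x).
Proof.
move=> x0; have x1 : 1 + x != 0 by rewrite lt0r_neq0 // ltr_pwDl.
have h1 : is_derive x 1 (fun y : R => 1 + y) 1.
  apply: is_derive_ext (is_derive_eq (is_deriveD (is_derive_cst (1 : R) x 1) (is_derive_id x 1)) (add0r 1)) => y.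
  by rewrite fctE.
case: N => [|N].
  rewrite oppr0 mul0r; apply: is_derive_ext (is_derive_cst (1 : R) x 1) => y.
  by rewrite /wgt expr0 invr1.
have h1' : is_derive x 1 (fun y : R => (1 + y) ^+ N.+1) ((N.+1%:R * (1 + x) ^+ N) *: (1 : R)).
  have hX := @is_deriveX R R (fun y : R => 1 + y) N.+1 x 1 1 h1.
  by apply: is_derive_ext hX => y; elim: (N.+1) => [|k IH]; rewrite ?expr0 // !exprS -IH.
have h2 := @is_deriveV R (fun y : R => (1 + y) ^+ N.+1) x _ 1 (expf_neq0 N.+1 x1) h1'.
apply: is_derive_eq h2 _; rewrite /GRing.scale /= /wgt.
by rewrite -mulr_natr !exprS; field; rewrite x1 expf_neq0.
Qed.

(** Rapid decay on the half line. *)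
Definition rap (f : R -> R) := forall N, exists2 B : R, 0 <= B & forall x : R, 0 <= x -> `|f x| <= B * wgt N x.

Lemma rapid_from (f : R -> R) (X : R) : (forall x : R, 0 <= x -> `|f x| <= 1) -> 0 <= X ->
  (forall N, exists2 B : R, 0 <= B & forall x : R, X <= x -> `|f x| <= B * wgt N x) -> rap f.
Proof.
move=> f1 X0 h N; have [B B0 hB] := h N.
exists (B + (wgt N X)^-1); first by rewrite addr_ge0 // invr_ge0 wgt_ge0.
move=> x x0; rewrite mulrDl; have [Xx|xX] := leP X x.
  by apply: le_trans (hB x Xx) _; rewrite lerDl wgtV_ge0.
apply: le_trans (f1 x x0) _; apply: (@le_trans _ _ ((wgt N X)^-1 * wgt N x)).
  by rewrite mulrC ler_pdivlMr ?wgt_gt0 // mul1r wgt_mono // ltW.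
by rewrite lerDr mwgt_ge0 ?invr_ge0 //.
Qed.

(** A multiple of the weight is a supersolution of the stable equation far
    enough out. *)
Lemma decay_down (f df e : R -> R) (d X : R) : 0 < d -> 0 <= X ->
  (forall x : R, 0 <= x -> 0 <= f x <= 1) -> rap e ->
  (forall x : R, X <= x -> is_derive x 1 f (df x)) ->
  (forall x : R, X <= x -> df x <= - d * f x + e x) -> rap f.
Proof.
move=> d0 X0 f1 re hf hd.
have fn x : 0 <= x -> `|f x| = f x by move=> /f1/andP[h _]; rewrite ger0_norm.
apply: (@rapid_from _ X) => // [x x0|N]; first by rewrite fn //; have /andP[] := f1 x x0.
(* From [X'] on, [N / (1 + x)] is at most [d / 2]. *)
pose X' := X + N%:R * 2 / d.
have X'0 : X <= X' by rewrite lerDl; apply: divr_ge0; [apply: mulr_ge0|apply: ltW].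
have X'1 : 0 <= X' := le_trans X0 X'0.
have [B B0 hB] := re N.
pose K := 2 * B / d + (wgt N X')^-1 + (wgt N X')^-1.
have wX := wgt_gt0 N X'1.
have B2 : 0 <= 2 * B / d by apply: divr_ge0; [apply: mulr_ge0|apply: ltW].
have wi : 0 <= (wgt N X')^-1 by rewrite invr_ge0 ltW.
have K0 : 0 <= K by rewrite !addr_ge0.
have fX : f X' <= K * wgt N X'.
  have /andP[_] := f1 X' X'1 => /le_trans; apply.
  by rewrite -ler_pdivrMr // mul1r lerDr addr_ge0.
have far x : X' <= x -> f x <= K * wgt N x.
  move=> xX; rewrite -subr_le0.
  have := @exp_compare (fun x => f x - K * wgt N x) (fun x => df x - K * (- N%:R * wgt N.+1 x)) (- d) X' x xX _ _.
  move=> h; apply: le_trans (h _ _) _.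
  - move=> z /andP[z1 _]; have z0 : 0 <= z := le_trans X'1 z1.
    have := is_deriveB (hf z (le_trans X'0 z1)) (is_deriveZ K (wgt_der N z0)).
    by [].
  - move=> z /andP[z1 _]; have z0 : 0 <= z := le_trans X'1 z1.
    have h1 := hd z (le_trans X'0 z1).
    have /ler_normlW h2 := hB z z0.
    have z2 : 0 < 1 + z by rewrite ltr_pwDl.
    have h3 : N%:R * wgt N.+1 z <= d / 2 * wgt N z.
      rewrite wgtS mulrCA mulrC; apply: ler_wpM2r; first exact: wgt_ge0.
      rewrite ler_pdivrMr // mulrC.
      have : N%:R * 2 / d <= 1 + z by move: z1; rewrite /X'; lra.
      by rewrite ler_pdivrMr //; lra.
    have h4 : B * wgt N z <= K * (d / 2) * wgt N z.
      apply: ler_wpM2r; first exact: wgt_ge0.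
      have : 2 * B / d * (d / 2) <= K * (d / 2).
        by apply: ler_wpM2r; [lra|rewrite /K -addrA lerDl addr_ge0].
      by have -> : 2 * B / d * (d / 2) = B by field; rewrite lt0r_neq0.
    have h5 := ler_wpM2l K0 h3.
    lra.
  by rewrite mulr_le0_ge0 ?expR_ge0 // subr_le0.
exists (K + (wgt N X')^-1); first by rewrite addr_ge0.
move=> x Xx; have x0 := le_trans X0 Xx; rewrite fn // mulrDl; have [X'x|xX'] := leP X' x.
  by apply: le_trans (far x X'x) _; rewrite lerDl wgtV_ge0.
have /andP[_] := f1 x x0 => /le_trans; apply; apply: (@le_trans _ _ ((wgt N X')^-1 * wgt N x)).
  by rewrite mulrC ler_pdivlMr // mul1r wgt_mono // ltW.
by rewrite lerDr mwgt_ge0 // invr_ge0 wgt_ge0.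
Qed.

(** A bounded function cannot leave a supersolution in an unstable direction. *)
Lemma decay_up (f df e : R -> R) (d X : R) : 0 < d -> 0 <= X ->
  (forall x : R, 0 <= x -> 0 <= f x <= 1) -> rap e ->
  (forall x : R, X <= x -> is_derive x 1 f (df x)) ->
  (forall x : R, X <= x -> d * f x - e x <= df x) -> rap f.
Proof.
move=> d0 X0 f1 re hf hd.
have fn x : 0 <= x -> `|f x| = f x by move=> /f1/andP[h _]; rewrite ger0_norm.
apply: (@rapid_from _ X) => // [x x0|N]; first by rewrite fn //; have /andP[] := f1 x x0.
have [B B0 hB] := re N; pose K := B / d.
have K0 : 0 <= K by rewrite divr_ge0 // ltW.
exists K => // x Xx; have x0 := le_trans X0 Xx; rewrite fn // leNgt; apply/negP => hx.
pose h0 := f x - K * wgt N x.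
have h00 : 0 < h0 by rewrite subr_gt0.
pose Y := x + (h0 * d)^-1.
have hd0 : 0 < h0 * d by rewrite mulr_gt0.
have xY : x <= Y by rewrite lerDl invr_ge0 ltW.
have := @exp_compare (fun x => - (f x - K * wgt N x)) (fun x => - (df x - K * (- N%:R * wgt N.+1 x))) d x Y xY _ _.
move=> h; have {h} : h0 * expR (d * (Y - x)) <= f Y - K * wgt N Y.
  suff h' : - (f Y - K * wgt N Y) <= - h0 * expR (d * (Y - x)) by move: h'; rewrite mulNr lerN2.
  apply: h => [z|z] /andP[z1 _]; have z0 : 0 <= z := le_trans x0 z1; have zX := le_trans Xx z1.
    by have := is_deriveN (is_deriveB (hf z zX) (is_deriveZ K (wgt_der N z0))).
  have h1 := hd z zX; have /ler_normlW h2 := hB z z0.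
  have h3 : 0 <= K * (N%:R * wgt N.+1 z) by rewrite mulr_ge0 // mwgt_ge0.
  have h4 : K * d = B by rewrite /K mulfVK // lt0r_neq0.
  have h5 : d * (K * wgt N z) = B * wgt N z by rewrite mulrA [d * K]mulrC h4.
  by move: h1 h2 h3 h5; rewrite mulNr mulrN; lra.
have Y0 := le_trans x0 xY.
have /andP[_ fY] := f1 Y Y0.
have : 0 <= K * wgt N Y by rewrite mwgt_ge0 ?invr_ge0 //.
have : h0 * (1 + d * (Y - x)) <= h0 * expR (d * (Y - x)).
  by apply: ler_wpM2l; [exact: ltW|exact: expR_ge1Dx].
have -> : h0 * (1 + d * (Y - x)) = h0 + 1.
  by rewrite /Y; field; rewrite !lt0r_neq0.
lra.
Qed.

(** After subtraction of [c / (1 + x)] the function is nondecreasing and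
    bounded. *)
Lemma drift_limit (f df : R -> R) (c K : R) : 0 <= c ->
  (forall x : R, 0 <= x -> is_derive x 1 f (df x)) ->
  (forall x : R, 0 <= x -> - (c * wgt 2 x) <= df x) ->
  (forall x : R, 0 <= x -> f x <= K) ->
  exists L : R, forall e : R, 0 < e -> exists2 X : R, 0 <= X & forall x : R, X <= x -> `|f x - L| <= e.
Proof.
move=> c0 hf hd hK; pose G x := f x - c * wgt 1 x.
have Gm x y : 0 <= x -> x <= y -> G x <= G y.
  move=> x0 xy.
  have h1 (z : R) (hz : x <= z <= y) := is_deriveZ c (wgt_der 1 (le_trans x0 (andP hz).1)).
  have h2 (z : R) (hz : x <= z <= y) := hf z (le_trans x0 (andP hz).1).
  have := mvi xy h1 h2; rewrite /G => h.
  have : c *: wgt 1 y - c *: wgt 1 x <= f y - f x.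
    by apply: h => z /andP[z1 _]; have := hd z (le_trans x0 z1); rewrite /GRing.scale /=; lra.
  by rewrite /GRing.scale /=; lra.
pose S := [set y | exists2 x, 0 <= x & y = G x].
have hS : has_sup S.
  split; first by exists (G 0), 0.
  exists K => _ [x x0 ->]; rewrite /G lerBlDr; apply: le_trans (hK x x0) _.
  by rewrite lerDl mwgt_ge0.
exists (sup S) => e e0.
have e2 : 0 < e / 2 by rewrite divr_gt0.
have [_ [x0 x00 ->] hx0] := sup_adherent e2 hS.
have X1 : 0 <= c / (e / 2) by rewrite divr_ge0 // ltW.
exists (x0 + c / (e / 2)); first by rewrite addr_ge0.
move=> x xX; have xx0 : x0 <= x by move: xX; lra.
have x_ge0 : 0 <= x := le_trans x00 xx0.
have h1 := Gm _ _ x00 xx0.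
have h2 : G x <= sup S by apply: sup_upper_bound => //; exists x.
have h3 : c * wgt 1 x <= e / 2.
  rewrite /wgt expr1 ler_pdivrMr ?ltr_pwDl // mulrC -ler_pdivrMr //; lra.
have h4 : 0 <= c * wgt 1 x by rewrite mwgt_ge0 ?invr_ge0 //.
rewrite /G in h1 h2 hx0; rewrite ler_norml; apply/andP; split; move: h1 h2 hx0 h3 h4; rewrite /G; lra.
Qed.
End Decay.
Section Replicator.
Variable R : realType.

Lemma is_derive_sumr (I : Type) (r : seq I) (f : I -> R -> R) (df : I -> R) (x : R) :
  (forall i, is_derive x 1 (f i) (df i)) ->
  is_derive x 1 (fun y => \sum_(i <- r) f i y) (\sum_(i <- r) df i).
Proof.
move=> h; elim: r => [|i r IH].
  rewrite big_nil; apply: is_derive_ext (is_derive_cst (0 : R) x 1) => y.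
  by rewrite big_nil.
rewrite big_cons; apply: is_derive_ext (is_deriveD (h i) IH) => y.
by rewrite big_cons.
Qed.

Lemma rapN (f : R -> R) : rap f -> rap (fun x => - f x).
Proof. by move=> h N; have [B B0 hB] := h N; exists B => // x x0; rewrite normrN hB. Qed.

(** The mean [sum L_i r_i] increases by its variance, up to an integrable error,
    so it converges; components with another rate are driven to 0, or else
    they could not have stayed bounded. *)
Lemma replicator (m : nat) (La : 'I_m -> R) (r e : 'I_m -> R -> R) :
  (forall k (x : R), 0 <= x -> is_derive x 1 (r k) ((La k - \sum_i La i * r i x) * r k x + e k x)) ->
  (forall k (x : R), 0 <= x -> 0 <= r k x) -> (forall x : R, 0 <= x -> \sum_i r i x = 1) ->
  (forall k, rap (e k)) -> exists L, forall k, La k != L -> rap (r k).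
Proof.
move=> hr r0 r1 he.
have rle k (x : R) : 0 <= x -> 0 <= r k x <= 1.
  move=> x0; rewrite r0 //= -(r1 x x0) (bigD1 k) //= lerDl.
  by apply: sumr_ge0 => i _; apply: r0.
pose Me x := \sum_i La i * r i x.
have cex : exists c, forall k, 0 <= c k /\ forall x : R, 0 <= x -> `|e k x| <= c k * wgt 2 x.
  have h k : exists B, 0 <= B /\ forall x : R, 0 <= x -> `|e k x| <= B * wgt 2 x.
    by have [B B0 hB] := he k 2%N; exists B.
  by have [c hc] := choice h; exists c.
have [c hc] := cex.
pose K := \sum_i `|La i|; pose c' := \sum_i `|La i| * c i.
have c'0 : 0 <= c' by apply: sumr_ge0 => i _; apply: mulr_ge0 => //; have [] := hc i.
have hM (x : R) : 0 <= x -> is_derive x 1 Me (\sum_i La i * ((La i - Me x) * r i x + e i x)).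
  by move=> x0; apply: is_derive_sumr => i; apply: is_deriveZ; apply: hr.
have dM (x : R) : 0 <= x -> - (c' * wgt 2 x) <= \sum_i La i * ((La i - Me x) * r i x + e i x).
  move=> x0.
  have -> : \sum_i La i * ((La i - Me x) * r i x + e i x) =
     \sum_i (La i - Me x) ^+ 2 * r i x + \sum_i La i * e i x.
    rewrite -big_split /=; apply/eqP; rewrite -subr_eq0 -sumrB.
    rewrite (eq_bigr (fun i => Me x * (La i * r i x) - Me x ^+ 2 * r i x)); last by move=> i _; ring.
    by rewrite sumrB -!mulr_sumr r1 // -/(Me x) expr2 mulr1 subrr.
  apply: (@le_trans _ _ (\sum_i La i * e i x)); last first.
    by rewrite lerDr; apply: sumr_ge0 => i _; rewrite mulr_ge0 ?sqr_ge0 ?r0.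
  rewrite lerNl -sumrN /c' mulr_suml; apply: ler_sum => i _.
  rewrite -mulrA; apply: le_trans (ler_norm _) _; rewrite normrN normrM.
  by apply: ler_wpM2l => //; have [_] := hc i; apply.
have MK (x : R) : 0 <= x -> Me x <= K.
  move=> x0; apply: ler_sum => i _; have /andP[h1 h2] := rle i x x0.
  apply: le_trans (ler_norm _) _; rewrite normrM (ger0_norm h1).
  by rewrite ler_piMr.
have [L hL] := drift_limit c'0 hM dM MK.
exists L => k kL; pose d := `|La k - L| / 2.
have d0 : 0 < d by rewrite divr_gt0 // normr_gt0 subr_eq0.
have [X X0 hX] := hL d d0.
have [kl|kl] := ltP (La k) L.
  have dE : d = (L - La k) / 2 by rewrite /d ltr0_norm ?subr_lt0 // opprB.
  apply: (decay_down d0 X0 (rle k) (he k) (fun x Xx => hr k x (le_trans X0 Xx))).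
  move=> x Xx; have x0 := le_trans X0 Xx; rewrite lerD2r; apply: ler_wpM2r; first exact: r0.
  by have := hX x Xx; rewrite ler_norml -/(Me x) => /andP[h1 h2]; lra.
have dE : d = (La k - L) / 2 by rewrite /d ger0_norm ?subr_ge0.
apply: (decay_up d0 X0 (rle k) (rapN (he k)) (fun x Xx => hr k x (le_trans X0 Xx))).
move=> x Xx; have x0 := le_trans X0 Xx; rewrite opprK lerD2r; apply: ler_wpM2r; first exact: r0.
by have := hX x Xx; rewrite ler_norml -/(Me x) => /andP[h1 h2]; lra.
Qed.
End Replicator.

Section ProjectionFlow.
Variables (R : realType) (n : nat).
Notation C := R[i].
Notation M := 'M[C]_n.
Variable a : M.
Hypothesis a_diag : is_diag_mx a.
Hypothesis a_un : in_un a.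

Lemma mul_delta (x y : M) (l i j : 'I_n) : (x *m delta_mx l l *m y) i j = x i l * y l j.
Proof.
rewrite mxE (bigD1 l) //= big1 ?addr0 => [|k kl].
  congr (_ * _); rewrite mxE (bigD1 l) //= big1 ?addr0 => [|k kl]; rewrite mxE ?eqxx ?mulr1 //.
  by rewrite (negbTE kl) mulr0.
rewrite [X in X * _]mxE big1 ?mul0r // => k' _.
by rewrite mxE (negbTE kl) andbF mulr0.
Qed.

(** The defining identity of a rank one projection at a matrix unit. *)
Lemma rk1_entries (p : M) : rk1 p -> forall k l, p k l * p l k = p k k * p l l.
Proof.
move=> [_ _ h] k l; have := congr1 (fun X : M => X k k) (h (delta_mx l l)).
rewrite /= mul_delta entZ => ->; rewrite mulrC; congr (_ * _).
rewrite /mxtrace -[RHS]mul1r -[X in X * _](_ : (1%:M : M) l l = 1); last by rewrite mxE eqxx.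
rewrite -[RHS](mul_delta 1%:M p l l l) mul1mx (bigD1 l) //= big1 ?addr0 // => i il.
by rewrite mxE big1 // => k' _; rewrite mxE (negbTE il) mul0r.
Qed.

Lemma adjE (p : M) i j : adjmx p i j = conjc (p j i).
Proof. by rewrite !mxE. Qed.

Lemma rk1_adj (p : M) k l : rk1 p -> p l k = conjc (p k l).
Proof. by move=> [h _ _]; rewrite -{1}h adjE. Qed.

Lemma conjc_mul_cn (z : C) : z * conjc z = (cn z ^+ 2)%:C.
Proof.
rewrite /cn /Normc.normc; case: z => x y; rewrite sqr_sqrtr ?addr_ge0 ?sqr_ge0 //.
by apply/eqP; rewrite eq_complex /=; apply/andP; split; apply/eqP; ring.
Qed.

(** The diagonal of a rank one projection is a probability vector, which
    controls the other entries. *)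
Lemma rk1_diag (p : M) : rk1 p ->
  [/\ forall k, p k k = (complex.Re (p k k))%:C, forall k, 0 <= complex.Re (p k k),
      \sum_k complex.Re (p k k) = 1
    & forall k l, cn (p k l) ^+ 2 = complex.Re (p k k) * complex.Re (p l l)].
Proof.
move=> hp; have [_ h1 _] := hp.
have re k : p k k = (complex.Re (p k k))%:C.
  have := rk1_adj k k hp; case: (p k k) => x y [] h; congr (_ +i* _); lra.
have nn k : 0 <= complex.Re (p k k).
  have := congr1 (fun X : M => X k k) (rk1_idem hp); rewrite /= mxE => h.
  have -> : p k k = (\sum_l cn (p k l) ^+ 2)%:C.
    rewrite -h rmorph_sum; apply: eq_bigr => l _.
    by rewrite (rk1_adj k l hp) conjc_mul_cn.
  by apply: sumr_ge0 => l _; apply: sqr_ge0.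
split=> //.
  by have := congr1 (@complex.Re R) h1; rewrite /mxtrace raddf_sum.
move=> k l; have := rk1_entries hp k l; rewrite (rk1_adj k l hp) conjc_mul_cn (re k) (re l) -rmorphM.
by move=> /complexI.
Qed.

Lemma rk1_cn_le (p : M) k l : rk1 p -> cn (p k l) <= 1.
Proof.
move=> hp; have [_ h0 h1 hs] := rk1_diag hp.
have le1 i : complex.Re (p i i) <= 1.
  by rewrite -h1 (bigD1 i) //= lerDl; apply: sumr_ge0 => i' _.
rewrite -(@ler_pXn2r _ 2) ?nnegrE ?cn_ge0 // hs expr1n.
by apply: le_trans (ler_wpM2l (h0 k) (le1 l)) _; rewrite mulr1.
Qed.

Lemma rk1_nm (p : M) : rk1 p -> nm p <= (n * n)%:R.
Proof.
move=> hp; have := @nm_le R n p 1 (fun i j => rk1_cn_le i j hp).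
by rewrite mulr1.
Qed.

(** Derivative of the dressing projection for the coefficient [l a + v]. *)
Definition dproj (al : C) (v p : M) : M :=
  - ((1%:M - p) *m (al *: a + v) *m p) + p *m (conjc al *: a + v) *m (1%:M - p).

Lemma dprojE al v p : rk1 p ->
  dproj al v p = - (al *: (lie a p *m p)) - conjc al *: (p *m lie a p) + lie p v.
Proof.
move=> hp; have pp := rk1_idem hp; rewrite /dproj /lie.
have h1 : a *m p *m p = a *m p by rewrite -mulmxA pp.
have h2 : p *m p *m a = p *m a by rewrite pp.
rewrite !mulmxBl !mulmxBr !mul1mx !mulmx1 !mulmxDl !mulmxDr !mulmxDl -!scalemxAl -!scalemxAr -!scalemxAl !mulmxA h1 h2.
mxlin.
Qed.

(** Growth rate of the [k]-th diagonal entry of the projection under the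
    dressing flow, relative to the mean rate. *)
Definition rate (al : C) (k : 'I_n) : R := 2 * complex.Im al * complex.Im (a k k).

(** Replicator dynamics: [p a p] is a multiple of [p], and the factor is the
    mean rate. *)
Lemma dproj_diag al v p k : rk1 p ->
  complex.Re (dproj al v p k k) =
  (rate al k - \sum_i rate al i * complex.Re (p i i)) * complex.Re (p k k) + complex.Re (lie p v k k).
Proof.
move=> hp; have [re _ _ _] := rk1_diag hp.
pose m := \sum_i complex.Im (a i i) * complex.Re (p i i).
have hm : \sum_i rate al i * complex.Re (p i i) = 2 * complex.Im al * m.
  by rewrite mulr_sumr; apply: eq_bigr => i _; rewrite /rate mulrA.
have pap : p *m a *m p = (0 +i* m) *: p.
  have [_ _ ->] := hp; congr (_ *: _); rewrite /mxtrace.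
  apply/eqP; rewrite eq_complex !raddf_sum /=; apply/andP; split; apply/eqP.
    apply: big1 => i _; have -> : (a *m p) i i = a i i * p i i.
      by have /is_diag_mxP e := a_diag; rewrite mxE (bigD1 i) //= big1 ?addr0 // => i' ii'; rewrite e ?mul0r // eq_sym.
    by rewrite (diag_entry a_un) (re i) ReM /=; ring.
  apply: eq_bigr => i _; have -> : (a *m p) i i = a i i * p i i.
    by have /is_diag_mxP e := a_diag; rewrite mxE (bigD1 i) //= big1 ?addr0 // => i' ii'; rewrite e ?mul0r // eq_sym.
  by rewrite (diag_entry a_un) (re i) ImM /=; ring.
have pp := rk1_idem hp.
have ap : (a *m p) k k = a k k * p k k.
  by have /is_diag_mxP e := a_diag; rewrite mxE (bigD1 k) //= big1 ?addr0 // => i' ii'; rewrite e ?mul0r // eq_sym.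
have pa : (p *m a) k k = p k k * a k k.
  by have /is_diag_mxP e := a_diag; rewrite mxE (bigD1 k) //= big1 ?addr0 // => i' ii'; rewrite e ?mulr0.
rewrite dprojE // entD [complex.Re (_ + _)]raddfD hm; congr (_ + _).
have -> : lie a p *m p = a *m p - (0 +i* m) *: p by rewrite /lie mulmxBl -mulmxA pp pap.
have -> : p *m lie a p = (0 +i* m) *: p - p *m a by rewrite /lie mulmxBr !mulmxA pp pap.
rewrite !(entD, entN, entZ) ap pa (re k) (diag_entry a_un k) /rate.
move: (complex.Re (p k k)) (complex.Im (a k k)) => r A; clear; case: al => x y /=.
ring.
Qed.
End ProjectionFlow.
Section RapidClasses.
Variables (R : realType) (n : nat).
Notation C := R[i].
Notation M := 'M[C]_n.
Implicit Types f g : R -> M.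

Definition rapM f := forall N, exists2 B : R, 0 <= B & forall x : R, nm (f x) <= B * wgt N `|x|.
Definition bndM f := exists2 B : R, 0 <= B & forall x : R, nm (f x) <= B.

Lemma rapMD f g : rapM f -> rapM g -> rapM (fun x => f x + g x).
Proof.
move=> hf hg N; have [B B0 hB] := hf N; have [D D0 hD] := hg N.
by exists (B + D); rewrite ?addr_ge0 // => x; rewrite mulrDl; apply: le_trans (nmD _ _) _; apply: lerD.
Qed.
Lemma rapM_bnd f g : rapM f -> bndM g -> rapM (fun x => f x *m g x).
Proof.
move=> hf [D D0 hD] N; have [B B0 hB] := hf N.
exists (B * D) => [|x]; first exact: mulr_ge0.
by rewrite mulrAC; apply: le_trans (nmM _ _) _; apply: ler_pM; rewrite ?nm_ge0.
Qed.
Lemma bnd_rapM f g : bndM f -> rapM g -> rapM (fun x => f x *m g x).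
Proof.
move=> [D D0 hD] hg N; have [B B0 hB] := hg N.
exists (D * B) => [|x]; first exact: mulr_ge0.
by rewrite -mulrA; apply: le_trans (nmM _ _) _; apply: ler_pM; rewrite ?nm_ge0.
Qed.
Lemma rapM_bndM f : rapM f -> bndM f.
Proof.
move=> /(_ 0%N)[B B0 hB]; exists B => // x; apply: le_trans (hB x) _.
by rewrite /wgt expr0 invr1 mulr1.
Qed.

(** [Pr] holds for the function and its first [k] derivatives. *)
Fixpoint dcl (Pr : (R -> M) -> Prop) k f : Prop :=
  Pr f /\ if k is k'.+1 then exists f', (forall x, has_deriv f x (f' x)) /\ dcl Pr k' f' else True.

Lemma dcl0 Pr k f : dcl Pr k f -> Pr f.
Proof. by case: k => [|k] []. Qed.
Lemma dclS Pr k f : dcl Pr k.+1 f -> dcl Pr k f.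
Proof.
elim: k f => [|k IH] f [h [f' [h1 h2]]]; first by [].
by split=> //; exists f'; split=> //; apply: IH.
Qed.
Lemma dcl_imp (Pr Pr' : (R -> M) -> Prop) k f : (forall g, Pr g -> Pr' g) -> dcl Pr k f -> dcl Pr' k f.
Proof.
move=> h; elim: k f => [|k IH] f [h1 h2]; split; try exact: h; first by [].
by case: h2 => f' [h2 h3]; exists f'; split=> //; apply: IH.
Qed.
Lemma dclD (Pr : (R -> M) -> Prop) : (forall f g, Pr f -> Pr g -> Pr (fun x => f x + g x)) ->
  forall k f g, dcl Pr k f -> dcl Pr k g -> dcl Pr k (fun x => f x + g x).
Proof.
move=> hP; elim=> [|k IH] f g [h1 h2] [h3 h4]; split; try exact: hP; first by [].
case: h2 h4 => f' [h5 h6] [g' [h7 h8]]; exists (fun x => f' x + g' x); split; last exact: IH.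
by move=> x; apply: hd_add.
Qed.
Lemma dclM (P1 P2 P3 : (R -> M) -> Prop) : (forall f g, P1 f -> P2 g -> P3 (fun x => f x *m g x)) ->
  (forall f g, P3 f -> P3 g -> P3 (fun x => f x + g x)) ->
  forall k f g, dcl P1 k f -> dcl P2 k g -> dcl P3 k (fun x => f x *m g x).
Proof.
move=> h12 h3; elim=> [|k IH] f g hf hg; first by split=> //; apply: h12; [case: hf|case: hg].
have hf1 := dclS hf; have hg1 := dclS hg.
split; first by apply: h12; [apply: dcl0 hf|apply: dcl0 hg].
case: hf hg => _ [f' [h5 h6]] [_ [g' [h7 h8]]]; exists (fun x => f' x *m g x + f x *m g' x); split.
  by move=> x; apply: hd_mul.
by apply: dclD => //; apply: IH.
Qed.
Lemma dcl_cst k (c : M) : dcl bndM k (fun=> c).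
Proof.
have h (d : M) : bndM (fun=> d) by exists (nm d); rewrite ?nm_ge0.
elim: k c => [|k IH] c; split=> //.
by exists (fun=> 0); split=> // x; apply: hd_cst.
Qed.
Lemma dcl_scale k (c : C) f : dcl rapM k f -> dcl rapM k (fun x => c *: f x).
Proof.
move=> /(dclM bnd_rapM rapMD (dcl_cst k c%:M)).
by congr (dcl _ _ _); apply/funext => x; rewrite mul_scalar_mx.
Qed.

Lemma pow1p (t : R) N : 0 <= t -> (1 + t) ^+ N <= 2 ^+ N * (1 + t ^+ N).
Proof.
move=> t0; rewrite mulrDr mulr1; have [t1|t1] := leP t 1.
  apply: (@le_trans _ _ (2 ^+ N)); last by rewrite lerDl mulr_ge0 // exprn_ge0.
  by rewrite lerXn2r ?nnegrE ?addr_ge0 //; lra.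
apply: (@le_trans _ _ (2 ^+ N * t ^+ N)); last by rewrite lerDr exprn_ge0.
by rewrite -exprMn lerXn2r ?nnegrE ?addr_ge0 ?mulr_ge0 //; lra.
Qed.

Lemma schwartz_rap f : schwartz f -> rapM f.
Proof.
move=> hf N.
have hs (g : R -> R) : schwartz_real g -> exists2 B, 0 <= B & forall x, `|g x| <= B * wgt N `|x|.
  move=> [_ hg]; have [B0 hB0] := hg 0%N 0%N; have [B1 hB1] := hg 0%N N.
  have b0 : 0 <= B0 by apply: le_trans (hB0 0); rewrite mulr_ge0.
  have b1 : 0 <= B1 by apply: le_trans (hB1 0); rewrite mulr_ge0 // exprn_ge0.
  exists (2 ^+ N * (B0 + B1)) => [|x]; first by rewrite mulr_ge0 ?exprn_ge0 ?addr_ge0.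
  rewrite /wgt ler_pdivlMr ?exprn_gt0 ?ltr_pwDl //.
  have := hB0 x; have := hB1 x; rewrite expr0 mul1r /derive1n /= => h1 h2.
  apply: le_trans (ler_wpM2l (normr_ge0 _) (pow1p N (normr_ge0 x))) _.
  rewrite mulrCA; apply: ler_wpM2l; first by rewrite exprn_ge0.
  by rewrite mulrDr mulr1 lerD // mulrC.
have h i j : exists B, 0 <= B /\ forall x, cn (f x i j) <= B * wgt N `|x|.
  have [h1 h2] := hf i j; have [B1 b1 hB1] := hs _ h1; have [B2 b2 hB2] := hs _ h2.
  exists (B1 + B2); split; first exact: addr_ge0.
  by move=> x; apply: le_trans (cn_le _) _; rewrite mulrDl; apply: lerD.
have [B hB] := choice (fun ij : 'I_n * 'I_n => h ij.1 ij.2).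
exists (\sum_i \sum_j B (i, j)).
  by apply: sumr_ge0 => i _; apply: sumr_ge0 => j _; have [] := hB (i, j).
move=> x; rewrite /nm mulr_suml; apply: ler_sum => i _; rewrite mulr_suml; apply: ler_sum => j _.
by have [_] := hB (i, j); apply.
Qed.

Lemma derive1nSr (g : R -> R) k : derive1n k.+1 g = derive1n k (g^`()%classic).
Proof. by rewrite /derive1n iterSr. Qed.

Definition dM f : R -> M := fun x => \matrix_(i, j)
  ((fun y => complex.Re (f y i j))^`()%classic x +i* (fun y => complex.Im (f y i j))^`()%classic x).

Lemma schwartz_dM f : schwartz f -> (forall x, has_deriv f x (dM f x)) /\ schwartz (dM f).
Proof.
move=> hf; split.
  move=> x i j; have [[h1 _] [h2 _]] := hf i j; rewrite !mxE /=.
  by split; apply: DeriveDef; rewrite ?derive1E //; [exact: (h1 0%N x)|exact: (h2 0%N x)].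
move=> i j; have [h1 h2] := hf i j.
have -> : (fun x => complex.Re (dM f x i j)) = (fun y => complex.Re (f y i j))^`()%classic.
  by apply/funext => x; rewrite mxE.
have -> : (fun x => complex.Im (dM f x i j)) = (fun y => complex.Im (f y i j))^`()%classic.
  by apply/funext => x; rewrite mxE.
split; split=> [k x|k m].
- by rewrite -derive1nSr; apply: (h1.1 k.+1).
- by rewrite -derive1nSr; apply: (h1.2 k.+1).
- by rewrite -derive1nSr; apply: (h2.1 k.+1).
by rewrite -derive1nSr; apply: (h2.2 k.+1).
Qed.

Lemma schwartz_dcl f : schwartz f -> forall k, dcl rapM k f.
Proof.
move=> hf k; elim: k f hf => [|k IH] f hf; split; try exact: schwartz_rap; first by [].
by have [h1 h2] := schwartz_dM hf; exists (dM f); split=> //; apply: IH.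
Qed.

Lemma dcl_schwartz f : (forall k, dcl rapM k f) -> schwartz f.
Proof.
move=> hf i j.
have hp (pr : C -> R) : (forall g g' : R -> M, (forall x, has_deriv g x (g' x)) ->
     forall x : R, is_derive x 1 (fun y : R => pr (g y i j)) (pr (g' x i j))) -> (forall z, `|pr z| <= cn z) ->
   schwartz_real (fun x => pr (f x i j)).
  move=> hpr prn.
  have key k g : dcl rapM k g -> exists2 g', rapM g' & derive1n k (fun x => pr (g x i j)) = (fun x => pr (g' x i j)).
    elim: k g => [|k IH] g; first by move=> [h _]; exists g.
    move=> [_ [g1 [h1 h2]]]; rewrite derive1nSr.
    have -> : (fun x => pr (g x i j))^`()%classic = (fun x => pr (g1 x i j)).
      by apply/funext => x; rewrite derive1E; exact: (@derive_val _ _ _ _ _ _ _ (hpr _ _ h1 x)).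
    exact: IH.
  have key' k g : dcl rapM k.+1 g -> forall x, derivable (derive1n k (fun x => pr (g x i j))) x 1.
    elim: k g => [|k IH] g.
      by move=> [_ [g1 [h1 _]]] x; have [] := hpr _ _ h1 x.
    move=> [_ [g1 [h1 h2]]] x; rewrite derive1nSr.
    have -> : (fun x => pr (g x i j))^`()%classic = (fun x => pr (g1 x i j)).
      by apply/funext => y; rewrite derive1E; exact: (@derive_val _ _ _ _ _ _ _ (hpr _ _ h1 y)).
    exact: IH.
  split=> [k x|k m]; first by apply: key'; apply: hf.
  have [g rg ->] := key k f (hf k); have [B B0 hB] := rg m; exists B => x.
  have x1 : 0 < (1 + `|x|) ^+ m by rewrite exprn_gt0 // ltr_pwDl.
  have h1 : `|pr (g x i j)| <= B * wgt m `|x|.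
    by apply: le_trans (prn _) _; apply: le_trans (cn_nm _ i j) (hB x).
  have h2 : `|x| ^+ m <= (1 + `|x|) ^+ m by rewrite lerXn2r ?nnegrE ?addr_ge0 // lerDr.
  rewrite mulrC; move: h1; rewrite /wgt ler_pdivlMr //; apply: le_trans.
  exact: ler_wpM2l.
split; apply: hp; try exact: cn_re; try exact: cn_im.
  by move=> g g' h x; have [] := h x i j.
by move=> g g' h x; have [] := h x i j.
Qed.
End RapidClasses.
Section ProjectionDecay.
Variables (R : realType) (n : nat).
Notation C := R[i].
Notation M := 'M[C]_n.
Variable a : M.
Hypothesis a_diag : is_diag_mx a.
Hypothesis a_un : in_un a.
Variables (al : C) (v P : R -> M).
Hypothesis al_im : complex.Im al != 0.
Hypothesis v_schwartz : schwartz v.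
Hypothesis P_rk1 : forall x, rk1 (P x).
Hypothesis P_der : forall x, has_deriv P x (dproj a al (v x) (P x)).

Let W x := lie a (P x).

Lemma P_bnd : bndM P.
Proof. by exists (n * n)%:R => // x; apply: rk1_nm. Qed.

(** [|P_kl|^2 = P_kk P_ll]. When [a] separates [k] and [l], one of the two
    diagonal entries does not have the winning rate and decays. *)
Lemma W_half (s : R) : s = 1 \/ s = -1 -> forall N, exists2 B, 0 <= B & forall y, 0 <= y -> nm (W (s * y)) <= B * wgt N y.
Proof.
move=> hs.
have ns y : 0 <= y -> `|s * y| = y.
  by move=> y0; case: hs => ->; rewrite ?mul1r ?mulN1r ?normrN ger0_norm.
have s0 : s != 0 by case: hs => ->; rewrite ?oppr_eq0 oner_eq0.
have ds (f : R -> R) (x d : R) : is_derive (s * x) 1 f d -> is_derive x 1 (fun y => f (s * y)) (s * d).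
  move=> h; have h1 : is_derive x 1 (fun y : R => s * y) s.
    by apply: is_derive_eq; rewrite ?scaler0 /GRing.scale /=; ring.
  have := @is_derive1_comp _ f (fun y : R => s * y) x d s h h1.
  by rewrite mulrC.
(* Going to [-oo] reverses the sign of all rates. *)
pose La k := s * rate a al k.
pose r k y := complex.Re (P (s * y) k k).
pose e k y := s * complex.Re (lie (P (s * y)) (v (s * y)) k k).
have [k y y0|k y y0|y y0|k N|L hL] := @replicator R n La r e.
- have [h _] := P_der (s * y) k k; apply: is_derive_eq (ds _ _ _ h) _.
  rewrite dproj_diag // /La /r /e mulrDr; congr (_ + _).
  rewrite mulrA mulrBr; congr ((_ - _) * _).
  by rewrite mulr_sumr; apply: eq_bigr => i _; rewrite mulrA.
- by have [_ h _ _] := rk1_diag (P_rk1 (s * y)); apply: h.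
- by have [_ _ h _] := rk1_diag (P_rk1 (s * y)).
- have [B B0 hB] := schwartz_rap v_schwartz N.
  exists (2 * (n * n)%:R * B) => [|y y0]; first by rewrite !mulr_ge0.
  have e1 : `|e k y| <= nm (lie (P (s * y)) (v (s * y))).
    rewrite /e normrM; have -> : `|s| = 1 by case: hs => ->; rewrite ?normrN normr1.
    by rewrite mul1r; apply: le_trans (cn_re _) _; apply: cn_nm.
  apply: le_trans e1 _; apply: le_trans (nmB _ _) _.
  have h1 := hB (s * y); rewrite ns // in h1.
  have h2 := rk1_nm (P_rk1 (s * y)).
  have h3 : nm (P (s * y)) * nm (v (s * y)) <= (n * n)%:R * (B * wgt N y) by apply: ler_pM; rewrite ?nm_ge0.
  have := nmM (P (s * y)) (v (s * y)); have := nmM (v (s * y)) (P (s * y)); lra.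
move=> N.
have ent k l : exists B, 0 <= B /\ forall y, 0 <= y -> cn (W (s * y) k l) <= B * wgt N y.
  have [kl|kl] := eqVneq (a k k) (a l l).
    exists 0; split=> // y y0; rewrite /W lie_diagE // kl subrr mul0r cn0 mul0r //.
  have key m : rap (r m) -> (forall y, 0 <= y -> cn (P (s * y) k l) ^+ 2 <= r m y) ->
     exists B, 0 <= B /\ forall y, 0 <= y -> cn (W (s * y) k l) <= B * wgt N y.
    move=> rm hm; have [B B0 hB] := rm (N + N)%N.
    exists (cn (a k k - a l l) * (B + 1)); split; first by rewrite mulr_ge0 ?cn_ge0 ?addr_ge0.
    move=> y y0; rewrite /W lie_diagE // cnM -mulrA; apply: ler_wpM2l; first exact: cn_ge0.
    have w0 := wgt_ge0 N y0.
    rewrite -(@ler_pXn2r _ 2) ?nnegrE ?cn_ge0 //; last by rewrite mulr_ge0 // addr_ge0.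
    apply: le_trans (hm y y0) _; apply: le_trans (ler_norm _) _; apply: le_trans (hB y y0) _.
    have -> : wgt (N + N) y = wgt N y ^+ 2 by rewrite /wgt exprD invfM expr2.
    rewrite exprMn; apply: ler_wpM2r; first exact: sqr_ge0.
    by rewrite expr2; nra.
  have r01 m y : 0 <= y -> 0 <= r m y <= 1.
    move=> y0; have [_ h0 h1 _] := rk1_diag (P_rk1 (s * y)).
    by rewrite /r h0 /= -h1 (bigD1 m) //= lerDl; apply: sumr_ge0 => i' _.
  have hprod y : cn (P (s * y) k l) ^+ 2 = r k y * r l y.
    by have [_ _ _ ->] := rk1_diag (P_rk1 (s * y)).
  have [kL|kL] := eqVneq (La k) L.
    apply: (key l); last first.
      move=> y y0; rewrite hprod; have /andP[h1 h2] := r01 k y y0; have /andP[h3 h4] := r01 l y y0.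
      by rewrite ler_piMl.
    apply: hL; apply: contra_neq kl => lL.
    have : rate a al k = rate a al l by apply: (mulfI s0); rewrite -/(La k) -/(La l) kL lL.
    rewrite /rate => /(mulfI _) e'; rewrite (diag_entry a_un k) (diag_entry a_un l) e' //.
    by rewrite mulf_neq0.
  apply: (key k); first exact: hL.
  move=> y y0; rewrite hprod; have /andP[h1 h2] := r01 k y y0; have /andP[h3 h4] := r01 l y y0.
  by rewrite ler_piMr.
have [B hB] := choice (fun ij : 'I_n * 'I_n => ent ij.1 ij.2).
exists (\sum_i \sum_j B (i, j)).
  by apply: sumr_ge0 => i _; apply: sumr_ge0 => j _; have [] := hB (i, j).
move=> y y0; rewrite /nm mulr_suml; apply: ler_sum => i _; rewrite mulr_suml; apply: ler_sum => j _.
by have [_] := hB (i, j); apply.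
Qed.

Lemma W_rap : rapM W.
Proof.
move=> N; have [B B0 hB] := W_half (or_introl erefl) N.
have [D D0 hD] := W_half (or_intror erefl) N.
exists (B + D) => [|x]; first exact: addr_ge0.
rewrite mulrDl; have [x0|x0] := leP 0 x.
  have := hB x x0; rewrite mul1r ger0_norm // => h; apply: le_trans h _.
  by rewrite lerDl mwgt_ge0.
have x0' : 0 <= - x by rewrite oppr_ge0 ltW.
have := hD (- x) x0'; rewrite mulN1r opprK ltr0_norm // => h; apply: le_trans h _.
by rewrite lerDr mwgt_ge0.
Qed.

(** Each derivative of the projection is made of the commutator and of [v]. *)
Lemma PW_dcl k : dcl (@bndM R n) k P /\ dcl (@rapM R n) k W.
Proof.
have rb := @dclM R n _ _ _ (@rapM_bnd R n) (@rapMD R n).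
have br := @dclM R n _ _ _ (@bnd_rapM R n) (@rapMD R n).
have DD := @dclD R n _ (@rapMD R n).
elim: k => [|k [IHP IHW]]; first by do !split; [exact: P_bnd|exact: W_rap].
have dv : dcl (@rapM R n) k v := schwartz_dcl v_schwartz k.
have dP : dcl (@rapM R n) k (fun x => dproj a al (v x) (P x)).
  have := DD k _ _ (DD k _ _ (dcl_scale (- al) (rb k _ _ IHW IHP)) (dcl_scale (- conjc al) (br k _ _ IHP IHW)))
    (DD k _ _ (br k _ _ IHP dv) (dcl_scale (-1) (rb k _ _ dv IHP))).
  congr (dcl _ _ _); apply/funext => x; rewrite dprojE // /W /lie; mxlin.
split; split.
- exact: P_bnd.
- by exists (fun x => dproj a al (v x) (P x)); split=> //; apply: dcl_imp dP; apply: rapM_bndM.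
- exact: W_rap.
exists (fun x => lie a (dproj a al (v x) (P x))); split.
  by move=> x; apply: hd_sub; [apply: hd_mull|apply: hd_mulr].
have := DD k _ _ (br k _ _ (dcl_cst k a) dP) (dcl_scale (-1) (rb k _ _ dP (dcl_cst k a))).
by congr (dcl _ _ _); apply/funext => x; rewrite scaleN1r.
Qed.

Lemma dressed_schwartz (c : C) : schwartz (fun x => v x - c *: lie a (P x)).
Proof.
apply: dcl_schwartz => k; have [_ hW] := PW_dcl k.
have := @dclD R n _ (@rapMD R n) k _ _ (schwartz_dcl v_schwartz k) (dcl_scale (- c) hW).
by congr (dcl _ _ _); apply/funext => x; rewrite scaleNr.
Qed.

(** Convergence at [-oo]. *)
Definition mlim (f : R -> M) (L : M) := forall e : R, 0 < e -> exists X : R, forall x : R, x <= X -> nm (f x - L) <= e.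

(** The derivative is rapidly decreasing, so every entry converges. *)
Lemma P_lim : exists L, mlim P L.
Proof.
have rP : rapM (fun x => dproj a al (v x) (P x)).
  by have [[_ [P' [h1 h2]]] _] := PW_dcl 1; have [h _] := PW_dcl 0;
     have [_ hW] := PW_dcl 0; have dv := schwartz_dcl v_schwartz 0;
     have := rapMD (rapMD (dcl0 (dcl_scale (- al) (dclM (@rapM_bnd R n) (@rapMD R n) hW h)))
                 (dcl0 (dcl_scale (- conjc al) (dclM (@bnd_rapM R n) (@rapMD R n) h hW))))
       (rapMD (bnd_rapM P_bnd (schwartz_rap v_schwartz)) (dcl0 (dcl_scale (-1) (dclM (@rapM_bnd R n) (@rapMD R n) dv h))));
     congr rapM; apply/funext => x; rewrite dprojE // /W /lie; mxlin.
have [B B0 hB] := rP 2%N.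
have ent (pr : C -> R) i j : (forall (g g' : R -> M), (forall x, has_deriv g x (g' x)) ->
     forall x : R, is_derive x 1 (fun y : R => pr (g y i j)) (pr (g' x i j))) -> (forall z, `|pr z| <= cn z) ->
   exists L : R, forall e : R, 0 < e -> exists2 X : R, 0 <= X & forall x : R, X <= x -> `|pr (P (- x) i j) - L| <= e.
  move=> hpr prn; apply: (@drift_limit R (fun x => pr (P (- x) i j)) (fun x => - pr (dproj a al (v (- x)) (P (- x)) i j)) B 1) => //.
  - by move=> x x0; apply: (is_derive_reflect (hpr _ _ P_der (- x))).
  - move=> x x0; rewrite lerN2; apply: le_trans (ler_norm _) _; apply: le_trans (prn _) _.
    apply: le_trans (cn_nm _ i j) _; have := hB (- x).
    by rewrite normrN ger0_norm.
  move=> x x0; apply: le_trans (ler_norm _) _; apply: le_trans (prn _) _.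
  exact: rk1_cn_le.
have re i j : exists L : R, forall e : R, 0 < e -> exists2 X : R, 0 <= X & forall x : R, X <= x -> `|complex.Re (P (- x) i j) - L| <= e.
  by apply: ent => [g g' h x|z]; [have [] := h x i j|exact: cn_re].
have im i j : exists L : R, forall e : R, 0 < e -> exists2 X : R, 0 <= X & forall x : R, X <= x -> `|complex.Im (P (- x) i j) - L| <= e.
  by apply: ent => [g g' h x|z]; [have [] := h x i j|exact: cn_im].
have [Lr hLr] := choice (fun ij : 'I_n * 'I_n => re ij.1 ij.2).
have [Li hLi] := choice (fun ij : 'I_n * 'I_n => im ij.1 ij.2).
exists (\matrix_(i, j) (Lr (i, j) +i* Li (i, j))) => e e0.
pose d := e / ((n * n)%:R * 2 + 1).
have K1 : 0 < (n * n)%:R * 2 + 1 :> R by rewrite ltr_wpDl // mulr_ge0.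
have d0 : 0 < d by rewrite divr_gt0.
have hX (ij : 'I_n * 'I_n) : exists X : R, forall x : R, X <= x ->
    `|complex.Re (P (- x) ij.1 ij.2) - Lr ij| <= d /\ `|complex.Im (P (- x) ij.1 ij.2) - Li ij| <= d.
  have [X1 _ h1] := hLr ij d d0; have [X2 _ h2] := hLi ij d d0.
  exists (Num.max X1 X2) => x; rewrite ge_max => /andP[x1 x2].
  by split; [apply: h1|apply: h2].
have [X hX'] := choice hX.
exists (- \sum_ij `|X ij|) => x xX; apply: (@le_trans _ _ ((n * n)%:R * (d + d))); last first.
  have -> : (n * n)%:R * (d + d) = e * ((n * n)%:R * 2) / ((n * n)%:R * 2 + 1).
    by rewrite /d; field; rewrite lt0r_neq0.
  by rewrite ler_pdivrMr // ler_pM2l // lerDl.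
apply: nm_le => i j; have xij : X (i, j) <= - x.
  apply: (@le_trans _ _ (\sum_ij `|X ij|)); last by rewrite lerNr.
  by rewrite (bigD1 (i, j)) //=; apply: le_trans (ler_norm _) _; rewrite lerDl sumr_ge0.
have [] := hX' (i, j) _ xij; rewrite opprK /= => h1 h2.
apply: le_trans (cn_le _) _; rewrite !mxE.
by apply: lerD; [move: h1|move: h2]; case: (P x i j) => ? ? /=.
Qed.
End ProjectionDecay.
(** * Dressing by a simple element *)

Section ProjectionOfFrame.
Variables (R : realType) (n : nat).
Notation C := R[i].
Notation M := 'M[C]_n.

(** Projection on the line spanned by the image of [adjmx X *m p]. *)
Definition frame_proj (p X : M) : M :=
  (\tr (adjmx X *m p *m X))^-1 *: (adjmx X *m p *m X).

Lemma frame_tr (p X : M) : rk1 p -> X \in unitmx ->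
  \tr (adjmx X *m p *m X) = (complex.Re (\tr (adjmx X *m p *m X)))%:C /\ \tr (adjmx X *m p *m X) != 0.
Proof.
move=> hp uX; have [pa ptr _] := hp.
have e : \tr (adjmx X *m p *m X) = (\sum_i \sum_j cn ((adjmx X *m p) i j) ^+ 2)%:C.
  rewrite -tr_MadjM adjM adjK pa !mulmxA -[adjmx X *m p *m p]mulmxA (rk1_idem hp) //.
split; first by rewrite e.
rewrite e; apply/eqP => h0.
have z i j : (adjmx X *m p) i j = 0.
  apply/eqP; rewrite -cn_eq0 -sqrf_eq0 eq_le sqr_ge0 andbT.
  have -> : 0 = \sum_i \sum_j cn ((adjmx X *m p) i j) ^+ 2 :> R.
    by case: h0 => ->.
  rewrite (bigD1 i) //= (bigD1 j) //= -addrA lerDl addr_ge0 ?sumr_ge0 // => [k _|k _]; rewrite ?sqr_ge0 //.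
  by apply: sumr_ge0 => ? _; apply: sqr_ge0.
have p0 : p = 0.
  have uXa : adjmx X \in unitmx.
    have /mulmx1_unit[] // : adjmx X *m adjmx (invmx X) = 1%:M by rewrite -adjM mulVmx // adj1.
  by rewrite -(mulKmx uXa p) (_ : adjmx X *m p = 0) ?mulmx0 //; apply/matrixP => i j; rewrite z mxE.
by move: ptr; rewrite p0 mxtrace0 => /esym/eqP; rewrite oner_eq0.
Qed.

Lemma conj_real (z : C) : z = (complex.Re z)%:C -> conjc z = z.
Proof. by move=> ->; apply/eqP; rewrite eq_complex /= oppr0 !eqxx. Qed.

Lemma rk1_frame (p X : M) : rk1 p -> X \in unitmx -> rk1 (frame_proj p X).
Proof.
move=> hp uX; have [tr_re tr0] := frame_tr hp uX; have [pa ptr pp] := hp.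
rewrite /frame_proj; set N := adjmx X *m p *m X in tr_re tr0 *.
have Na : adjmx N = N by rewrite /N !adjM adjK pa mulmxA.
have NN y : N *m y *m N = \tr (y *m N) *: N.
  transitivity (adjmx X *m (p *m (X *m y *m adjmx X) *m p) *m X); first by rewrite /N !mulmxA.
  rewrite pp -scalemxAr -scalemxAl; congr (_ *: _).
  by rewrite -!mulmxA mxtrace_mulC /N !mulmxA.
split.
- rewrite adjZ Na; congr (_ *: _); rewrite -[in RHS](conj_real tr_re).
  by rewrite -[LHS]/(_ (_)) fmorphV.
- by rewrite mxtraceZ mulVf.
move=> y; rewrite -!scalemxAl -!scalemxAr NN mxtraceZ.
by rewrite !scalerA mulrAC mulrC mulrA.
Qed.

(** A frame moving by [X' = X A] moves the projection by a Riccati equation. *)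
Lemma hd_frame (p : M) (X : R -> M) (Aa Ab : M) (x : R) : rk1 p -> (forall y, X y \in unitmx) ->
  has_deriv X x (X x *m Ab) -> adjmx Ab = - Aa ->
  has_deriv (fun y => frame_proj p (X y)) x
    (- ((1%:M - frame_proj p (X x)) *m Aa *m frame_proj p (X x)) +
     frame_proj p (X x) *m Ab *m (1%:M - frame_proj p (X x))).
Proof.
move=> hp uX dX hA.
pose N y := adjmx (X y) *m p *m X y; pose tau y := complex.Re (\tr (N y)).
have dN : has_deriv N x (- (Aa *m N x) + N x *m Ab).
  apply: hd_eq (hd_mul (hd_mulr p (hd_adj dX)) dX) _.
  by rewrite adjM hA /N !mulNmx !mulmxA.
have tauE y : \tr (N y) = (tau y)%:C by have [h _] := frame_tr hp (uX y); rewrite /N -h.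
have tau0 y : tau y != 0.
  by have [_] := frame_tr hp (uX y); rewrite -/(N y) tauE; apply: contra_neq => ->.
have hr := rk1_frame hp (uX x).
have dtau : is_derive x 1 tau (complex.Re (\tr (- (Aa *m N x) + N x *m Ab))) by have [] := hd_tr dN.
have dinv := hdc_real (is_deriveV (tau0 x) dtau).
have h := hd_scale dinv dN.
have fE y : frame_proj p (X y) = ((tau y)^-1)%:C *: N y.
  by rewrite /frame_proj -/(N y) tauE fmorphV.
apply: hd_ext (fun y => esym (fE y)) _.
apply: hd_eq h _.
have NP : N x = (tau x)%:C *: frame_proj p (X x).
  by rewrite fE scalerA -rmorphM mulfV // scale1r.
move: (frame_proj p (X x)) hr NP => P hr NP.
have dre : (complex.Re (\tr (- (Aa *m N x) + N x *m Ab)))%:C = \tr (- (Aa *m N x) + N x *m Ab).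
  have h1 : hdc (fun y => \tr (N y)) x (\tr (- (Aa *m N x) + N x *m Ab)) := hd_tr dN.
  have h2 := hdc_ext (fun y => esym (tauE y)) (hdc_real dtau).
  exact: hdc_unique h2 h1.
have [_ _ pp] := hr.
have e1 : \tr (- (Aa *m N x) + N x *m Ab) = (tau x)%:C * (\tr (Ab *m P) - \tr (Aa *m P)).
  rewrite NP -scalemxAl -scalemxAr -scalerN -scalerDr mxtraceZ mxtraceD mxtrace_mulC; congr (_ * _).
  by rewrite addrC raddfN.
have t0 : (tau x)%:C != 0 :> C by rewrite -(rmorph0 (@real_complex R)) (inj_eq (@complexI R)).
rewrite [X in X *: N x](_ : _ = - ((tau x)%:C^-1 * (\tr (Ab *m P) - \tr (Aa *m P)))); last first.
  move: dre e1; move: (\tr (- (Aa *m N x) + N x *m Ab)) => T dre e1.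
  have -> : - tau x ^- 2 *: complex.Re T = - tau x ^- 2 * complex.Re T by [].
  by rewrite rmorphM /= dre e1 rmorphN fmorphV rmorphXn; field.
have -> : ((tau x)^-1)%:C = (tau x)%:C^-1 :> C by rewrite fmorphV.
rewrite NP; move: (real_complex R (tau x)) t0 => t t0.
have -> (d : C) : - (t^-1 * d) *: (t *: P) + t^-1 *: (- (Aa *m (t *: P)) + t *: P *m Ab) =
    - (d *: P) - Aa *m P + P *m Ab.
  rewrite -scalemxAl -scalemxAr; apply/matrixP => i j; rewrite ?(entD, entN, entZ).
  by field.
rewrite !mulmxBl !mulmxBr !mul1mx !mulmx1.
rewrite !pp scalerBl.
mxlin.
Qed.

(** A rank one projection is bounded, so the equations bound its partial
    derivatives and make it continuous; they then raise its regularity step by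
    step. *)
Lemma riccati_smooth (P Aa Ab Ba Bb : R -> R -> M) :
  (forall x t, rk1 (P x t)) -> smooth Aa -> smooth Ab -> smooth Ba -> smooth Bb ->
  (forall x t, has_deriv (fun y => P y t) x (- ((1%:M - P x t) *m Aa x t *m P x t) + P x t *m Ab x t *m (1%:M - P x t))) ->
  (forall x t, has_deriv (P x) t (- ((1%:M - P x t) *m Ba x t *m P x t) + P x t *m Bb x t *m (1%:M - P x t))) ->
  smooth P.
Proof.
move=> hP sAa sAb sBa sBb hx ht.
have cP : jc P.
  apply: (jc_of_partials hx ht) => x0 t0; exists 1 => //.
  have [c1 c10 h1] := @jc_bound _ _ Aa (`|x0| + 1) (`|t0| + 1) (smooth_jc sAa).
  have [c2 c20 h2] := @jc_bound _ _ Ab (`|x0| + 1) (`|t0| + 1) (smooth_jc sAb).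
  pose k : R := (n * n)%:R; pose k1 := nm (1%:M : M) + k.
  have k0 : 0 <= k by [].
  exists (k1 * c1 * k + k * c2 * k1) => x t xd td.
  have bnd (z z0 : R) : `|z - z0| < 1 -> `|z| <= `|z0| + 1.
    move=> h; have -> : z = z0 + (z - z0) by rewrite addrC subrK.
    by apply: le_trans (ler_normD _ _) _; rewrite lerD2l ltW.
  have nP : nm (P x t) <= k by apply: rk1_nm.
  have n1P : nm (1%:M - P x t) <= k1 by apply: le_trans (nmB _ _) _; rewrite lerD2l.
  apply: le_trans (nmD _ _) _; rewrite nmN; apply: lerD.
    apply: le_trans (nmM _ _) _; apply: ler_pM; rewrite ?nm_ge0 //.
    by apply: le_trans (nmM _ _) _; apply: ler_pM; rewrite ?nm_ge0 // h1 ?bnd.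
  apply: le_trans (nmM _ _) _; apply: ler_pM; rewrite ?nm_ge0 //.
  by apply: le_trans (nmM _ _) _; apply: ler_pM; rewrite ?nm_ge0 // h2 ?bnd.
elim=> [|k IH]; first exact/jcP.
have C1 : Ck k (fun x t => 1%:M - P x t).
  have := CkD (Ck_cst k 1%:M) (CkM (Ck_cst k (- 1%:M)) IH).
  by congr (Ck _ _); apply/funext => x; apply/funext => t; rewrite mulNmx mul1mx.
have F (A B : R -> R -> M) : smooth A -> smooth B ->
   Ck k (fun x t => - ((1%:M - P x t) *m A x t *m P x t) + P x t *m B x t *m (1%:M - P x t)).
  move=> sA sB; have := CkD (CkM (Ck_cst k (- 1%:M)) (CkM (CkM C1 (sA k)) IH)) (CkM (CkM IH (sB k)) C1).
  by congr (Ck _ _); apply/funext => x; apply/funext => t; rewrite mulNmx mul1mx.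
by eexists; eexists; split; [exact: hx|exact: ht|exact: F|exact: F].
Qed.
End ProjectionOfFrame.
(** Identities over an abstract ring of scalars. *)
Section NoncommutativeIdentities.
Variables (K : comNzRingType) (n : nat).
Implicit Types (P X a v : 'M[K]_n) (k e l : K).

(** One step of the Horner scheme for the divided differences of [X] at [be]
    and at [al]. *)
Lemma divdiff_step P P1 X Xa Xb qm l al be e k :
  l *: (X + e *: (P *m (X - Xb) *m P1) - k *: (P1 *m (X - Xa) *m P)) +
  (qm + (e * (l - be)) *: (P *m Xb *m P1) - (k * (l - al)) *: (P1 *m Xa *m P)) =
  l *: X + qm + e *: (P *m (l *: X + qm - (be *: Xb + qm)) *m P1) -
  k *: (P1 *m (l *: X + qm - (al *: Xa + qm)) *m P).
Proof.
have -> : l *: X + qm - (be *: Xb + qm) = l *: X - be *: Xb by mxlin.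
have -> : l *: X + qm - (al *: Xa + qm) = l *: X - al *: Xa by mxlin.
rewrite !mulmxBr !mulmxBl -!scalemxAr -!scalemxAl; mxlin.
Qed.

(** Gauge transformation of a [t] coefficient with value [X]. Here [Xa] and
    [Xb] are its values at [al] and [conjc al], and [e] and [k] are the scalar
    factors of the simple element and of its inverse. *)
Lemma dress_time P X (Xa Xb : 'M[K]_n) e k : P *m P = P -> k * e = e - k ->
  X *m (1%:M - k *: P) - k *: (- ((1%:M - P) *m Xa *m P) + P *m Xb *m (1%:M - P)) =
  (1%:M - k *: P) *m (X + e *: (P *m (X - Xb) *m (1%:M - P)) - k *: ((1%:M - P) *m (X - Xa) *m P)).
Proof.
move=> PP ke; set Y := _ - k *: ((1%:M - P) *m (X - Xa) *m P).
have PY : P *m Y = P *m X + e *: (P *m (X - Xb) *m (1%:M - P)).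
  have hh (U V : 'M[K]_n) : P *m (X + e *: (P *m U) - k *: ((1%:M - P) *m V)) = P *m X + e *: (P *m U).
    rewrite mulmxBr mulmxDr -!scalemxAr !mulmxA PP mulmxBr mulmx1 PP subrr mul0mx scaler0 subr0 //.
  by rewrite /Y -!mulmxA hh.
rewrite [RHS]mulmxBl mul1mx -scalemxAl PY [k *: (P *m X + _)]scalerDr scalerA ke /Y.
rewrite !(mulmxBr, mulmxBl, mulmx1, mul1mx) -!scalemxAr.
mxlin.
Qed.

(** Gauge transformation of the [x] coefficient: the potential moves by a
    commutator with [a]. *)
Lemma dress_space_id a v P (al be l k : K) : P *m P = P -> be = al + k * (l - al) ->
  (l *: a + v) *m (1%:M - k *: P) -
    k *: (- ((1%:M - P) *m (al *: a + v) *m P) + P *m (be *: a + v) *m (1%:M - P)) =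
  (1%:M - k *: P) *m (l *: a + (v - (be - al) *: (a *m P - P *m a))).
Proof.
move=> PP ->.
have PPr (X : 'M[K]_n) : X *m P *m P = X *m P by rewrite -mulmxA PP.
do 4 (rewrite ?(mulmxDl, mulmxDr, mulmxBl, mulmxBr, mulNmx, mulmxN, mul1mx, mulmx1, mulmxA) -?scalemxAl -?scalemxAr ?(PP, PPr)).
mxlin.
Qed.

End NoncommutativeIdentities.

Section DressingAlgebra.
Variables (R : realType) (n : nat).
Notation C := R[i].
Notation M := 'M[C]_n.

(** The simple element with pole [conjc al], and its inverse. *)
Definition sm (al : C) (P : M) (l : C) : M := 1%:M + ((conjc al - al) / (l - conjc al)) *: P.
Definition si (al : C) (P : M) (l : C) : M := 1%:M - ((conjc al - al) / (l - al)) *: P.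

Lemma sm_si al P l : P *m P = P -> l != al -> l != conjc al -> sm al P l *m si al P l = 1%:M.
Proof.
move=> PP l1 l2; rewrite /sm /si.
have h1 : l - al != 0 by rewrite subr_eq0.
have h2 : l - conjc al != 0 by rewrite subr_eq0.
rewrite mulmxBr mulmxDl mulmx1 mulmxDl !mul1mx -!scalemxAr -!scalemxAl PP ?mulmx1.
by move: (conjc al) h2 => be h2; apply/matrixP => i j; rewrite ?(entD, entN, entZ); field; rewrite h1 h2.
Qed.

Lemma si_sm al P l : P *m P = P -> l != al -> l != conjc al -> si al P l *m sm al P l = 1%:M.
Proof. by move=> PP l1 l2; apply: mulmx1C; apply: sm_si. Qed.

(** The coefficients of [s S s^-1] for [S = sum q_k l^-k] and the simple
    element [s] with projection [P]. *)
Definition dq (al : C) (P : M) (q : nat -> M) (m : nat) : M :=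
  q m + (conjc al - al) *: (P *m hor q m (conjc al) *m (1%:M - P)) -
  (conjc al - al) *: ((1%:M - P) *m hor q m al *m P).

Lemma hor_divdiff (q : nat -> M) (P : M) (be al l c1 c2 e k : C) m :
  c1 = e * (l - be) -> c2 = k * (l - al) ->
  hor (fun m => q m + c1 *: (P *m hor q m be *m (1%:M - P)) - c2 *: ((1%:M - P) *m hor q m al *m P)) m l =
  hor q m l + e *: (P *m (hor q m l - hor q m be) *m (1%:M - P)) -
    k *: ((1%:M - P) *m (hor q m l - hor q m al) *m P).
Proof.
move=> -> ->; elim: m => [|m /= ->]; last exact: divdiff_step.
by rewrite /hor !(subr0, mulmx0, mul0mx, scaler0, addr0).
Qed.

Lemma dress_space (a v P : M) (al l k : C) : P *m P = P -> conjc al - al = k * (l - al) ->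
  (l *: a + v) *m (1%:M - k *: P) - k *: dproj a al v P =
  (1%:M - k *: P) *m (l *: a + (v - (conjc al - al) *: lie a P)).
Proof. by move=> PP hk; apply: dress_space_id => //; rewrite -hk addrC subrK. Qed.

(** Conjugation by a simple element acts on polynomial parts through divided
    differences at the two poles. *)
Lemma hor_dq al P q m l : l != al -> l != conjc al ->
  hor (dq al P q) m l = hor q m l +
    ((conjc al - al) / (l - conjc al)) *: (P *m (hor q m l - hor q m (conjc al)) *m (1%:M - P)) -
    ((conjc al - al) / (l - al)) *: ((1%:M - P) *m (hor q m l - hor q m al) *m P).
Proof. by move=> l1 l2; apply: hor_divdiff; rewrite mulfVK // subr_eq0. Qed.

Lemma in_un_dress (c : C) (a P : M) : in_un a -> adjmx P = P -> conjc c = - c -> in_un (c *: lie a P).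
Proof.
move=> ua hP hc; have aa : adjmx a = - a := ua.
rewrite /in_un adjZ hc /lie adjB !adjM aa hP mulmxN mulNmx.
by rewrite scaleNr opprK addrC.
Qed.

Lemma conj_diff (al : C) : conjc (conjc al - al) = - (conjc al - al).
Proof. by case: al => x y; apply/eqP; rewrite eq_complex /=; apply/andP; split; apply/eqP; ring. Qed.

Lemma smooth_hor (q : nat -> R -> R -> M) l m : (forall k, smooth (q k)) -> smooth (fun x t => hor (fun k => q k x t) m l).
Proof.
move=> sq; elim: m => [|m IH] /=; first exact: smooth_cst.
by apply: smoothD => //; apply: smoothZ.
Qed.

End DressingAlgebra.
Section WaveTools.
Variables (R : realType) (n : nat).
Notation C := R[i].
Notation M := 'M[C]_n.

Lemma asyN_sub (W W' : set C) N (f : C -> M) c : (forall l, W' l -> W l) -> asyN W N f c -> asyN W' N f c.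
Proof.
move=> h /asyN_bd[K [B hB]]; apply/asyN_bd; exists K, B => l Wl; exact/hB/h.
Qed.

(** Dividing by [l - z] replaces the coefficients by their Horner sums at [z]. *)
Lemma asyN_pole (W : set C) N (z : C) (S : C -> M) (q : nat -> M) : asyN W N S q ->
  asyN W N (fun l => (l - z)^-1 *: S l) (fun k => hor q k z).
Proof.
elim: N S q => [|N IH] S q hS.
  have := @bd_near _ _ W (1 + cn z) (fun l => (l - z)^-1 *: S l) S _ hS; apply=> l _ hl.
  rewrite nmZ cnV; apply: ler_piMl; first exact: nm_ge0.
  have h1 : 1 <= cn (l - z) by have := cnD (l - z) z; rewrite subrK; lra.
  by rewrite invf_le1 // (lt_le_trans ltr01).
have hS' := asyN_pred hS.
have := asyND hS' (asyN_mull z%:M (IH _ _ hS')).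
have -> : q + (fun k => z%:M *m hor q k z) = sh (fun k => hor q k z).
  by apply/funext => k; rewrite fctE /sh /= mul_scalar_mx addrC.
rewrite /=; apply: (@asyN_near _ _ W N (cn z)) => l _ hl.
have lz : l - z != 0 by rewrite subr_eq0; apply: contraTneq hl => ->; rewrite ltxx.
rewrite subr0 mul_scalar_mx !scalerA -[X in _ = X + _]scale1r -scalerDl; congr (_ *: _).
by field.
Qed.

Lemma asyN_mulr (W : set C) N (f : C -> M) c (b : M) : asyN W N f c -> asyN W N (fun l => f l *m b) (fun k => c k *m b).
Proof.
move=> h; have := asyNM h (asyN_cst W N b).
by congr (asyN _ _ _ _); apply/funext => k; rewrite conv_constr.
Qed.
Lemma asyN_scale (W : set C) N (f : C -> M) c (z : C) : asyN W N f c -> asyN W N (fun l => z *: f l) (fun k => z *: c k).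
Proof.
move=> /(asyN_mull z%:M); congr (asyN _ _ _ _); apply/funext => k; by rewrite mul_scalar_mx.
Qed.

(** The expansions of a simple element and of its inverse at infinity. *)
Definition ser_sm (al : C) (P : M) : nat -> M := const_ser 1%:M + (fun k => (conjc al - al) *: hor (const_ser P) k (conjc al)).
Definition ser_si (al : C) (P : M) : nat -> M := const_ser 1%:M + (fun k => - (conjc al - al) *: hor (const_ser P) k al).

Lemma asyN_sm W N al P : asyN W N (sm al P) (ser_sm al P).
Proof.
have := asyND (asyN_cst W N 1%:M) (asyN_scale (conjc al - al) (asyN_pole (conjc al) (asyN_cst W N P))).
by apply: (@asyN_near _ _ W N 0) => l _ _; rewrite /sm scalerA.
Qed.
Lemma asyN_si W N al P : asyN W N (si al P) (ser_si al P).
Proof.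
have := asyND (asyN_cst W N 1%:M) (asyN_scale (- (conjc al - al)) (asyN_pole al (asyN_cst W N P))).
by apply: (@asyN_near _ _ W N 0) => l _ _; rewrite /si scalerA mulNr scaleNr.
Qed.

Lemma mero_atM (f g : C -> M) z : mero_at f z -> mero_at g z -> mero_at (fun l => f l *m g l) z.
Proof.
move=> [m [h [hh /dnbhsCP[d d0 hd]]]] [m' [h' [hh' /dnbhsCP[d' d'0 hd']]]].
exists (m + m')%N, (fun l => h l *m h' l); split; first exact: holo_atM.
apply/dnbhsCP; exists (Num.min d d'); first by rewrite lt_min d0.
move=> w wz; rewrite lt_min => /andP[w1 w2].
by rewrite -(hd w wz w1) -(hd' w wz w2) exprD -scalerA -scalemxAl -scalemxAr.
Qed.

Lemma holo_affine (X Y : M) (e z l : C) : l != z -> holo_at (fun l => X + (e / (l - z)) *: Y) l.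
Proof.
move=> lz; have -> : (fun l => X + (e / (l - z)) *: Y) = (fun l => X + ((l - z)^-1)%:M *m (e *: Y)).
  by apply/funext => w; rewrite mul_scalar_mx scalerA mulrC.
exact: holo_atD (holo_at_cst X l) (holo_atM (holo_pole lz) (holo_at_cst (e *: Y) l)).
Qed.
Lemma mero_affine (X Y : M) (e z l : C) : mero_at (fun l => X + (e / (l - z)) *: Y) l.
Proof.
have [->|lz] := eqVneq l z; last exact/mero_at_holo/holo_affine.
exists 1%N, (fun w => (w - z)%:M *m X + e *: Y); split.
  apply: holo_atD (holo_at_cst _ _); apply: holo_atM (holo_at_cst _ _).
  apply: (@holo_scal R n (fun l0 => l0 - z) z 1 ltr01) => w _.
  by apply: derivableB; [exact: derivable_id|exact: derivable_cst].
apply/dnbhsCP; exists 1 => // w wz _; rewrite expr1 mul_scalar_mx scalerDr scalerA mulrC mulfVK //.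
by rewrite subr_eq0.
Qed.
Lemma sm_form (al : C) (P : M) : sm al P = (fun l => 1%:M + ((conjc al - al) / (l - conjc al)) *: P).
Proof. by []. Qed.
Lemma si_form (al : C) (P : M) : si al P = (fun l => 1%:M + (- (conjc al - al) / (l - al)) *: P).
Proof. by apply/funext => l; rewrite /si mulNr scaleNr. Qed.

Lemma mlim_cst (c : M) : mlim (fun=> c) c.
Proof. by move=> e e0; exists 0 => x _; rewrite subrr nm0 ltW. Qed.
Lemma mlim_ext (f g : R -> M) L : f =1 g -> mlim f L -> mlim g L.
Proof. by move=> /funext ->. Qed.
Lemma mlimD (f g : R -> M) L N : mlim f L -> mlim g N -> mlim (fun x => f x + g x) (L + N).
Proof.
move=> hf hg e e0; have e2 : 0 < e / 2 by rewrite divr_gt0.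
have [X hX] := hf _ e2; have [Y hY] := hg _ e2; exists (Num.min X Y) => x.
rewrite le_min => /andP[x1 x2]; rewrite opprD addrACA [e](splitr e).
by apply: le_trans (nmD _ _) _; apply: lerD; [apply: hX|apply: hY].
Qed.
Lemma mlimM (f g : R -> M) L N : mlim f L -> mlim g N -> mlim (fun x => f x *m g x) (L *m N).
Proof.
move=> hf hg e e0.
pose k := nm L + nm N + 1; have k0 : 0 < k by rewrite ltr_wpDl // addr_ge0 ?nm_ge0.
pose d := Num.min 1 (e / 2 / k).
have d0 : 0 < d by rewrite lt_min ltr01 !divr_gt0.
have [X hX] := hf _ d0; have [Y hY] := hg _ d0; exists (Num.min X Y) => x.
rewrite le_min => /andP[/hX x1 /hY x2].
have -> : f x *m g x - L *m N = (f x - L) *m g x + L *m (g x - N).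
  by rewrite mulmxBl mulmxBr addrA subrK.
have gN : nm (g x) <= nm N + 1.
  have := nmD (g x - N) N; rewrite subrK => h; apply: le_trans h _; rewrite addrC lerD2l.
  by apply: le_trans x2 _; rewrite ge_min lexx.
have dk : d * k <= e / 2 by rewrite -ler_pdivlMr // ge_min lexx orbT.
apply: le_trans (nmD _ _) _.
have h1 : nm ((f x - L) *m g x) <= d * (nm N + 1).
  by apply: le_trans (nmM _ _) _; apply: ler_pM; rewrite ?nm_ge0.
have h2 : nm (L *m (g x - N)) <= nm L * d.
  by apply: le_trans (nmM _ _) _; apply: ler_wpM2l; rewrite ?nm_ge0.
have h3 : d * k = d * (nm N + 1) + nm L * d by rewrite /k; ring.
lra.
Qed.
Lemma mlim_unique (f : R -> M) L N : mlim f L -> mlim f N -> L = N.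
Proof.
move=> hf hg; apply/eqP; rewrite -subr_eq0; apply/eqP/nm_eq0; rewrite leNgt; apply/negP => e0.
have e3 : 0 < nm (L - N) / 3 by rewrite divr_gt0.
have [X hX] := hf _ e3; have [Y hY] := hg _ e3.
pose x := Num.min X Y; have x1 : x <= X by rewrite ge_min lexx.
have x2 : x <= Y by rewrite ge_min lexx orbT.
have := nmB (f x - N) (f x - L); have -> : f x - N - (f x - L) = L - N.
  by rewrite opprB addrC addrA subrK.
have := hX x x1; have := hY x x2; lra.
Qed.
Lemma mlim_rap (f : R -> M) : rapM f -> mlim f 0.
Proof.
move=> /(_ 1%N)[B B0 hB] e e0; exists (- (B / e)) => x xB; rewrite subr0.
apply: le_trans (hB x) _; rewrite /wgt expr1.
have x1 : 0 < 1 + `|x| by rewrite ltr_pwDl.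
rewrite ler_pdivrMr // mulrC -ler_pdivrMr //.
have : B / e <= - x by rewrite lerNr.
have := ler_norm (- x); rewrite normrN; lra.
Qed.
Lemma mlim_cvg (f : R -> M) L : mlim f L <-> forall i j, (f x i j : C^o) @[x --> -oo] --> (L i j : C^o).
Proof.
split=> [hf i j|hf e e0].
  apply/cvgrPdist_le => e e0.
  have [r er] : exists r, e = r%:C by apply/complex_realP; apply: ger0_real; apply: ltW.
  move: e0; rewrite er ltcR => r0; have [X hX] := hf r r0.
  exists X; split; first exact: num_real.
  move=> x /= xX; rewrite cnE lecR -cnN opprB.
  by apply: le_trans (hX x (ltW xX)); have := cn_nm (f x - L) i j; rewrite !mxE.
pose d := e / ((n * n)%:R + 1).
have K1 : 0 < (n * n)%:R + 1 :> R by rewrite ltr_wpDl.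
have d0 : 0 < d by rewrite divr_gt0.
have hX (ij : 'I_n * 'I_n) : exists X : R, forall x : R, x <= X -> cn (f x ij.1 ij.2 - L ij.1 ij.2) <= d.
  have /cvgrPdist_le/(_ d%:C) := hf ij.1 ij.2; rewrite ltcR => /(_ d0)[X [_ h]].
  exists (X - 1) => x xX; have xX' : x < X by lra.
  by have := h x xX'; rewrite /= cnE lecR -cnN opprB.
have [X hX'] := choice hX.
exists (- \sum_ij `|X ij|) => x xX; apply: (@le_trans _ _ ((n * n)%:R * d)); last first.
  have -> : (n * n)%:R * d = e * (n * n)%:R / ((n * n)%:R + 1) by rewrite /d mulrCA mulrA.
  by rewrite ler_pdivrMr // ler_pM2l // lerDl.
apply: nm_le => i j; rewrite !mxE; apply: (hX' (i, j)).
apply: le_trans xX _; rewrite lerNl; apply: (@le_trans _ _ `|X (i, j)|).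
  by rewrite -normrN ler_norm.
by rewrite (bigD1 (i, j)) //= lerDl sumr_ge0.
Qed.

Lemma expdiag0 (a : M) : expdiag a 0 = 1%:M.
Proof.
rewrite /expdiag; have -> : \row_k0 cexp ((0 : C) * a k0 k0) = const_mx 1.
  apply/matrixP => i j; rewrite !mxE mul0r /cexp /= expR0 cos0 sin0.
  by apply/eqP; rewrite eq_complex /= !mul1r mulr0 subr0 mul0r addr0 !eqxx.
by rewrite diag_const_mx.
Qed.

Lemma expdiag_comm (a L : M) s : is_diag_mx a -> lie a L = 0 -> expdiag a s *m L = L *m expdiag a s.
Proof.
move=> ad aL; apply/matrixP => i j; rewrite expdiagM Mexpdiag.
have := congr1 (fun X : M => X i j) aL; rewrite lie_diagE // mxE => /eqP; rewrite mulf_eq0 subr_eq0.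
by move=> /orP[/eqP->|/eqP->]; rewrite ?mulr0 ?mul0r // mulrC.
Qed.
End WaveTools.
Lemma conj_pole_id (K : comNzRingType) (n : nat) (e k : K) (P S : 'M[K]_n) : k * e = e - k ->
  (1%:M + e *: P) *m S *m (1%:M - k *: P) =
  S + e *: (P *m S *m (1%:M - P)) - k *: ((1%:M - P) *m S *m P).
Proof.
move=> ke; have -> : (1%:M + e *: P) *m S *m (1%:M - k *: P) =
    S + e *: (P *m S) - k *: (S *m P) - (k * e) *: (P *m S *m P) by ncring.
by rewrite ke; ncring.
Qed.

Section WaveDressing.
Variables (R : realType) (n : nat).
Notation C := R[i].
Notation M := 'M[C]_n.
Variables a b : M.
Hypothesis a_diag : is_diag_mx a.
Hypothesis a_un : in_un a.
Hypothesis b_comm : forall x, lie a x = 0 -> lie b x = 0.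
Variables (al : C) (v P : R -> M).
Hypothesis al_im : complex.Im al != 0.
Hypothesis v_schwartz : schwartz v.
Hypothesis v_un : forall x, in_un (v x).
Hypothesis P_rk1 : forall x, rk1 (P x).
Hypothesis P_der : forall x, has_deriv P x (dproj a al (v x) (P x)).

Lemma pole_ratio (l : C) : l != al -> l != conjc al ->
  (conjc al - al) / (l - al) * ((conjc al - al) / (l - conjc al)) =
  (conjc al - al) / (l - conjc al) - (conjc al - al) / (l - al).
Proof.
move=> l1 l2; have h1 : l - al != 0 by rewrite subr_eq0.
have h2 : l - conjc al != 0 by rewrite subr_eq0.
by move: (conjc al) h2 => be h2; field; rewrite h1 h2.
Qed.

(** The wave function [mu] becomes [s_oo mu s^-1], where [s_oo] is the simple
    element of the limit of [P] at [-oo], which normalizes the new one there. *)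
Theorem dressed_is_Q Q : is_Q a b v Q ->
  is_Q a b (fun x => v x - (conjc al - al) *: lie a (P x)) (fun k x => dq al (P x) (Q^~ x) k).
Proof.
move=> [Z [mu [[hZ [hmero hmu] [Mw [hM hM0]] [F [eF hF hFd]] hlim] hQ]]].
have PP x : P x *m P x = P x := rk1_idem (P_rk1 x).
have [L hL] := P_lim a_diag a_un al_im v_schwartz P_rk1 P_der.
have LL : L *m L = L.
  by apply: (mlim_unique (mlimM hL hL)); apply: mlim_ext hL => x; rewrite PP.
have aL : lie a L = 0.
  have h1 := mlimD (mlimM (mlim_cst a) hL) (mlimM (mlim_cst (- 1%:M)) (mlimM hL (mlim_cst a))).
  rewrite mulNmx mul1mx in h1; apply: (mlim_unique h1).
  apply: mlim_ext (mlim_rap (W_rap a_diag a_un al_im v_schwartz P_rk1 P_der)) => x.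
  by rewrite mulNmx mul1mx.
have bL : lie b L = 0 by apply: b_comm.
pose be := conjc al; pose c := be - al.
pose Z' : set C := [set z | Z z \/ z = al \/ z = be].
have off l : nonreal_off Z' l -> [/\ nonreal_off Z l, l != al & l != be].
  move=> [h1 h2]; split; first by split=> // h; apply: h2; left.
    by apply/eqP => h; apply: h2; right; left.
  by apply/eqP => h; apply: h2; right; right.
pose mu' x l := sm al L l *m mu x l *m si al (P x) l.
have fund : mcont (fun x => v x - c *: lie a (P x)).
  have h1 : mcont v by apply: hd_mcont (schwartz_dM v_schwartz).1.
  have h2 : mcont P := hd_mcont P_der.
  have h3 := mcontD h1 (mcontZ (- c) (mcontD (mcontM (mcont_cst a) h2) (mcontZ (-1) (mcontM h2 (mcont_cst a))))).
  by move: h3; congr mcont; apply/funext => x; rewrite scaleNr scaleN1r.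
have un' x : in_un (v x - c *: lie a (P x)).
  have [Pa _ _] := P_rk1 x; have h2 := in_un_dress a_un Pa (conj_diff al).
  have h1 := v_un x; rewrite /in_un adjB; rewrite /in_un in h1 h2.
  by rewrite h1 h2 opprB opprK addrC.
have [Y [Y0 Yd Yu Ye]] := fund_lax a_un fund un'.
have uS x l : l != al -> l != be -> sm al (P x) l \in unitmx.
  by move=> l1 l2; have [] := mulmx1_unit (sm_si (PP x) l1 l2).
have umu x l : nonreal_off Z l -> mu x l \in unitmx by move=> /(hmu x)[].
have F0 l : nonreal_off Z l -> F 0 l = 1%:M.
  by move=> hl; rewrite hF // mulr0 expdiag0 mulmx1 mulVmx // umu.
have inv_mu' x l : nonreal_off Z' l ->
    invmx (mu' x l) = sm al (P x) l *m invmx (mu x l) *m si al L l.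
  move=> /off[hl l1 l2].
  have e : mu' x l *m (sm al (P x) l *m invmx (mu x l) *m si al L l) = 1%:M.
    rewrite /mu' !mulmxA -[_ *m si al (P x) l *m sm al (P x) l]mulmxA si_sm // mulmx1.
    by rewrite -[_ *m mu x l *m invmx (mu x l)]mulmxA mulmxV ?umu // mulmx1 sm_si.
  have [u _] := mulmx1_unit e.
  by rewrite -[RHS](mulKmx u) e mulmx1.
have YF x l : nonreal_off Z' l -> Y x l = sm al (P 0) l *m F x l *m si al (P x) l.
  move=> /off[hl l1 l2].
  pose Zx x := sm al (P 0) l *m F x l *m si al (P x) l.
  have := @sol_unique R n (fun y => l *: a + (v y - c *: lie a (P y))) (fun y => Y y l) (fun y => adjmx (Y y (conjc l))) Zx.
  have -> : Zx 0 = 1%:M by rewrite /Zx F0 // mulmx1 sm_si.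
  move=> h; rewrite -[LHS]mul1mx -h //.
    move=> z; exact: (@hd_cofund R n (fun y l => l *: a + (v y - c *: lie a (P y))) Y z (fun l => lax_adj a_un l (un' z)) (Yd z)).
  move=> z; have [u [D [hD eD]]] := hFd z l.
  have hD' : has_deriv (fun y => F y l) z (F z l *m (l *: a + v z)).
    by apply: hd_eq hD _; rewrite -eD mulKVmx.
  pose k := c / (l - al).
  have hsi : has_deriv (fun y => si al (P y) l) z (- (k *: dproj a al (v z) (P z))).
    apply: hd_eq (hd_sub (hd_cst 1%:M z) (hd_Z k (P_der z))) _.
    by rewrite sub0r.
  apply: hd_eq (hd_mul (hd_mull (sm al (P 0) l) hD') hsi) _.
  have hk : conjc al - al = k * (l - al) by rewrite mulfVK // subr_eq0.
  have key := @dress_space R n a (v z) (P z) al l k (PP z) hk.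
  rewrite /Zx -[in RHS]mulmxA -[si al (P z) l]/(1%:M - k *: P z) -key.
  have gen (s f A I D' : M) : s *m (f *m A) *m I + s *m f *m - D' = s *m f *m (A *m I - D').
    by rewrite mulmxBr mulmxN !mulmxA.
  exact: gen.
have asmu' x N : asyN (nonreal_off Z') N (mu' x) (conv (conv (ser_sm al L) (Mw^~ x)) (ser_si al (P x))).
  apply: asyNM (asyN_si _ _ _ _); apply: asyNM (asyN_sm _ _ _ _) _.
  by apply: (@asyN_sub _ _ (nonreal_off Z)) => [l /off[]|] //; exact: (asymptoticP _ _ _).1 (hM x) N.
exists Z', mu'; split; first split.
- move=> l hl; have /dnbhsCP[d d0 hd] := hZ l hl.
  have avoid z : exists2 d', 0 < d' & forall w, w != l -> cn (w - l) < d' -> w != z.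
    have [->|lz] := eqVneq l z; first by exists 1.
    exists (cn (l - z)); first by rewrite cn_gt0 subr_eq0.
    move=> w _; apply: contraTneq => ->; by rewrite -cnN opprB ltxx.
  have [d1 d10 h1] := avoid al; have [d2 d20 h2] := avoid be.
  apply/dnbhsCP; exists (Num.min d (Num.min d1 d2)); first by rewrite !lt_min d0 d10.
  move=> w wl; rewrite !lt_min => /and3P[w0 w1 w2].
  by case=> [/(hd w wl w0)//|[/eqP|/eqP]]; [apply/negP/h1|apply/negP/h2].
- split=> x l hl.
    apply: mero_atM; last by rewrite si_form; apply: mero_affine.
    by apply: mero_atM; [rewrite sm_form; apply: mero_affine|apply: hmero].
  have [hl' l1 l2] := off l hl; have [h1 h2] := hmu x l hl'; split.
    apply: holo_atM; last by rewrite si_form; apply: holo_affine.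
    by apply: holo_atM h1; rewrite sm_form; apply: holo_affine.
  rewrite /mu' !unitmx_mul h2 andbT; apply/andP; split.
    by have [] := mulmx1_unit (sm_si LL l1 l2).
  by have [] := mulmx1_unit (sm_si (PP x) l1 l2).
- exists (fun k x => conv (conv (ser_sm al L) (Mw^~ x)) (ser_si al (P x)) k); split=> x.
    by apply/asymptoticP => N; apply: asmu'.
  have sm0 : ser_sm al L 0%N = 1%:M by rewrite /ser_sm fctE /= scaler0 addr0.
  have si0 : ser_si al (P x) 0%N = 1%:M by rewrite /ser_si fctE /= scaler0 addr0.
  have sm1 : ser_sm al L 1%N = c *: L by rewrite /ser_sm fctE /= scaler0 !add0r.
  have si1 : ser_si al (P x) 1%N = - c *: P x by rewrite /ser_si fctE /= scaler0 !add0r.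
  have [M0 M1] := hM0 x.
  split; first by rewrite !conv0 sm0 si0 M0 !mulmx1.
  have -> : conv (conv (ser_sm al L) (Mw^~ x)) (ser_si al (P x)) 1%N = - c *: P x + (Mw 1%N x + c *: L).
    rewrite {1}/conv big_ord_recl big_ord1 /= conv0 sm0 si0 si1 M0 !mulmx1 mul1mx; congr (_ + _).
    by rewrite /conv big_ord_recl big_ord1 /= sm0 sm1 M0 mulmx1 mul1mx.
  have lieZ (z : C) (X : M) : lie a (z *: X) = z *: lie a X by rewrite /lie -scalemxAl -scalemxAr scalerBr.
  by rewrite !lieD !lieZ aL scaler0 addr0 -M1 scaleNr addrC.
- exists Y; split=> [//|x l hl|x l].
    have [hl' l1 l2] := off l hl; rewrite (YF _ _ hl) (inv_mu' _ _ hl) /mu' (hF _ _ hl').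
    have e : expdiag a (l * x%:C) *m sm al L l = sm al L l *m expdiag a (l * x%:C).
      by rewrite /sm mulmxDl mulmxDr mulmx1 mul1mx -scalemxAl -scalemxAr expdiag_comm.
    have gen (p i s t g m q : M) : s *m t = 1%:M -> g *m t = t *m g ->
        p *m (i *m g *m m) *m q = p *m i *m s *m g *m (t *m m *m q).
      by move=> st gt; rewrite !mulmxA -(mulmxA _ g t) gt mulmxA -(mulmxA _ s t) st mulmx1.
    by apply: gen e; apply: si_sm LL l1 l2.
  split; first by have [] := mulmx1_unit (Yu x l).
  exists (Y x l *m (l *: a + (v x - c *: lie a (P x)))); split; first exact: Yd.
  by rewrite mulKmx //; have [] := mulmx1_unit (Yu x l).
- move=> l hl; have [hl' l1 l2] := off l hl; apply/mlim_cvg.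
  have h1 : mlim (fun x => mu x l) 1%:M by apply/mlim_cvg; apply: hlim.
  have h2 : mlim (fun x => si al (P x) l) (si al L l).
    have := mlimD (mlim_cst 1%:M) (mlimM (mlim_cst (- (c / (l - al)))%:M) hL).
    rewrite mul_scalar_mx scaleNr; apply: mlim_ext => x.
    by rewrite mul_scalar_mx scaleNr.
  have := mlimM (mlimM (mlim_cst (sm al L l)) h1) h2.
  by rewrite mulmx1 (sm_si LL l1 l2).
move=> x; apply/asymptoticP => N.
have hS : asyN (nonreal_off Z') N (fun l => invmx (mu x l) *m b *m mu x l) (Q^~ x).
  by apply: (@asyN_sub _ _ (nonreal_off Z)) => [l /off[]|] //; exact: (asymptoticP _ _ _).1 (hQ x) N.
pose S l := invmx (mu x l) *m b *m mu x l.
have h1 := asyN_scale c (asyN_mulr (1%:M - P x) (asyN_mull (P x) (asyN_pole be hS))).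
have h2 := asyN_scale (- c) (asyN_mulr (P x) (asyN_mull (1%:M - P x) (asyN_pole al hS))).
have := asyND (asyND hS h1) h2.
have -> : (Q^~ x + (fun k => c *: (P x *m hor (Q^~ x) k be *m (1%:M - P x))) +
   (fun k => - c *: ((1%:M - P x) *m hor (Q^~ x) k al *m P x))) = (fun k => dq al (P x) (Q^~ x) k).
  by apply/funext => k; rewrite !fctE scaleNr.
apply: (@asyN_near _ _ _ N 0) => l hl _; have [hl' l1 l2] := off l hl.
rewrite (inv_mu' _ _ hl) /mu'.
have eb : si al L l *m b *m sm al L l = b.
  have -> : si al L l *m b = b *m si al L l.
    by rewrite /si mulmxBl mulmxBr mulmx1 mul1mx -scalemxAl -scalemxAr (lie_swap bL).
  by rewrite -mulmxA (si_sm LL l1 l2) mulmx1.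
have -> : sm al (P x) l *m invmx (mu x l) *m si al L l *m b *m (sm al L l *m mu x l *m si al (P x) l) =
   sm al (P x) l *m S l *m si al (P x) l.
  by rewrite /S -{2}eb !mulmxA.
rewrite (conj_pole_id _ _ (pole_ratio l1 l2)) -/(S l).
move: (S l) => T.
have h (X U : M) (z w : C) : z *: (X *m (w *: T) *m U) = (z * w) *: (X *m T *m U).
  by rewrite -(scalemxAr w) -(scalemxAl w) scalerA.
by rewrite !h mulNr scaleNr.
Qed.
End WaveDressing.
Lemma frac_scale (T : idomainType) (p q r : T) : r != 0 ->
  tofrac (p * r) / tofrac (q * r) = tofrac p / tofrac q :> {fraction T}.
Proof.
move=> r0; rewrite !tofracM; have : tofrac r != 0 :> {fraction T} by rewrite tofrac_eq0.
move: (tofrac p) (tofrac q) (tofrac r) => x y w w0.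
by rewrite -mulf_div divff ?mulr1.
Qed.

Section FactorizationByContinuity.
Variables (R : realType) (n : nat).
Notation C := R[i].
Notation M := 'M[C]_n.

(** The product of the denominators of all entries is a common one. *)
Lemma rat_at_frac (g : ratmx R n) z (A : M) : rat_at g z A ->
  exists (N : 'M[{poly C}]_n) (d : {poly C}), d.[z] != 0 /\ g = ratof N d.
Proof.
move=> h; have h1 (ij : 'I_n * 'I_n) : exists pq : {poly C} * {poly C},
   pq.2.[z] != 0 /\ g ij.1 ij.2 = tofrac pq.1 / tofrac pq.2.
  by have [p [q [q0 e _]]] := h ij.1 ij.2; exists (p, q).
have [pq hpq] := choice h1.
pose D := \prod_ij (pq ij).2.
have D0 : D.[z] != 0.
  by rewrite horner_prod; apply/prodf_neq0 => ij _; have [] := hpq ij.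
exists (\matrix_(i, j) ((pq (i, j)).1 * \prod_(kl | kl != (i, j)) (pq kl).2)), D; split=> //.
apply/matrixP => i j; rewrite !mxE; have [q0 ->] := hpq (i, j).
have Dn : D != 0 := horner_neq0 D0.
have qn : (pq (i, j)).2 != 0 := horner_neq0 q0.
have DE : D = (pq (i, j)).2 * \prod_(kl | kl != (i, j)) (pq kl).2 by rewrite /D (bigD1 (i, j)).
have rn : \prod_(kl | kl != (i, j)) (pq kl).2 != 0.
  by apply: contraNneq Dn => e; rewrite DE e mulr0.
by rewrite DE frac_scale.
Qed.

(** After clearing denominators both sides are continuous, so a finite set can
    be left out. *)
Lemma factorization_off (g : ratmx R n) (f f' : C -> M) (h : ratmx R n) (s : seq C) :
  @Gplus R n f -> @Gplus R n f' -> @Gminus R n h ->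
  (forall z A B, z \notin s -> rat_at g z A -> rat_at h z B -> A *m f z = f' z *m B) ->
  factorization g f f' h.
Proof.
move=> [ef _ _] Gf' Gh hs; split=> // z A B hA hB; have [ef' _ _] := Gf'.
have [N [d [d0 eg]]] := rat_at_frac hA; have [N' [d' [d'0 eh]]] := rat_at_frac hB.
rewrite eg in hA; rewrite eh in hB.
rewrite (rat_at_ev d0 hA) (rat_at_ev d'0 hB) -scalemxAl -scalemxAr.
have [s1 hs1] := poly_roots_seq d; have [s2 hs2] := poly_roots_seq d'.
have key i j w : d'.[w] * (evm N w *m f w) i j = d.[w] * (f' w *m evm N' w) i j.
  move: w; apply: (@ccont_eq R (s ++ s1 ++ s2) (fun w => d'.[w] * (evm N w *m f w) i j) (fun w => d.[w] * (f' w *m evm N' w) i j)).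
  - apply: ccontM (ccont_poly d') _.
    have -> : (fun w => (evm N w *m f w) i j) = (fun w => \sum_k (N i k).[w] * f w k j).
      by apply/funext => w; rewrite mxE; apply: eq_bigr => k _; rewrite evmE.
    by apply: ccont_sum => k; apply: ccontM; [apply: ccont_poly|apply: entire_ccont].
  - apply: ccontM (ccont_poly d) _.
    have -> : (fun w => (f' w *m evm N' w) i j) = (fun w => \sum_k f' w i k * (N' k j).[w]).
      by apply/funext => w; rewrite mxE; apply: eq_bigr => k _; rewrite evmE.
    by apply: ccont_sum => k; apply: ccontM; [apply: entire_ccont|apply: ccont_poly].
  move=> w; rewrite !mem_cat !negb_or => /and3P[ws w1 w2].
  have dw : d.[w] != 0 by rewrite -[_ == 0]/(root d w) -hs1 ?(horner_neq0 d0).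
  have d'w : d'.[w] != 0 by rewrite -[_ == 0]/(root d' w) -hs2 ?(horner_neq0 d'0).
  have := hs w _ _ ws; rewrite eg eh => /(_ _ _ (ev_rat_at N dw) (ev_rat_at N' d'w)).
  rewrite -scalemxAl -scalemxAr => /(congr1 (fun X : M => d'.[w] * d.[w] * X i j)).
  rewrite !entZ => e; rewrite -[X in d'.[w] * X](mulVKf dw) mulrA e; field; exact: d'w.
apply/matrixP => i j; rewrite !entZ; have := key i j z.
move: (_ i j) (_ i j) => x y e.
by apply: (mulfI d0); apply: (mulfI d'0); rewrite mulVKf // e; field.
Qed.

Lemma rat_at_simple (al : C) (P : M) z (A : M) : z != conjc al -> rat_at (simple al P) z A -> A = sm al P z.
Proof.
move=> zb hA; have d0 : ('X - (conjc al)%:P).[z] != 0 by rewrite hornerXsubC subr_eq0.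
rewrite (rat_at_ev d0 hA) hornerXsubC /sm.
have h : z - conjc al != 0 by rewrite subr_eq0.
have -> : evm (simN al P) z = (z - conjc al)%:M + (conjc al - al) *: P.
  apply/matrixP => i j; rewrite !mxE /horner_eval hornerD hornerMn hornerXsubC; congr (_ + _).
  by rewrite hornerC.
by rewrite scalerDr scale_scalar_mx mulVf // scalerA mulrC.
Qed.
End FactorizationByContinuity.
Section DressedFlow.
Variables (R : realType) (n : nat).
Notation C := R[i].
Notation M := 'M[C]_n.
Variables a b : M.
Hypothesis a_diag : is_diag_mx a.
Hypothesis a_un : in_un a.
Hypothesis b_un : in_un b.
Hypothesis ab_comm : lie a b = 0.
Hypothesis b_central : central_in_U a b.
Variable j : nat.
Variables (u : R -> R -> M) (q : nat -> R -> R -> M) (E : R -> R -> C -> M).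
Hypothesis u_flow : flow_solutions a b j u.
Hypothesis u_pair : flow_pair a b j u q.
Hypothesis u_isQ : forall t, is_Q a b (u^~ t) (fun k x => q k x t).
Hypothesis E_lax : lax_sol a j u q E.
Variables (al : C) (p : M).
Hypothesis al_im : complex.Im al != 0.
Hypothesis p_rk1 : rk1 p.

Let P x t := frame_proj p (E x t (conjc al)).
Let u' x t := u x t - (conjc al - al) *: lie a (P x t).
Let q' k x t := dq al (P x t) (fun k => q k x t) k.

Let E_unit x t l : E x t l \in unitmx.
Proof. by have [_ _ _ EE _] := E_lax; have [] := mulmx1_unit (EE x t l). Qed.

Lemma dressed_rk1 x t : rk1 (P x t).
Proof. exact: rk1_frame. Qed.

Lemma dressed_dx x t : has_deriv (fun y => P y t) x (dproj a al (u x t) (P x t)).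
Proof.
have [_ Ex _ _ _] := E_lax; have [_ _ uu _] := u_pair.
apply: (@hd_frame R n p (fun y => E y t (conjc al)) (al *: a + u x t) (conjc al *: a + u x t) x p_rk1) => //.
exact: lax_adj.
Qed.

Lemma dressed_dt x t : has_deriv (P x) t
  (- ((1%:M - P x t) *m hor (fun k => q k x t) j.+1 al *m P x t) +
   P x t *m hor (fun k => q k x t) j.+1 (conjc al) *m (1%:M - P x t)).
Proof.
have [_ _ Et _ _] := E_lax.
apply: (@hd_frame R n p (fun s => E x s (conjc al)) _ _ t p_rk1) => //.
exact: hor_adj u_pair.
Qed.

Lemma dressed_smooth : smooth P.
Proof.
have [[sq _ _ _ _] su _ _] := u_pair.
have sA (l : C) : smooth (fun x t => l *: a + u x t) by apply: smoothD => //; apply: smooth_cst.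
exact: (riccati_smooth dressed_rk1 (sA al) (sA (conjc al)) (smooth_hor al j.+1 sq) (smooth_hor (conjc al) j.+1 sq) dressed_dx dressed_dt).
Qed.

Lemma dressed_adj x t : adjmx (P x t) = P x t.
Proof. by have [] := dressed_rk1 x t. Qed.

Lemma dressed_smooth_u : smooth u'.
Proof.
have [_ su _ _] := u_pair; apply: smoothB => //; apply: smoothZ; apply: smoothB.
  by apply: smoothM dressed_smooth; apply: smooth_cst.
by apply: smoothM (smooth_cst a); apply: dressed_smooth.
Qed.

Lemma dressed_perp x t : in_Uperp a (u' x t).
Proof.
have [_ uu _ _] := u_flow; have [h1 h2] := uu x t; split.
  have h3 := in_un_dress a_un (dressed_adj x t) (conj_diff al).
  rewrite /in_un in h1 h3; rewrite /in_un adjB h1 h3 opprB opprK addrC //.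
move=> z hz; rewrite /u' mulmxBl raddfB /= (h2 z hz) sub0r -scalemxAl mxtraceZ.
have [_ /lie_swap za] := hz.
have -> : \tr (lie a (P x t) *m z) = 0; last by rewrite mulr0 oppr0.
by rewrite /lie mulmxBl raddfB /= -!mulmxA mxtrace_mulC -mulmxA -za subrr.
Qed.

(** The next dressed density is [q_(j+1)] plus a multiple of [P_t], so the
    equation of [u] is carried over. *)
Lemma dressed_ut x t : has_deriv (u' x) t (lie (q' j.+1 x t) a).
Proof.
have [_ _ _ ut] := u_pair.
apply: hd_eq (hd_sub (ut x t) (hd_Z (conjc al - al) (hd_sub (hd_mull a (dressed_dt x t)) (hd_mulr a (dressed_dt x t))))) _.
rewrite /q' /dq; move: (P x t *m _ *m _) ((1%:M - P x t) *m _ *m _) (conjc al - al) (q j.+1 x t) => X Y c qj.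
rewrite /lie; ncring.
Qed.

Lemma dressed_isQ t : is_Q a b (u'^~ t) (fun k x => q' k x t).
Proof.
have [_ _ uu _] := u_pair; have [_ _ us _] := u_flow.
have hb := central_complex a_un b_central.
exact: (@dressed_is_Q R n a b a_diag a_un hb al (u^~ t) (P^~ t) al_im (us t) (fun x => uu x t) (fun x => dressed_rk1 x t) (fun x => dressed_dx x t) _ (u_isQ t)).
Qed.

(** The dressed coefficients belong to a reduced wave function of the dressed
    potential, so they are its densities; in this way they inherit the
    recursion. *)
Lemma dressed_pair : flow_pair a b j u' q'.
Proof.
have un' x t : in_un (u' x t) by have [] := dressed_perp x t.
have [q1 dq1] := densities_of a_diag a_un b_un ab_comm b_central dressed_smooth_u un'.
have e : q' = q1.
  have [_ _ _ _ h] := dq1; apply/funext => k; apply/funext => x; apply/funext => t.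
  by have := h t _ (dressed_isQ t) => /(congr1 (fun Q => Q k x)).
split; [by rewrite e|exact: dressed_smooth_u|exact: un'|exact: dressed_ut].
Qed.

Lemma dressed_flow : flow_solutions a b j u'.
Proof.
have [_ _ us _] := u_flow; split.
- exact: dressed_smooth_u.
- exact: dressed_perp.
- move=> t; exact: (dressed_schwartz a_diag a_un al_im (us t) (fun x => dressed_rk1 x t) (fun x => dressed_dx x t)).
exists (fun t k x => q' k x t); split; first exact: dressed_isQ.
have [[_ _ _ rec _] _ _ _] := dressed_pair.
move=> x t; exists (lie (q' j.+1 x t) a + lie (q' j x t) (u' x t)); split; first exact: rec.
apply: hd_eq (dressed_ut x t) _.
by rewrite -addrA -[X in _ + X](_ : 0 = _) ?addr0 // /lie addrA subrK subrr.
Qed.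

(** Away from the poles both sides solve the dressed Lax pair with value 1 at
    the origin. *)
Lemma dressed_frame E' : lax_sol a j u' q' E' -> forall x t l, l != al -> l != conjc al ->
  E' x t l = sm al p l *m E x t l *m si al (P x t) l.
Proof.
move=> hE' x t l l1 l2.
have [E0 Ex Et _ _] := E_lax; have PP x t : P x t *m P x t = P x t := rk1_idem (dressed_rk1 x t).
pose k := (conjc al - al) / (l - al).
have hk : conjc al - al = k * (l - al) by rewrite mulfVK // subr_eq0.
pose Z x t l := sm al p l *m E x t l *m si al (P x t) l.
have gen (s f A I D' : M) : s *m (f *m A) *m I + s *m f *m - D' = s *m f *m (A *m I - D').
  by rewrite mulmxBr mulmxN !mulmxA.
have hsi (f : R -> M) z D : has_deriv f z D -> has_deriv (fun y => si al (f y) l) z (- (k *: D)).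
  by move=> h; apply: hd_eq (hd_sub (hd_cst 1%:M z) (hd_Z k h)) _; rewrite sub0r.
have Zx y s : has_deriv (fun y => Z y s l) y (Z y s l *m (l *: a + u' y s)).
  apply: hd_eq (hd_mul (hd_mull (sm al p l) (Ex y s l)) (hsi _ _ _ (dressed_dx y s))) _.
  have key := @dress_space R n a (u y s) (P y s) al l k (PP y s) hk.
  by rewrite gen /Z -[in RHS]mulmxA -[si al (P y s) l]/(1%:M - k *: P y s) -key.
have Zt y s : has_deriv (fun s => Z y s l) s (Z y s l *m hor (fun k => q' k y s) j.+1 l).
  apply: hd_eq (hd_mul (hd_mull (sm al p l) (Et y s l)) (hsi _ _ _ (dressed_dt y s))) _.
  have key := dress_time (hor (fun k => q k y s) j.+1 l) (hor (fun k => q k y s) j.+1 al)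
    (hor (fun k => q k y s) j.+1 (conjc al)) (PP y s) (pole_ratio l1 l2).
  rewrite gen /Z -[in RHS]mulmxA -[si al (P y s) l]/(1%:M - k *: P y s) key.
  by rewrite -(hor_dq (P y s) (fun k => q k y s) j.+1 l1 l2).
have := lax_sol_unique a_un dressed_pair hE' Zx Zt x t.
have -> : Z 0 0 l = 1%:M.
  rewrite /Z E0 mulmx1 /P E0 /frame_proj adj1 mul1mx mulmx1.
  by have [_ -> _] := p_rk1; rewrite invr1 scale1r (sm_si (rk1_idem p_rk1) l1 l2).
by rewrite mul1mx => <-.
Qed.

(** The poles of [s_p E s_P^-1] cancel, since it is the entire frame of the
    dressed solution. *)
Lemma dressed_factorization E' : lax_sol a j u' q' E' -> forall x t,
  factorization (simple al p) (E x t) (E' x t) (simple al (P x t)).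
Proof.
move=> hE' x t; apply: (@factorization_off _ _ _ _ _ _ [:: al; conjc al]).
- exact: lax_sol_Gplus E_lax.
- exact: lax_sol_Gplus hE'.
- by apply: Gminus_simple; apply: dressed_rk1.
move=> z A B; rewrite !inE negb_or => /andP[z1 z2] hA hB.
rewrite (rat_at_simple z2 hA) (rat_at_simple z2 hB) (dressed_frame hE' x t z1 z2).
by rewrite -!mulmxA (si_sm (rk1_idem (dressed_rk1 x t)) z1 z2) mulmx1.
Qed.
End DressedFlow.
(** * The action of the rational loop group *)

Section FactorizationProducts.
Variables (R : realType) (n : nat).
Notation C := R[i].
Notation M := 'M[C]_n.

Lemma factorization1 (f : C -> M) : @Gplus R n f -> factorization (1%:M : ratmx R n) f f 1%:M.
Proof.
move=> hf; split=> //; first exact: Gminus1.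
by move=> z A B hA hB; rewrite (rat_at_uniq hA (@rat_at1 R n z)) (rat_at_uniq hB (@rat_at1 R n z)) mul1mx mulmx1.
Qed.

Lemma factorizationM (g1 g2 h1 h2 : ratmx R n) (f f1 f2 : C -> M) :
  @Gminus R n g1 -> @Gminus R n g2 -> @Gplus R n f ->
  factorization g2 f f1 h2 -> factorization g1 f1 f2 h1 -> factorization (g1 *m g2) f f2 (h1 *m h2).
Proof.
move=> G1 G2 Gf [_ H2 e2] [Gf2 H1 e1].
have [s1 hs1] : exists s : seq C, forall z, z \notin s -> exists A, rat_at g1 z A.
  by have [[s hs] _ _] := G1; exists s => z /hs[A [hA _]]; exists A.
have [s2 hs2] : exists s : seq C, forall z, z \notin s -> exists A, rat_at g2 z A.
  by have [[s hs] _ _] := G2; exists s => z /hs[A [hA _]]; exists A.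
have [s3 hs3] : exists s : seq C, forall z, z \notin s -> exists A, rat_at h1 z A.
  by have [[s hs] _ _] := H1; exists s => z /hs[A [hA _]]; exists A.
have [s4 hs4] : exists s : seq C, forall z, z \notin s -> exists A, rat_at h2 z A.
  by have [[s hs] _ _] := H2; exists s => z /hs[A [hA _]]; exists A.
apply: (@factorization_off _ _ _ _ _ _ (s1 ++ s2 ++ s3 ++ s4)) => //; first exact: GminusM.
move=> z A B; rewrite !mem_cat !negb_or => /and4P[/hs1[A1 hA1] /hs2[A2 hA2] /hs3[B1 hB1] /hs4[B2 hB2]] hA hB.
rewrite (rat_at_uniq hA (rat_atM hA1 hA2)) (rat_at_uniq hB (rat_atM hB1 hB2)).
by rewrite -mulmxA (e2 z _ _ hA2 hB2) mulmxA (e1 z _ _ hA1 hB1) mulmxA.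
Qed.

End FactorizationProducts.

Section Dressability.
Variables (R : realType) (n : nat).
Notation C := R[i].
Notation M := 'M[C]_n.
Variables a b : M.
Hypothesis a_diag : is_diag_mx a.
Hypothesis a_un : in_un a.
Hypothesis b_un : in_un b.
Hypothesis ab_comm : lie a b = 0.
Hypothesis b_central : central_in_U a b.
Variable j : nat.

(** A solution together with its frame. *)
Definition lax_data (u : R -> R -> M) (E : R -> R -> C -> M) := exists q,
  [/\ flow_solutions a b j u, flow_pair a b j u q,
      forall t, is_Q a b (u^~ t) (fun k x => q k x t) & lax_sol a j u q E].

Lemma lax_data_exists u : flow_solutions a b j u -> exists E, lax_data u E.
Proof.
move=> hu; have [q [hq hQ]] := flow_pair_of a_diag a_un b_un ab_comm b_central hu.
by have [E hE] := lax_sol_exists a_un ab_comm hq; exists E, q.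
Qed.
Lemma lax_data_of u E : flow_solutions a b j u -> is_trivialization a b j u E -> lax_data u E.
Proof.
move=> hu hE; have [q [hq hQ]] := flow_pair_of a_diag a_un b_un ab_comm b_central hu.
by exists q; split=> //; apply: (triv_lax_sol a_un ab_comm hq hE).
Qed.
Lemma lax_data_triv u E : lax_data u E -> is_trivialization a b j u E.
Proof. by move=> [q [_ hq hQ hE]]; exact: (lax_sol_triv hq hQ hE). Qed.
Lemma lax_data_Gplus u E x t : lax_data u E -> @Gplus R n (E x t).
Proof. by move=> [q [_ _ _ hE]]; apply: lax_sol_Gplus hE. Qed.
Lemma lax_data_logderiv u E x t l : lax_data u E -> has_logderiv (fun y => E y t l) x (l *: a + u x t).
Proof.
move=> [q [_ _ _ [_ Ex _ EE _]]]; have [uE _] := mulmx1_unit (EE x t l).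
by split=> //; exists (E x t l *m (l *: a + u x t)); rewrite mulKmx.
Qed.
Lemma lax_data_unique u E E' : lax_data u E -> lax_data u E' -> E = E'.
Proof.
move=> hE [q [hu hq _ hE1]].
have [E0 Ex Et _ _] := triv_lax_sol a_un ab_comm hq (lax_data_triv hE).
apply/funext => x; apply/funext => t; apply/funext => l.
by rewrite (lax_sol_unique a_un hq hE1 (fun x t => Ex x t l) (fun x t => Et x t l)) E0 mul1mx.
Qed.

Definition dressable (g : ratmx R n) := forall u E, lax_data u E ->
  exists u' E' h, lax_data u' E' /\ forall x t, factorization g (E x t) (E' x t) (h x t).

(** Dressability is inherited by products, so it only has to be proved for the
    simple elements, which generate. *)
Theorem Gminus_dressable g : @Gminus R n g -> dressable g.
Proof.
move=> /Gminus_gen; elim=> {g} [|al p al_im hp|g h gg IHg gh IHh] u E hE.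
- exists u, E, (fun _ _ => 1%:M); split=> // x t; apply: factorization1; exact: lax_data_Gplus hE.
- have [q [hu hq hQ hL]] := hE.
  have hq' := dressed_pair a_diag a_un b_un ab_comm b_central hu hq hQ hL al_im hp.
  have [E' hE'] := lax_sol_exists a_un ab_comm hq'.
  eexists; exists E'; eexists; split.
    eexists; split; [|exact: hq'| |exact: hE'].
      exact: (dressed_flow a_diag a_un b_un ab_comm b_central hu hq hQ hL al_im hp).
    exact: (dressed_isQ a_diag a_un b_central hu hq hQ hL al_im hp).
  exact: (dressed_factorization a_diag a_un b_un ab_comm b_central hu hq hQ hL al_im hp hE').
have [u1 [E1 [h1 [hE1 f1]]]] := IHh u E hE.
have [u2 [E2 [h2 [hE2 f2]]]] := IHg u1 E1 hE1.
exists u2, E2, (fun x t => h2 x t *m h1 x t); split=> // x t.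
apply: (factorizationM (gen_Gminus gg) (gen_Gminus gh) _ (f1 x t) (f2 x t)).
exact: lax_data_Gplus hE.
Qed.

Lemma dressing_of g u u' E E' h : lax_data u E -> lax_data u' E' ->
  (forall x t, factorization g (E x t) (E' x t) (h x t)) -> dressing a b j g u u'.
Proof.
move=> hE hE' hf; exists E, E', h; split=> //; first exact: lax_data_triv.
by move=> x t l; apply: lax_data_logderiv.
Qed.

(** The trivialization, the factorization and the logarithmic derivative are
    all unique. *)
Lemma dressing_unique g u u' u'' : flow_solutions a b j u ->
  dressing a b j g u u' -> dressing a b j g u u'' -> u' = u''.
Proof.
move=> hu [E [E' [g' [tE fE dE]]]] [F [F' [g'' [tF fF dF]]]].
have eE : E = F := lax_data_unique (lax_data_of hu tE) (lax_data_of hu tF).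
apply/funext => x; apply/funext => t; apply: (addrI (0 *: a)).
have eE' y s : E' y s = F' y s.
  by have h2 := fF y s; rewrite -eE in h2; have [->] := factorization_unique (fE y s) h2.
have [uE [D [hD eD]]] := dE x t 0; have [uF [D' [hD' eD']]] := dF x t 0.
have e : D = D' by apply: hd_unique hD _; apply: hd_ext hD' => y; rewrite eE'.
by rewrite -eD -eD' e eE'.
Qed.
End Dressability.
Theorem mainTheorem7 (R : realType) (n : nat) (a b : 'M[R[i]]_n) (j : nat)
    (a_diag : is_diag_mx a) (a_un : in_un a) (b_un : in_un b)
    (ab_comm : lie a b = 0) (b_central : central_in_U a b) (j_ge1 : (1 <= j)%N) :
  (forall (g : ratmx R n) (u : R -> R -> 'M[R[i]]_n)
      (E : R -> R -> R[i] -> 'M[R[i]]_n),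
    @Gminus R n g -> flow_solutions a b j u -> is_trivialization a b j u E ->
    exists (E' : R -> R -> R[i] -> 'M[R[i]]_n) (g' : R -> R -> ratmx R n),
      [/\ forall x t, factorization g (E x t) (E' x t) (g' x t),
          forall x t f h, factorization g (E x t) f h ->
            f = E' x t /\ h = g' x t
        & exists u' : R -> R -> 'M[R[i]]_n,
            [/\ flow_solutions a b j u',
                forall x t l,
                  has_logderiv (fun y => E' y t l) x (l *: a + u' x t)
              & is_trivialization a b j u' E']]) /\
  (exists act : ratmx R n -> (R -> R -> 'M[R[i]]_n) -> (R -> R -> 'M[R[i]]_n),
    [/\ forall g u, @Gminus R n g -> flow_solutions a b j u ->
          [/\ flow_solutions a b j (act g u), dressing a b j g u (act g u)
            & forall u', dressing a b j g u u' -> u' = act g u],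
        forall u, flow_solutions a b j u -> act 1%:M u = u
      & forall g1 g2 u, @Gminus R n g1 -> @Gminus R n g2 ->
          flow_solutions a b j u -> act (g1 *m g2) u = act g1 (act g2 u)]).
Proof.
have data u E : flow_solutions a b j u -> is_trivialization a b j u E -> lax_data a b j u E.
  exact: lax_data_of.
split.
  move=> g u E hg hu hE; have hL := data u E hu hE.
  have [u' [E' [h [hE' hf]]]] := Gminus_dressable a_diag a_un b_un ab_comm b_central hg hL.
  exists E', h; split=> //; first by move=> x t f k hfk; apply: factorization_unique hfk (hf x t).
  exists u'; split; first by have [q []] := hE'.
    by move=> x t l; apply: lax_data_logderiv hE'.
  exact: lax_data_triv hE'.
have ex (gu : ratmx R n * (R -> R -> 'M[R[i]]_n)) : exists u',
    @Gminus R n gu.1 -> flow_solutions a b j gu.2 -> flow_solutions a b j u' /\ dressing a b j gu.1 gu.2 u'.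
  case: gu => g u /=.
  have [[hg hu]|hn] := pselect (@Gminus R n g /\ flow_solutions a b j u); last by exists u => hg hu; case: hn.
  have [E hE] := lax_data_exists a_diag a_un b_un ab_comm b_central hu.
  have [u' [E' [h [hE' hf]]]] := Gminus_dressable a_diag a_un b_un ab_comm b_central hg hE.
  exists u' => _ _; split; first by have [q []] := hE'.
  exact: dressing_of hE hE' hf.
have [act hact] := choice ex.
have uniq g u u' : @Gminus R n g -> flow_solutions a b j u -> dressing a b j g u u' -> u' = act (g, u).
  move=> hg hu hd; have [_ hd'] := hact (g, u) hg hu.
  exact: (dressing_unique a_diag a_un b_un ab_comm b_central hu hd hd').
exists (fun g u => act (g, u)); split.
- by move=> g u hg hu; have [h1 h2] := hact (g, u) hg hu; split=> // u'; apply: uniq.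
- move=> u hu; apply/esym; apply: uniq => //; first exact: Gminus1.
  have [E hE] := lax_data_exists a_diag a_un b_un ab_comm b_central hu.
  apply: (@dressing_of _ _ _ _ _ 1%:M u u E E (fun _ _ => 1%:M)) => // x t.
  by apply: factorization1; apply: lax_data_Gplus hE.
move=> g1 g2 u hg1 hg2 hu.
have [E hE] := lax_data_exists a_diag a_un b_un ab_comm b_central hu.
have [u1 [E1 [h1 [hE1 f1]]]] := Gminus_dressable a_diag a_un b_un ab_comm b_central hg2 hE.
have [u2 [E2 [h2 [hE2 f2]]]] := Gminus_dressable a_diag a_un b_un ab_comm b_central hg1 hE1.
have hu1 : flow_solutions a b j u1 by have [q []] := hE1.
rewrite -(uniq g2 u u1 hg2 hu (dressing_of hE hE1 f1)) -(uniq g1 u1 u2 hg1 hu1 (dressing_of hE1 hE2 f2)).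
apply/esym; apply: uniq => //; first exact: GminusM.
apply: (dressing_of (h := fun x t => h2 x t *m h1 x t) hE hE2) => x t.
apply: (factorizationM hg1 hg2 _ (f1 x t) (f2 x t)).
exact: lax_data_Gplus hE.
Qed.
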